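(* Let $(\Omega,d,\mu)$ be a space of homogeneous type with homogeneous dimension index $n_0$, and let $L$ be a non-negative, self-adjoint, injective operator on $L^2(\Omega,\mu)$ whose semigroup $\{e^{-tL}\}_{t>0}$ satisfies the Davies-Gaffney estimates. Let $\kappa$ be an integer with $\kappa>(n_0+1)/2$. Let $m\colon[0,\infty)\to\mathbb{C}$ be a continuous function which is $C^{\kappa}$ on $(0,\infty)$. Assume that $$\sup_{0\le j\le \kappa}\ \sup_{\lambda>0}|\lambda^j m^{(j)}(\lambda)|<\infty$$ and, additionally, $$\lim_{\lambda\to0^+}\lambda^j m^{(j)}(\lambda)=0,\qquad j=1,\ldots,\kappa.$$ Then for every $f\in H^1_L$ we have $$\lim_{t\to0^+}m(t\sqrt{L})f=m(0)f,$$ the limit being in the norm of $H^1_L$.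
   Context: Setting. $(\Omega,d)$ is a metric space with a positive measure $\mu$; $B_d(x,t)=\{y\in\Omega: d(x,y)<t\}$ and $V(x,t)=\mu(B_d(x,t))$. $(\Omega,d,\mu)$ is a space of homogeneous type in the sense of Coifman-Weiss: there is $C>0$ with $\mu(B_d(x,2t))\le C\mu(B_d(x,t))$ for all $x\in\Omega$, $t>0$ (as usual, balls have positive finite measure). Consequently there are $C_0>0$, $q>0$ such that $$\mu(B_d(x,st))\le C_0 s^q\mu(B_d(x,t))\quad\text{for all }x\in\Omega,\ t>0,\ s>1, \qquad ( * )$$ and $n_0$ denotes the infimum of the $q$ for which $( * )$ holds (with some $C_0$). $L$ is a non-negative self-adjoint operator on $L^2(\Omega,\mu)$, injective on its domain, and $T_t=e^{-tL}$. Davies-Gaffney estimates: there are constants $C,c>0$ such that for all $t>0$, all open $U_1,U_2\subset\Omega$ and all $f_i\in L^2(\Omega)$ with $\operatorname{supp}f_i\subset U_i$ ($i=1,2$), $$|\langle T_tf_1,f_2\rangle|\le C\exp\left(-\frac{\operatorname{dist}(U_1,U_2)^2}{ct}\right)\|f_1\|_{L^2(\Omega)}\|f_2\|_{L^2(\Omega)}.$$ Hardy space. For $f\in L^2(\Omega)$ let $$S_hf(x)=\left(\iint_{\Gamma(x)}|t^2LT_{t^2}f(y)|^2\,\frac{d\mu(y)}{V(x,t)}\frac{dt}{t}\right)^{1/2},\qquad \Gamma(x)=\{(y,t)\in\Omega\times(0,\infty): d(x,y)\le t\}.$$ $H^1_L$ is the (abstract) completion of $\{f\in L^2(\Omega):\|S_hf\|_{L^1(\Omega)}<\infty\}$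 in the norm $\|f\|_{H^1_L}=\|S_hf\|_{L^1(\Omega)}$. Spectral multipliers. Let $E$ be the spectral measure of $\sqrt{L}$, so $Lf=\int_0^\infty\lambda^2\,dE(\lambda)f$. For bounded Borel $m\colon[0,\infty)\to\mathbb{C}$, $m(\sqrt{L})f=\int_0^\infty m(\lambda)\,dE(\lambda)f$ on $L^2(\Omega)$, and $m(t\sqrt{L})$ is the operator associated in this way with $\lambda\mapsto m(t\lambda)$. On $H^1_L$, such an operator is understood as its unique bounded extension from the dense subspace $\{f\in L^2(\Omega):\|S_hf\|_{L^1(\Omega)}<\infty\}$ (for $m$ as in the claim and $t>0$ this extension exists). *)

(* Defs.v *)
From HB Require Import structures.
From mathcomp Require Import all_boot all_order all_algebra.
From mathcomp Require Import complex.
From mathcomp Require Import all_classical all_reals all_analysis.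

Set Implicit Arguments.
Unset Strict Implicit.
Unset Printing Implicit Defensive.

Import Order.TTheory GRing.Theory Num.Theory.
Import numFieldNormedType.Exports.

Local Open Scope classical_set_scope.
Local Open Scope ring_scope.

HB.mixin Record isBorel d (T : Type) of Measurable d T & Topological T := {
  measurable_borelE : @measurable d T = <<s @open T >>
}.

#[short(type="borelMetricType")]
HB.structure Definition BorelMetric d (R : realType) :=
  {T of Metric R T & Measurable d T & isBorel d T}.

(* The real-valued modulus; [`|z|] has type [R[i]]. *)
Definition cmod (R : realType) (z : R[i]) : R := ComplexField.Normc.normc z.

Section doubling.
Context d (R : realType) (Omega : borelMetricType d R).
Variable mu : {measure set Omega -> \bar R}.

Definition vol (x : Omega) (t : R) : \bar R := mu (ball x t).

Definition homogeneous_space : Prop :=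
  (forall (x : Omega) (t : R), 0 < t -> (0 < vol x t)%E /\ (vol x t < +oo)%E) /\
  exists2 C : R, 0 < C &
    forall (x : Omega) (t : R), 0 < t -> (vol x (2 * t) <= C%:E * vol x t)%E.

Definition growth_exponent (q : R) : Prop :=
  0 < q /\ exists2 C0 : R, 0 < C0 &
    forall (x : Omega) (t s : R), 0 < t -> 1 < s ->
      (vol x (s * t) <= (C0 * s `^ q)%:E * vol x t)%E.

Definition homogeneous_dim : R := inf [set q | growth_exponent q].

End doubling.

(* Elements of $L^2(\Omega,\mu;\mathbb C)$ are represented by square-integrable
   functions, equality in $L^2$ being almost everywhere equality; operators
   act on representatives and are required to respect it. *)
Section L2.
Context d (R : realType) (Omega : borelMetricType d R).
Variable mu : {measure set Omega -> \bar R}.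
Implicit Types f g u : Omega -> R[i].

Definition L2norm f : \bar R := 'N[mu]_(2%:E)[EFin \o (@cmod R \o f)].

Definition L2 : set (Omega -> R[i]) := [set f : Omega -> R[i] |
  [/\ measurable_fun setT (@complex.Re R \o f),
      measurable_fun setT (@complex.Im R \o f) & (L2norm f < +oo)%E]].

Definition inner f g : R[i] :=
  let h := fun x => f x * (g x)^*%C in
  Complex (Rintegral mu setT (@complex.Re R \o h))
          (Rintegral mu setT (@complex.Im R \o h)).

Record L2_operator (D : set (Omega -> R[i]))
    (A : (Omega -> R[i]) -> Omega -> R[i]) : Prop := {
  L2_operator_dom : D `<=` L2 ;
  L2_operator_range : forall f, D f -> L2 (A f) ;
  L2_operator_ae : forall f g, D f -> L2 g -> ae_eq mu setT f g ->
    D g /\ ae_eq mu setT (A f) (A g) ;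
  L2_operator_linear : forall (a : R[i]) f g, D f -> D g ->
    D (fun x => a * f x + g x) /\
    ae_eq mu setT (A (fun x => a * f x + g x)) (fun x => a * A f x + A g x)
}.

Record operator := Operator {
  dom : set (Omega -> R[i]) ;
  act :> (Omega -> R[i]) -> Omega -> R[i] ;
  operatorP : L2_operator dom act
}.

Definition densely_defined (L : operator) : Prop :=
  forall f (e : R), L2 f -> 0 < e ->
    exists2 g, dom L g & (L2norm (f \- g)%R < e%:E)%E.

(* The left-hand side of the equivalence says that $f$ is in the domain of the
   adjoint of $L$, which maps it to $g$. *)
Definition self_adjoint (L : operator) : Prop :=
  densely_defined L /\
  forall f g, L2 f -> L2 g ->
    ((forall u, dom L u -> inner (L u) f = inner u g) <->
     (dom L f /\ ae_eq mu setT (L f) g)).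

Definition nonnegative (L : operator) : Prop :=
  forall f, dom L f -> 0 <= inner (L f) f.

Definition injective_operator (L : operator) : Prop :=
  forall f, dom L f -> ae_eq mu setT (L f) (cst 0) -> ae_eq mu setT f (cst 0).

(* Projection-valued measures on the Borel sets of $\mathbb R$ concentrated on
   $[0,\infty)$; the values outside the Borel sets are irrelevant. *)
Record proj_measure := ProjMeasure {
  proj :> set R -> (Omega -> R[i]) -> Omega -> R[i] ;
  proj_operator : forall A, measurable A -> L2_operator L2 (proj A) ;
  proj_idem : forall A f, measurable A -> L2 f ->
    ae_eq mu setT (proj A (proj A f)) (proj A f) ;
  proj_sym : forall A f g, measurable A -> L2 f -> L2 g ->
    inner (proj A f) g = inner f (proj A g) ;
  proj_total : forall f, L2 f -> ae_eq mu setT (proj `[0, +oo[ f) f ;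
  proj_sigma_additive : forall (A : nat -> set R) f,
    (forall n, measurable (A n)) -> trivIset setT A -> L2 f ->
    L2norm (proj (\bigcup_n A n) f \- (fun x => \sum_(k < n) proj (A k) f x))
      @[n --> \oo] --> 0%E
}.

(* $A \mapsto \langle E(A)f, f\rangle$ *)
Definition scalar_measure (E : proj_measure) f (A : set R) : \bar R :=
  (complex.Re (inner (E A f) f))%:E.

Definition sq_integral (E : proj_measure) f (phi : R -> R[i]) : \bar R :=
  integral (scalar_measure E f) `[0, +oo[ (fun l => (cmod (phi l) ^+ 2)%:E).

Definition simple_fun n (c : 'I_n -> R[i]) (A : 'I_n -> set R) (l : R) : R[i] :=
  \sum_(i < n) c i * (\1_(A i) l)%:C%C.

Definition simple_integral (E : proj_measure) n (c : 'I_n -> R[i])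
    (A : 'I_n -> set R) f : Omega -> R[i] :=
  fun x => \sum_(i < n) c i * E (A i) f x.

(* [spectral_integral E phi f g] : $f$ is in the domain of
   $\int_0^\infty \varphi\,dE$ and $g = \int_0^\infty \varphi(\lambda)\,dE(\lambda)f$,
   the limit in $L^2$ of the integrals of simple functions converging to
   $\varphi$ in $L^2(\langle E(\cdot)f,f\rangle)$. *)
Definition spectral_integral (E : proj_measure) (phi : R -> R[i]) f g : Prop :=
  [/\ L2 f, L2 g, (sq_integral E f phi < +oo)%E &
    forall e : R, 0 < e -> exists n (c : 'I_n -> R[i]) (A : 'I_n -> set R),
      [/\ forall i, measurable (A i),
          (sq_integral E f (phi \- simple_fun c A)%R < e%:E)%E &
          (L2norm (g \- simple_integral E c A f)%R < e%:E)%E]].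

Definition spectral_measure_sqrt (L : operator) (E : proj_measure) : Prop :=
  let sq := fun l : R => (l ^+ 2)%:C%C in
  forall f, L2 f ->
    (dom L f <-> (sq_integral E f sq < +oo)%E) /\
    (dom L f -> spectral_integral E sq f (L f)).

(* A representative (an arbitrary one, the class being unique) of
   $\int_0^\infty\varphi(\lambda)\,dE(\lambda)f$. *)
Definition multiplier (E : proj_measure) (phi : R -> R[i]) f : Omega -> R[i] :=
  xget (cst 0) [set g | spectral_integral E phi f g].

(* $e^{-tL}$, for $E$ the spectral measure of $\sqrt L$ *)
Definition heat (E : proj_measure) (t : R) : (Omega -> R[i]) -> Omega -> R[i] :=
  multiplier E (fun l => (expR (- (t * l ^+ 2)))%:C%C).

Definition support f : set Omega := [set x | forall r : R, 0 < r ->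
  ~ {ae mu, forall y, ball x r y -> f y = 0}].

Definition set_dist (U1 U2 : set Omega) : R :=
  inf [set mdist p.1 p.2 | p in U1 `*` U2].

Definition davies_gaffney (E : proj_measure) : Prop :=
  exists C c : R, [/\ 0 < C, 0 < c &
    forall (t : R) (U1 U2 : set Omega) f1 f2,
      0 < t -> open U1 -> open U2 -> L2 f1 -> L2 f2 ->
      support f1 `<=` U1 -> support f2 `<=` U2 ->
      cmod (inner (heat E t f1) f2) <=
        C * expR (- (set_dist U1 U2 ^+ 2 / (c * t))) *
        fine (L2norm f1) * fine (L2norm f2)].

(* The integral over the cone is iterated, $d\mu(y)$ first: the inner integral
   depends only on the class of $t^2Le^{-t^2L}f$ in $L^2$, so that no jointly
   measurable representative has to be chosen. *)
Definition square_function (L : operator) (E : proj_measure) f (x : Omega)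
    : \bar R :=
  let u := fun (t : R) (y : Omega) =>
    (t ^+ 2)%:C%C * L (heat E (t ^+ 2) f) y in
  ((\int[@lebesgue_measure R]_(t in [set t : R | (0 < t)%R])
     ((\int[mu]_(y in [set y | (mdist x y <= t)%R]) (cmod (u t y) ^+ 2)%:E)
      * ((fine (vol mu x t))^-1)%:E * (t^-1)%:E)) `^ 2^-1)%E.

Definition hardy_norm (L : operator) (E : proj_measure) f : \bar R :=
  'N[mu]_1[square_function L E f].

Definition hardy_dense (L : operator) (E : proj_measure)
    : set (Omega -> R[i]) :=
  [set f : Omega -> R[i] | L2 f /\ (hardy_norm L E f < +oo)%E].

Section completion.
Context (L : operator) (E : proj_measure) (H : completeNormedModType R[i]).
Variable iota : (Omega -> R[i]) -> H.

(* [H], with the canonical map [iota], is the completion of [hardy_dense L E]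
   for [hardy_norm L E]; the values of [iota] elsewhere are irrelevant. *)
Record hardy_completion : Prop := {
  hardy_linear : forall (a : R[i]) f g, hardy_dense L E f -> hardy_dense L E g ->
    iota (fun x => a * f x + g x) = a *: iota f + iota g ;
  hardy_isometry : forall f, hardy_dense L E f ->
    `|iota f| = (fine (hardy_norm L E f))%:C%C ;
  hardy_density : closure (iota @` hardy_dense L E) = setT
}.

Record bounded_extension (A : (Omega -> R[i]) -> Omega -> R[i])
    (B : H -> H) : Prop := {
  extension_linear : forall (a : R[i]) (v w : H),
    B (a *: v + w) = a *: B v + B w ;
  extension_bounded : continuous B ;
  extensionE : forall f, hardy_dense L E f ->
    hardy_dense L E (A f) /\ B (iota f) = iota (A f)
}.

(* The bounded extension to [H] of [multiplier E phi]; it is unique by density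
   when it exists, and [xget] returns 0 otherwise. *)
Definition hardy_multiplier (phi : R -> R[i]) : H -> H :=
  xget (cst 0) [set B | bounded_extension (multiplier E phi) B].

End completion.

End L2.

(* Derivatives of complex-valued functions of a real variable are taken
   componentwise, [R[i]] not being a normed module over [R]. The values of [m]
   on the negative half-line are irrelevant. *)
Section smoothness.
Context (R : realType).
Implicit Types (m : R -> R[i]) (l : R).

Definition continuous_on_nonneg m : Prop :=
  {within `[0, +oo[, continuous (@complex.Re R \o m)} /\
  {within `[0, +oo[, continuous (@complex.Im R \o m)}.

Definition smooth_on_pos (k : nat) m : Prop :=
  forall u : R -> R, u = @complex.Re R \o m \/ u = @complex.Im R \o m ->
    (forall j l, (j < k)%N -> 0 < l -> derivable (derive1n j u) l 1) /\
    (forall l, 0 < l -> {for l, continuous (derive1n k u)}).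

Definition cderive (j : nat) m l : R[i] :=
  Complex (derive1n j (@complex.Re R \o m) l) (derive1n j (@complex.Im R \o m) l).

Definition scaled_derive (j : nat) m l : R[i] := (l ^+ j)%:C%C * cderive j m l.

End smoothness.

(* Main.v *)
Require Import Defs.
From HB Require Import structures.
From mathcomp Require Import all_boot all_order all_algebra.
From mathcomp Require Import complex ring lra.
From mathcomp Require Import all_classical all_reals all_analysis.
From mathcomp Require Import measurable_realfun.
Import Order.TTheory GRing.Theory Num.Theory.
Import numFieldNormedType.Exports.
Set Implicit Arguments.
Unset Strict Implicit.
Unset Printing Implicit Defensive.
Local Open Scope classical_set_scope.
Local Open Scope ring_scope.

(** Replacing [m] by its dilates, the claim follows by density from two facts:
    the operators [m(t sqrt L)] are bounded on the Hardy space uniformly in [t],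
    and [(m(t sqrt L) - m(0)) f] tends to [0] for each [f] with integrable
    square function. Both come from one weighted estimate. Davies-Gaffney
    estimates bound the wave propagator (finite speed of propagation), hence
    give off-diagonal decay of order [2 kappa - 1] for multipliers with Mikhlin
    bounds up to order [kappa]. The Calderon reproducing formula writes
    [m(t sqrt L)] as a series of such multipliers at dyadic scales. Since
    [2 kappa - 1 > n_0], there is a weight [w >= S f], with comparable
    [L^1] norm, whose averages grow slower than this decay, so that
    [int w^-1 |S(m f)|^2] is at most [C int w^-1 |S f|^2 <= C int S f]; Young's
    inequality turns this into a bound for [int S(m f)]. The smallness at the
    origin enters through the dependence of the estimate on the scale. *)

(** The off-diagonal decay is read off polynomials in a heat operator. With Y = exp(-(r l)^2), a
    polynomial of degree n in Y combines heat symbols at times j r^2, j <= n; at distance 2^i r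
    Davies-Gaffney leaves a factor exp(-4^i / (c n)) against coefficients of size 7^n, so that for n
    a small multiple of 2^i only the approximation error remains. Setting Y = (1 + cos x) / 2 makes
    this error the tail of a cosine series, and kappa integrations by parts with Bessel's inequality
    bound its square by n^-(2 kappa - 1). The factors (Y (1 - Y))^(kappa + 1) supplied by the
    reproducing formula cancel the boundary terms. Multipliers act on L^2 classes and are controlled
    between sets only, so weighted integrals are compared through superlevel sets. Two weights
    occur, 1/w after the multiplier and 1/S f before it: averages of 1/w are at most those of 1/S f
    times th^i across 2^i radii. Here th lies strictly between the volume growth theta = 2^q and
    2^(2 kappa - 1): above theta for w to be integrable, below the other for the sum over distances
    to converge. *)

Section complex_modulus.
Context {R : realType}.
Implicit Types x y z : R[i].
Local Notation Re := (@complex.Re R).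
Local Notation Im := (@complex.Im R).

Lemma cReD x y : Re (x + y) = Re x + Re y. Proof. by case: x; case: y. Qed.
Lemma cImD x y : Im (x + y) = Im x + Im y. Proof. by case: x; case: y. Qed.
Lemma cReN x : Re (- x) = - Re x. Proof. by case: x. Qed.
Lemma cImN x : Im (- x) = - Im x. Proof. by case: x. Qed.
Lemma cReM x y : Re (x * y) = Re x * Re y - Im x * Im y.
Proof. by case: x; case: y. Qed.
Lemma cImM x y : Im (x * y) = Re x * Im y + Im x * Re y.
Proof. by case: x; case: y. Qed.
Lemma cReJ x : Re (x^*)%C = Re x. Proof. by case: x. Qed.
Lemma cImJ x : Im (x^*)%C = - Im x. Proof. by case: x. Qed.
Definition cRI := (cReD, cImD, cReN, cImN, cReM, cImM, cReJ, cImJ).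

Lemma cplx_eq x y : Re x = Re y -> Im x = Im y -> x = y.
Proof. by case: x y => a b [c d'] /= -> ->. Qed.

Lemma cRe_sum (I : Type) (r : seq I) (P : pred I) (F : I -> R[i]) :
  Re (\sum_(i <- r | P i) F i) = \sum_(i <- r | P i) Re (F i).
Proof. exact: (big_morph _ cReD). Qed.

Lemma cIm_sum (I : Type) (r : seq I) (P : pred I) (F : I -> R[i]) :
  Im (\sum_(i <- r | P i) F i) = \sum_(i <- r | P i) Im (F i).
Proof. exact: (big_morph _ cImD). Qed.

Lemma cmodE x : cmod x = Num.sqrt (Re x ^+ 2 + Im x ^+ 2).
Proof. by case: x. Qed.

Lemma cmod2 x : cmod x ^+ 2 = Re x ^+ 2 + Im x ^+ 2.
Proof. by rewrite cmodE sqr_sqrtr// addr_ge0// sqr_ge0. Qed.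

Lemma cmod_ge0 x : 0 <= cmod x.
Proof. by rewrite cmodE sqrtr_ge0. Qed.

Lemma cmodM x y : cmod (x * y) = cmod x * cmod y.
Proof. exact: ComplexField.Normc.normcM. Qed.

Lemma cmodD x y : cmod (x + y) <= cmod x + cmod y.
Proof. exact: le_normcD. Qed.

Lemma cmodN x : cmod (- x) = cmod x. Proof. exact: normcN. Qed.

Lemma cmod0 : cmod (0 : R[i]) = 0. Proof. exact: ComplexField.Normc.normc0. Qed.
Lemma cmod1 : cmod (1 : R[i]) = 1. Proof. exact: ComplexField.Normc.normc1. Qed.

Lemma cmod_eq0 x : cmod x = 0 -> x = 0.
Proof. exact: ComplexField.Normc.eq0_normc. Qed.

Lemma cmodJ x : cmod (x^*)%C = cmod x.
Proof. by rewrite !cmodE !cRI sqrrN. Qed.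

Lemma cmodR (a : R) : cmod (a%:C)%C = `|a|.
Proof. by rewrite cmodE /= expr0n addr0 sqrtr_sqr. Qed.

Lemma cnormE x : `|x| = (cmod x)%:C%C.
Proof. by rewrite normc_def cmodE. Qed.

Lemma cRe_le x : `|Re x| <= cmod x.
Proof.
by rewrite cmodE -(sqrtr_sqr (Re x)) ler_wsqrtr// lerDl sqr_ge0.
Qed.

Lemma cIm_le x : `|Im x| <= cmod x.
Proof.
by rewrite cmodE -(sqrtr_sqr (Im x)) ler_wsqrtr// lerDr sqr_ge0.
Qed.

Lemma cmod_le_ReIm x : cmod x <= `|Re x| + `|Im x|.
Proof.
rewrite -(@ler_pXn2r _ 2) ?nnegrE ?cmod_ge0 ?addr_ge0//.
rewrite cmod2 sqrrD !real_normK ?num_real//.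
have : 0 <= `|Re x| * `|Im x| by rewrite mulr_ge0.
lra.
Qed.

Lemma cmod2D x y : cmod (x + y) ^+ 2 <= 2 * cmod x ^+ 2 + 2 * cmod y ^+ 2.
Proof.
rewrite !cmod2 !cRI.
have := sqr_ge0 (Re x - Re y); have := sqr_ge0 (Im x - Im y).
rewrite !expr2; lra.
Qed.

Lemma conjM_mod x : x * (x^*)%C = ((cmod x ^+ 2)%:C)%C.
Proof. by apply: cplx_eq; rewrite !cRI cmod2/=; ring. Qed.

End complex_modulus.

(** * Complex inner products: Cauchy-Schwarz and the norm *)

Section inner_product.
Context {R : realType} {V : lmodType R[i]}.

Record is_inner (ip : V -> V -> R[i]) : Prop := {
  innerDl : forall u v w, ip (u + v) w = ip u w + ip v w ;
  innerZl : forall a u w, ip (a *: u) w = a * ip u w ;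
  innerC : forall u v, ip u v = (ip v u)^*%C ;
  inner_ge0 : forall v, 0 <= complex.Re (ip v v) ;
  inner_eq0 : forall v, complex.Re (ip v v) = 0 -> v = 0 }.

Variable ip : V -> V -> R[i].
Hypothesis ipP : is_inner ip.
Implicit Types u v w : V.
Local Notation Re := (@complex.Re R).
Local Notation Im := (@complex.Im R).

Definition nm v : R := Num.sqrt (Re (ip v v)).

Lemma ipDr u v w : ip u (v + w) = ip u v + ip u w.
Proof. by rewrite (innerC ipP) (innerDl ipP) rmorphD/= -!(innerC ipP). Qed.

Lemma ipZr a u v : ip u (a *: v) = (a^*)%C * ip u v.
Proof. by rewrite (innerC ipP) (innerZl ipP) rmorphM/= -(innerC ipP). Qed.

Lemma ip0l u : ip 0 u = 0.
Proof. by rewrite -(scale0r 0) (innerZl ipP) mul0r. Qed.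

Lemma ip0r u : ip u 0 = 0.
Proof. by rewrite -(scale0r 0) ipZr rmorph0 mul0r. Qed.

Lemma ipNl u v : ip (- u) v = - ip u v.
Proof. by rewrite -scaleN1r (innerZl ipP) mulN1r. Qed.

Lemma ip_suml (I : Type) (r : seq I) (F : I -> V) w :
  ip (\sum_(i <- r) F i) w = \sum_(i <- r) ip (F i) w.
Proof.
by apply: (big_morph (ip^~ w)) => [u v|]; [exact: (innerDl ipP)|exact: ip0l].
Qed.

Lemma ip_sumr (I : Type) (r : seq I) (F : I -> V) w :
  ip w (\sum_(i <- r) F i) = \sum_(i <- r) ip w (F i).
Proof.
by apply: (big_morph (ip w)) => [u v|]; [exact: ipDr|exact: ip0r].
Qed.

Lemma ipvv_real v : Im (ip v v) = 0.
Proof.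
have := congr1 Im (innerC ipP v v); rewrite cImJ => /eqP.
by rewrite -addr_eq0 -mulr2n mulrn_eq0/= => /eqP.
Qed.

Lemma nm_ge0 v : 0 <= nm v. Proof. exact: sqrtr_ge0. Qed.

Lemma nm2 v : nm v ^+ 2 = Re (ip v v).
Proof. by rewrite sqr_sqrtr// (inner_ge0 ipP). Qed.

Lemma nm0 : nm 0 = 0. Proof. by rewrite /nm ip0l sqrtr0. Qed.

Lemma nm_eq0 v : nm v = 0 -> v = 0.
Proof. by move=> v0; apply: (inner_eq0 ipP); rewrite -nm2 v0 expr0n. Qed.

Lemma nmZ a v : nm (a *: v) = cmod a * nm v.
Proof.
apply/eqP; rewrite -(@eqrXn2 _ 2) ?mulr_ge0 ?nm_ge0 ?cmod_ge0//.
rewrite exprMn !nm2 (innerZl ipP) ipZr mulrA conjM_mod cReM/=.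
by rewrite mul0r subr0.
Qed.

Lemma nmN v : nm (- v) = nm v.
Proof. by rewrite -scaleN1r nmZ cmodN cmod1 mul1r. Qed.

Lemma nmBC u v : nm (u - v) = nm (v - u).
Proof. by rewrite -nmN opprB. Qed.

Lemma nmD2 u v : nm (u + v) ^+ 2 = nm u ^+ 2 + 2 * Re (ip u v) + nm v ^+ 2.
Proof.
rewrite !nm2 (innerDl ipP) !ipDr !cReD (innerC ipP v u) cReJ; ring.
Qed.

Lemma Re_ip_le u v : Re (ip u v) <= nm u * nm v.
Proof.
have h (s : R) : 0 <= nm u ^+ 2 - 2 * s * Re (ip u v) + s ^+ 2 * nm v ^+ 2.
  have := sqr_ge0 (nm (u + (- s)%:C%C *: v)).
  rewrite nmD2 ipZr nmZ cmodR normrN exprMn cReM/= real_normK ?num_real//.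
  by rewrite oppr0 mul0r subr0; lra.
have [v0|v0] := eqVneq (nm v) 0; last first.
  have vp : 0 < nm v by rewrite lt0r v0 nm_ge0.
  have up := nm_ge0 u.
  have [//|r0] := lerP (Re (ip u v)) (nm u * nm v).
  (* The value of s that minimises the quadratic in [h]. *)
  have := h (Re (ip u v) / nm v ^+ 2).
  have -> : nm u ^+ 2 - 2 * (Re (ip u v) / nm v ^+ 2) * Re (ip u v) +
    (Re (ip u v) / nm v ^+ 2) ^+ 2 * nm v ^+ 2 =
    nm u ^+ 2 - Re (ip u v) ^+ 2 / nm v ^+ 2 by field.
  rewrite subr_ge0 ler_pdivrMr ?exprn_gt0// -exprMn.
  have R0 : 0 <= Re (ip u v) by apply: le_trans (ltW r0); rewrite mulr_ge0 ?nm_ge0.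
  by rewrite ler_pXn2r ?nnegrE ?mulr_ge0 ?nm_ge0// leNgt r0.
by rewrite (nm_eq0 v0) ip0r nm0 mulr0.
Qed.

(** Multiplying u by the conjugate of [ip u v] makes the product real, which reduces the modulus to
    the real part. *)
Lemma ip_le u v : cmod (ip u v) <= nm u * nm v.
Proof.
have [z0|z0] := eqVneq (cmod (ip u v)) 0.
  by rewrite z0 mulr_ge0 ?nm_ge0.
have zp : 0 < cmod (ip u v) by rewrite lt0r z0 cmod_ge0.
have := Re_ip_le (((ip u v)^*)%C *: u) v.
rewrite (innerZl ipP) nmZ cmodJ mulrC conjM_mod/=.
by rewrite expr2 -mulrA ler_pM2l.
Qed.

Lemma nmD u v : nm (u + v) <= nm u + nm v.
Proof.
rewrite -(@ler_pXn2r _ 2) ?nnegrE ?nm_ge0 ?addr_ge0 ?nm_ge0//.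
rewrite nmD2 sqrrD; have := Re_ip_le u v; lra.
Qed.

Lemma nm_sum (I : Type) (r : seq I) (F : I -> V) :
  nm (\sum_(i <- r) F i) <= \sum_(i <- r) nm (F i).
Proof.
elim: r => [|a r ih]; first by rewrite !big_nil nm0.
by rewrite !big_cons (le_trans (nmD _ _))// lerD2l.
Qed.

Lemma nm_trans w u v : nm (u - v) <= nm (u - w) + nm (w - v).
Proof. by have := nmD (u - w) (w - v); rewrite subrKA. Qed.

Lemma nm_dist u v : nm u <= nm v + nm (u - v).
Proof. by have := nmD (u - v) v; rewrite subrK addrC. Qed.

Lemma nm_small v : (forall e : R, 0 < e -> nm v <= e) -> v = 0.
Proof.
move=> h; apply: nm_eq0; apply/le_anti; rewrite nm_ge0 andbT.
by apply/ler_addgt0Pl => e e0; rewrite addr0 h.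
Qed.

Lemma nm_small_eq u v : (forall e : R, 0 < e -> nm (u - v) <= e) -> u = v.
Proof. by move=> /nm_small /eqP; rewrite subr_eq0 => /eqP. Qed.

End inner_product.

(** * Projection-valued measures on an inner product space *)

Section projection_valued.
Context {R : realType} {V : lmodType R[i]} {ip : V -> V -> R[i]}.
Local Notation Re := (@complex.Re R).
Local Notation nm := (nm ip).

(** Counterpart of [proj_measure] on a vector space, where almost everywhere equalities become
    equalities. It is instantiated by the L^2 classes. *)
Record pvm := Pvm {
  pe :> set R -> V -> V ;
  pe_inner : is_inner ip ;
  pe_lin : forall A, measurable A -> forall a u v,
    pe A (a *: u + v) = a *: pe A u + pe A v ;
  pe_idem : forall A v, measurable A -> pe A (pe A v) = pe A v ;
  pe_sym : forall A u v, measurable A -> ip (pe A u) v = ip u (pe A v) ;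
  pe_total : forall v, pe `[0, +oo[ v = v ;
  pe_sadd : forall (A : nat -> set R) v, (forall n, measurable (A n)) ->
    trivIset setT A -> forall e : R, 0 < e -> exists N, forall n, (N <= n)%N ->
    nm (pe (\bigcup_n A n) v - \sum_(k < n) pe (A k) v) <= e }.

Variable P : pvm.
Let ipP := pe_inner P.
Implicit Types (A B : set R) (u v : V).

Lemma peD A u v : measurable A -> P A (u + v) = P A u + P A v.
Proof. by move=> mA; have := pe_lin P mA 1 u v; rewrite !scale1r. Qed.

Lemma pe0 A : measurable A -> P A 0 = 0.
Proof.
by move=> mA; apply: (@addrI _ (P A 0)); rewrite -peD// !addr0.
Qed.

Lemma peZ A a v : measurable A -> P A (a *: v) = a *: P A v.
Proof. by move=> mA; have := pe_lin P mA a v 0; rewrite !addr0 pe0// addr0. Qed.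

(** Countable additivity along the constant sequence of empty sets: a partial sum with N + 2 terms
    differs from [P set0 v] by N + 1 copies of it, so this vector has arbitrarily small norm. *)
Lemma pe_set0 v : P set0 v = 0.
Proof.
apply: (nm_small ipP) => e e0.
have [|N hN] := pe_sadd P v (fun=> measurable0) _ e0.
  by apply/trivIsetP => i j _ _ _; rewrite set0I.
have := hN N.+2 (leqW (leqW (leqnn N))).
rewrite bigcup0// sumr_const card_ord mulrSr opprD addrCA subrr addr0 (nmN ipP).
rewrite -scaler_nat (nmZ ipP); apply: le_trans; rewrite ler_peMl ?nm_ge0//.
have -> : (N.+1%:R : R[i]) = (N.+1%:R : R)%:C%C by rewrite rmorph_nat.
by rewrite cmodR ger0_norm// ler1n.
Qed.

Lemma peU A B v : measurable A -> measurable B -> [disjoint A & B] ->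
  P (A `|` B) v = P A v + P B v.
Proof.
move=> mA mB /disj_setPS AB.
have AB0 : A `&` B = set0 by rewrite -subset0.
apply: (nm_small_eq ipP) => e e0.
have [||N hN] := @pe_sadd P (bigcup2 A B) v _ _ e e0.
- by move=> [|[|n]] /=.
- apply/trivIsetP => i j _ _; move: i j => [|[|i]] [|[|j]] //= _;
    by rewrite ?set0I ?setI0 ?(setIC B A) ?AB0.
- have := hN N.+2 (leqW (leqW (leqnn N))).
  rewrite bigcup2E !big_ord_recl big1/= ?addr0//.
  by move=> i _; exact: pe_set0.
Qed.

(** Idempotence of P (A U B) = P A + P B gives P A P B + P B P A = 0. Composing with P A on both
    sides gives 2 P A P B P A = 0, and then composing on the left only gives P A P B = 0. *)
Lemma pe_disj A B v : measurable A -> measurable B -> [disjoint A & B] ->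
  P A (P B v) = 0.
Proof.
move=> mA mB AB.
have mAB : measurable (A `|` B) by exact: measurableU.
have h w : P A (P B w) + P B (P A w) = 0.
  have := pe_idem P w mAB; rewrite !peU// !peD// !pe_idem// => h.
  apply: (@addrI _ (P A w + P B w)); rewrite addr0 -[RHS]h.
  by rewrite addrACA [P B w + _]addrC.
have hA w : P A (P B (P A w)) = 0.
  have := congr1 (P A) (h (P A w)); rewrite pe0// peD// !pe_idem//.
  move/eqP; rewrite -mulr2n -scaler_nat scaler_eq0 pnatr_eq0/=.
  by move/eqP.
have := congr1 (P A) (h v); rewrite pe0// peD// !pe_idem// hA addr0.
by [].
Qed.

Lemma peI A B v : measurable A -> measurable B -> P A (P B v) = P (A `&` B) v.
Proof.
move=> mA mB.
have mI : measurable (A `&` B) by exact: measurableI.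
have split C D : measurable C -> measurable D ->
    forall w, P C w = P (C `&` D) w + P (C `\` D) w.
  move=> mC mD w; rewrite -peU.
  - by rewrite setUIDK.
  - exact: measurableI.
  - exact: measurableD.
  - by apply/disj_setPS => x [[_ ?] [_ ?]].
have mAB : measurable (A `\` B) by exact: measurableD.
have mBA : measurable (B `\` A) by exact: measurableD.
have d1 : [disjoint A `\` B & B] by apply/disj_setPS => x [[_ ?]].
have d2 : [disjoint A `&` B & B `\` A] by apply/disj_setPS => x [[? _] [_ ?]].
rewrite (split A B mA mB) (pe_disj v mAB mB d1) addr0.
by rewrite (split B A mB mA) (setIC B A) peD// pe_idem// pe_disj// addr0.
Qed.

(** Set to 0 off the Borel sets, where [P] is unconstrained while a measure must still be
    nonnegative. *)
Definition nu (v : V) (A : set R) : \bar R :=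
  if pselect (measurable A) then (Re (ip (P A v) v))%:E else 0%E.

Lemma nuE v A : measurable A -> nu v A = (Re (ip (P A v) v))%:E.
Proof. by rewrite /nu; case: pselect. Qed.

Lemma pe_ip_nm v A : measurable A -> Re (ip (P A v) v) = nm (P A v) ^+ 2.
Proof.
by move=> mA; rewrite (nm2 ipP) -{1}(pe_idem P v mA) (pe_sym P)// -?(pe_idem P v).
Qed.

Let nu0 v : nu v set0 = 0%E.
Proof. by rewrite nuE// pe_set0 (ip0l ipP). Qed.

Let nu_ge0 v A : (0 <= nu v A)%E.
Proof.
rewrite /nu; case: pselect => // mA; rewrite lee_fin pe_ip_nm//.
exact: sqr_ge0.
Qed.

Let nu_sigma v : semi_sigma_additive (nu v).
Proof.
move=> F mF tF mUF; rewrite nuE//.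
under eq_fun do (under eq_bigr do rewrite nuE//; rewrite sumEFin).
apply/cvg_EFin; first by near=> n.
rewrite [X in X @ _ --> _](_ : _ =
  (fun n => \sum_(0 <= i < n) Re (ip (P (F i) v) v)))//.
apply/cvgrPdist_le => e e0.
have e1 : 0 < e / (nm v + 1).
  by rewrite divr_gt0// ltr_wpDl// nm_ge0.
have [N hN] := pe_sadd P v mF tF e1.
near=> n; have nN : (N <= n)%N by near: n; exists N.
rewrite big_mkord -cRe_sum -(ip_suml ipP) -cReN -(ipNl ipP) -cReD.
rewrite -(innerDl ipP) (le_trans (cRe_le _))// (le_trans (ip_le ipP _ _))//.
apply: (@le_trans _ _ (e / (nm v + 1) * (nm v + 1))); last first.
  by rewrite divfK// gt_eqF// ltr_wpDl// nm_ge0.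
by rewrite ler_pM ?nm_ge0 ?hN// lerDl.
Unshelve. all: by end_near. Qed.

HB.instance Definition _ v := isMeasure.Build _ _ _ (nu v) (nu0 v) (nu_ge0 v) (@nu_sigma v).

Lemma nu_D v : nu v `[0, +oo[ = (nm v ^+ 2)%:E.
Proof. by rewrite nuE// pe_total (nm2 ipP). Qed.

Lemma pe_setT v : P setT v = v.
Proof. by rewrite -{2}(pe_total P v) -(pe_total P (P setT v)) peI// setIT pe_total. Qed.

Let nu_fin v : fin_num_fun (nu v).
Proof. by move=> A mA; rewrite nuE. Qed.

HB.instance Definition _ v := Measure_isFinite.Build _ _ _ (nu v) (@nu_fin v).

Lemma nuI v A : measurable A -> nu v (A `&` `[0, +oo[) = nu v A.
Proof.
by move=> mA; rewrite !nuE ?pe_setT//; [rewrite -peI// pe_total|exact: measurableI].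
Qed.

End projection_valued.

(** * Simple functions and uniform approximation of bounded symbols *)

Section simple_symbols.
Context {R : realType}.
Local Notation Re := (@complex.Re R).
Local Notation Im := (@complex.Im R).
Local Notation D := (`[0%R, +oo[%classic : set R).

Fixpoint all_meas (K : Type) (s : seq (K * set R)) : Prop :=
  if s is p :: s' then measurable p.2 /\ all_meas s' else True.

Lemma all_meas_cat (K : Type) (s t : seq (K * set R)) :
  all_meas s -> all_meas t -> all_meas (s ++ t).
Proof. by elim: s => //= p s ih [mp ms] mt; split=> //; exact: ih. Qed.

Lemma all_meas_map (K K' : Type) (h : K * set R -> K' * set R) s :
  (forall p, measurable p.2 -> measurable (h p).2) ->
  all_meas s -> all_meas (map h s).
Proof. by move=> mh; elim: s => //= p s ih [mp ms]; split; [exact: mh|exact: ih]. Qed.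

(** Simple functions are lists of coefficients and sets, with no disjointness imposed; products are
    then formed term by term. *)
Definition prod_sim (K : pzRingType) (s t : seq (K * set R)) :=
  flatten [seq [seq (p.1 * q.1, p.2 `&` q.2) | q <- t] | p <- s].

Lemma all_meas_prod (K : pzRingType) (s t : seq (K * set R)) :
  all_meas s -> all_meas t -> all_meas (prod_sim s t).
Proof.
elim: s => //= p s ih [mp ms] mt; apply: all_meas_cat; last exact: ih.
by apply: all_meas_map mt => q mq; exact: measurableI.
Qed.

Definition sim (s : seq (R[i] * set R)) (l : R) : R[i] :=
  \sum_(p <- s) p.1 * (\1_(p.2) l)%:C%C.

Definition simr (s : seq (R * set R)) (l : R) : R :=
  \sum_(p <- s) p.1 * \1_(p.2) l.

(** The squared modulus of a simple function is a real simple function, so its integral against the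
    spectral measure is a finite sum. *)
Definition mod2_sim (s : seq (R[i] * set R)) : seq (R * set R) :=
  [seq (Re p.1, p.2) | p <- prod_sim s [seq ((p.1^*)%C, p.2) | p <- s]].

Lemma mod2_simE s l : cmod (sim s l) ^+ 2 = simr (mod2_sim s) l.
Proof.
have h x : cmod x ^+ 2 = Re (x * (x^*)%C) :> R by rewrite conjM_mod.
rewrite h /sim rmorph_sum/= big_distrl/= cRe_sum /simr/mod2_sim big_map.
rewrite /prod_sim big_flatten/= big_map; apply: eq_bigr => p _.
rewrite big_distrr/= cRe_sum !big_map; apply: eq_bigr => q _/=.
by rewrite indicI/= !cRI/=; ring.
Qed.

Lemma mod2_sim_meas s : all_meas s -> all_meas (mod2_sim s).
Proof.
move=> ms; apply: all_meas_map => //; apply: all_meas_prod => //.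
exact: all_meas_map.
Qed.

Lemma sim_cat s t l : sim (s ++ t) l = sim s l + sim t l.
Proof. exact: big_cat. Qed.

Lemma sim_prod s t l : sim (prod_sim s t) l = sim s l * sim t l.
Proof.
rewrite /sim big_distrl/= /prod_sim big_flatten/= big_map.
apply: eq_bigr => p _; rewrite big_distrr/= big_map; apply: eq_bigr => q _ /=.
by rewrite indicI/= rmorphM/=; ring.
Qed.

Definition scale_sim (a : R[i]) (s : seq (R[i] * set R)) :=
  [seq (a * p.1, p.2) | p <- s].

Lemma sim_scale a s l : sim (scale_sim a s) l = a * sim s l.
Proof.
by rewrite /sim big_map big_distrr/=; apply: eq_bigr => p _; rewrite mulrA.
Qed.

Lemma all_meas_scale a s : all_meas s -> all_meas (scale_sim a s).
Proof. exact: all_meas_map. Qed.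

Lemma simr_meas (s : seq (R * set R)) : all_meas s -> measurable_fun D (simr s).
Proof.
elim: s => [_|p s ih [mp ms]].
  rewrite (_ : simr [::] = cst 0); first exact: measurable_cst.
  by apply/funext => l; rewrite /simr big_nil.
rewrite (_ : simr (p :: s) = (fun l => p.1 * \1_(p.2) l + simr s l)); last first.
  by apply/funext => l; rewrite /simr big_cons.
apply: measurable_funD; last exact: ih.
apply: measurable_funM; first exact: measurable_cst.
by apply: measurable_funTS; exact: measurable_indic.
Qed.

Lemma Re_sim s : (fun l => Re (sim s l)) = simr [seq (Re p.1, p.2) | p <- s].
Proof.
apply/funext => l; rewrite /sim /simr cRe_sum big_map.
by apply: eq_bigr => p _ /=; rewrite cReM/= mulr0 subr0.
Qed.

Lemma Im_sim s : (fun l => Im (sim s l)) = simr [seq (Im p.1, p.2) | p <- s].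
Proof.
apply/funext => l; rewrite /sim /simr cIm_sum big_map.
by apply: eq_bigr => p _ /=; rewrite cImM/= mulr0 add0r.
Qed.

Definition msym (phi : R -> R[i]) : Prop :=
  measurable_fun D (fun l => Re (phi l)) /\ measurable_fun D (fun l => Im (phi l)).

Definition bsym (phi : R -> R[i]) : Prop :=
  msym phi /\ exists M : R, forall l, 0 <= l -> cmod (phi l) <= M.

Lemma msym_sim s : all_meas s -> msym (sim s).
Proof.
by move=> ms; split; rewrite ?Re_sim ?Im_sim; apply: simr_meas;
   exact: all_meas_map.
Qed.

Lemma msymD phi psi : msym phi -> msym psi -> msym (fun l => phi l + psi l).
Proof.
move=> [m1 m2] [m3 m4]; split.
- by under [X in measurable_fun _ X]eq_fun do [rewrite cReD]; exact: measurable_funD.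
- by under [X in measurable_fun _ X]eq_fun do [rewrite cImD]; exact: measurable_funD.
Qed.

Lemma msymM phi psi : msym phi -> msym psi -> msym (fun l => phi l * psi l).
Proof.
move=> [m1 m2] [m3 m4]; split.
- under [X in measurable_fun _ X]eq_fun do [rewrite cReM]; apply: measurable_funB; exact: measurable_funM.
- under [X in measurable_fun _ X]eq_fun do [rewrite cImM]; apply: measurable_funD; exact: measurable_funM.
Qed.

Lemma msym_cst a : msym (cst a).
Proof. by split; exact: measurable_cst. Qed.

Lemma msymB phi psi : msym phi -> msym psi -> msym (fun l => phi l - psi l).
Proof.
move=> m1 m2; have := msymD m1 (msymM (msym_cst (-1)) m2).
by rewrite (_ : (fun l => _) = (fun l => phi l - psi l))//; apply/funext => l; rewrite mulN1r.
Qed.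

Lemma bsymD phi psi : bsym phi -> bsym psi -> bsym (fun l => phi l + psi l).
Proof.
move=> [m1 [M hM]] [m2 [N hN]]; split; first exact: msymD.
by exists (M + N) => l l0; rewrite (le_trans (cmodD _ _))// lerD ?hM ?hN.
Qed.

Lemma bsymM phi psi : bsym phi -> bsym psi -> bsym (fun l => phi l * psi l).
Proof.
move=> [m1 [M hM]] [m2 [N hN]]; split; first exact: msymM.
by exists (M * N) => l l0; rewrite cmodM ler_pM ?cmod_ge0 ?hM ?hN.
Qed.

Lemma bsym_cst a : bsym (cst a).
Proof. by split; [exact: msym_cst|exists (cmod a)]. Qed.

Lemma bsymB phi psi : bsym phi -> bsym psi -> bsym (fun l => phi l - psi l).
Proof.
move=> [m1 [M hM]] [m2 [N hN]]; split; first exact: msymB.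
by exists (M + N) => l l0; rewrite (le_trans (cmodD _ _))// cmodN lerD ?hM ?hN.
Qed.

Lemma bsymZ a phi : bsym phi -> bsym (fun l => a * phi l).
Proof. exact: bsymM (bsym_cst a). Qed.

Lemma bsym_sum (I : Type) (r : seq I) (F : I -> R -> R[i]) :
  (forall i, bsym (F i)) -> bsym (fun l => \sum_(i <- r) F i l).
Proof.
move=> hF; elim: r => [|i r ih].
  by under [X in bsym X]eq_fun do [rewrite big_nil]; exact: bsym_cst.
by under [X in bsym X]eq_fun do [rewrite big_cons]; exact: bsymD.
Qed.

Lemma bsym_real (g : R -> R) (M : R) : measurable_fun D g ->
  (forall l, 0 <= l -> `|g l| <= M) -> bsym (fun l => (g l)%:C%C).
Proof.
move=> mg hM; split; first by split=> //=; exact: measurable_cst.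
by exists M => l l0; rewrite cmodR hM.
Qed.

(* The level sets of [g] over a grid of mesh [e] give the approximation. *)
Lemma real_sim (g : R -> R) (M e : R) : measurable_fun D g -> 0 < e ->
  (forall l, 0 <= l -> `|g l| <= M) ->
  exists2 s : seq (R * set R), all_meas s &
    forall l, 0 <= l -> `|g l - simr s l| <= e.
Proof.
move=> mg e0 hM.
(* Cells of length e starting at -M; this many of them reach past M. *)
pose n := (Num.truncn (2 * M / e)).+1.
pose A i := D `&` g @^-1` `[- M + i%:R * e, - M + i.+1%:R * e[%classic.
exists [seq (- M + i%:R * e, A i) | i <- iota 0 n].
  elim: (iota 0 n) => //= i s ih; split=> //.
  exact: mg.
move=> l l0; rewrite /simr big_map.
have := hM _ l0; rewrite ler_norml => /andP[g1 g2].
pose i := Num.truncn ((g l + M) / e).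
have q0 : 0 <= (g l + M) / e by rewrite divr_ge0 ?(ltW e0)//; lra.
have /andP[i1 i2] := truncn_itv q0.
have iA j : (\1_(A j) l : R) = (j == i)%:R.
  rewrite indicE; congr (nat_of_bool _)%:R.
  apply/idP/eqP.
    rewrite inE => -[_ /=]; rewrite in_itv/= => /andP[h1 h2].
    apply/eqP; rewrite eq_sym; apply/eqP; apply: truncn_def.
    by rewrite ler_pdivlMr// ltr_pdivrMr//; apply/andP; split; lra.
  move=> ->; rewrite inE; split; first by rewrite /= in_itv/= l0.
  move: i1 i2; rewrite ler_pdivlMr// ltr_pdivrMr// -/i => i1 i2.
  by rewrite /= in_itv/=; apply/andP; split; lra.
have iin : i \in iota 0 n.
  rewrite mem_iota add0n /n ltnS /= /i; apply: le_truncn.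
  by rewrite ler_pM2r ?invr_gt0//; lra.
rewrite (bigD1_seq i) ?iota_uniq//= iA eqxx mulr1 big1 ?addr0; last first.
  by move=> j ji; rewrite iA (negPf ji) mulr0.
move: i1 i2; rewrite ler_pdivlMr// ltr_pdivrMr// -/i -natr1 mulrDl mul1r => i1 i2.
by rewrite ler_norml; apply/andP; split; lra.
Qed.

Lemma sim_real (s : seq (R * set R)) l :
  sim [seq ((p.1)%:C%C, p.2) | p <- s] l = (simr s l)%:C%C.
Proof.
by rewrite /sim /simr big_map rmorph_sum; apply: eq_bigr => p _; rewrite rmorphM.
Qed.

Lemma bsym_sim phi (e : R) : bsym phi -> 0 < e ->
  exists2 s : seq (R[i] * set R), all_meas s &
    forall l, 0 <= l -> cmod (phi l - sim s l) <= e.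
Proof.
move=> [[m1 m2] [M hM]] e0.
have e2 : 0 < e / 2 by rewrite divr_gt0.
have [|s1 ms1 h1] := real_sim (M := M) m1 e2.
  by move=> l l0; rewrite (le_trans (cRe_le _))// hM.
have [|s2 ms2 h2] := real_sim (M := M) m2 e2.
  by move=> l l0; rewrite (le_trans (cIm_le _))// hM.
exists ([seq ((p.1)%:C%C, p.2) | p <- s1] ++
        scale_sim 'i%C [seq ((p.1)%:C%C, p.2) | p <- s2]).
  apply: all_meas_cat; first exact: all_meas_map.
  by apply: all_meas_scale; exact: all_meas_map.
move=> l l0; rewrite (le_trans (cmod_le_ReIm _))// (splitr e).
rewrite sim_cat sim_scale !sim_real; apply: lerD.
- rewrite (_ : Re _ = Re (phi l) - simr s1 l) ?h1//.
  by rewrite !cRI/=; ring.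
- rewrite (_ : Im _ = Im (phi l) - simr s2 l) ?h2//.
  by rewrite !cRI/=; ring.
Qed.

Lemma simr_int (m : {finite_measure set R -> \bar R})
  (s : seq (R * set R)) : all_meas s ->
  m.-integrable D (fun l => (simr s l)%:E) /\
  (\int[m]_(l in D) (simr s l)%:E)%E =
    (\sum_(p <- s) p.1 * fine (m (p.2 `&` D)))%:E.
Proof.
have mD : measurable D by [].
elim: s => [_|p s ih [mp /ih [i1 e1]]].
  rewrite (_ : (fun l => (simr [::] l)%:E) = cst 0%E); last first.
    by apply/funext => l; rewrite /simr big_nil.
  by split; [exact: integrable0|rewrite integral0 big_nil].
have i2 : m.-integrable D (fun l => (\1_(p.2) l)%:E).
  by apply: (@integrableS _ _ _ _ setT) => //; exact: integrable_indic.
have i3 := integrableZl mD p.1 i2.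
rewrite (_ : (fun l => (simr (p :: s) l)%:E) =
  (fun l => p.1%:E * (\1_(p.2) l)%:E + (simr s l)%:E)%E); last first.
  by apply/funext => l; rewrite /simr big_cons EFinD.
split; first exact: integrableD.
rewrite integralD// integralZl// integral_indic// e1 big_cons EFinD EFinM.
by rewrite fineK// fin_num_measure//; exact: measurableI.
Qed.

End simple_symbols.

(** * Functional calculus for bounded symbols *)

Section calculus.
Context {R : realType} {V : lmodType R[i]} {ip : V -> V -> R[i]}.
Local Notation Re := (@complex.Re R).
Local Notation nm := (nm ip).
Local Notation D := (`[0%R, +oo[%classic : set R).
Variable P : @pvm R V ip.
Let ipP := pe_inner P.
Hypothesis complete_nm : forall u : nat -> V,
  (forall e : R, 0 < e -> exists N, forall m n, (N <= m)%N -> (N <= n)%N ->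
     nm (u m - u n) <= e) ->
  exists v, forall e : R, 0 < e -> exists N, forall n, (N <= n)%N ->
     nm (u n - v) <= e.
Implicit Types (v w : V) (phi psi : R -> R[i]) (s t : seq (R[i] * set R)).

(** The restriction e <= 1 lets products of two errors be bounded linearly in e, as happens in
    [multM]. *)
Lemma small_eq v w (K : R) :
  (forall e, 0 < e -> e <= 1 -> nm (v - w) <= K * e) -> v = w.
Proof.
move=> h; apply: (nm_small_eq ipP) => e e0.
have K0 : 0 < `|K| + 1 by rewrite ltr_wpDl.
pose e' := Num.min 1 (e / (`|K| + 1)).
have e'0 : 0 < e' by rewrite lt_min ltr01 divr_gt0.
have := h e' e'0; rewrite ge_min lexx => /(_ isT) /le_trans; apply.
apply: (@le_trans _ _ ((`|K| + 1) * e')).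
  by rewrite ler_pM2r// (le_trans (ler_norm K))// lerDl.
rewrite mulrC -ler_pdivlMr// /e' ge_min; apply/orP; right.
by rewrite lexx.
Qed.

Lemma eq_big_meas (K : Type) (S : nmodType) (F G : K * set R -> S) r :
  all_meas r -> (forall p, measurable p.2 -> F p = G p) ->
  \sum_(p <- r) F p = \sum_(p <- r) G p.
Proof.
move=> + h; elim: r => [|p r ih]; first by rewrite !big_nil.
by move=> [mp mr]; rewrite !big_cons h// ih.
Qed.

Definition Tsim s v := \sum_(p <- s) p.1 *: P p.2 v.

Lemma Tsim_cat s t v : Tsim (s ++ t) v = Tsim s v + Tsim t v.
Proof. exact: big_cat. Qed.

Lemma Tsim_scale a s v : Tsim (scale_sim a s) v = a *: Tsim s v.
Proof.
by rewrite /Tsim big_map scaler_sumr; apply: eq_bigr => p _; rewrite scalerA.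
Qed.

Lemma Tsim_lin s a u v : all_meas s ->
  Tsim s (a *: u + v) = a *: Tsim s u + Tsim s v.
Proof.
move=> ms; rewrite /Tsim scaler_sumr -big_split/=; apply: (eq_big_meas ms) => p mp.
by rewrite (pe_lin P)// scalerDr !scalerA mulrC.
Qed.

Lemma TsimB s u v : all_meas s -> Tsim s (u - v) = Tsim s u - Tsim s v.
Proof.
by move=> ms; rewrite addrC -scaleN1r Tsim_lin// scaleN1r addrC.
Qed.

Lemma Tsim_prod s t v : all_meas s -> all_meas t ->
  Tsim (prod_sim s t) v = Tsim s (Tsim t v).
Proof.
move=> ms mt; rewrite /Tsim /prod_sim big_flatten/= big_map.
apply: (eq_big_meas ms) => p mp; rewrite big_map.
have -> : P p.2 (\sum_(q <- t) q.1 *: P q.2 v) = \sum_(q <- t) q.1 *: P p.2 (P q.2 v).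
  have -> : P p.2 (\sum_(q <- t) q.1 *: P q.2 v) = \sum_(q <- t) P p.2 (q.1 *: P q.2 v).
    apply: (big_morph (P p.2)) => [x y|]; [exact: peD|exact: pe0].
  by apply: eq_bigr => q _; rewrite peZ.
rewrite scaler_sumr; apply: (eq_big_meas mt) => q mq /=.
by rewrite peI// scalerA.
Qed.

Definition sqint phi v : \bar R :=
  (\int[nu P v]_(l in D) (cmod (phi l) ^+ 2)%:E)%E.

(** The isometry on which the calculus rests. Expanding the squared norm produces the products of P
    A v and P B v, which are the masses of the intersections of A and B because projections multiply
    by intersection. *)
Lemma Tsim_nm2 s v : all_meas s -> sqint (sim s) v = (nm (Tsim s v) ^+ 2)%:E.
Proof.
move=> ms; rewrite /sqint; under eq_integral do rewrite mod2_simE.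
have [_ ->] := simr_int (nu P v) (mod2_sim_meas ms).
rewrite (nm2 ipP) /mod2_sim big_map /prod_sim big_flatten/= big_map.
rewrite /Tsim (ip_suml ipP) cRe_sum; congr EFin; apply: (eq_big_meas ms) => p mp.
rewrite (ip_sumr ipP) cRe_sum !big_map; apply: (eq_big_meas ms) => q mq.
have mpq : measurable (p.2 `&` q.2) by exact: measurableI.
rewrite nuI//= nuE//= (innerZl ipP) (ipZr ipP) mulrA -(pe_sym P)// (peI P)//.
rewrite (setIC q.2) [RHS]cReM; have -> : complex.Im (ip (P (p.2 `&` q.2) v) v) = 0.
  by rewrite -(pe_idem P v mpq) (pe_sym P)// (ipvv_real ipP).
by rewrite mulr0 subr0.
Qed.

(** Mirrors [spectral_integral]: the same simple function approximates the symbol in L^2 of the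
    scalar measure and the value in norm. *)
Definition specint phi v w := forall e : R, 0 < e -> exists s, [/\ all_meas s,
  (sqint (fun l => phi l - sim s l)%R v < e%:E)%E & nm (w - Tsim s v) < e].

Lemma cmod2_meas phi : msym phi ->
  measurable_fun D (fun l => (cmod (phi l) ^+ 2)%:E).
Proof.
move=> [m1 m2]; apply/measurable_EFinP; under [X in measurable_fun _ X]eq_fun do rewrite cmod2.
by apply: measurable_funD; exact: measurable_funX.
Qed.

Lemma sqint_le phi psi v : msym phi -> msym psi ->
  (forall l, 0 <= l -> cmod (phi l) <= cmod (psi l)) ->
  (sqint phi v <= sqint psi v)%E.
Proof.
move=> m1 m2 h; apply: ge0_le_integral => //.
- by move=> l _; rewrite lee_fin sqr_ge0.
- exact: cmod2_meas.
- exact: cmod2_meas.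
- move=> l; rewrite /= in_itv/= andbT => l0.
  by rewrite lee_fin ler_pXn2r ?nnegrE ?cmod_ge0// h.
Qed.

Lemma sqint_cst a v : sqint (cst a) v = (cmod a ^+ 2 * nm v ^+ 2)%:E.
Proof.
have := @integral_cst _ _ _ (nu P v) D (measurable_itv _) (cmod a ^+ 2)%:E.
by rewrite /sqint /= => ->; rewrite nu_D EFinM.
Qed.

Lemma sqint_bd phi v (M : R) : msym phi -> 0 <= M ->
  (forall l, 0 <= l -> cmod (phi l) <= M) ->
  (sqint phi v <= (M ^+ 2 * nm v ^+ 2)%:E)%E.
Proof.
move=> m1 M0 hM; have -> : M ^+ 2 * nm v ^+ 2 = cmod (M%:C%C) ^+ 2 * nm v ^+ 2.
  by rewrite cmodR ger0_norm.
rewrite -sqint_cst; apply: (sqint_le v m1 (msym_cst _)) => l l0.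
by rewrite /cst cmodR ger0_norm// hM.
Qed.

Lemma sqintD phi psi v : msym phi -> msym psi ->
  (sqint (fun l => phi l + psi l)%R v <= 2%:E * (sqint phi v + sqint psi v))%E.
Proof.
move=> m1 m2; have mD : measurable D by [].
rewrite /sqint -ge0_integralD//; last 4 first.
- by move=> l _; rewrite lee_fin sqr_ge0.
- exact: cmod2_meas.
- by move=> l _; rewrite lee_fin sqr_ge0.
- exact: cmod2_meas.
rewrite -ge0_integralZl_EFin//; last 2 first.
- by move=> l _; rewrite -EFinD lee_fin addr_ge0 ?sqr_ge0.
- by apply: emeasurable_funD; exact: cmod2_meas.
apply: ge0_le_integral => //.
- by move=> l _; rewrite lee_fin sqr_ge0.
- by apply: cmod2_meas; exact: msymD.
- apply: emeasurable_funM; first exact: measurable_cst.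
  by apply: emeasurable_funD; exact: cmod2_meas.
- by move=> l _; rewrite -EFinD -EFinM lee_fin mulrDr cmod2D.
Qed.

Lemma sqintN phi v : sqint (fun l => - phi l)%R v = sqint phi v.
Proof. by rewrite /sqint; under eq_integral do rewrite cmodN. Qed.

(* Two simple functions close to [phi] and [psi] are close to each other, and
   [Tsim] is an isometry on them. *)
Lemma specint_close phi psi v w w' (b : R) : msym phi -> msym psi -> 0 <= b ->
  specint phi v w -> specint psi v w' ->
  (sqint (fun l => phi l - psi l)%R v <= (b ^+ 2)%:E)%E -> nm (w - w') <= 2 * b.
Proof.
move=> m1 m2 b0 s1 s2 hb; suff h (e : R) : 0 < e -> nm (w - w') <= e + 2 * b.
  by apply/ler_addgt0Pl => e /h.
(* [sqint] controls squared norms, hence the square in the second bound. *)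
move=> e0; pose e1 := Num.min (e / 8) ((e / 8) ^+ 2).
have e10 : 0 < e1 by rewrite lt_min ?exprn_gt0 divr_gt0.
have e1e : e1 <= e / 8 by rewrite ge_min lexx.
have e1e2 : e1 <= (e / 8) ^+ 2 by rewrite ge_min lexx orbT.
have [s [ms hs ws]] := s1 _ e10; have [t [mt ht wt]] := s2 _ e10.
have key : (sqint (sim (s ++ scale_sim (-1)%R t)) v <= (4 * e1 + 4 * (b ^+ 2 + e1))%:E)%E.
  have -> : sqint (sim (s ++ scale_sim (-1)%R t)) v = sqint (fun l =>
      - (phi l - sim s l) + ((phi l - psi l) + (psi l - sim t l)))%R v.
    by congr (sqint _ v); apply/funext => l; rewrite sim_cat sim_scale; ring.
  apply: (le_trans (sqintD _ _ _)).
  - have := msymM (msym_cst (-1)) (msymB m1 (msym_sim ms)).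
    by congr (msym _); apply/funext => l; rewrite mulN1r.
  - by apply: msymD; apply: msymB => //; exact: msym_sim.
  have h2 : (sqint (fun l => (phi l - psi l) + (psi l - sim t l))%R v <=
     (2 * (b ^+ 2 + e1))%:E)%E.
    apply: (le_trans (sqintD _ _ _)).
    - exact: msymB.
    - by apply: msymB => //; exact: msym_sim.
    by rewrite EFinM lee_pmul2l// EFinD leeD// ltW.
  rewrite sqintN; apply: (@le_trans _ _ (2%:E * (e1%:E + (2 * (b ^+ 2 + e1))%:E))%E).
    by rewrite lee_pmul2l// leeD// ltW.
  rewrite -EFinD -EFinM lee_fin; have := ltW e10; lra.
rewrite Tsim_nm2 ?lee_fin in key; last first.
  by apply: all_meas_cat => //; exact: all_meas_scale.
rewrite Tsim_cat Tsim_scale scaleN1r in key.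
have key2 : nm (Tsim s v - Tsim t v) <= 2 * b + e / 8 * 3.
  rewrite -(@ler_pXn2r _ 2) ?nnegrE ?nm_ge0//; last by rewrite addr_ge0 ?mulr_ge0 ?divr_ge0 ?(ltW e0).
  apply: (le_trans key); have := mulr_ge0 b0 (ltW e0); have := sqr_ge0 e.
  move: e1e2; rewrite !expr2; lra.
have := nm_trans ipP (Tsim s v) w w'; have := nm_trans ipP (Tsim t v) (Tsim s v) w'.
rewrite (nmBC ipP (Tsim t v) w'); lra.
Qed.

Lemma specint_unique phi v w w' : msym phi ->
  specint phi v w -> specint phi v w' -> w = w'.
Proof.
move=> m1 s1 s2; apply: (nm_small_eq ipP) => e e0.
apply: (@le_trans _ _ (2 * 0)); last by rewrite mulr0 ltW.
apply: (specint_close (phi := phi) (psi := phi) (v := v)) => //.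
rewrite (_ : (fun l => _) = cst 0); last by apply/funext => l; rewrite subrr.
by rewrite sqint_cst cmod0 expr0n/= mul0r.
Qed.

Lemma specint_sim s v : all_meas s -> specint (sim s) v (Tsim s v).
Proof.
move=> ms e e0; exists s; split => //; last by rewrite subrr (nm0 ipP).
rewrite (_ : (fun l => _) = cst 0); last by apply/funext => l; rewrite subrr.
by rewrite sqint_cst cmod0 expr0n/= mul0r lte_fin.
Qed.

Lemma Tsim_bd s v (M : R) : all_meas s -> 0 <= M ->
  (forall l, 0 <= l -> cmod (sim s l) <= M) -> nm (Tsim s v) <= M * nm v.
Proof.
move=> ms M0 hM; rewrite -(@ler_pXn2r _ 2) ?nnegrE ?nm_ge0 ?mulr_ge0 ?nm_ge0//.
by rewrite exprMn -lee_fin -Tsim_nm2// sqint_bd//; exact: msym_sim.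
Qed.

Lemma Tsim_close s t v (e : R) : all_meas s -> all_meas t -> 0 <= e ->
  (forall l, 0 <= l -> cmod (sim s l - sim t l) <= e) ->
  nm (Tsim s v - Tsim t v) <= e * nm v.
Proof.
move=> ms mt e0 h; have := @Tsim_bd (s ++ scale_sim (-1)%R t) v e.
rewrite Tsim_cat Tsim_scale scaleN1r; apply => //.
  by apply: all_meas_cat => //; exact: all_meas_scale.
by move=> l l0; rewrite sim_cat sim_scale mulN1r h.
Qed.

(** Simple functions within 1/(n + 1) of phi uniformly have, by the isometry, Cauchy values;
    completeness provides the limit. *)
Lemma specint_exists phi v : bsym phi -> exists w, specint phi v w.
Proof.
move=> bp.
have e0 (n : nat) : 0 < (n.+1%:R)^-1 :> R by rewrite invr_gt0.
have ap n := cid2 (bsym_sim bp (e0 n)).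
pose s n := projT1 (ap n).
have ms n : all_meas (s n) by rewrite /s; case: (ap n).
have hs n l : 0 <= l -> cmod (phi l - sim (s n) l) <= (n.+1%:R)^-1.
  by rewrite /s; case: (ap n) => t /= _; apply.
have small (e : R) : 0 < e -> exists N, forall n, (N <= n)%N -> (n.+1%:R)^-1 <= e.
  move=> ep; exists (Num.truncn (e^-1)) => n nN.
  rewrite invf_ple ?posrE// (le_trans (ltW (truncnS_gt _)))// ler_nat.
  by rewrite ltnS.
have [] := complete_nm (u := fun n => Tsim (s n) v).
  move=> e ep; have K0 : 0 < 2 * nm v + 1.
    by rewrite ltr_wpDl// mulr_ge0// nm_ge0.
  have [N hN] := small (e / (2 * nm v + 1)) (divr_gt0 ep K0).
  exists N => m n mN nN.
  apply: (@le_trans _ _ ((m.+1%:R^-1 + n.+1%:R^-1) * nm v)).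
    apply: (Tsim_close v (ms m) (ms n)); first by rewrite addr_ge0// ltW.
    move=> l l0; rewrite -(subrKA (phi l)) (le_trans (cmodD _ _))//.
    by rewrite lerD ?hs// -cmodN opprB hs.
  apply: (@le_trans _ _ (e / (2 * nm v + 1) * (2 * nm v))).
    rewrite mulrCA [leRHS]mulrA ler_wpM2r ?nm_ge0//.
    by rewrite [leRHS]mulr_natl mulr2n lerD// hN.
  by rewrite -mulrA ler_piMr ?(ltW ep)// mulrC ler_pdivrMr// mul1r lerDl.
move=> w hw; exists w => e ep.
have K0 : 0 < nm v ^+ 2 + 1 by rewrite ltr_wpDl// sqr_ge0.
have e2 : 0 < e / 2 by rewrite divr_gt0.
have [N1 hN1] := hw _ e2.
pose e1 := Num.min 1 (e / 2 / (nm v ^+ 2 + 1)).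
have e10 : 0 < e1 by rewrite lt_min ltr01 !divr_gt0.
have [N2 hN2] := small _ e10.
pose n := maxn N1 N2; exists (s n); split => //; last first.
  rewrite (nmBC ipP) (le_lt_trans (hN1 n (leq_maxl _ _)))//.
  by rewrite ltr_pdivrMr// ltr_pMr// ltr1n.
apply: (@le_lt_trans _ _ ((e1 ^+ 2 * nm v ^+ 2)%:E)).
  apply: sqint_bd (ltW e10) _; first by apply: msymB; [exact: bp.1|exact: msym_sim].
  by move=> l l0; rewrite (le_trans (hs n l l0))// hN2// leq_maxr.
rewrite lte_fin; apply: (@le_lt_trans _ _ (e1 * (nm v ^+ 2 + 1))).
  have e11 : e1 <= 1 by rewrite ge_min lexx.
  have : e1 ^+ 2 <= e1 by rewrite expr2 ler_piMr// ltW.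
  by have := sqr_ge0 (nm v); nra.
apply: (@le_lt_trans _ _ (e / 2)); last by rewrite ltr_pdivrMr// ltr_pMr// ltr1n.
by rewrite -ler_pdivlMr// ge_min lexx orbT.
Qed.

Definition mult phi v : V := xget 0 [set w | specint phi v w].

Lemma multP phi v : bsym phi -> specint phi v (mult phi v).
Proof.
by move=> /specint_exists-/(_ v)[w hw]; rewrite /mult; case: xgetP => [? ->//|/(_ w)].
Qed.

(** The factor 2 is the loss in [specint_close]. *)
Lemma mult_approx phi s v (e : R) : bsym phi -> all_meas s -> 0 <= e ->
  (forall l, 0 <= l -> cmod (phi l - sim s l) <= e) ->
  nm (mult phi v - Tsim s v) <= 2 * e * nm v.
Proof.
move=> bp ms e0 h; rewrite -mulrA.
have m1 := bp.1; have m2 := msym_sim ms.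
apply: (specint_close m1 m2 _ (multP v bp) (specint_sim v ms)).
  by rewrite mulr_ge0// nm_ge0.
by rewrite exprMn; apply: sqint_bd => //; exact: msymB.
Qed.

Lemma mult_sim s v : all_meas s -> mult (sim s) v = Tsim s v.
Proof.
move=> ms; have [M hM] : exists M, forall l, 0 <= l -> cmod (sim s l) <= M.
  exists (\sum_(p <- s) cmod p.1) => l _; rewrite /sim.
  elim: s {ms} => [|p s ih]; first by rewrite !big_nil cmod0.
  rewrite !big_cons (le_trans (cmodD _ _))// lerD// cmodM cmodR indicE.
  by rewrite ler_piMr ?cmod_ge0//; case: (_ \in _); rewrite ?normr1 ?normr0.
have b1 : bsym (sim s) by split; [exact: msym_sim|exists M].
by apply: (specint_unique b1.1) (multP v b1) (specint_sim v ms).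
Qed.

Lemma mult_lin phi a u v : bsym phi ->
  mult phi (a *: u + v) = a *: mult phi u + mult phi v.
Proof.
move=> bp; apply: (@small_eq _ _ (2 * nm (a *: u + v) + (cmod a * (2 * nm u) + 2 * nm v))).
move=> e e0 _; have [s ms hs] := bsym_sim bp e0.
apply: le_trans (nm_trans ipP (Tsim s (a *: u + v)) _ _) _.
rewrite mulrDl; apply: lerD.
  by rewrite mulrAC; apply: mult_approx => //; exact: ltW.
rewrite (nmBC ipP) Tsim_lin// opprD addrACA -scalerBr.
rewrite (le_trans (nmD ipP _ _))// mulrDl (nmZ ipP) lerD//.
  rewrite -mulrA ler_wpM2l ?cmod_ge0// mulrAC.
  by apply: mult_approx => //; exact: ltW.
by rewrite mulrAC; apply: mult_approx => //; exact: ltW.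
Qed.

(** [Tsim_bd] has constant 1 on simple functions, and the factor 2 of [mult_approx] only multiplies
    an error that tends to 0, so the sharp constant M survives. *)
Lemma mult_le phi v (M : R) : bsym phi ->
  (forall l, 0 <= l -> cmod (phi l) <= M) -> nm (mult phi v) <= M * nm v.
Proof.
move=> bp hM; have M0 : 0 <= M by rewrite (le_trans (cmod_ge0 _) (hM 0 _)).
apply/ler_addgt0Pl => e e0.
have K0 : 0 < 3 * nm v + 1 by rewrite ltr_wpDl// mulr_ge0// nm_ge0.
have d0 := divr_gt0 e0 K0; have [s ms hs] := bsym_sim bp d0.
have h1 := mult_approx v bp ms (ltW d0) hs.
have h2 : nm (Tsim s v) <= (M + e / (3 * nm v + 1)) * nm v.
  apply: Tsim_bd => //; first by rewrite addr_ge0// ltW.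
  move=> l l0; rewrite -(subrK (phi l) (sim s l)) addrC (le_trans (cmodD _ _))//.
  by rewrite lerD ?hM// -cmodN opprB hs.
have := nm_dist ipP (mult phi v) (Tsim s v).
have : e / (3 * nm v + 1) * (3 * nm v + 1) = e by rewrite divfK// gt_eqF.
move: d0 h1 h2; set x := e / _; move: (nm (mult phi v)) (nm (Tsim s v)) (nm (_ - _)).
move=> a b c; lra.
Qed.

Lemma multD phi psi v : bsym phi -> bsym psi ->
  mult (fun l => phi l + psi l) v = mult phi v + mult psi v.
Proof.
move=> bp bq; apply: (@small_eq _ _ (8 * nm v)) => e e0 _.
have [s ms hs] := bsym_sim bp e0; have [t mt ht] := bsym_sim bq e0.
apply: le_trans (nm_trans ipP (Tsim (s ++ t) v) _ _) _.
have -> : 8 * nm v * e = 2 * (e + e) * nm v + (2 * e * nm v + 2 * e * nm v) by ring.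
apply: lerD.
  apply: mult_approx; [exact: bsymD|exact: all_meas_cat|by rewrite addr_ge0// ltW|].
  move=> l l0; rewrite sim_cat opprD addrACA (le_trans (cmodD _ _))//.
  by rewrite lerD ?hs ?ht.
rewrite (nmBC ipP) Tsim_cat opprD addrACA (le_trans (nmD ipP _ _))//.
by rewrite lerD//; apply: mult_approx => //; exact: ltW.
Qed.

(** Both symbols are replaced by simple functions, for which the claim is [Tsim_prod]; since e <= 1
    the approximant of phi is bounded by M + 1. *)
Lemma multM phi psi v : bsym phi -> bsym psi ->
  mult (fun l => phi l * psi l) v = mult phi (mult psi v).
Proof.
move=> bp bq; have [M hM] := bp.2; have [N hN] := bq.2.
have M0 : 0 <= M by rewrite (le_trans (cmod_ge0 _) (hM 0 _)).
have N0 : 0 <= N by rewrite (le_trans (cmod_ge0 _) (hN 0 _)).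
apply: (@small_eq _ _ (2 * (M + N + 1) * nm v + ((M + 1) * (2 * nm v) + 2 * nm (mult psi v)))).
move=> e e0 e1.
have [s ms hs] := bsym_sim bp e0; have [t mt ht] := bsym_sim bq e0.
apply: le_trans (nm_trans ipP (Tsim (prod_sim s t) v) _ _) _.
rewrite mulrDl; apply: lerD.
  have -> : 2 * (M + N + 1) * nm v * e = 2 * ((M + N + 1) * e) * nm v by ring.
  apply: mult_approx; [exact: bsymM|exact: all_meas_prod| |].
    by rewrite mulr_ge0 ?(ltW e0)// !addr_ge0.
  move=> l l0; rewrite sim_prod.
  have -> : phi l * psi l - sim s l * sim t l =
    phi l * (psi l - sim t l) + (phi l - sim s l) * (psi l - (psi l - sim t l)).
    by ring.
  rewrite (le_trans (cmodD _ _))// !cmodM.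
  have h1 : cmod (phi l) * cmod (psi l - sim t l) <= M * e.
    by rewrite ler_pM ?cmod_ge0 ?hM ?ht.
  have h2 : cmod (psi l - (psi l - sim t l)) <= N + 1.
    rewrite (le_trans (cmodD _ _))// cmodN lerD ?hN//.
    by rewrite (le_trans (ht _ l0)).
  have h3 : cmod (phi l - sim s l) * cmod (psi l - (psi l - sim t l)) <= e * (N + 1).
    by rewrite ler_pM ?cmod_ge0 ?hs.
  lra.
rewrite (nmBC ipP) Tsim_prod//.
apply: le_trans (nm_trans ipP (Tsim s (mult psi v)) _ _) _.
rewrite addrC mulrDl lerD//; last first.
  by rewrite mulrAC; apply: mult_approx => //; exact: ltW.
rewrite -TsimB//; apply: (@le_trans _ _ ((M + 1) * nm (mult psi v - Tsim t v))).
  apply: Tsim_bd => //; first by rewrite addr_ge0.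
  move=> l l0; rewrite -(subrK (phi l) (sim s l)) addrC (le_trans (cmodD _ _))//.
  by rewrite lerD ?hM// -cmodN opprB (le_trans (hs _ l0)).
rewrite -mulrA ler_wpM2l ?addr_ge0// mulrAC.
by apply: mult_approx => //; exact: ltW.
Qed.

Lemma mult_cst a v : mult (cst a) v = a *: v.
Proof.
have m1 : all_meas [:: (a, setT : set R)] by split=> //; exact: measurableT.
have := mult_sim v m1; rewrite /Tsim big_seq1/= pe_setT => <-.
congr (mult _ v); apply/funext => l.
by rewrite /sim big_seq1/= indicT mulr1.
Qed.

Lemma multZ a phi v : bsym phi -> mult (fun l => a * phi l) v = a *: mult phi v.
Proof. by move=> bp; rewrite (multM v (bsym_cst a) bp) mult_cst. Qed.

Lemma multB phi psi v : bsym phi -> bsym psi ->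
  mult (fun l => phi l - psi l) v = mult phi v - mult psi v.
Proof.
move=> bp bq; have := multD v bp (bsymZ (-1) bq); rewrite multZ// scaleN1r => <-.
by congr (mult _ v); apply/funext => l; rewrite mulN1r.
Qed.

Lemma mult_sum (I : Type) (r : seq I) (F : I -> R -> R[i]) v :
  (forall i, bsym (F i)) ->
  mult (fun l => \sum_(i <- r) F i l) v = \sum_(i <- r) mult (F i) v.
Proof.
move=> hF; elim: r => [|i r ih].
  rewrite (_ : (fun l => _) = cst 0); first by rewrite mult_cst scale0r big_nil.
  by apply/funext => l; rewrite big_nil.
rewrite (_ : (fun l => _) = fun l => F i l + \sum_(j <- r) F j l); last first.
  by apply/funext => l; rewrite big_cons.
by rewrite multD ?ih ?big_cons//; exact: bsym_sum.
Qed.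

Lemma mult_dist phi psi v (e : R) : bsym phi -> bsym psi ->
  (forall l, 0 <= l -> cmod (phi l - psi l) <= e) ->
  nm (mult phi v - mult psi v) <= e * nm v.
Proof. by move=> bp bq h; rewrite -multB// mult_le//; exact: bsymB. Qed.

End calculus.

(** * Unbounded symbols applied after a damping symbol *)

Section unbounded_symbols.
Context {R : realType} {V : lmodType R[i]} {ip : V -> V -> R[i]}.
Local Notation nm := (nm ip).
Local Notation D := (`[0%R, +oo[%classic : set R).
Variable P : @pvm R V ip.
Let ipP := pe_inner P.
Hypothesis complete_nm : forall u : nat -> V,
  (forall e : R, 0 < e -> exists N, forall m n, (N <= m)%N -> (N <= n)%N ->
     nm (u m - u n) <= e) ->
  exists v, forall e : R, 0 < e -> exists N, forall n, (N <= n)%N ->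
     nm (u n - v) <= e.
Implicit Types (v w : V) (phi psi : R -> R[i]).
Local Notation mult := (mult P).
Local Notation sqint := (sqint P).

Let J (n : nat) : set R := `[0, n%:R]%classic.

Let mJ n : measurable (J n). Proof. exact: measurable_itv. Qed.

Let JP n l : J n l <-> 0 <= l /\ l <= n%:R.
Proof. by rewrite /J /= in_itv/=; split=> /andP. Qed.

Let chi (A : set R) phi (l : R) : R[i] := phi l * (\1_A l)%:C%C.

Let msym_indic A : measurable A -> msym (fun l => (\1_A l : R)%:C%C).
Proof.
move=> mA; split; last exact: measurable_cst.
by apply: measurable_funTS; exact: measurable_indic.
Qed.

Let msym_chi A phi : measurable A -> msym phi -> msym (chi A phi).
Proof. by move=> mA m1; apply: msymM => //; exact: msym_indic. Qed.

Let chi_in A phi l : A l -> chi A phi l = phi l.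
Proof. by move=> Al; rewrite /chi indicE mem_set// mulr1. Qed.

Let chi_out A phi l : ~ A l -> chi A phi l = 0.
Proof. by move=> Al; rewrite /chi indicE memNset// mulr0. Qed.

Let cmod_chi A phi l : cmod (chi A phi l) <= cmod (phi l).
Proof.
have [Al|Al] := pselect (A l); first by rewrite chi_in.
by rewrite chi_out// cmod0 cmod_ge0.
Qed.

Definition loc_bounded phi :=
  forall n : nat, exists M : R, forall l, 0 <= l -> l <= n%:R -> cmod (phi l) <= M.

Let bsym_chi (n : nat) phi : msym phi -> loc_bounded phi ->
  bsym (chi (J n) phi).
Proof.
move=> m1 /(_ n)[M hM]; split; first exact: msym_chi.
have M0 : 0 <= M by rewrite (le_trans (cmod_ge0 _) (hM 0 _ _)).
exists M => l l0; have [ln|ln] := pselect ((J n) l).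
  by rewrite chi_in// hM//; have [] := (JP n l).1 ln.
by rewrite chi_out// cmod0.
Qed.

(** The truncation of phi to [0, n] is bounded, so multiplicativity controls it by the product phi
    psi; monotone convergence in n then removes the truncation. The factor 2 comes from the
    quadratic triangle inequality. This is how heat flows are seen to lie in the domain of L. *)
Lemma sqint_mult_le phi psi v (M : R) : msym phi -> loc_bounded phi ->
  bsym psi -> 0 <= M -> (forall l, 0 <= l -> cmod (phi l * psi l) <= M) ->
  (sqint phi (mult psi v) <= (2 * (M * nm v) ^+ 2)%:E)%E.
Proof.
move=> m1 lb bp M0 hM; set g := mult psi v.
have bn n := bsym_chi n m1 lb.
have gM n : nm (mult (chi (J n) phi) g) <= M * nm v.
  rewrite -(multM P complete_nm v (bn n) bp); apply: (mult_le P complete_nm).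
    exact: bsymM.
  move=> l l0; rewrite cmodM (le_trans _ (hM l l0))// cmodM.
  by rewrite ler_wpM2r ?cmod_ge0// cmod_chi.
have hn n : (sqint (chi (J n) phi) g <= (2 * (M * nm v) ^+ 2)%:E)%E.
  pose a := M * nm v; have a0 : 0 <= a by rewrite mulr_ge0// nm_ge0.
  pose K := 2 * (nm g ^+ 2 + 4 * a * nm g + 4 * nm g ^+ 2).
  have g0 := nm_ge0 ip g.
  have K0 : 0 <= K by have := sqr_ge0 (nm g); have := mulr_ge0 a0 g0; rewrite /K; lra.
  apply/lee_addgt0Pr => e e0.
  pose e1 := Num.min 1 (e / (K + 1)).
  have Kp : 0 < K + 1 by rewrite ltr_wpDl.
  have e10 : 0 < e1 by rewrite lt_min ltr01 divr_gt0.
  have e11 : e1 <= 1 by rewrite ge_min lexx.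
  have e1e : e1 * (K + 1) <= e by rewrite -ler_pdivlMr// ge_min lexx orbT.
  have [s ms hs] := bsym_sim (bn n) e10.
  have m2 : msym (fun l => chi (J n) phi l - sim s l).
    by apply: msymB; [exact: (bn n).1|exact: msym_sim].
  have -> : sqint (chi (J n) phi) g =
      sqint (fun l => (chi (J n) phi l - sim s l) + sim s l)%R g.
    by congr (sqint _ g); apply/funext => l; rewrite subrK.
  apply: (le_trans (sqintD P _ m2 (msym_sim ms))).
  rewrite Tsim_nm2//.
  have h1 : (sqint (fun l => chi (J n) phi l - sim s l)%R g <=
      (e1 ^+ 2 * nm g ^+ 2)%:E)%E by apply: sqint_bd => //; exact: ltW.
  have h2 : nm (Tsim P s g) <= a + 2 * e1 * nm g.
    have := mult_approx P complete_nm g (bn n) ms (ltW e10) hs.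
    have := nm_dist ipP (Tsim P s g) (mult (chi (J n) phi) g).
    rewrite (nmBC ipP (Tsim P s g)); have := gM n; rewrite -/a; lra.
  apply: (@le_trans _ _ (2%:E * ((e1 ^+ 2 * nm g ^+ 2)%:E + ((a + 2 * e1 * nm g) ^+ 2)%:E))%E).
    rewrite lee_pmul2l// leeD// lee_fin ler_pXn2r ?nnegrE ?nm_ge0//.
    by rewrite addr_ge0// !mulr_ge0// ltW.
  rewrite -!EFinD -EFinM lee_fin -/a.
  apply: (@le_trans _ _ (2 * a ^+ 2 + e1 * (K + 1))); last by rewrite lerD2l.
  have e12 : e1 ^+ 2 <= e1 by rewrite expr2 ler_piMr// ltW.
  have g2 := sqr_ge0 (nm g).
  have : e1 ^+ 2 * nm g ^+ 2 <= e1 * nm g ^+ 2 by rewrite ler_wpM2r.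
  by rewrite /K; have := ltW e10; rewrite !expr2; lra.
have mD : measurable D by [].
pose G (n : nat) (l : R) := (cmod (chi (J n) phi l) ^+ 2)%:E.
have limG l : D l -> limn (G ^~ l) = (cmod (phi l) ^+ 2)%:E.
  rewrite /= in_itv/= andbT => l0; apply: lim_near_cst => //.
  near=> n; rewrite /G chi_in//; apply/JP; split=> //.
  near: n; exists (Num.truncn l).+1 => // n /= ln.
  by rewrite (le_trans (ltW (truncnS_gt _)))// ler_nat.
have -> : sqint phi g = (\int[nu P g]_(l in D) limn (G ^~ l))%E.
  by apply: eq_integral => l /[!inE] Dl; rewrite limG.
rewrite monotone_convergence//; first last.
- move=> l Dl m n mn; rewrite lee_fin ler_pXn2r ?nnegrE ?cmod_ge0//.
  have [lm|lm] := pselect ((J m) l); last by rewrite chi_out// cmod0 cmod_ge0.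
  have [l0 lm'] := (JP m l).1 lm; rewrite !chi_in//; apply/JP; split=> //.
  by rewrite (le_trans lm')// ler_nat.
- by move=> n l Dl; rewrite lee_fin sqr_ge0.
- by move=> n; apply: cmod2_meas; exact: (bn n).1.
apply: lime_le; last by near=> n; exact: hn.
apply: ereal_nondecreasing_is_cvgn => m n mn; apply: ge0_le_integral => //.
- by move=> l Dl; rewrite lee_fin sqr_ge0.
- by apply: cmod2_meas; exact: (bn m).1.
- by apply: cmod2_meas; exact: (bn n).1.
- move=> l Dl; rewrite lee_fin ler_pXn2r ?nnegrE ?cmod_ge0//.
  have [lm|lm] := pselect ((J m) l); last by rewrite chi_out// cmod0 cmod_ge0.
  have [l0 lm'] := (JP m l).1 lm; rewrite !chi_in//; apply/JP; split=> //.
  by rewrite (le_trans lm')// ler_nat.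
Unshelve. all: by end_near. Qed.

(** By the tail condition phi psi may be cut at n with a small uniform error. On [0, n] the symbol
    phi is bounded and has a simple approximant; beyond n its contribution is small by
    [sqint_mult_le]. The case of interest is phi = l^2, the symbol of L. *)
Lemma specint_mult phi psi v : msym phi -> loc_bounded phi -> bsym psi ->
  bsym (fun l => phi l * psi l) ->
  (forall e : R, 0 < e -> exists n : nat, forall l, n%:R < l ->
     cmod (phi l * psi l) <= e) ->
  specint P phi (mult psi v) (mult (fun l => phi l * psi l) v).
Proof.
move=> m1 lb bp bpp tail e e0; set g := mult psi v.
have v0 := nm_ge0 ip v.
have Kp : 0 < 16 * nm v ^+ 2 + 4 * nm v + 4 by rewrite ltr_wpDl// addr_ge0 ?mulr_ge0 ?sqr_ge0.
have gp : 0 < 16 * nm g ^+ 2 + 4 * nm g + 4.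
  by rewrite ltr_wpDl// addr_ge0 ?mulr_ge0 ?sqr_ge0// nm_ge0.
pose e1 := Num.min 1 (Num.min (e / (16 * nm v ^+ 2 + 4 * nm v + 4)) (e / (16 * nm g ^+ 2 + 4 * nm g + 4))).
have e10 : 0 < e1 by rewrite !lt_min ltr01 !divr_gt0.
have e11 : e1 <= 1 by rewrite ge_min lexx.
have e1v : e1 * (16 * nm v ^+ 2 + 4 * nm v + 4) <= e.
  by rewrite -ler_pdivlMr// !ge_min lexx !orbT.
have e1g : e1 * (16 * nm g ^+ 2 + 4 * nm g + 4) <= e.
  by rewrite -ler_pdivlMr// !ge_min lexx !orbT.
have [n hn] := tail _ e10.
have bn := bsym_chi n m1 lb.
have [s ms hs] := bsym_sim bn e10.
have mc : measurable (~` J n : set R) by exact: measurableC.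
have e12 : e1 ^+ 2 <= e1 by rewrite expr2 ler_piMr// ltW.
exists s; split => //.
- have -> : sqint (fun l => phi l - sim s l)%R g = sqint (fun l =>
     chi (~` (J n)) phi l + (chi (J n) phi l - sim s l))%R g.
    congr (sqint _ g); apply/funext => l.
    have [ln|ln] := pselect ((J n) l).
      by rewrite [chi (~` _) _ _]chi_out ?chi_in ?add0r//; exact.
    by rewrite [chi (~` _) _ _]chi_in// chi_out// sub0r.
  have m2 : msym (fun l => chi (J n) phi l - sim s l).
    by apply: msymB; [exact: bn.1|exact: msym_sim].
  apply: (le_lt_trans (sqintD P _ (msym_chi mc m1) m2)).
  have h1 : (sqint (chi (~` (J n)) phi) g <= (2 * (e1 * nm v) ^+ 2)%:E)%E.
    apply: sqint_mult_le => //; [exact: msym_chi| |exact: ltW|].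
      move=> k; have [M hM] := lb k; exists M => l l0 lk.
      by rewrite (le_trans (cmod_chi _ _ _))// hM.
    move=> l l0; have [ln|ln] := pselect ((J n) l).
      by rewrite chi_out ?mul0r ?cmod0 ?(ltW e10)//; exact.
    by rewrite chi_in// hn// ltNge; apply/negP => nl; apply: ln; apply/JP.
  have h2 : (sqint (fun l => chi (J n) phi l - sim s l)%R g <=
      (e1 ^+ 2 * nm g ^+ 2)%:E)%E by apply: sqint_bd => //; exact: ltW.
  apply: (@le_lt_trans _ _ (2%:E * ((2 * (e1 * nm v) ^+ 2)%:E + (e1 ^+ 2 * nm g ^+ 2)%:E))%E).
    by rewrite lee_pmul2l// leeD.
  rewrite -EFinD -EFinM lte_fin exprMn.
  have : e1 ^+ 2 * nm g ^+ 2 <= e1 * nm g ^+ 2 by rewrite ler_wpM2r// sqr_ge0.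
  have : e1 ^+ 2 * nm v ^+ 2 <= e1 * nm v ^+ 2 by rewrite ler_wpM2r// sqr_ge0.
  have := mulr_ge0 (ltW e10) v0; have := mulr_ge0 (ltW e10) (nm_ge0 ip g).
  have := mulr_ge0 (ltW e10) (sqr_ge0 (nm v)); have := mulr_ge0 (ltW e10) (sqr_ge0 (nm g)).
  lra.
- apply: (le_lt_trans (nm_trans ipP (mult (chi (J n) phi) g) _ _)).
  have h1 := mult_approx P complete_nm g bn ms (ltW e10) hs.
  have h2 : nm (mult (fun l => phi l * psi l) v - mult (chi (J n) phi) g) <= e1 * nm v.
    rewrite -(multM P complete_nm v bn bp); apply: (mult_dist P complete_nm) => //.
      exact: bsymM.
    move=> l l0; rewrite -mulrBl; have [ln|ln] := pselect ((J n) l).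
      by rewrite chi_in// subrr mul0r cmod0 ltW.
    by rewrite chi_out// subr0 hn// ltNge; apply/negP => nl; apply: ln; apply/JP.
  have := mulr_ge0 (ltW e10) v0; have := mulr_ge0 (ltW e10) (nm_ge0 ip g).
  have := mulr_ge0 (ltW e10) (sqr_ge0 (nm v)); have := mulr_ge0 (ltW e10) (sqr_ge0 (nm g)).
  move: e1v e1g h1 h2; rewrite -/g; lra.
Qed.

End unbounded_symbols.

(** * Square-integrable complex functions *)

Section square_integrable.
Context d (R : realType) (Omega : borelMetricType d R).
Variable mu : {measure set Omega -> \bar R}.
Local Notation Re := (@complex.Re R).
Local Notation Im := (@complex.Im R).
Implicit Types f g h : Omega -> R[i].

Definition N2 f : \bar R := (\int[mu]_x (cmod (f x) ^+ 2)%:E)%E.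

Definition mfun2 f := measurable_fun setT (fun x => Re (f x)) /\
  measurable_fun setT (fun x => Im (f x)).

Lemma N2_ge0 f : (0 <= N2 f)%E.
Proof. by apply: integral_ge0 => x _; rewrite lee_fin sqr_ge0. Qed.

Lemma L2normE f : L2norm mu f = ((N2 f) `^ 2^-1)%E.
Proof.
rewrite /L2norm Lnorm.unlock; congr (_ `^ _)%E; apply: eq_integral => x _ /=.
by rewrite -[2]/(2%:R) powR_mulrn// real_normK ?num_real.
Qed.

Lemma L2normE_fin f : (N2 f < +oo)%E -> L2norm mu f = (Num.sqrt (fine (N2 f)))%:E.
Proof.
move=> fin; rewrite L2normE poweR12_sqrt ?N2_ge0//.
by have := N2_ge0 f; case: (N2 f) fin.
Qed.

Lemma L2P f : L2 mu f <-> mfun2 f /\ (N2 f < +oo)%E.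
Proof.
rewrite /L2/= L2normE; split=> [[m1 m2 lt]|[[m1 m2] lt]]; split=> //.
  by rewrite ltey; apply/eqP => eqy; move: lt; rewrite eqy poweRyr// invr_eq0.
exact: poweR_lty.
Qed.

Lemma mfun2D f g : mfun2 f -> mfun2 g -> mfun2 (fun x => f x + g x).
Proof.
move=> [m1 m2] [m3 m4]; split.
- under [X in measurable_fun _ X]eq_fun do [rewrite cReD]; exact: measurable_funD.
- under [X in measurable_fun _ X]eq_fun do [rewrite cImD]; exact: measurable_funD.
Qed.

Lemma mfun2M f g : mfun2 f -> mfun2 g -> mfun2 (fun x => f x * g x).
Proof.
move=> [m1 m2] [m3 m4]; split.
- by under [X in measurable_fun _ X]eq_fun do [rewrite cReM]; apply: measurable_funB; exact: measurable_funM.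
- by under [X in measurable_fun _ X]eq_fun do [rewrite cImM]; apply: measurable_funD; exact: measurable_funM.
Qed.

Lemma mfun2_cst a : mfun2 (cst a).
Proof. by split; exact: measurable_cst. Qed.

Lemma mfun2_real (g : Omega -> R) : measurable_fun setT g -> mfun2 (fun x => (g x)%:C%C).
Proof. by split=> //; exact: measurable_cst. Qed.

Lemma mfun2J f : mfun2 f -> mfun2 (fun x => (f x)^*%C).
Proof.
move=> [m1 m2]; split.
- by under [X in measurable_fun _ X]eq_fun do [rewrite cReJ].
- by under [X in measurable_fun _ X]eq_fun do [rewrite cImJ]; exact: measurableT_comp.
Qed.

Lemma mod2_meas f : mfun2 f -> measurable_fun setT (fun x => (cmod (f x) ^+ 2)%:E).
Proof.
move=> [m1 m2]; apply/measurable_EFinP; under [X in measurable_fun _ X]eq_fun do rewrite cmod2.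
by apply: measurable_funD; exact: measurable_funX.
Qed.

Lemma N2D f g : mfun2 f -> mfun2 g ->
  (N2 (fun x => f x + g x)%R <= 2%:E * (N2 f + N2 g))%E.
Proof.
move=> mf mg; rewrite /N2 -ge0_integralD//; last 4 first.
- by move=> l _; rewrite lee_fin sqr_ge0.
- exact: mod2_meas.
- by move=> l _; rewrite lee_fin sqr_ge0.
- exact: mod2_meas.
rewrite -ge0_integralZl_EFin//; last 2 first.
- by move=> l _; rewrite -EFinD lee_fin addr_ge0 ?sqr_ge0.
- by apply: emeasurable_funD; exact: mod2_meas.
apply: ge0_le_integral => //.
- by move=> l _; rewrite lee_fin sqr_ge0.
- by apply: mod2_meas; exact: mfun2D.
- apply: emeasurable_funM; first exact: measurable_cst.
  by apply: emeasurable_funD; exact: mod2_meas.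
- by move=> l _; rewrite -EFinD -EFinM lee_fin mulrDr cmod2D.
Qed.

Lemma N2Z a f : mfun2 f -> N2 (fun x => a * f x) = ((cmod a ^+ 2)%:E * N2 f)%E.
Proof.
move=> mf; rewrite /N2 -ge0_integralZl_EFin//; last 3 first.
- by move=> l _; rewrite lee_fin sqr_ge0.
- exact: mod2_meas.
- exact: sqr_ge0.
by apply: eq_integral => x _; rewrite -EFinM cmodM exprMn.
Qed.

Lemma L2_comb a f g : L2 mu f -> L2 mu g -> L2 mu (fun x => a * f x + g x).
Proof.
move=> /L2P[mf fy] /L2P[mg gy].
have ma : mfun2 (fun x => a * f x) by apply: mfun2M => //; exact: mfun2_cst.
apply/L2P; split; first exact: mfun2D.
apply: (le_lt_trans (N2D ma mg)); rewrite N2Z//.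
have ff : N2 f \is a fin_num by rewrite ge0_fin_numE ?N2_ge0.
have gf : N2 g \is a fin_num by rewrite ge0_fin_numE ?N2_ge0.
by rewrite -(fineK ff) -(fineK gf) -EFinM ltry.
Qed.

Lemma L2_0 : L2 mu (cst 0).
Proof.
apply/L2P; split; first exact: mfun2_cst.
rewrite /N2 (eq_integral (cst 0%E)) ?integral0//.
by move=> x _; rewrite cmod0 expr0n.
Qed.

Lemma L2D f g : L2 mu f -> L2 mu g -> L2 mu (fun x => f x + g x).
Proof.
move=> lf lg; have := L2_comb 1 lf lg.
by congr (L2 mu _); apply/funext => x; rewrite mul1r.
Qed.

Lemma L2Z a f : L2 mu f -> L2 mu (fun x => a * f x).
Proof.
move=> lf; have := L2_comb a lf L2_0.
by congr (L2 mu _); apply/funext => x; rewrite addr0.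
Qed.

Lemma L2N f : L2 mu f -> L2 mu (fun x => - f x).
Proof.
move=> lf; have := L2Z (-1) lf.
by congr (L2 mu _); apply/funext => x; rewrite mulN1r.
Qed.

Lemma L2_le f g : mfun2 f -> L2 mu g -> (forall x, cmod (f x) <= cmod (g x)) ->
  L2 mu f.
Proof.
move=> mf /L2P[mg gy] h; apply/L2P; split=> //; apply: le_lt_trans gy.
apply: ge0_le_integral => //.
- by move=> l _; rewrite lee_fin sqr_ge0.
- exact: mod2_meas.
- exact: mod2_meas.
- by move=> l _; rewrite lee_fin ler_pXn2r ?nnegrE ?cmod_ge0.
Qed.

Lemma L2_integrable f : L2 mu f -> mu.-integrable setT (fun x => (cmod (f x) ^+ 2)%:E).
Proof.
move=> /L2P[mf fy]; apply/integrableP; split; first exact: mod2_meas.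
by rewrite (eq_integral (fun x => (cmod (f x) ^+ 2)%:E))// => x _; rewrite gee0_abs// lee_fin sqr_ge0.
Qed.

(** [p] stands for the real or the imaginary part. *)
Lemma L2_prod_integrable f g (p : R[i] -> R) : L2 mu f -> L2 mu g ->
  measurable_fun setT (fun x => p (f x * (g x)^*%C)) ->
  (forall z, `|p z| <= cmod z) ->
  mu.-integrable setT (EFin \o (fun x => p (f x * (g x)^*%C))).
Proof.
move=> lf lg mp hp.
apply: (@le_integrable _ _ _ mu setT measurableT _
  (fun x => (cmod (f x) ^+ 2)%:E + (cmod (g x) ^+ 2)%:E)%E).
- exact/measurable_EFinP.
- move=> x _ /=; rewrite lee_fin (le_trans (hp _))// ger0_norm ?addr_ge0 ?sqr_ge0//.
  rewrite cmodM cmodJ; have := sqr_ge0 (cmod (f x) - cmod (g x)).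
  have := mulr_ge0 (cmod_ge0 (f x)) (cmod_ge0 (g x)); rewrite !expr2; lra.
- by apply: integrableD => //; exact: L2_integrable.
Qed.

Lemma integrable_Re f g : L2 mu f -> L2 mu g ->
  mu.-integrable setT (EFin \o (fun x => Re (f x * (g x)^*%C))).
Proof.
move=> lf lg; have [[mf _] [mg _]] := ((L2P f).1 lf, (L2P g).1 lg).
apply: L2_prod_integrable => //; last exact: cRe_le.
exact: (mfun2M mf (mfun2J mg)).1.
Qed.

Lemma integrable_Im f g : L2 mu f -> L2 mu g ->
  mu.-integrable setT (EFin \o (fun x => Im (f x * (g x)^*%C))).
Proof.
move=> lf lg; have [[mf _] [mg _]] := ((L2P f).1 lf, (L2P g).1 lg).
apply: L2_prod_integrable => //; last exact: cIm_le.
exact: (mfun2M mf (mfun2J mg)).2.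
Qed.

Lemma Re_inner f g : Re (inner mu f g) = Rintegral mu setT (fun x => Re (f x * (g x)^*%C)).
Proof. by []. Qed.
Lemma Im_inner f g : Im (inner mu f g) = Rintegral mu setT (fun x => Im (f x * (g x)^*%C)).
Proof. by []. Qed.

Lemma inner_ae f f' g g' : L2 mu f -> L2 mu f' -> L2 mu g -> L2 mu g' ->
  ae_eq mu setT f f' -> ae_eq mu setT g g' -> inner mu f g = inner mu f' g'.
Proof.
move=> lf lf' lg lg' ff' gg'.
have h (p : R[i] -> R) : mu.-integrable setT (EFin \o (fun x => p (f x * (g x)^*%C))) ->
    mu.-integrable setT (EFin \o (fun x => p (f' x * (g' x)^*%C))) ->
    Rintegral mu setT (fun x => p (f x * (g x)^*%C)) =
    Rintegral mu setT (fun x => p (f' x * (g' x)^*%C)).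
  move=> i1 i2; rewrite /Rintegral; congr fine; apply: ae_eq_integral => //.
  - exact: measurable_int i1.
  - exact: measurable_int i2.
  - by move: ff' gg'; apply: filterS2 => x h1 h2 _; rewrite h1// h2.
apply: cplx_eq; [apply: (h Re)|apply: (h Im)];
  by [exact: integrable_Re|exact: integrable_Im].
Qed.

Lemma inner_self f : Re (inner mu f f) = fine (N2 f).
Proof.
rewrite Re_inner /Rintegral /N2; congr fine; apply: eq_integral => x _.
by rewrite conjM_mod.
Qed.

Lemma innerD f g h : L2 mu f -> L2 mu g -> L2 mu h ->
  inner mu (fun x => f x + g x) h = inner mu f h + inner mu g h.
Proof.
move=> lf lg lh; apply: cplx_eq.
- rewrite cReD !Re_inner -RintegralD//; [|exact: integrable_Re|exact: integrable_Re].
  by apply: eq_Rintegral => x _; rewrite mulrDl cReD.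
- rewrite cImD !Im_inner -RintegralD//; [|exact: integrable_Im|exact: integrable_Im].
  by apply: eq_Rintegral => x _; rewrite mulrDl cImD.
Qed.

Lemma innerZ a f h : L2 mu f -> L2 mu h ->
  inner mu (fun x => a * f x) h = a * inner mu f h.
Proof.
move=> lf lh.
have [i1 i2] := (integrable_Re lf lh, integrable_Im lf lh).
have iZ (c : R) (F : Omega -> R) : mu.-integrable setT (EFin \o F) ->
    mu.-integrable setT (EFin \o (fun x => c * F x)).
  by move=> /(integrableZl measurableT c); apply: eq_integrable => // x _.
apply: cplx_eq.
- rewrite cReM !Re_inner !Im_inner -!RintegralZl// -RintegralB//; [|exact: iZ|exact: iZ].
  by apply: eq_Rintegral => x _; rewrite -mulrA cReM.
- rewrite cImM !Re_inner !Im_inner -!RintegralZl// -RintegralD//; [|exact: iZ|exact: iZ].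
  by apply: eq_Rintegral => x _; rewrite -mulrA cImM.
Qed.

Lemma inner_conj f g : L2 mu f -> L2 mu g -> inner mu f g = (inner mu g f)^*%C.
Proof.
move=> lf lg; apply: cplx_eq.
- rewrite cReJ !Re_inner; apply: eq_Rintegral => x _; rewrite !cRI; ring.
- rewrite cImJ !Im_inner -mulN1r -RintegralZl//; last exact: integrable_Im.
  by apply: eq_Rintegral => x _; rewrite !cRI; ring.
Qed.

Lemma N2_eq0 f : mfun2 f -> N2 f = 0%E -> ae_eq mu setT f (cst 0).
Proof.
move=> mf f0; have : (\int[mu]_x `|(cmod (f x) ^+ 2)%:E| = 0)%E.
  by rewrite -[RHS]f0; apply: eq_integral => x _; rewrite gee0_abs// lee_fin sqr_ge0.
move=> /(ae_eq_integral_abs mu measurableT (mod2_meas mf)).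
apply: filterS => x h _; have /eqP := h I; rewrite eqe sqrf_eq0 => /eqP.
exact: cmod_eq0.
Qed.

Lemma N2_ae f g : mfun2 f -> mfun2 g -> ae_eq mu setT f g -> N2 f = N2 g.
Proof.
move=> mf mg fg; apply: ae_eq_integral => //; [exact: mod2_meas|exact: mod2_meas|].
by move: fg; apply: filterS => x h _; rewrite h.
Qed.

End square_integrable.

Lemma filterS4 (T : Type) (F : set_system T) : Filter F ->
  forall P Q S U W : set T, (forall x, P x -> Q x -> S x -> U x -> W x) ->
  F P -> F Q -> F S -> F U -> F W.
Proof.
move=> FF P Q S U W h FP FQ FS FU.
by apply: filterS3 FP FQ (filterI FS FU) => x Px Qx [Sx Ux]; exact: h.
Qed.

Section geometric.
Context {R : realType}.

(** The sequences a k + 2 A / 2^k and a k - 2 A / 2^k are monotone in opposite directions and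
    enclose the limit, which also yields the rate. *)
Lemma geometric_cvg (a : nat -> R) (A : R) :
  (forall k, `|a k.+1 - a k| <= A / 2 ^+ k) ->
  exists2 l : R, a @ \oo --> l & forall k, `|l - a k| <= 2 * A / 2 ^+ k.
Proof.
move=> h.
pose b k := a k + 2 * A / 2 ^+ k; pose c k := a k - 2 * A / 2 ^+ k.
have A0 : 0 <= A by have := h 0%N; rewrite expr0 divr1; apply: le_trans.
have p2 k : 0 <= 2 * A / 2 ^+ k by rewrite divr_ge0 ?mulr_ge0 ?exprn_ge0.
have step k : 2 * A / 2 ^+ k.+1 = A / 2 ^+ k.
  by rewrite exprS -mulf_div divff// mul1r.
have dbl k : 2 * A / 2 ^+ k = 2 * (A / 2 ^+ k) by rewrite mulrA.
have nb : nonincreasing_seq b.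
  apply/nonincreasing_seqP => k; rewrite /b step dbl.
  by have := h k; rewrite ler_norml => /andP[_]; lra.
have nc : nondecreasing_seq c.
  apply/nondecreasing_seqP => k; rewrite /c step dbl.
  by have := h k; rewrite ler_norml => /andP[]; lra.
have cb k n : c k <= b n.
  have := nc k (maxn k n) (leq_maxl _ _); have := nb n (maxn k n) (leq_maxr _ _).
  rewrite /b /c; have := p2 (maxn k n); lra.
have cvb : cvgn b.
  apply: nonincreasing_is_cvgn => //; exists (c 0%N) => _ [n _ <-]; exact: cb.
exists (limn b).
  have -> : a = b \- (fun k => 2 * A / 2 ^+ k).
    by apply/funext => k; rewrite /b /= addrK.
  rewrite -[X in _ --> X]subr0; apply: cvgB => //.
  rewrite (_ : (fun k => _) = geometric (2 * A) 2^-1).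
    by apply: cvg_geometric; rewrite ger0_norm ?invf_lt1// ltr1n.
  by apply/funext => k; rewrite /geometric/= exprVn.
move=> k; rewrite ler_norml; apply/andP; split.
  have : c k <= limn b by apply: limr_ge => //; near=> n; exact: cb.
  rewrite /c; lra.
have : limn b <= b k by apply: nonincreasing_cvgn_ge.
rewrite /b; lra.
Unshelve. all: by end_near. Qed.

End geometric.

(** * L^2 classes as a complete inner product space *)

Section L2_quotient.
Context d (R : realType) (Omega : borelMetricType d R).
Variable mu : {measure set Omega -> \bar R}.
Local Notation Re := (@complex.Re R).
Local Notation Im := (@complex.Im R).
Local Notation "f =m g" := (ae_eq mu setT f g) (at level 70).
Implicit Types f g h : Omega -> R[i].

(* The representative depends only on the class, so that equality in [L2cls]
   is almost everywhere equality. *)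
Definition canon f : Omega -> R[i] := xget (cst 0) [set g | L2 mu g /\ f =m g].

Lemma canonP f : L2 mu f -> L2 mu (canon f) /\ f =m canon f.
Proof.
move=> lf; rewrite /canon; case: xgetP => [g _ //|/(_ f)[]].
by split=> //; exact: ae_eq_refl.
Qed.

Lemma canon_eq f g : f =m g -> canon f = canon g.
Proof.
move=> fg; rewrite /canon; congr (xget _ _); apply/seteqP; split => h /= [lh fh].
  by split=> //; apply: ae_eq_trans fh; exact: ae_eq_sym.
by split=> //; exact: ae_eq_trans fh.
Qed.

Record L2cls := L2Cls { rp :> Omega -> R[i] ; rpP : L2 mu rp /\ canon rp = rp }.

HB.instance Definition _ := gen_eqMixin L2cls.
HB.instance Definition _ := gen_choiceMixin L2cls.

Lemma L2cls_inj (u v : L2cls) : rp u = rp v -> u = v.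
Proof.
case: u v => f pf [g pg] /= fg; subst g; congr L2Cls; exact: Prop_irrelevance.
Qed.

Lemma canon_canonP f : L2 mu f -> L2 mu (canon f) /\ canon (canon f) = canon f.
Proof.
by move=> lf; have [lc fc] := canonP lf; split=> //; apply: canon_eq; exact: ae_eq_sym.
Qed.

Definition cls f : L2cls :=
  if pselect (L2 mu f) is left lf then L2Cls (canon_canonP lf)
  else L2Cls (canon_canonP (L2_0 mu)).

Lemma cls_ae f : L2 mu f -> rp (cls f) =m f.
Proof.
by rewrite /cls; case: pselect => // lf _ /=; apply: ae_eq_sym; exact: (canonP lf).2.
Qed.

Lemma rpL2 (v : L2cls) : L2 mu (rp v). Proof. by case: v => f []. Qed.

Lemma cls_eq f g : L2 mu f -> L2 mu g -> f =m g -> cls f = cls g.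
Proof.
move=> lf lg fg; apply: L2cls_inj; rewrite /cls.
by case: pselect => // ?; case: pselect => // ? /=; exact: canon_eq.
Qed.

Lemma rpK (v : L2cls) : cls (rp v) = v.
Proof.
apply: L2cls_inj; rewrite /cls; case: pselect => [lv /=|/(_ (rpL2 v))//].
by case: v {lv} => f [].
Qed.

Lemma cls_rp_eq (v : L2cls) f : L2 mu f -> rp v =m f -> v = cls f.
Proof. by move=> lf h; rewrite -(rpK v); apply: cls_eq => //; exact: rpL2. Qed.

Definition addcl (u v : L2cls) := cls (fun x => rp u x + rp v x).
Definition oppcl (u : L2cls) := cls (fun x => - rp u x).
Definition scalecl (a : R[i]) (u : L2cls) := cls (fun x => a * rp u x).

Lemma addcl_ae u v : rp (addcl u v) =m (fun x => rp u x + rp v x).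
Proof. by apply: cls_ae; apply: L2D; exact: rpL2. Qed.
Lemma oppcl_ae u : rp (oppcl u) =m (fun x => - rp u x).
Proof. by apply: cls_ae; apply: L2N; exact: rpL2. Qed.
Lemma scalecl_ae a u : rp (scalecl a u) =m (fun x => a * rp u x).
Proof. by apply: cls_ae; apply: L2Z; exact: rpL2. Qed.

Lemma L2cls_eq (u v : L2cls) : rp u =m rp v -> u = v.
Proof. by move=> uv; rewrite -(rpK u) -(rpK v); apply: cls_eq => //; exact: rpL2. Qed.

Let addA : associative addcl.
Proof.
move=> u v w; apply: L2cls_eq.
have := addcl_ae u (addcl v w); have := addcl_ae v w; have := addcl_ae (addcl u v) w.
have := addcl_ae u v; apply: filterS4 => x h1 h2 h3 h4 _.
by rewrite h4// h3// h2// h1// addrA.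
Qed.

Let addC : commutative addcl.
Proof.
move=> u v; rewrite /addcl; congr cls; apply/funext => x; exact: addrC.
Qed.

Let add0 : left_id (cls (cst 0)) addcl.
Proof.
move=> u; apply: L2cls_eq; have := addcl_ae (cls (cst 0)) u.
have := cls_ae (L2_0 mu); apply: filterS2 => x h1 h2 _.
by rewrite h2// h1// add0r.
Qed.

Let addN : left_inverse (cls (cst 0)) oppcl addcl.
Proof.
move=> u; apply: L2cls_eq; have := addcl_ae (oppcl u) u.
have := oppcl_ae u; have := cls_ae (L2_0 mu); apply: filterS3 => x h1 h2 h3 _.
by rewrite h3// h2// h1// addNr.
Qed.

HB.instance Definition _ := GRing.isZmodule.Build L2cls addA addC add0 addN.

Let scaleA a b u : scalecl a (scalecl b u) = scalecl (a * b) u.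
Proof.
apply: L2cls_eq; have := scalecl_ae a (scalecl b u); have := scalecl_ae b u.
have := scalecl_ae (a * b) u; apply: filterS3 => x h1 h2 h3 _.
by rewrite h3// h2// h1// mulrA.
Qed.

Let scale1 : left_id 1 scalecl.
Proof.
move=> u; apply: L2cls_eq; have := scalecl_ae 1 u; apply: filterS => x h _.
by rewrite h// mul1r.
Qed.

Let clsD0 f g : L2 mu f -> L2 mu g -> addcl (cls f) (cls g) = cls (fun x => f x + g x).
Proof.
move=> lf lg; apply: L2cls_eq.
have := cls_ae (L2D lf lg); have := cls_ae lf; have := cls_ae lg.
have := addcl_ae (cls f) (cls g); apply: filterS4 => x h1 h2 h3 h4 _.
by rewrite h4// h1// h2// h3.
Qed.

Let clsZ0 a f : L2 mu f -> scalecl a (cls f) = cls (fun x => a * f x).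
Proof.
move=> lf; apply: L2cls_eq.
have := cls_ae (L2Z a lf); have := cls_ae lf.
have := scalecl_ae a (cls f); apply: filterS3 => x h1 h2 h3 _.
by rewrite h3// h1// h2.
Qed.

Let scaleDr : right_distributive scalecl +%R.
Proof.
move=> a u v; rewrite -(rpK u) -(rpK v); have [lu lv] := (rpL2 u, rpL2 v).
rewrite [LHS](_ : _ = scalecl a (addcl (cls u) (cls v)))//.
rewrite [RHS](_ : _ = addcl (scalecl a (cls u)) (scalecl a (cls v)))//.
rewrite clsD0// !clsZ0//; last exact: L2D.
rewrite clsD0; [|exact: L2Z|exact: L2Z].
by congr cls; apply/funext => x; rewrite mulrDr.
Qed.

Let scaleDl v : {morph scalecl^~ v : a b / a + b}.
Proof.
move=> a b; rewrite -(rpK v); have lv := rpL2 v.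
rewrite [RHS](_ : _ = addcl (scalecl a (cls v)) (scalecl b (cls v)))//.
rewrite !clsZ0// clsD0; [|exact: L2Z|exact: L2Z].
by congr cls; apply/funext => x; rewrite mulrDl.
Qed.

HB.instance Definition _ := GRing.Zmodule_isLmodule.Build R[i] L2cls
  scaleA scale1 scaleDr scaleDl.

Lemma rpD (u v : L2cls) : rp (u + v) =m (fun x => rp u x + rp v x).
Proof. exact: addcl_ae. Qed.
Lemma rpZ a (u : L2cls) : rp (a *: u) =m (fun x => a * rp u x).
Proof. exact: scalecl_ae. Qed.
Lemma clsD f g : L2 mu f -> L2 mu g -> cls (fun x => f x + g x) = cls f + cls g.
Proof. by move=> lf lg; rewrite -clsD0. Qed.

Lemma clsZ a f : L2 mu f -> cls (fun x => a * f x) = a *: cls f.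
Proof. by move=> lf; rewrite -clsZ0. Qed.

Lemma clsB f g : L2 mu f -> L2 mu g -> cls (f \- g)%R = cls f - cls g.
Proof.
move=> lf lg; rewrite -scaleN1r -clsZ// -clsD//; last exact: L2Z.
by congr cls; apply/funext => x /=; rewrite mulN1r.
Qed.

Lemma cls0 : cls (cst 0) = 0. Proof. by []. Qed.

Definition ipc (u v : L2cls) : R[i] := inner mu (rp u) (rp v).

Lemma ipc_inner : is_inner ipc.
Proof.
split.
- move=> u v w; rewrite /ipc -innerD; try exact: rpL2.
  apply: inner_ae; try exact: rpL2; [|exact: rpD|exact: ae_eq_refl].
  by apply: L2D; exact: rpL2.
- move=> a u w; rewrite /ipc -innerZ; try exact: rpL2.
  apply: inner_ae; try exact: rpL2; [|exact: rpZ|exact: ae_eq_refl].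
  by apply: L2Z; exact: rpL2.
- by move=> u v; apply: inner_conj; exact: rpL2.
- by move=> v; rewrite /ipc inner_self fine_ge0// N2_ge0.
- move=> v; rewrite /ipc inner_self => v0.
  have [mv vy] := (L2P mu (rp v)).1 (rpL2 v).
  have N0 : N2 mu (rp v) = 0%E.
    by rewrite -[RHS]/(0%:E) -v0 fineK// ge0_fin_numE// N2_ge0.
  rewrite -cls0; apply: cls_rp_eq; first exact: L2_0.
  exact: N2_eq0.
Qed.

Local Notation nm := (nm ipc).

Lemma ipc_cls f g : L2 mu f -> L2 mu g -> ipc (cls f) (cls g) = inner mu f g.
Proof.
by move=> lf lg; exact: inner_ae (rpL2 _) lf (rpL2 _) lg (cls_ae lf) (cls_ae lg).
Qed.

Lemma nm2_N2 (v : L2cls) : (nm v ^+ 2)%:E = N2 mu (rp v).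
Proof.
rewrite (nm2 ipc_inner) /ipc inner_self fineK// ge0_fin_numE ?N2_ge0//.
exact: ((L2P mu (rp v)).1 (rpL2 v)).2.
Qed.

Lemma nm2_cls f : L2 mu f -> (nm (cls f) ^+ 2)%:E = N2 mu f.
Proof.
move=> lf; rewrite nm2_N2; apply: N2_ae; [| |exact: cls_ae].
  exact: ((L2P mu _).1 (rpL2 _)).1.
exact: ((L2P mu _).1 lf).1.
Qed.

Lemma nm_cls f : L2 mu f -> (nm (cls f))%:E = L2norm mu f.
Proof.
move=> lf; rewrite L2normE_fin -?nm2_cls ?ltry//.
by rewrite /= sqrtr_sqr ger0_norm// nm_ge0.
Qed.

(* Riesz-Fischer. *)
Lemma L2cls_complete (u : nat -> L2cls) :
  (forall e : R, 0 < e -> exists N, forall m n, (N <= m)%N -> (N <= n)%N ->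
     nm (u m - u n) <= e) ->
  exists v, forall e : R, 0 < e -> exists N, forall n, (N <= n)%N ->
     nm (u n - v) <= e.
Proof.
move=> cu.
have e8 k : 0 < ((8 : R) ^+ k)^-1 by rewrite invr_gt0 exprn_gt0.
have [N hN] := choice (fun k => cu _ (e8 k)).
pose n k := (\max_(i < k.+1) N i + k)%N.
have Nn k : (N k <= n k)%N by rewrite /n (leq_trans _ (leq_addr _ _))// (@leq_bigmax _ (fun i : 'I_k.+1 => N i) ord_max).
have nn k : (n k <= n k.+1)%N.
  by rewrite /n leq_add// [leqRHS]big_ord_recr/= leq_maxl.
pose f k := rp (u (n k)); pose D k x := f k.+1 x - f k x.
have mf k : mfun2 (f k) by exact: ((L2P mu _).1 (rpL2 _)).1.
have lD k : L2 mu (D k).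
  have := L2_comb (-1) (rpL2 (u (n k))) (rpL2 (u (n k.+1))).
  by congr (L2 mu _); apply/funext => x; rewrite mulN1r addrC.
have clsDk k : cls (D k) = u (n k.+1) - u (n k).
  by rewrite -[D k]/(f k.+1 \- f k)%R clsB ?rpK//; exact: rpL2.
have nD k : (N2 mu (D k) <= (((8 : R) ^+ k)^-1)%:E)%E.
  rewrite -nm2_cls// clsDk lee_fin.
  have h := hN k (n k.+1) (n k) (leq_trans (Nn k) (nn k)) (Nn k).
  apply: (@le_trans _ _ ((((8 : R) ^+ k)^-1) ^+ 2)).
    by rewrite ler_pXn2r ?nnegrE ?nm_ge0// ltW.
  rewrite expr2 ler_piMr// ?(ltW (e8 k))// invf_le1 ?exprn_gt0//.
  by rewrite exprn_ege1// ler1n.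
(* As the squared norm of D k is at most 8^-k, G is integrable. Where G is finite, D k is at most
   sqrt(G) / 2^k in modulus, which gives pointwise convergence with a rate. *)
pose G x := (\sum_(0 <= k <oo) (4 ^+ k * cmod (D k x) ^+ 2)%:E)%E.
have g0 k x : (0 <= (4 ^+ k * cmod (D k x) ^+ 2)%:E)%E.
  by rewrite lee_fin mulr_ge0 ?sqr_ge0// exprn_ge0.
have mGk k : measurable_fun setT (fun x => (4 ^+ k * cmod (D k x) ^+ 2)%:E).
  have /measurable_EFinP h := mod2_meas ((L2P mu _).1 (lD k)).1.
  by apply/measurable_EFinP; apply: measurable_funM.
have intG : (\int[mu]_x G x < +oo)%E.
  rewrite /G integral_nneseries//.
  apply: (@le_lt_trans _ _ (\sum_(0 <= k <oo) (2 / (2 ^ (k + 1))%:R)%:E)%E).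
    apply: lee_nneseries => k; first by move=> _ _; apply: integral_ge0 => x _.
    under eq_integral do rewrite EFinM.
    rewrite ge0_integralZl_EFin ?exprn_ge0//; last 2 first.
    - by move=> x _; rewrite lee_fin sqr_ge0.
    - exact: mod2_meas ((L2P mu _).1 (lD k)).1.
    move=> _.
    apply: (@le_trans _ _ ((4 ^+ k)%:E * (((8 : R) ^+ k)^-1)%:E)%E).
      by apply: lee_wpmul2l (nD k); rewrite lee_fin exprn_ge0.
    rewrite -EFinM lee_fin natrX addn1 exprS invfM mulrA divff// mul1r.
    by rewrite -!exprVn -exprMn (_ : 4 * 8^-1 = 2^-1 :> R)//; field.
  by rewrite (cvg_lim _ (@cvg_geometric_eseries_half R 2 0))// ltry.
have mG : measurable_fun setT G by apply: ge0_emeasurable_sum.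
have Gfin : {ae mu, forall x, G x < +oo}%E.
  have iG : mu.-integrable setT G.
    apply/integrableP; split=> //.
    rewrite (eq_integral G)// => x _; rewrite gee0_abs//.
    by apply: nneseries_ge0.
  have := integrable_ae measurableT iG; apply: filterS => x /(_ I).
  by rewrite ltey_eq => ->.
have DG k x : (G x < +oo)%E -> cmod (D k x) <= Num.sqrt (fine (G x)) / 2 ^+ k.
  move=> Gx; have Gx0 : (0 <= G x)%E by apply: nneseries_ge0.
  have h : 4 ^+ k * cmod (D k x) ^+ 2 <= fine (G x).
    rewrite -lee_fin fineK ?ge0_fin_numE//.
    by rewrite (le_trans _ (nneseries_lim_ge k.+1 _))// big_nat_recr//= leeDr// sume_ge0.
  rewrite -(@ler_pXn2r _ 2) ?nnegrE ?cmod_ge0 ?divr_ge0 ?sqrtr_ge0 ?exprn_ge0//.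
  rewrite expr_div_n sqr_sqrtr ?fine_ge0// ler_pdivlMr ?exprn_gt0 ?exprn_gt0//.
  by rewrite mulrC exprAC (_ : 2 ^+ 2 = 4 :> R)//; ring.
pose B := [set x | (G x < +oo)%E].
have mB : measurable B.
  by rewrite /B -[X in measurable X]setTI; apply: emeasurable_fun_infty_o.
(* Cut to 0 where G is infinite, so that the limit exists everywhere and is measurable. *)
pose F (p : R[i] -> R) k x := p (f k x) * \1_B x.
have cF (p : R[i] -> R) x : (forall y z, p (y - z) = p y - p z) -> (forall z, `|p z| <= cmod z) ->
    exists2 l : R, F p ^~ x @ \oo --> l &
    forall k, `|l - F p k x| <= 2 * (Num.sqrt (fine (G x)) * \1_B x) / 2 ^+ k.
  move=> pB pm; apply: geometric_cvg => k; rewrite /F -mulrBl -pB normrM.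
  have [Bx|Bx] := pselect (B x).
    by rewrite indicE mem_set// normr1 !mulr1 (le_trans (pm _))// DG.
  by rewrite indicE memNset// normr0 !mulr0 mul0r.
have ReB (y z : R[i]) : Re (y - z) = Re y - Re z by rewrite !cRI.
have ImB (y z : R[i]) : Im (y - z) = Im y - Im z by rewrite !cRI.
pose g x : R[i] := Complex (limn (F Re ^~ x)) (limn (F Im ^~ x)).
have mF (p : R[i] -> R) k : measurable_fun setT (fun x => p (f k x)) -> measurable_fun setT (F p k).
  by move=> mp; apply: measurable_funM => //; exact: measurable_indic.
have mg : mfun2 g.
  split; rewrite /=.
  - apply: (@measurable_fun_cvg _ _ _ setT (F Re)).
      by move=> k; apply: mF; exact: (mf k).1.
    by move=> x _; have [l cl _] := cF Re x ReB (@cRe_le R); rewrite (cvg_lim _ cl).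
  - apply: (@measurable_fun_cvg _ _ _ setT (F Im)).
      by move=> k; apply: mF; exact: (mf k).2.
    by move=> x _; have [l cl _] := cF Im x ImB (@cIm_le R); rewrite (cvg_lim _ cl).
have gG k x : B x -> cmod (g x - f k x) <= 4 * Num.sqrt (fine (G x)) / 2 ^+ k.
  move=> Bx; apply: (le_trans (cmod_le_ReIm _)); rewrite ReB ImB /=.
  have [l1 c1 h1] := cF Re x ReB (@cRe_le R); have [l2 c2 h2] := cF Im x ImB (@cIm_le R).
  rewrite (cvg_lim _ c1)// (cvg_lim _ c2)//; have := h1 k; have := h2 k.
  by rewrite /F indicE mem_set// !mulr1; lra.
have gN k : (N2 mu (fun x => g x - f k x)%R <= ((4 / 2 ^+ k) ^+ 2)%:E * \int[mu]_x G x)%E.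
  rewrite -ge0_integralZl_EFin ?sqr_ge0//; last by move=> x _; apply: nneseries_ge0.
  apply: ae_ge0_le_integral => //.
  - by move=> x _; rewrite lee_fin sqr_ge0.
  - apply: mod2_meas; have := mfun2D mg (mfun2M (mfun2_cst _ (-1)) (mf k)).
    by congr (mfun2 _); apply/funext => x; rewrite mulN1r.
  - by move=> x _; rewrite mule_ge0 ?lee_fin ?sqr_ge0//; apply: nneseries_ge0.
  - by apply: emeasurable_funM => //; exact: measurable_cst.
  move: Gfin; apply: filterS => x Bx _.
  have Gx0 : (0 <= G x)%E by apply: nneseries_ge0.
  rewrite -[G x in leRHS]fineK ?ge0_fin_numE// -EFinM lee_fin.
  have q0 : 0 <= 4 / 2 ^+ k * Num.sqrt (fine (G x)).
    by rewrite mulr_ge0 ?sqrtr_ge0 ?divr_ge0 ?exprn_ge0.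
  rewrite -[fine (G x)]sqr_sqrtr ?fine_ge0// -exprMn.
  by rewrite ler_pXn2r ?nnegrE ?cmod_ge0// mulrAC gG.
have IG0 : (0 <= \int[mu]_x G x)%E by apply: integral_ge0 => x _; apply: nneseries_ge0.
pose I0 := fine (\int[mu]_x G x)%E.
have IE : (\int[mu]_x G x)%E = I0%:E by rewrite fineK// ge0_fin_numE.
have I00 : 0 <= I0 by rewrite fine_ge0.
have lgk k : L2 mu (fun x => g x - f k x).
  apply/L2P; split; last by rewrite (le_lt_trans (gN k))// IE -EFinM ltry.
  have := mfun2D mg (mfun2M (mfun2_cst _ (-1)) (mf k)).
  by congr (mfun2 _); apply/funext => x; rewrite mulN1r.
have lg : L2 mu g.
  have := L2D (lgk 0%N) (rpL2 (u (n 0%N))).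
  by congr (L2 mu _); apply/funext => x; rewrite subrK.
have vk k : nm (cls g - u (n k)) <= 4 / 2 ^+ k * Num.sqrt I0.
  have -> : cls g - u (n k) = cls (g \- f k)%R by rewrite clsB ?rpK//; exact: rpL2.
  rewrite -(@ler_pXn2r _ 2) ?nnegrE ?nm_ge0 ?mulr_ge0 ?invr_ge0 ?exprn_ge0 ?sqrtr_ge0//.
  rewrite exprMn (sqr_sqrtr I00) -lee_fin nm2_cls; [|exact: lgk].
  by have := gN k; rewrite IE -EFinM.
exists (cls g) => e e0.
have e2 : 0 < e / 2 by rewrite divr_gt0.
have [N0 hN0] := cu _ e2.
pose K := (Num.truncn (4 * Num.sqrt I0 / (e / 2))).+1.
exists N0 => m mN.
pose k := maxn N0 K.
have kn : (N0 <= n k)%N.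
  by rewrite /n (leq_trans (leq_maxl N0 K))// leq_addl.
apply: (le_trans (nm_trans ipc_inner (u (n k)) _ _)).
rewrite [leRHS]splitr; apply: lerD; first exact: hN0.
rewrite (nmBC ipc_inner); apply: (le_trans (vk k)).
have h : 4 * Num.sqrt I0 / (e / 2) <= 2 ^+ k.
  apply: (le_trans (ltW (truncnS_gt _))); rewrite -/K.
  rewrite (_ : 2 ^+ k = (2 ^ k)%:R); last by rewrite natrX.
  rewrite ler_nat.
  by apply: (leq_trans (leq_maxr N0 K)); apply: ltnW; exact: ltn_expl.
by rewrite mulrAC ler_pdivrMr ?exprn_gt0// [leRHS]mulrC -ler_pdivrMr.
Qed.

End L2_quotient.

(** * The spectral calculus on L^2 classes *)

Section set_function_integral.
Import HBNNSimple.

(** The integral is built from suprema over simple functions and so sees only the values on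
    measurable sets. This lets [scalar_measure], a bare set function in [sq_integral], be replaced
    by the measure [nu]. *)
Lemma eq_set_function_integral d (T : measurableType d) (R : realType)
    (m1 m2 : set T -> \bar R) (D : set T) (f : T -> \bar R) :
  (forall A, measurable A -> m1 A = m2 A) ->
  integral m1 D f = integral m2 D f.
Proof.
move=> m12.
have h (g : {nnsfun T >-> R}) : sintegral m1 g = sintegral m2 g.
  by apply: eq_fsbigr => r _; rewrite m12.
have hs (g : T -> \bar R) :
    [set sintegral m1 h | h in [set h : {nnsfun T >-> R} | forall x, ((h x)%:E <= g x)%E]] =
    [set sintegral m2 h | h in [set h : {nnsfun T >-> R} | forall x, ((h x)%:E <= g x)%E]].
  by apply/seteqP; split => _ [k kg <-]; exists k.
by rewrite /integral !hs.
Qed.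

End set_function_integral.

Section L2_spectral.
Context d (R : realType) (Omega : borelMetricType d R).
Variable mu : {measure set Omega -> \bar R}.
Local Notation "f =m g" := (ae_eq mu setT f g) (at level 70).
Implicit Types f g h : Omega -> R[i].
Local Notation cls := (cls mu).
Local Notation ipc := (@ipc d R Omega mu).
Local Notation nm := (nm ipc).
Variable E : proj_measure mu.

Let EL2 A f : measurable A -> L2 mu f -> L2 mu (E A f).
Proof. by move=> mA; exact: (L2_operator_range (proj_operator E mA)). Qed.

Let Eae A f g : measurable A -> L2 mu f -> L2 mu g -> f =m g -> E A f =m E A g.
Proof.
by move=> mA lf lg fg; have [] := L2_operator_ae (proj_operator E mA) lf lg fg.
Qed.

Definition pec (A : set R) (v : L2cls mu) : L2cls mu := cls (E A (rp v)).

Lemma pec_cls A f : measurable A -> L2 mu f -> pec A (cls f) = cls (E A f).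
Proof.
move=> mA lf; apply: cls_eq; try by apply: EL2 => //; exact: rpL2.
by apply: Eae => //; [exact: rpL2|exact: cls_ae].
Qed.

Lemma cls_sum (n : nat) (F : 'I_n -> Omega -> R[i]) : (forall i, L2 mu (F i)) ->
  L2 mu (fun x => \sum_(i < n) F i x) /\
  cls (fun x => \sum_(i < n) F i x) = \sum_(i < n) cls (F i).
Proof.
elim: n F => [|n ih] F lF.
  rewrite (_ : (fun x => _) = cst 0); last by apply/funext => x; rewrite big_ord0.
  by split; [exact: L2_0|rewrite big_ord0].
rewrite (_ : (fun x => _) =
  fun x => \sum_(i < n) F (widen_ord (leqnSn n) i) x + F ord_max x); last first.
  by apply/funext => x; rewrite big_ord_recr.
have [l1 e1] := ih (fun i => F (widen_ord (leqnSn n) i)) (fun i => lF _).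
by split; [exact: L2D|rewrite clsD// e1 big_ord_recr].
Qed.

Lemma pec_lin A : measurable A -> forall a u v,
  pec A (a *: u + v) = a *: pec A u + pec A v.
Proof.
move=> mA a u v; have [lu lv] := (rpL2 u, rpL2 v).
rewrite -{1}(rpK u) -{1}(rpK v) -clsZ// -clsD//; last exact: L2Z.
have [lc le] := L2_operator_linear (proj_operator E mA) a lu lv.
have [lEu lEv] := (EL2 mA lu, EL2 mA lv).
have lc' := L2_comb a lu lv; rewrite pec_cls// [pec A u]/pec [pec A v]/pec -clsZ// -clsD//.
  by apply: cls_eq => //; [exact: EL2|exact: L2_comb].
exact: L2Z.
Qed.

Lemma pec_sadd (A : nat -> set R) v : (forall n, measurable (A n)) ->
  trivIset setT A -> forall e : R, 0 < e -> exists N, forall n, (N <= n)%N ->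
  nm (pec (\bigcup_n A n) v - \sum_(k < n) pec (A k) v) <= e.
Proof.
move=> mA tA e e0; have mU : measurable (\bigcup_n A n) by exact: bigcup_measurable.
have /fine_cvgP[_ /cvgrPdist_le/(_ e e0)[N _ hN]] := proj_sigma_additive E mA tA (rpL2 v).
exists N => n /hN /=; have [l1 e1] := cls_sum (fun k : 'I_n => EL2 (mA k) (rpL2 v)).
rewrite -e1 -clsB//; last exact: EL2 mU (rpL2 v).
rewrite sub0r normrN -nm_cls/=; first by rewrite ger0_norm ?nm_ge0.
have := L2_comb (-1) l1 (EL2 mU (rpL2 v)).
by congr (L2 mu _); apply/funext => x /=; rewrite mulN1r addrC.
Qed.

Lemma pec_idem A v : measurable A -> pec A (pec A v) = pec A v.
Proof.
move=> mA; have lE := EL2 mA (rpL2 v).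
rewrite {2 3}/pec pec_cls//; apply: cls_eq => //; first exact: EL2.
by apply: (proj_idem E) => //; exact: rpL2.
Qed.

Lemma pec_sym A u v : measurable A -> ipc (pec A u) v = ipc u (pec A v).
Proof.
move=> mA; have [lu lv] := (EL2 mA (rpL2 u), EL2 mA (rpL2 v)).
rewrite -{1}(rpK v) -{2}(rpK u) /pec !ipc_cls//; try exact: rpL2.
by apply: (proj_sym E) => //; exact: rpL2.
Qed.

Lemma pec_total v : pec `[0, +oo[ v = v.
Proof.
rewrite -[RHS]rpK; apply: cls_eq; [|exact: rpL2|].
  by apply: EL2 => //; exact: rpL2.
by apply: (proj_total E); exact: rpL2.
Qed.

Definition spv : @pvm R (L2cls mu) ipc :=
  Pvm (ipc_inner mu) pec_lin pec_idem pec_sym pec_total pec_sadd.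

Local Notation mult := (mult spv).

Lemma scalar_measureE f A : measurable A -> L2 mu f ->
  scalar_measure E f A = nu spv (cls f) A.
Proof.
move=> mA lf; rewrite nuE// /scalar_measure -ipc_cls -?pec_cls//.
exact: EL2.
Qed.

Lemma sq_integralE f phi : L2 mu f -> sq_integral E f phi = sqint spv phi (cls f).
Proof.
by move=> lf; apply: eq_set_function_integral => A mA; rewrite scalar_measureE.
Qed.

Definition sim_of n (c : 'I_n -> R[i]) (A : 'I_n -> set R) : seq (R[i] * set R) :=
  [seq (c i, A i) | i <- index_enum 'I_n].

Lemma sim_ofE n (c : 'I_n -> R[i]) (A : 'I_n -> set R) :
  simple_fun c A = sim (sim_of c A).
Proof. by apply/funext => l; rewrite /simple_fun /sim /sim_of big_map. Qed.

Lemma sim_of_meas n (c : 'I_n -> R[i]) (A : 'I_n -> set R) :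
  (forall i, measurable (A i)) -> all_meas (sim_of c A).
Proof. by move=> mA; rewrite /sim_of; elim: (index_enum _) => //= i s ih; split. Qed.

Lemma simple_integral_cls n (c : 'I_n -> R[i]) (A : 'I_n -> set R) f :
  (forall i, measurable (A i)) -> L2 mu f ->
  L2 mu (simple_integral E c A f) /\
  cls (simple_integral E c A f) = Tsim spv (sim_of c A) (cls f).
Proof.
move=> mA lf; have [|l1 e1] := cls_sum (F := fun i x => c i * E (A i) f x).
  by move=> i; apply: L2Z; exact: EL2.
split; first exact: l1.
rewrite [LHS]e1 /Tsim /sim_of big_map; apply: eq_bigr => i _ /=.
by rewrite clsZ ?pec_cls//; exact: EL2.
Qed.

Lemma spectral_integral_specint phi f g : spectral_integral E phi f g ->
  specint spv phi (cls f) (cls g).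
Proof.
move=> [lf lg _ h] e e0; have [n [c [A [mA h1 h2]]]] := h e e0.
have [l1 e1] := simple_integral_cls c mA lf.
exists (sim_of c A); split; first exact: sim_of_meas.
  by move: h1; rewrite sq_integralE// sim_ofE.
rewrite -lte_fin -e1 -clsB// nm_cls//.
have := L2_comb (-1) l1 lg.
by congr (L2 mu _); apply/funext => x /=; rewrite mulN1r addrC.
Qed.

Lemma specint_spectral_integral phi f w : L2 mu f -> bsym phi ->
  specint spv phi (cls f) w -> spectral_integral E phi f (rp w).
Proof.
move=> lf bp h; split => //; first exact: rpL2.
  have [M hM] := bp.2; have M0 : 0 <= M by rewrite (le_trans (cmod_ge0 _) (hM 0 _)).
  by rewrite sq_integralE// (le_lt_trans (sqint_bd _ _ bp.1 M0 hM))// ltry.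
move=> e e0; have [s [ms h1 h2]] := h e e0.
(* The list is reindexed by ordinals, the form required by [simple_integral]. *)
pose c (i : 'I_(size s)) := (nth (0, set0) s i).1.
pose A (i : 'I_(size s)) := (nth (0, set0) s i).2.
have es : s = sim_of c A.
  rewrite /sim_of -[LHS](mkseq_nth (0, set0)) /mkseq -val_enum_ord -map_comp.
  rewrite enumT; apply: eq_map => i /=.
  by rewrite /c /A -surjective_pairing.
have mA i : measurable (A i).
  rewrite /A; move: ms (ltn_ord i); elim: (s) (nat_of_ord i) => //= p r ih [|j] [mp mr] //= jr.
  exact: ih.
exists (size s), c, A; split => //.
  by rewrite sq_integralE// sim_ofE -es.
have [l1 e1] := simple_integral_cls c mA lf.
rewrite -nm_cls; last first.
  have := L2_comb (-1) l1 (rpL2 w).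
  by congr (L2 mu _); apply/funext => x /=; rewrite mulN1r addrC.
by rewrite clsB; [rewrite rpK e1 -es lte_fin|exact: rpL2|exact: l1].
Qed.

(** The representative picked by [multiplier] is arbitrary, but uniqueness of spectral integrals
    determines its class. *)
Lemma cls_multiplier phi f : L2 mu f -> bsym phi ->
  L2 mu (multiplier E phi f) /\ cls (multiplier E phi f) = mult phi (cls f).
Proof.
move=> lf bp; have hs := multP spv (@L2cls_complete _ _ _ mu) (cls f) bp.
have hi := specint_spectral_integral lf bp hs.
have hm : spectral_integral E phi f (multiplier E phi f).
  by rewrite /multiplier; case: xgetP => [? ->//|/(_ _ hi)].
split; first by case: hm.
by apply: (specint_unique (phi := phi) bp.1 _ hs); exact: spectral_integral_specint.
Qed.

End L2_spectral.

(** * The heat semigroup in the functional calculus *)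

Section heat_semigroup.
Context d (R : realType) (Omega : borelMetricType d R).
Variable mu : {measure set Omega -> \bar R}.
Variable (E : proj_measure mu) (L : operator mu).
Hypothesis LE : spectral_measure_sqrt L E.
Local Notation cls := (cls mu).
Local Notation mult := (mult (spv E)).
Local Notation D := (`[0%R, +oo[%classic : set R).
Let complete := @L2cls_complete _ _ _ mu.

Lemma bsym_cont_real (g : R -> R) (M : R) : continuous g ->
  (forall l, 0 <= l -> `|g l| <= M) -> bsym (fun l => (g l)%:C%C).
Proof.
move=> cg hM; apply: (bsym_real (M := M)) => //.
by apply: measurable_funTS; exact: continuous_measurable_fun.
Qed.

Lemma expR_continuous (t : R) : continuous (fun l : R => expR (- (t * l ^+ 2))).
Proof.
move=> l; apply: continuous_comp; last exact: continuous_expR.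
by apply: cvgN; apply: cvgM; [exact: cvg_cst|exact: exprn_continuous].
Qed.

Definition heat_symbol (t : R) : R -> R[i] := fun l => (expR (- (t * l ^+ 2)))%:C%C.

Lemma heat_symbol_le1 (t l : R) : 0 <= t -> `|expR (- (t * l ^+ 2))| <= 1.
Proof.
by move=> t0; rewrite ger0_norm ?expR_ge0// -expR0 ler_expR oppr_le0 mulr_ge0 ?sqr_ge0.
Qed.

Lemma bsym_heat (t : R) : 0 <= t -> bsym (heat_symbol t).
Proof.
move=> t0; apply: (bsym_cont_real (M := 1)); first exact: expR_continuous.
by move=> l _; exact: heat_symbol_le1.
Qed.

Lemma cls_heat (t : R) f : 0 <= t -> L2 mu f ->
  L2 mu (heat E t f) /\ cls (heat E t f) = mult (heat_symbol t) (cls f).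
Proof. by move=> t0 lf; exact: cls_multiplier (bsym_heat t0). Qed.

Lemma expR_sq_ge (x : R) : 0 <= x -> x ^+ 2 <= 4 * expR x.
Proof.
move=> x0; have h := @expR_ge1Dx R (x / 2).
have e2 : expR x = expR (x / 2) ^+ 2 by rewrite expr2 -expRD -splitr.
have h2 : (1 + x / 2) ^+ 2 <= expR (x / 2) ^+ 2.
  by rewrite ler_pXn2r ?nnegrE ?expR_ge0// addr_ge0 ?divr_ge0.
rewrite e2; move: h2; rewrite !expr2; nra.
Qed.

Definition dheat_symbol (t : R) : R -> R[i] :=
  fun l => (l ^+ 2 * expR (- (t * l ^+ 2)))%:C%C.

Lemma sq_expR_le (t l : R) : 0 < t -> (t * l ^+ 2) * expR (- (t * l ^+ 2)) <= 1.
Proof.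
move=> t0; rewrite expRN ler_pdivrMr ?expR_gt0// mul1r.
by apply: le_trans (expR_ge1Dx _); rewrite lerDr.
Qed.

Lemma sq_heat_continuous (t : R) : continuous (fun l : R => l ^+ 2 * expR (- (t * l ^+ 2))).
Proof. by move=> l; apply: cvgM; [exact: exprn_continuous|exact: expR_continuous]. Qed.

Lemma bsym_dheat (t : R) : 0 < t -> bsym (dheat_symbol t).
Proof.
move=> t0; apply: (bsym_cont_real (M := t^-1)); first exact: sq_heat_continuous.
move=> l _; rewrite ger0_norm; last exact: mulr_ge0 (sqr_ge0 _) (expR_ge0 _).
by rewrite -[leRHS]mulr1 ler_pdivlMl// mulrA sq_expR_le.
Qed.

(** Since l^2 exp(-t l^2) is at most 1/t, the spectral criterion puts the heat flow in the domain of
    L. There L f is a spectral integral of l^2, and so is the value of [dheat_symbol]; uniqueness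
    identifies the two. *)
Lemma cls_L_heat (t : R) f : 0 < t -> L2 mu f ->
  L2 mu (L (heat E t f)) /\ cls (L (heat E t f)) = mult (dheat_symbol t) (cls f).
Proof.
move=> t0 lf; have [lg eg] := cls_heat (ltW t0) lf; set g := heat E t f in lg eg *.
pose sq := fun l : R => ((l ^+ 2)%:C)%C : R[i].
have msq : msym sq.
  split=> /=; last exact: measurable_cst.
  by apply: measurable_funTS; exact: exprn_measurable.
have lsq : loc_bounded sq.
  move=> n; exists (n%:R ^+ 2) => l l0 ln.
  by rewrite cmodR ger0_norm ?sqr_ge0// ler_pXn2r// nnegrE.
have bh := bsym_heat (ltW t0).
have prodE : (fun l => sq l * heat_symbol t l) = dheat_symbol t.
  by apply/funext => l; rewrite /sq /heat_symbol /dheat_symbol -rmorphM.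
have cE l : cmod (sq l * heat_symbol t l) = l ^+ 2 * expR (- (t * l ^+ 2)).
  rewrite (congr1 (@^~ l) prodE) /dheat_symbol cmodR ger0_norm//.
  exact: mulr_ge0 (sqr_ge0 _) (expR_ge0 _).
have tail (e : R) : 0 < e -> exists n : nat, forall l, n%:R < l ->
     cmod (sq l * heat_symbol t l) <= e.
  (* From exp(x) >= x^2 / 4 at x = t l^2 the product is at most 4 / (t^2 l^2), and l^2 >= l >= 4 /
     (t^2 e) beyond this index. *)
  move=> e0; exists (Num.truncn (4 / (t ^+ 2 * e))).+1 => l ln; rewrite cE.
  have l1 : 1 <= l by rewrite (le_trans _ (ltW ln))// ler1n.
  have lp : 0 < l by rewrite (lt_le_trans ltr01).
  have h := expR_sq_ge (x := t * l ^+ 2); rewrite mulr_ge0 ?sqr_ge0 ?(ltW t0)// in h.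
  rewrite expRN ler_pdivrMr ?expR_gt0//.
  have h1 : 4 / (t ^+ 2 * e) <= l.
    by rewrite (le_trans (ltW (truncnS_gt _)))// ltW.
  rewrite ler_pdivrMr ?mulr_gt0 ?exprn_gt0// in h1.
  have h2 : (t * l ^+ 2) ^+ 2 * e <= 4 * expR (t * l ^+ 2) * e by rewrite ler_wpM2r ?h// ltW.
  have l2 : l <= l ^+ 2 by rewrite expr2 ler_peMr// ltW.
  have h3 : 4 * l ^+ 2 <= (t * l ^+ 2) ^+ 2 * e.
    have -> : (t * l ^+ 2) ^+ 2 * e = l ^+ 2 * (l ^+ 2 * (t ^+ 2 * e)) by ring.
    rewrite mulrC ler_wpM2l ?sqr_ge0// (le_trans h1)// ler_wpM2r//.
    by rewrite mulr_ge0 ?sqr_ge0 ?(ltW e0).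
  by rewrite mulrC; lra.
have bd := bsym_dheat t0.
have dg : dom L g.
  apply/(LE lg).1; rewrite sq_integralE// eg.
  have ti0 : 0 <= t^-1 by rewrite invr_ge0 ltW.
  have hM l : 0 <= l -> cmod (sq l * heat_symbol t l) <= t^-1.
    by move=> l0; rewrite cE -[leRHS]mulr1 ler_pdivlMl// mulrA sq_expR_le.
  apply: le_lt_trans (sqint_mult_le (spv E) complete (cls f) msq lsq bh ti0 hM) _.
  exact: ltry.
have hs := (LE lg).2 dg; split; first by case: hs.
have h1 := spectral_integral_specint hs.
have := specint_mult (spv E) complete (cls f) msq lsq bh _ tail.
rewrite prodE => /(_ bd) h2; rewrite eg in h1.
exact: specint_unique msq h1 h2.
Qed.

End heat_semigroup.

Section derive_real.
Context {R : realType}.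
Implicit Types (f g : R -> R) (x a b c : R).

Lemma is_derive1_mul f g x a b : is_derive x 1 f a -> is_derive x 1 g b ->
  is_derive x 1 (fun y => f y * g y) (a * g x + f x * b).
Proof.
move=> hf hg; have h := is_deriveM hf hg.
by apply: (is_derive_eq h); rewrite /GRing.scale/=; ring.
Qed.

Lemma is_derive1_add f g x a b : is_derive x 1 f a -> is_derive x 1 g b ->
  is_derive x 1 (fun y => f y + g y) (a + b).
Proof. by move=> hf hg; exact: is_deriveD hf hg. Qed.

Lemma is_derive1_scale c f x a : is_derive x 1 f a ->
  is_derive x 1 (fun y => c * f y) (c * a).
Proof.
move=> hf; have := is_derive1_mul (is_derive_cst c x 1) hf.
by rewrite mul0r add0r.
Qed.

End derive_real.

Section measurable_inverse.
Context {R : realType}.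

Lemma measurable_invr : measurable_fun setT (fun x : R => x^-1).
Proof.
have -> : [set: R] = [set 0] `|` [set~ 0] by rewrite setUv.
have m0 : measurable [set (0 : R)] by exact: measurable_set1.
apply/measurable_funU => //; first exact: measurableC.
split; first exact: measurable_fun_set1.
apply: open_continuous_measurable_fun.
  by rewrite openC; exact: closed_eq.
by move=> x; rewrite inE => /= /eqP x0; exact: inv_continuous.
Qed.

End measurable_inverse.

(** * Trigonometric integrals on [0, pi] *)

Section fourier.
Context {R : realType}.
Local Notation pi := (@pi R).
Local Notation I := (`[0%R, pi]%classic : set R).
Implicit Types f g h : R -> R.

Definition bm f := measurable_fun I f /\
  exists M : R, forall x, 0 <= x <= pi -> `|f x| <= M.

Definition J f : R := Rintegral (@lebesgue_measure R) I f.

Lemma bm_integrable f : bm f -> (@lebesgue_measure R).-integrable I (EFin \o f).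
Proof.
move=> [mf [M hM]]; apply: measurable_bounded_integrable => //.
  by rewrite /= lebesgue_measure_itv/=; case: ifP => _; rewrite ?ltry// -EFinB ltry.
exists M; split; rewrite ?num_real// => x Mx y /=; rewrite in_itv/= => h.
by rewrite (le_trans (hM y h))// ltW.
Qed.

Lemma bm_cont f : continuous f -> bm f.
Proof.
move=> cf; split; first by apply: measurable_funTS; exact: continuous_measurable_fun.
have : {within I, continuous f} by exact: continuous_subspaceT.
move=> /continuous_compact/(_ (@segment_compact _ _ _)) /compact_bounded [M [_ hM]].
exists (M + 1) => x hx; apply: (hM (M + 1)); first by rewrite ltrDl.
by exists x => //=; rewrite in_itv.
Qed.

Lemma bmD f g : bm f -> bm g -> bm (fun x => f x + g x).
Proof.
move=> [mf [M hM]] [mg [N hN]]; split; first exact: measurable_funD.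
by exists (M + N) => x hx; rewrite (le_trans (ler_normD _ _))// lerD ?hM ?hN.
Qed.

Lemma bmM f g : bm f -> bm g -> bm (fun x => f x * g x).
Proof.
move=> [mf [M hM]] [mg [N hN]]; split; first exact: measurable_funM.
by exists (M * N) => x hx; rewrite normrM ler_pM ?hM ?hN.
Qed.

Lemma bm_cst c : bm (fun=> c). Proof. by apply: bm_cont => x; exact: cvg_cst. Qed.

Lemma bmZ c f : bm f -> bm (fun x => c * f x).
Proof. exact: bmM (bm_cst c). Qed.

Lemma JD f g : bm f -> bm g -> J (fun x => f x + g x) = J f + J g.
Proof. by move=> bf bg; rewrite /J RintegralD//; exact: bm_integrable. Qed.

Lemma JZ c f : bm f -> J (fun x => c * f x) = c * J f.
Proof. by move=> bf; rewrite /J RintegralZl//; exact: bm_integrable. Qed.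

Lemma JB f g : bm f -> bm g -> J (fun x => f x - g x) = J f - J g.
Proof. by move=> bf bg; rewrite /J RintegralB//; exact: bm_integrable. Qed.

Lemma J_ge0 f : (forall x, 0 <= x <= pi -> 0 <= f x) -> 0 <= J f.
Proof. by move=> h; apply: Rintegral_ge0 => x /=; rewrite in_itv/= => /h. Qed.

Lemma eq_J f g : (forall x, 0 <= x <= pi -> f x = g x) -> J f = J g.
Proof. by move=> h; apply: eq_Rintegral => x; rewrite inE/= in_itv/= => /h. Qed.

Lemma J_cst c : J (fun=> c) = c * pi.
Proof.
have p0 := pi_gt0 R.
rewrite /J Rintegral_cst//= lebesgue_measure_itv/= lte_fin p0/=.
by rewrite subr0.
Qed.

Lemma J_le f g : bm f -> bm g -> (forall x, 0 <= x <= pi -> f x <= g x) -> J f <= J g.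
Proof.
move=> bf bg h; rewrite -subr_ge0 -JB//; apply: J_ge0 => x hx.
by rewrite subr_ge0 h.
Qed.

Lemma J_bound f M : bm f -> (forall x, 0 <= x <= pi -> `|f x| <= M) -> `|J f| <= M * pi.
Proof.
move=> bf h; rewrite ler_norml -J_cst -mulN1r -JZ; last exact: bm_cst.
apply/andP; split; apply: J_le => //; try exact: bm_cst; try by apply: bmZ; exact: bm_cst.
  by move=> x /h; rewrite ler_norml mulN1r => /andP[].
by move=> x /h; rewrite ler_norml => /andP[].
Qed.

Lemma J_ftc f F : continuous f -> continuous F ->
  (forall x, 0 < x < pi -> is_derive x 1 F (f x)) -> J f = F pi - F 0.
Proof.
move=> cf cF dF; rewrite /J /Rintegral (@continuous_FTC2 _ f F 0 pi (pi_gt0 R)).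
- by [].
- exact: continuous_subspaceT.
- split; first by move=> x; rewrite in_itv/= => /dF [].
    by apply: cvg_at_right_filter; exact: cF.
  by apply: cvg_at_left_filter; exact: cF.
- by move=> x; rewrite in_itv/= => /dF [_ h]; rewrite derive1E h.
Qed.

Definition cosn (n : nat) (x : R) := cos (n%:R * x).
Definition sinn (n : nat) (x : R) := sin (n%:R * x).

Lemma cosn_cont n : continuous (cosn n).
Proof.
move=> x; apply: continuous_comp; last exact: continuous_cos.
by apply: cvgM; [exact: cvg_cst|exact: cvg_id].
Qed.

Lemma sinn_cont n : continuous (sinn n).
Proof.
move=> x; apply: continuous_comp; last exact: continuous_sin.
by apply: cvgM; [exact: cvg_cst|exact: cvg_id].
Qed.

Let is_derive_lin (c x : R) : is_derive x 1 (fun y => c * y) c.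
Proof.
by have := is_derive1_scale c (is_derive_id x 1); rewrite mulr1.
Qed.

Lemma sinn_derive (n : nat) (x : R) : is_derive x 1 (sinn n) (n%:R * cosn n x).
Proof.
have := is_derive1_comp (is_derive_sin (n%:R * x)) (is_derive_lin n%:R x).
by rewrite /cosn mulrC.
Qed.

Lemma cosn_derive (n : nat) (x : R) : is_derive x 1 (cosn n) (- (n%:R * sinn n x)).
Proof.
have := is_derive1_comp (is_derive_cos (n%:R * x)) (is_derive_lin n%:R x).
by rewrite /sinn mulrC mulrN.
Qed.

Lemma sinn_pi n : sinn n pi = 0.
Proof.
elim: n => [|n ih]; first by rewrite /sinn mul0r sin0.
move: ih; rewrite /sinn -natr1 mulrDl mul1r sinD sinpi cospi mulr0 addr0 => ->.
by rewrite mul0r.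
Qed.

Lemma J_cosn n : (0 < n)%N -> J (cosn n) = 0.
Proof.
move=> n0; have nz : n%:R != 0 :> R by rewrite pnatr_eq0 -lt0n.
have -> : J (cosn n) = n%:R^-1 * sinn n pi - n%:R^-1 * sinn n 0; last first.
  by rewrite sinn_pi /sinn !mulr0 sin0 mulr0 subr0.
apply: (J_ftc (F := fun x => n%:R^-1 * sinn n x)).
- exact: cosn_cont.
- by move=> x; apply: cvgM; [exact: cvg_cst|exact: sinn_cont].
- move=> x _; have := is_derive1_scale n%:R^-1 (sinn_derive n x).
  by rewrite mulrA mulVf// mul1r.
Qed.

Lemma cosn_prod j k x : (j <= k)%N ->
  cosn j x * cosn k x = 2^-1 * cosn (k + j) x + 2^-1 * cosn (k - j) x.
Proof.
by move=> jk; rewrite /cosn natrD natrB// !mulrDl !mulNr !cosD cosN sinN; field.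
Qed.

Lemma sinn_prod j k x : (j <= k)%N ->
  sinn j x * sinn k x = 2^-1 * cosn (k - j) x - 2^-1 * cosn (k + j) x.
Proof.
by move=> jk; rewrite /sinn /cosn natrD natrB// !mulrDl !mulNr !cosD cosN sinN; field.
Qed.

Lemma bm_cosn n : bm (cosn n). Proof. by apply: bm_cont; exact: cosn_cont. Qed.
Lemma bm_sinn n : bm (sinn n). Proof. by apply: bm_cont; exact: sinn_cont. Qed.

Lemma J_cosn_prod j k : (0 < j)%N -> (j <= k)%N ->
  J (fun x => cosn j x * cosn k x) = if j == k then pi / 2 else 0.
Proof.
move=> j0 jk; rewrite (eq_J (g := fun x => 2^-1 * cosn (k + j) x + 2^-1 * cosn (k - j) x)); last first.
  by move=> x _; rewrite cosn_prod.
rewrite JD ?JZ; try exact: bm_cosn; try by apply: bmZ; exact: bm_cosn.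
rewrite J_cosn ?addn_gt0 ?j0 ?orbT// mulr0 add0r; case: eqP => [<-|/eqP jk'].
  rewrite subnn (eq_J (g := fun=> 1)) ?J_cst ?mul1r 1?mulrC// => x _.
  by rewrite /cosn mul0r cos0.
by rewrite J_cosn ?mulr0// subn_gt0 ltn_neqAle jk'.
Qed.

Lemma J_sinn_prod j k : (0 < j)%N -> (j <= k)%N ->
  J (fun x => sinn j x * sinn k x) = if j == k then pi / 2 else 0.
Proof.
move=> j0 jk; rewrite (eq_J (g := fun x => 2^-1 * cosn (k - j) x - 2^-1 * cosn (k + j) x)); last first.
  by move=> x _; rewrite sinn_prod.
rewrite JB ?JZ; try exact: bm_cosn; try by apply: bmZ; exact: bm_cosn.
rewrite [J (cosn (k + j))]J_cosn ?addn_gt0 ?j0 ?orbT// mulr0 subr0; case: eqP => [<-|/eqP jk'].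
  rewrite subnn (eq_J (g := fun=> 1)) ?J_cst ?mul1r 1?mulrC// => x _.
  by rewrite /cosn mul0r cos0.
by rewrite J_cosn ?mulr0// subn_gt0 ltn_neqAle jk'.
Qed.

(** The residual after n projections has squared norm J (f^2) minus 2/pi times the sum, computed by
    induction, and this is nonnegative. Indices start at 1 since the constant cosine has a different
    norm. *)
Lemma bessel (e : nat -> R -> R) f (n : nat) : (forall k, bm (e k)) -> bm f ->
  (forall j k, (0 < j)%N -> (j <= k)%N ->
    J (fun x => e j x * e k x) = if j == k then pi / 2 else 0) ->
  \sum_(k < n) J (fun x => f x * e k.+1 x) ^+ 2 <= pi / 2 * J (fun x => f x ^+ 2).
Proof.
move=> be bf orth; have p0 := pi_gt0 R.
pose b k := J (fun x => f x * e k x).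
pose r n x := f x - \sum_(k < n) (2 / pi * b k.+1) * e k.+1 x.
have rS m : r m.+1 = fun x => r m x - (2 / pi * b m.+1) * e m.+1 x.
  by apply/funext => x; rewrite /r big_ord_recr/= opprD addrA.
have br m : bm (r m).
  elim: m => [|m ih].
    by rewrite (_ : r 0%N = f)//; apply/funext => x; rewrite /r big_ord0 subr0.
  rewrite rS (_ : (fun x => _) = fun x => r m x + (- (2 / pi * b m.+1)) * e m.+1 x).
    by apply: bmD => //; exact: bmZ.
  by apply/funext => x; rewrite mulNr.
have jr m k : (m < k)%N -> J (fun x => r m x * e k x) = b k.
  elim: m => [|m ih] mk.
    by apply: eq_J => x _; rewrite /r big_ord0 subr0.
  rewrite rS (eq_J (g := fun x => r m x * e k x - (2 / pi * b m.+1) * (e m.+1 x * e k x))).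
    rewrite JB; [|exact: bmM|by apply: bmZ; exact: bmM].
    rewrite ih 1?ltnW// JZ; last exact: bmM.
    by rewrite orth// 1?ltnW// ltn_eqF// mulr0 subr0.
  by move=> x _; ring.
suff : J (fun x => r n x ^+ 2) = J (fun x => f x ^+ 2) - 2 / pi * \sum_(k < n) b k.+1 ^+ 2.
  have : 0 <= J (fun x => r n x ^+ 2) by apply: J_ge0 => x _; exact: sqr_ge0.
  move=> /[swap] ->; rewrite subr_ge0 => h.
  have := ler_wpM2l (ltW (divr_gt0 p0 (ltr0n R 2))) h.
  have -> : pi / 2 * (2 / pi * \sum_(k < n) b k.+1 ^+ 2) = \sum_(k < n) b k.+1 ^+ 2.
    have aux (p s : R) : p != 0 -> p / 2 * (2 / p * s) = s by move=> pn; field.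
    by rewrite aux// gt_eqF.
  by [].
elim: n => [|n ih].
  by rewrite big_ord0 mulr0 subr0; apply: eq_J => x _; rewrite /r big_ord0 subr0.
rewrite big_ord_recr/= mulrDr opprD addrA -ih rS.
set c := 2 / pi * b n.+1.
rewrite (eq_J (g := fun x => (r n x ^+ 2 - (2 * c) * (r n x * e n.+1 x)) + c ^+ 2 * (e n.+1 x * e n.+1 x))); last first.
  by move=> x _; ring.
have b1 : bm (fun x => r n x ^+ 2) by apply: bmM.
have b2 : bm (fun x => (2 * c) * (r n x * e n.+1 x)) by apply: bmZ; exact: bmM.
have b3 : bm (fun x => e n.+1 x * e n.+1 x) by exact: bmM.
rewrite JD; [|rewrite (_ : (fun x => _) = fun x => r n x ^+ 2 + -1 * ((2 * c) * (r n x * e n.+1 x)))|exact: bmZ]; first last.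
- by apply/funext => x; ring.
- by apply: bmD => //; exact: bmZ.
rewrite JB// JZ; last exact: bmM.
rewrite JZ// orth// eqxx jr// /c.
have aux (p s t : R) : p != 0 ->
    t - 2 * (2 / p * s) * s + (2 / p * s) ^+ 2 * (p / 2) = t - 2 / p * s ^+ 2.
  by move=> pn; field.
by rewrite aux// gt_eqF.
Qed.

End fourier.

Lemma cauchy_schwarz_sum {R : realFieldType} (r : seq nat) (a b : nat -> R) :
  (forall i, 0 <= a i) -> (forall i, 0 <= b i) ->
  (\sum_(i <- r) a i * b i) ^+ 2 <=
  (\sum_(i <- r) a i ^+ 2) * (\sum_(i <- r) b i ^+ 2).
Proof.
move=> a0 b0; elim: r => [|i r ih]; first by rewrite !big_nil expr0n mul0r.
rewrite !big_cons.
have X0 : 0 <= \sum_(i <- r) a i * b i by apply: sumr_ge0 => j _; rewrite mulr_ge0.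
have A0 : 0 <= \sum_(i <- r) a i ^+ 2 by apply: sumr_ge0 => j _; exact: sqr_ge0.
have B0 : 0 <= \sum_(i <- r) b i ^+ 2 by apply: sumr_ge0 => j _; exact: sqr_ge0.
move: ih X0 A0 B0; move: (\sum_(i <- r) _ * _) (\sum_(i <- r) a i ^+ 2) (\sum_(i <- r) b i ^+ 2).
move=> x A B ih x0 A0 B0; have [u0 v0] := (a0 i, b0 i); move: (a i) (b i) u0 v0 => u v u0 v0.
have key : 2 * (x * (u * v)) <= A * v ^+ 2 + B * u ^+ 2.
  have q0 : 0 <= A * v ^+ 2 + B * u ^+ 2 by rewrite addr_ge0 ?mulr_ge0 ?sqr_ge0.
  have p0 : 0 <= 2 * (x * (u * v)) by rewrite !mulr_ge0.
  rewrite -(@ler_pXn2r _ 2) ?nnegrE//.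
  have h1 : (2 * (x * (u * v))) ^+ 2 <= 4 * (A * B) * (u * v) ^+ 2.
    have -> : (2 * (x * (u * v))) ^+ 2 = 4 * x ^+ 2 * (u * v) ^+ 2 by ring.
    by rewrite ler_wpM2r ?sqr_ge0// ler_wpM2l.
  apply: (le_trans h1); rewrite -subr_ge0.
  have -> : (A * v ^+ 2 + B * u ^+ 2) ^+ 2 - 4 * (A * B) * (u * v) ^+ 2 =
    (A * v ^+ 2 - B * u ^+ 2) ^+ 2 by ring.
  exact: sqr_ge0.
have -> : (u * v + x) ^+ 2 = x ^+ 2 + 2 * (x * (u * v)) + u ^+ 2 * v ^+ 2 by ring.
have -> : (u ^+ 2 + A) * (v ^+ 2 + B) =
  A * B + (A * v ^+ 2 + B * u ^+ 2) + u ^+ 2 * v ^+ 2 by ring.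
by rewrite lerD2r lerD.
Qed.

(** Telescoping, from 1 / (l + 1)^2 <= 1/l - 1/(l + 1). *)
Lemma sum_inv_sq {R : realFieldType} (n N : nat) : (0 < n)%N -> (n <= N)%N ->
  \sum_(n <= l < N) (l.+1%:R^-1) ^+ 2 <= n%:R^-1 - N%:R^-1 :> R.
Proof.
move=> n0 /subnK <-; elim: (N - n)%N => [|k ih].
  by rewrite add0n big_geq// subrr.
rewrite addSn big_nat_recr ?leq_addl//=; apply: (le_trans (lerD ih (lexx _))).
set m := (k + n)%N; have m0 : 0 < m%:R :> R by rewrite ltr0n addn_gt0 n0 orbT.
have m1 : 0 < m%:R + 1 :> R by rewrite addr_gt0.
rewrite -natr1 -addrA lerD2l -subr_ge0.
have -> : - (m%:R + 1)^-1 - (- m%:R^-1 + (m%:R + 1)^-1 ^+ 2) =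
   (m%:R * (m%:R + 1) ^+ 2)^-1 :> R by field; rewrite !gt_eqF.
by rewrite invr_ge0 mulr_ge0 ?sqr_ge0 ?ltW.
Qed.

(** * Truncation error of a cosine series *)

Section fourier_series.
Context {R : realType}.
Local Notation pi := (@pi R).
Local Notation cosn := (@cosn R).
Local Notation sinn := (@sinn R).
Variables (kappa : nat) (g : nat -> R -> R) (M M1 : R).
Hypothesis kappa_gt0 : (0 < kappa)%N.
Hypothesis gc : forall j, (j <= kappa)%N -> continuous (g j).
Hypothesis gd : forall j x, (j < kappa)%N -> 0 < x < pi -> is_derive x 1 (g j) (g j.+1 x).
Hypothesis g0 : forall j, (j <= kappa)%N -> g j 0 = 0.
Hypothesis gpi : forall j, (j <= kappa)%N -> g j pi = 0.
Hypothesis gM : forall x, 0 <= x <= pi -> `|g kappa x| <= M.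
Hypothesis g1 : forall x, 0 < x < pi -> `|g 1 x| <= M1 * sin x.

Let p0 : 0 < pi := pi_gt0 R.

Let M_ge0 : 0 <= M.
Proof. by apply: le_trans (gM (x := 0) _); rewrite ?normr_ge0// lexx ltW. Qed.

(** Cosines and sines alternate under repeated integration by parts. *)
Let en (j : nat) := if odd j then sinn else cosn.

Let bg j : (j <= kappa)%N -> bm (g j). Proof. by move=> jk; apply: bm_cont; exact: gc. Qed.

Let J_parts j (e e' : R -> R) (c : R) : (j < kappa)%N -> continuous e ->
  continuous e' ->
  (forall x : R, is_derive x 1 e (c * e' x)) ->
  c * J (fun x => g j x * e' x) = - J (fun x => g j.+1 x * e x).
Proof.
move=> jk ce ce' de; have jk' := ltnW jk.
have be := bm_cont ce; have be' := bm_cont ce'.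
have h : J (fun x => g j.+1 x * e x + c * (g j x * e' x)) = g j pi * e pi - g j 0 * e 0.
  apply: (J_ftc (F := fun x => g j x * e x)).
  - move=> x; apply: cvgD; first by apply: cvgM; [exact: gc|exact: ce].
    by apply: cvgM; [exact: cvg_cst|apply: cvgM; [exact: gc|exact: ce']].
  - by move=> x; apply: cvgM; [exact: gc|exact: ce].
  - move=> x hx; have h := is_derive1_mul (gd jk hx) (de x).
    by apply: (is_derive_eq h); ring.
rewrite g0// gpi// !mul0r subrr JD in h; last 2 first.
- by apply: bmM => //; exact: bg.
- by apply: bmZ; apply: bmM => //; exact: bg.
rewrite JZ in h; last by apply: bmM => //; exact: bg.
by apply/eqP; rewrite -addr_eq0 addrC h.
Qed.

Definition fcoef (l : nat) := J (fun x => g 0 x * cosn l x).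

(** Integration by parts j times. The boundary terms vanish because every g j is 0 at 0 and at pi;
    the absolute values absorb the signs. *)
Lemma fcoef_parts l j : (0 < l)%N -> (j <= kappa)%N ->
  `|fcoef l| * l%:R ^+ j = `|J (fun x => g j x * en j l x)|.
Proof.
move=> l0; elim: j => [|j ih] jk; first by rewrite expr0 mulr1.
rewrite exprSr mulrA ih ?(ltnW jk)//.
have nl : l%:R = `|l%:R| :> R by rewrite ger0_norm.
rewrite /en /=; case: (boolP (odd j)) => oj /=.
- have de (x : R) : is_derive x 1 (cosn l) (- l%:R * sinn l x).
    by rewrite mulNr; exact: cosn_derive.
  have h := J_parts jk (@cosn_cont _ l) (@sinn_cont _ l) de.
  by rewrite [X in _ * X]nl -normrM -[RHS]normrN -h mulNr normrN mulrC.
- have h := J_parts jk (@sinn_cont _ l) (@cosn_cont _ l) (@sinn_derive _ l).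
  by rewrite [X in _ * X]nl -normrM -[RHS]normrN -h mulrC.
Qed.

Definition fsum (n : nat) (x : R) :=
  pi^-1 * J (g 0) + 2 / pi * \sum_(0 <= l < n) fcoef l.+1 * cosn l.+1 x.

(** Cauchy-Schwarz pairs the factors l^-kappa with the Fourier coefficients of g kappa. Bessel's
    inequality bounds the latter, and the squares of the former add up to at most n^-(2 kappa - 1)
    beyond n. This is the origin of the exponent 2 kappa - 1. *)
Lemma fsum_cauchy n N x : (0 < n)%N -> (n <= N)%N ->
  (fsum N x - fsum n x) ^+ 2 * n%:R ^+ (kappa.*2.-1) <= 2 * M ^+ 2.
Proof.
move=> n0 nN.
pose B l := `|J (fun x => g kappa x * en kappa l x)|.
have bessel_B : \sum_(n <= l < N) B l.+1 ^+ 2 <= (pi * M) ^+ 2 / 2.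
  apply: (@le_trans _ _ (\sum_(0 <= l < N) B l.+1 ^+ 2)).
    by rewrite (big_cat_nat (leq0n n) nN)/= lerDr sumr_ge0// => i _; exact: sqr_ge0.
  rewrite big_mkord.
  have bk := bg (leqnn kappa).
  have := @bessel _ (en kappa) (g kappa) N _ bk _.
  rewrite (eq_bigr (fun k : 'I_N => B k.+1 ^+ 2)); last first.
    by move=> k _; rewrite /B real_normK ?num_real.
  move=> h; apply: (le_trans (h _ _)).
  - by move=> k; rewrite /en; case: ifP => _; [exact: bm_sinn|exact: bm_cosn].
  - by move=> j k j1 jk; rewrite /en; case: ifP => _; [exact: J_sinn_prod|exact: J_cosn_prod].
  have b2 : bm (fun x => g kappa x ^+ 2) by exact: bmM.
  have h2 : J (fun x => g kappa x ^+ 2) <= M ^+ 2 * pi.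
    rewrite -J_cst; apply: J_le => //; first exact: bm_cst.
    by move=> y hy; rewrite -(real_normK (num_real (g kappa y))) ler_pXn2r ?nnegrE ?gM.
  have := ler_wpM2l (ltW (divr_gt0 p0 (ltr0n R 2))) h2.
  move=> /le_trans; apply; move: (pi) p0 => p _.
  by rewrite (_ : p / 2 * (M ^+ 2 * p) = (p * M) ^+ 2 / 2)//; field.
have n0R : 0 < n%:R :> R by rewrite ltr0n.
(* All but two powers of n / (l + 1) <= 1 are dropped; the remaining inverse squares telescope. *)
have tail2 : (\sum_(n <= l < N) ((l.+1%:R^-1) ^+ kappa) ^+ 2) * n%:R ^+ (kappa.*2.-1) <= 1 :> R.
  rewrite mulr_suml.
  have [k kE] : exists k, kappa = k.+1 by case: kappa kappa_gt0 => // k _; exists k.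
  apply: (@le_trans _ _ (\sum_(n <= l < N) (n%:R * (l.+1%:R^-1) ^+ 2))).
    rewrite big_nat_cond [leRHS]big_nat_cond; apply: ler_sum => l /andP[/andP[nl _] _].
    have l0 : 0 < l.+1%:R :> R by rewrite ltr0n.
    have q1 : n%:R * l.+1%:R^-1 <= 1 :> R.
      by rewrite ler_pdivrMr// mul1r ler_nat ltnW.
    have q0 : 0 <= n%:R * l.+1%:R^-1 :> R by rewrite mulr_ge0// invr_ge0 ltW.
    rewrite kE doubleS /= [n%:R ^+ _]exprSr.
    have -> : ((l.+1%:R^-1) ^+ k.+1) ^+ 2 * (n%:R ^+ k.*2 * n%:R) =
       n%:R * (l.+1%:R^-1) ^+ 2 * (n%:R * l.+1%:R^-1) ^+ k.*2 :> R.
      by rewrite -exprM mulnC mul2n doubleS exprMn !exprS; ring.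
    by rewrite ler_piMr ?exprn_ile1// mulr_ge0 ?sqr_ge0// ltW.
  rewrite -mulr_sumr -ler_pdivlMl// mulr1 (le_trans (sum_inv_sq n0 nN))//.
  by rewrite lerBlDr lerDl.
pose X := \sum_(n <= l < N) (l.+1%:R^-1) ^+ kappa * B l.+1.
have hX : `|fsum N x - fsum n x| <= 2 / pi * X.
  have -> : fsum N x - fsum n x = 2 / pi * \sum_(n <= l < N) fcoef l.+1 * cosn l.+1 x.
    rewrite /fsum (big_cat_nat (leq0n n) nN)/= mulrDr opprD addrACA subrr add0r.
    by rewrite addrAC subrr add0r.
  have tp : 0 <= 2 / pi by rewrite divr_ge0// ltW.
  rewrite normrM (ger0_norm tp) ler_wpM2l// (le_trans (ler_norm_sum _ _ _))//.
  apply: ler_sum => l _; rewrite normrM.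
  have l0 : 0 < l.+1%:R :> R by rewrite ltr0n.
  rewrite /B -fcoef_parts// mulrC mulrA.
  have -> : (l.+1%:R^-1) ^+ kappa * `|fcoef l.+1| * l.+1%:R ^+ kappa = `|fcoef l.+1|.
    by rewrite mulrAC -exprMn mulVf ?expr1n ?mul1r// gt_eqF.
  by rewrite ler_piMl// /cosn cos_max.
have X2 : X ^+ 2 * n%:R ^+ (kappa.*2.-1) <= (pi * M) ^+ 2 / 2.
  have := cauchy_schwarz_sum (index_iota n N) (a := fun l => (l.+1%:R^-1) ^+ kappa) (b := fun l => B l.+1) _ _.
  move=> /(_ _ _)/le_trans h.
  have pn : 0 <= n%:R ^+ (kappa.*2.-1) :> R by rewrite exprn_ge0.
  have cs : X ^+ 2 <= (\sum_(n <= l < N) ((l.+1%:R^-1) ^+ kappa) ^+ 2) * (\sum_(n <= l < N) B l.+1 ^+ 2).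
    by apply: cauchy_schwarz_sum => i; rewrite ?exprn_ge0 ?invr_ge0// /B normr_ge0.
  apply: (le_trans (ler_wpM2r pn cs)); rewrite mulrAC -[leRHS]mul1r.
  apply: ler_pM => //; first by rewrite mulr_ge0// sumr_ge0// => i _; exact: sqr_ge0.
  by apply: sumr_ge0 => i _; exact: sqr_ge0.
have hX2 : (fsum N x - fsum n x) ^+ 2 <= (2 / pi * X) ^+ 2.
  rewrite -[in leLHS]real_normK ?num_real// ler_pXn2r// nnegrE.
  exact: le_trans (normr_ge0 _) hX.
have pn : 0 <= n%:R ^+ (kappa.*2.-1) :> R by rewrite exprn_ge0.
apply: (le_trans (ler_wpM2r pn hX2)).
rewrite exprMn -mulrA; apply: (le_trans (ler_wpM2l (sqr_ge0 _) X2)).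
have aux (p : R) : p != 0 -> (2 / p) ^+ 2 * ((p * M) ^+ 2 / 2) = 2 * M ^+ 2.
  by move=> pn'; field.
by rewrite aux// gt_eqF.
Qed.

(** The functions g 0 + M1 cos and - g 0 + M1 cos have nonpositive derivative by the bound on g 1,
    so g 0 is Lipschitz as a function of the cosine. *)
Let gM0 x y : 0 <= x <= pi -> 0 <= y <= pi ->
  `|g 0 y - g 0 x| <= M1 * `|cos y - cos x|.
Proof.
have mono (s : R) : (s = 1 \/ s = -1) -> forall a b, 0 <= a -> b <= pi -> a < b ->
    s * (g 0 b - g 0 a) <= M1 * (cos a - cos b).
  move=> hs a b ha hb ab.
  have hh t : t \in `]a, b[%R -> 0 < t < pi.
    by rewrite in_itv/= => /andP[h1 h2]; rewrite (le_lt_trans ha h1) (lt_le_trans h2 hb).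
  have dF t : t \in `]a, b[%R -> is_derive t 1 (fun t => s * g 0 t + M1 * cos t)
      (s * g 1 t + M1 * (- sin t)).
    move=> /hh ht.
    exact: is_derive1_add (is_derive1_scale s (gd kappa_gt0 ht))
                          (is_derive1_scale M1 (is_derive_cos t)).
  have cF : {within `[a, b], continuous (fun t => s * g 0 t + M1 * cos t)}.
    apply: continuous_subspaceT => t; apply: cvgD.
      by apply: cvgM; [exact: cvg_cst|exact: gc].
    by apply: cvgM; [exact: cvg_cst|exact: continuous_cos].
  have [c /hh hcc hc] := MVT ab dF cF.
  have : (s * g 1 c + M1 * (- sin c)) * (b - a) <= 0.
    rewrite mulr_le0_ge0 ?subr_ge0 ?(ltW ab)//; have := g1 hcc; rewrite ler_norml => /andP[].
    by case: hs => ->; rewrite mulrN ?mul1r ?mulN1r; lra.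
  rewrite -hc; lra.
have absle a b : 0 <= a -> b <= pi -> a < b ->
    `|g 0 b - g 0 a| <= M1 * (cos a - cos b).
  move=> ha hb ab; have h1 := mono 1 (or_introl erefl) a b ha hb ab.
  have h2 := mono (-1) (or_intror erefl) a b ha hb ab.
  by rewrite ler_norml; apply/andP; split; lra.
have csg a b : 0 <= a -> b <= pi -> a < b -> 0 <= cos a - cos b.
  move=> a0 bp ab; rewrite subr_ge0 ltW// ltr_cos// in_itv/=.
    by rewrite a0 (le_trans (ltW ab)).
  by rewrite bp (le_trans a0 (ltW ab)).
move=> /andP[x0 xp] /andP[y0 yp]; case: (ltgtP x y) => [xy|yx|->].
- by rewrite [`|cos y - _|]distrC (ger0_norm (csg _ _ x0 yp xy)) absle.
- by rewrite distrC (ger0_norm (csg _ _ y0 xp yx)) absle.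
- by rewrite !subrr normr0 mulr0.
Qed.

(** Dividing g 0 - g 0 x by cos - cos x gives a bounded h. Multiplication by the cosine shifts
    frequencies by one in each direction, so the error of the partial sum, expressed through the
    coefficients H of h, telescopes to two boundary terms, as in the Christoffel-Darboux formula.
    These tend to 0 by Bessel's inequality. *)
Lemma fsum_cvg x : 0 < x < pi -> fsum ^~ x @ \oo --> g 0 x.
Proof.
move=> hx; have x1 := hx; move: x1 => /andP[x0 xpi].
have hx' : 0 <= x <= pi by rewrite !ltW.
have M10 : 0 <= M1.
  by rewrite -(pmulr_lge0 _ (sin_gt0_pi hx)) (le_trans _ (g1 hx)).
(* Where cos y = cos x the inverse is 0 by convention, and there [gM0] makes the numerator vanish
   too. *)
pose h y := (g 0 y - g 0 x) * (cos y - cos x)^-1.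
have bg0 : bm (g 0) by exact: bg.
have bcx : bm (fun y => cos y - cos x).
  apply: bm_cont => y; apply: cvgB; [exact: continuous_cos|exact: cvg_cst].
have hE y : 0 <= y <= pi -> g 0 y - g 0 x = h y * (cos y - cos x).
  move=> hy; have [e|ne] := eqVneq (cos y - cos x) 0.
    by rewrite e mulr0; apply/eqP; rewrite -normr_le0 (le_trans (gM0 hx' hy))// e normr0 mulr0.
  by rewrite /h -mulrA mulVf// mulr1.
have bh : bm h.
  split.
    apply: measurable_funM.
      by apply: measurable_funB; [exact: bg0.1|exact: measurable_cst].
    by apply: (measurableT_comp (@measurable_invr R)); exact: bcx.1.
  exists M1 => y hy; rewrite /h normrM normfV.
  have [e|ne] := eqVneq (cos y - cos x) 0; first by rewrite e normr0 invr0 mulr0.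
  by rewrite ler_pdivrMr ?normr_gt0// gM0.
pose H l := J (fun y => h y * cosn l y).
have bhc l : bm (fun y => h y * cosn l y) by apply: bmM => //; exact: bm_cosn.
have H0 : H @ \oo --> 0.
  have Hsq : (fun l => H l.+1 ^+ 2) @ \oo --> 0.
    apply: cvg_series_cvg_0; apply: nondecreasing_is_cvgn.
      by apply: nondecreasing_series => k _ _; exact: sqr_ge0.
    exists (pi / 2 * J (fun y => h y ^+ 2)) => _ [n _ <-].
    rewrite /series/= big_mkord; apply: bessel => //; first by move=> k; exact: bm_cosn.
    exact: J_cosn_prod.
  rewrite -(cvg_shiftS H); apply/cvgrPdist_le => e e0.
  have e2 : 0 < e ^+ 2 by rewrite exprn_gt0.
  move/cvgrPdist_le : Hsq => /(_ _ e2); apply: filterS => n /=.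
  rewrite !sub0r !normrN normrX ler_pXn2r// nnegrE//; exact: ltW.
have cos1 y : cosn 1 y = cos y by rewrite /cosn mul1r.
have cl0 y : cosn 0 y = 1 by rewrite /cosn mul0r cos0.
have id0 : J (g 0) - pi * g 0 x = H 1%N - cos x * H 0%N.
  rewrite [pi * _]mulrC -J_cst -JB//; last exact: bm_cst.
  rewrite -JZ// -JB//; last exact: bmZ.
  by apply: eq_J => y hy; rewrite hE// cl0 cos1; ring.
(* The product cos y cos((l + 1) y) splits into the frequencies l + 2 and l; the constant g 0 x is
   orthogonal to nonconstant cosines. *)
have idl l : 2 * fcoef l.+1 = H l.+2 + H l - 2 * cos x * H l.+1.
  have -> : fcoef l.+1 = J (fun y => (g 0 y - g 0 x) * cosn l.+1 y).
    rewrite (eq_J (g := fun y => g 0 y * cosn l.+1 y - g 0 x * cosn l.+1 y)); last first.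
      by move=> y _; rewrite mulrBl.
    rewrite JB; [|by apply: bmM => //; exact: bm_cosn|by apply: bmZ; exact: bm_cosn].
    by rewrite JZ ?J_cosn ?mulr0 ?subr0//; exact: bm_cosn.
  rewrite -!JZ//; last by apply: bmM; [apply: bmD => //; exact: bm_cst|exact: bm_cosn].
  rewrite -JD// -JB//; [|exact: bmD|exact: bmZ].
  apply: eq_J => y hy; rewrite hE//.
  have := @cosn_prod R 1 l.+1 y isT; rewrite cos1 addn1 subn1/= => e.
  have -> : 2 * (h y * (cos y - cos x) * cosn l.+1 y) =
    2 * h y * (cos y * cosn l.+1 y) - 2 * h y * cos x * cosn l.+1 y by ring.
  by rewrite e; field.
have tel n : pi * fsum n x - pi * g 0 x = cosn n x * H n.+1 - cosn n.+1 x * H n.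
  have fE : pi * fsum n x = J (g 0) + \sum_(0 <= l < n) (2 * fcoef l.+1) * cosn l.+1 x.
    rewrite /fsum mulrDr mulrA divff ?gt_eqF// mul1r; congr (_ + _).
    rewrite mulrA mulrCA divff ?gt_eqF// mulr1 mulr_sumr.
    by apply: eq_bigr => l _; rewrite mulrA.
  rewrite fE addrAC id0 {fE}; elim: n => [|n ih].
    by rewrite big_geq// addr0 cl0 cos1 mul1r.
  rewrite big_nat_recr//= addrA ih idl.
  have := @cosn_prod R 1 n.+1 x isT; rewrite cos1 addn1 subn1/= => e.
  have -> : cosn n x = 2 * (cos x * cosn n.+1 x) - cosn n.+2 x by rewrite e; field.
  ring.
have lim : (fun n => g 0 x + pi^-1 * (cosn n x * H n.+1 - cosn n.+1 x * H n)) @ \oo --> g 0 x.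
  rewrite -[X in _ --> X]addr0; apply: cvgD; first exact: cvg_cst.
  rewrite -[X in _ --> X](mulr0 pi^-1); apply: cvgM; first exact: cvg_cst.
  apply/cvgrPdist_le => e e0; have e2 : 0 < e / 2 by rewrite divr_gt0.
  move/cvgrPdist_le : (H0) => /(_ _ e2) h1.
  move/cvgrPdist_le : (H0); rewrite -(cvg_shiftS H) in H0.
  move/cvgrPdist_le : (H0) => /(_ _ e2) h2 _.
  move: h1 h2; apply: filterS2 => n; rewrite !sub0r !normrN => h1 h2.
  rewrite (le_trans (ler_normB _ _))// (splitr e) lerD// normrM.
    by rewrite -[leRHS]mul1r ler_pM// /cosn cos_max.
  by rewrite -[leRHS]mul1r ler_pM// /cosn cos_max.
apply: cvg_trans lim; apply: near_eq_cvg; near=> n.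
rewrite -tel -mulrBr mulrA mulVf ?gt_eqF// mul1r addrC subrK.
by [].
Unshelve. all: by end_near. Qed.

Lemma fsum_error n x : 0 < x < pi -> (0 < n)%N ->
  (g 0 x - fsum n x) ^+ 2 * n%:R ^+ (kappa.*2.-1) <= 2 * M ^+ 2.
Proof.
move=> hx n0; pose F N := (fsum N x - fsum n x) ^+ 2 * n%:R ^+ (kappa.*2.-1).
have cF : F @ \oo --> (g 0 x - fsum n x) ^+ 2 * n%:R ^+ (kappa.*2.-1).
  apply: cvgM; last exact: cvg_cst.
  rewrite expr2; under [X in X @ _]eq_fun do rewrite expr2.
  by apply: cvgM; apply: cvgB; [exact: fsum_cvg|exact: cvg_cst|exact: fsum_cvg|exact: cvg_cst].
rewrite -(cvg_lim _ cF)//; apply: limr_le; first by apply/cvg_ex; eexists; exact: cF.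
near=> N; apply: fsum_cauchy => //.
by near: N; exists n.
Unshelve. all: by end_near. Qed.

Lemma fcoef_bound l : (forall x, 0 <= x <= pi -> `|g 0 x| <= M) -> `|fcoef l| <= M * pi.
Proof.
move=> h; apply: J_bound; first by apply: bmM; [exact: bg|exact: bm_cosn].
move=> x hx; rewrite normrM -[leRHS]mulr1 ler_pM ?h//.
by rewrite /cosn cos_max.
Qed.

End fourier_series.

(** * Polynomials with controlled coefficients *)

Section coefficient_bounds.
Context {R : realType}.
Implicit Types (f : R -> R) (A B : R).

(** Powers will be replaced by heat operators, each with its own estimate, so the sum of the moduli
    of the coefficients is the relevant norm. *)
Definition poly_repr f (n : nat) A := exists c : nat -> R,
  \sum_(i < n.+1) `|c i| <= A /\ forall y, f y = \sum_(i < n.+1) c i * y ^+ i.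

Lemma poly_repr_le f n A B : A <= B -> poly_repr f n A -> poly_repr f n B.
Proof. by move=> AB [c [h1 h2]]; exists c; split=> //; exact: le_trans AB. Qed.

Lemma poly_repr_ge0 f n A : poly_repr f n A -> 0 <= A.
Proof. by move=> [c [h _]]; apply: le_trans h; exact: sumr_ge0. Qed.

Lemma poly_reprD f g n A B : poly_repr f n A -> poly_repr g n B ->
  poly_repr (fun y => f y + g y) n (A + B).
Proof.
move=> [c [c1 c2]] [d [d1 d2]]; exists (fun i => c i + d i); split.
  apply: (le_trans _ (lerD c1 d1)); rewrite -big_split/=.
  by apply: ler_sum => i _; exact: ler_normD.
by move=> y; rewrite c2 d2 -big_split/=; apply: eq_bigr => i _; rewrite mulrDl.
Qed.

Lemma poly_reprZ a f n A : poly_repr f n A -> poly_repr (fun y => a * f y) n (`|a| * A).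
Proof.
move=> [c [c1 c2]]; exists (fun i => a * c i); split.
  apply: (le_trans _ (ler_wpM2l (normr_ge0 a) c1)); rewrite mulr_sumr.
  by apply: ler_sum => i _; rewrite normrM.
by move=> y; rewrite c2 mulr_sumr; apply: eq_bigr => i _; rewrite mulrA.
Qed.

Lemma poly_repr_widen f n A : poly_repr f n A -> poly_repr f n.+1 A.
Proof.
move=> [c [c1 c2]]; exists (fun i => if (i < n.+1)%N then c i else 0); split.
  rewrite big_ord_recr/= ltnn normr0 addr0; apply: le_trans c1.
  by apply: ler_sum => i _; rewrite ltn_ord.
move=> y; rewrite c2 [RHS]big_ord_recr/= ltnn mul0r addr0.
by apply: eq_bigr => i _; rewrite ltn_ord.
Qed.

Lemma poly_repr_mulX f n A : poly_repr f n A -> poly_repr (fun y => y * f y) n.+1 A.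
Proof.
move=> [c [c1 c2]]; exists (fun i => if i is j.+1 then c j else 0); split.
  by rewrite big_ord_recl/= normr0 add0r.
move=> y; rewrite c2 [RHS]big_ord_recl/= mul0r add0r mulr_sumr.
by apply: eq_bigr => i _; rewrite exprS; ring.
Qed.

(** Chebyshev polynomials in the variable y = (1 + cos x) / 2. Their recurrence is T(l + 2) = (4 y -
    2) T(l + 1) - T(l), and the coefficient sums grow at most by the factor 7 because 4 * 7 + 2 * 7
    + 1 <= 49. *)
Lemma cosn_poly l : exists2 f, poly_repr f l (7 ^+ l) &
  forall x, cosn l x = f ((1 + cos x) / 2).
Proof.
suff : (exists2 f, poly_repr f l (7 ^+ l) & forall x, cosn l x = f ((1 + cos x) / 2)) /\
    (exists2 f, poly_repr f l.+1 (7 ^+ l.+1) & forall x, cosn l.+1 x = f ((1 + cos x) / 2)).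
  by case.
elim: l => [|l [ih1 ih2]].
  split.
    exists (fun=> 1); last by move=> x; rewrite /cosn mul0r cos0.
    exists (fun=> 1); split; first by rewrite big_ord1 normr1 expr0.
    by move=> y; rewrite big_ord1 expr0 mulr1.
  exists (fun y => 2 * y - 1); last by move=> x; rewrite /cosn mul1r; field.
  exists (fun i => if i is 0%N then -1 else 2); split.
    by rewrite !big_ord_recr big_ord0/= add0r normrN normr1 ger0_norm// expr1; lra.
  by move=> y; rewrite !big_ord_recr big_ord0/= expr0 expr1; ring.
split=> //; move: ih1 ih2 => [f rf hf] [h rh hh].
exists (fun y => 4 * (y * h y) + (-2 * h y + -1 * f y)).
  apply: (@poly_repr_le _ _ (`|4| * 7 ^+ l.+1 + (`|-2| * 7 ^+ l.+1 + `|-1| * 7 ^+ l))).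
    rewrite !normrN normr1 !ger0_norm// !exprS.
    have : 0 <= 7 ^+ l :> R by rewrite exprn_ge0.
    lra.
  apply: poly_reprD; first by apply: poly_reprZ; exact: poly_repr_mulX.
  apply: poly_reprD; apply: poly_reprZ; first exact: poly_repr_widen.
  by apply: poly_repr_widen; exact: poly_repr_widen.
move=> x; rewrite -hf -hh.
have := @cosn_prod R 1 l.+1 x isT; rewrite addn1 subn1/= {1}/cosn mul1r => e.
have -> : cosn l.+2 x = 2 * (cos x * cosn l.+1 x) - cosn l x by rewrite e; field.
by field.
Qed.

Variables (kappa : nat) (g : nat -> R -> R) (M M1 : R).
Hypothesis kappa_gt0 : (0 < kappa)%N.
Hypothesis gc : forall j, (j <= kappa)%N -> continuous (g j).
Hypothesis gd : forall j x, (j < kappa)%N -> 0 < x < pi -> is_derive x 1 (g j) (g j.+1 x).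
Hypothesis g0 : forall j, (j <= kappa)%N -> g j 0 = 0.
Hypothesis gpi : forall j, (j <= kappa)%N -> g j pi = 0.
Hypothesis gM : forall x, 0 <= x <= pi -> `|g kappa x| <= M.
Hypothesis g0M : forall x, 0 <= x <= pi -> `|g 0 x| <= M.
Hypothesis g1 : forall x, 0 < x < pi -> `|g 1 x| <= M1 * sin x.

(** The truncated cosine series read as a polynomial in (1 + cos x) / 2: each of its n + 1
    coefficients is at most 2 M, and each Chebyshev polynomial has coefficient sum at most 7^n. *)
Lemma fourier_poly n : (0 < n)%N -> exists2 f, poly_repr f n (2 * M * n.+1%:R * 7 ^+ n) &
  forall x, 0 < x < pi ->
    (g 0 x - f ((1 + cos x) / 2)) ^+ 2 * n%:R ^+ (kappa.*2.-1) <= 2 * M ^+ 2.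
Proof.
move=> n0; have p0 := pi_gt0 R.
have M0 : 0 <= M by apply: le_trans (g0M (x := 0) _); rewrite ?normr_ge0// lexx ltW.
have [f rf hf] : exists2 f, poly_repr f n (2 * M * n.+1%:R * 7 ^+ n) &
    forall x, fsum g n x = f ((1 + cos x) / 2); last first.
  exists f => // x hx; rewrite -hf.
  exact: (fsum_error kappa_gt0 gc gd g0 gpi gM g1).
have fb l : `|fcoef g l| <= M * pi by apply: (fcoef_bound gc).
elim: n {n0} => [|n [f rf hf]].
  exists (fun=> pi^-1 * J (g 0)).
    exists (fun=> pi^-1 * J (g 0)); split; last by move=> y; rewrite big_ord1 mulr1.
    rewrite big_ord1 expr0 !mulr1 normrM (@ger0_norm _ pi^-1) ?invr_ge0 ?(ltW p0)//.
    have : `|J (g 0)| <= M * pi by apply: J_bound => //; apply: bm_cont; exact: gc.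
    move=> h1; rewrite ler_pdivrMl// mulrC (le_trans h1)//.
    by rewrite ler_wpM2r ?(ltW p0)//; lra.
  by move=> x; rewrite /fsum big_geq// mulr0 addr0.
have [h rh hh] := cosn_poly n.+1.
exists (fun y => f y + (2 / pi * fcoef g n.+1) * h y); last first.
  by move=> x; rewrite -hf -hh /fsum big_nat_recr//= mulrDr addrA mulrA.
apply: (@poly_repr_le _ _ (2 * M * n.+1%:R * 7 ^+ n + `|2 / pi * fcoef g n.+1| * 7 ^+ n.+1)); last first.
  by apply: poly_reprD; [exact: poly_repr_widen|exact: poly_reprZ].
have h1 : `|2 / pi * fcoef g n.+1| <= 2 * M.
  rewrite normrM ger0_norm ?divr_ge0 ?(ltW p0)//.
  apply: (@le_trans _ _ (2 / pi * (M * pi))).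
    by rewrite ler_wpM2l ?divr_ge0 ?(ltW p0).
  have aux (p : R) : p != 0 -> 2 / p * (M * p) = 2 * M by move=> pn; field.
  by rewrite aux// gt_eqF.
rewrite -[n.+2%:R]natr1 mulrDr mulr1 mulrDl lerD//; last by rewrite ler_wpM2r ?exprn_ge0.
by rewrite ler_wpM2l ?mulr_ge0// exprS ler_peMl ?exprn_ge0//; lra.
Qed.

End coefficient_bounds.

(** * Mikhlin symbol classes *)

Section symbol_classes.
Context {R : realType}.
Implicit Types (F G om : R -> R) (k : nat).

Lemma is_derive_continuous F (x a : R) : is_derive x 1 F a -> {for x, continuous F}.
Proof. by move=> [dF _]; apply: differentiable_continuous; exact/derivable1_diffP. Qed.

(* [F] and its first [k] derivatives with respect to [w d/dx] are bounded by
   [om] on [D]; [w x = x] gives Mikhlin conditions. *)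
Fixpoint Sym (D : pred R) (w : R -> R) k om F : Prop :=
  (forall x, D x -> `|F x| <= om x) /\
  if k is k'.+1 then
    exists2 G, forall x : R, D x -> is_derive x 1 F (G x / w x) & Sym D w k' om G
  else forall x, D x -> {for x, continuous F}.

Section sym_theory.
Variables (D : pred R) (w : R -> R).
Local Notation Sym := (Sym D w).

Lemma Sym_bd k om F : Sym k om F -> forall x, D x -> `|F x| <= om x.
Proof. by case: k => [|k] []. Qed.

Lemma Sym_cont k om F : Sym k om F -> forall x, D x -> {for x, continuous F}.
Proof.
case: k => [|k] [_] //; case=> G h _ x /h; exact: is_derive_continuous.
Qed.

Lemma Sym_le k om om' F : (forall x, D x -> om x <= om' x) -> Sym k om F -> Sym k om' F.
Proof.
elim: k F => [|k ih] F h [b c]; split=> //; try by move=> x Dx; rewrite (le_trans (b x Dx))// h.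
by case: c => G dG sG; exists G => //; exact: ih.
Qed.

Lemma Sym_S k om F : Sym k.+1 om F -> Sym k om F.
Proof.
elim: k F => [|k ih] F [b [G dG sG]]; split=> //.
  by move=> x /dG; exact: is_derive_continuous.
by exists G => //; exact: ih.
Qed.

Lemma SymD k om om' F G : Sym k om F -> Sym k om' G ->
  Sym k (fun x => om x + om' x) (fun x => F x + G x).
Proof.
elim: k F G => [|k ih] F G [b c] [b' c']; split.
- by move=> x Dx; rewrite (le_trans (ler_normD _ _))// lerD ?b ?b'.
- by move=> x Dx; apply: cvgD; [exact: c|exact: c'].
- by move=> x Dx; rewrite (le_trans (ler_normD _ _))// lerD ?b ?b'.
- case: c => F1 d1 s1; case: c' => G1 d2 s2; exists (fun x => F1 x + G1 x); last exact: ih.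
  by move=> x Dx; rewrite mulrDl; apply: is_derive1_add; [exact: d1|exact: d2].
Qed.

Lemma SymZ k om c F : Sym k om F -> Sym k (fun x => `|c| * om x) (fun x => c * F x).
Proof.
elim: k F => [|k ih] F [b d]; split.
- by move=> x Dx; rewrite normrM ler_wpM2l ?b.
- by move=> x Dx; apply: cvgM; [exact: cvg_cst|exact: d].
- by move=> x Dx; rewrite normrM ler_wpM2l ?b.
- case: d => F1 d1 s1; exists (fun x => c * F1 x); last exact: ih.
  by move=> x Dx; rewrite -mulrA; apply: is_derive1_scale; exact: d1.
Qed.

(** By the Leibniz rule each derivative splits a product into two, hence 2^k. *)
Lemma SymM k om om' F G : Sym k om F -> Sym k om' G ->
  Sym k (fun x => 2 ^+ k * (om x * om' x)) (fun x => F x * G x).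
Proof.
elim: k F G => [|k ih] F G [b c] [b' c']; split.
- by move=> x Dx; rewrite expr0 mul1r normrM ler_pM ?b ?b'.
- by move=> x Dx; apply: cvgM; [exact: c|exact: c'].
- move=> x Dx; rewrite normrM (le_trans (ler_pM _ _ (b _ Dx) (b' _ Dx)))//.
  rewrite ler_peMl ?exprn_ege1 ?ler1n// mulr_ge0//.
    by rewrite (le_trans _ (b _ Dx)).
  by rewrite (le_trans _ (b' _ Dx)).
- have sF : Sym k om F by apply: Sym_S; split.
  have sG : Sym k om' G by apply: Sym_S; split.
  case: c => F1 d1 s1; case: c' => G1 d2 s2.
  exists (fun x => F1 x * G x + F x * G1 x).
    move=> x Dx; apply: (is_derive_eq (is_derive1_mul (d1 x Dx) (d2 x Dx))).
    by ring.
  apply: Sym_le (SymD (ih _ _ s1 sG) (ih _ _ sF s2)) => x Dx.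
  by rewrite exprS; lra.
Qed.

Lemma Sym_cst k c : Sym k (fun=> `|c|) (fun=> c).
Proof.
elim: k c => [|k ih] c; split=> //; first by move=> x _; exact: cvg_cst.
exists (fun=> 0); first by move=> x _; rewrite mul0r; exact: is_derive_cst.
by apply: Sym_le (ih 0) => x _; rewrite normr0.
Qed.

Definition Symc k F := exists2 C : R, 0 <= C & Sym k (fun=> C) F.

Lemma Symc_cst k c : Symc k (fun=> c).
Proof. by exists `|c| => //; exact: Sym_cst. Qed.

Lemma SymcD k F G : Symc k F -> Symc k G -> Symc k (fun x => F x + G x).
Proof. by move=> [A A0 sF] [B B0 sG]; exists (A + B); [exact: addr_ge0|exact: SymD sF sG]. Qed.

Lemma SymcM k F G : Symc k F -> Symc k G -> Symc k (fun x => F x * G x).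
Proof.
move=> [A A0 sF] [B B0 sG]; exists (2 ^+ k * (A * B)); last exact: SymM sF sG.
by rewrite !mulr_ge0// exprn_ge0.
Qed.

Lemma SymcX k F n : Symc k F -> Symc k (fun x => F x ^+ n).
Proof.
move=> sF; elim: n => [|n ih]; first exact: Symc_cst.
have -> : (fun x => F x ^+ n.+1) = (fun x => F x * F x ^+ n).
  by apply/funext => x; rewrite exprS.
exact: SymcM.
Qed.

Lemma Symc_poly k F q n A : Symc k F -> poly_repr q n A -> Symc k (fun x => q (F x)).
Proof.
move=> sF [c [_ hc]]; rewrite (_ : (fun x => _) = fun x => \sum_(i < n.+1) c i * F x ^+ i); last first.
  by apply/funext => x; rewrite hc.
elim: n {hc} => [|n ih].
  rewrite (_ : (fun x => _) = fun=> c 0%N); first exact: Symc_cst.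
  by apply/funext => x; rewrite big_ord1 mulr1.
rewrite (_ : (fun x => _) = fun x => \sum_(i < n.+1) c i * F x ^+ i + c n.+1 * F x ^+ n.+1).
  by apply: SymcD => //; apply: SymcM; [exact: Symc_cst|exact: SymcX].
by apply/funext => x; rewrite big_ord_recr.
Qed.

(** The constant is fixed before [om] and F, since later estimates must be uniform over all symbols
    and scales. *)
Lemma Symc_mul k G : Symc k G -> exists2 C : R, 0 <= C & forall om F,
  Sym k om F -> Sym k (fun x => C * om x) (fun x => G x * F x).
Proof.
move=> [A A0 sG]; exists (2 ^+ k * A); first by rewrite mulr_ge0 ?exprn_ge0.
by move=> om F sF; apply: Sym_le (SymM sG sF) => x _; rewrite mulrA.
Qed.

End sym_theory.

Definition pos : pred R := fun x => 0 < x.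
Local Notation Syml := (Sym pos id).

(** The operator x d/dx commutes with dilations; this is the source of all uniformity in t. *)
Lemma Syml_scale k om F (c : R) : 0 < c -> Syml k om F ->
  Syml k (fun x => om (c * x)) (fun x => F (c * x)).
Proof.
move=> c0; elim: k F => [|k ih] F [b h]; split.
- by move=> x x0; apply: b; exact: mulr_gt0.
- move=> x x0; apply: (@continuous_comp _ _ _ (fun x => c * x) F).
    by apply: cvgM; [exact: cvg_cst|exact: cvg_id].
  by apply: h; exact: mulr_gt0.
- by move=> x x0; apply: b; exact: mulr_gt0.
- case: h => G dG sG; exists (fun x => G (c * x)); last exact: ih.
  move=> x x0; have cx : 0 < c * x by exact: mulr_gt0.
  have dl : is_derive x 1 (fun y => c * y) c.
    by have := is_derive1_scale c (is_derive_id x 1); rewrite mulr1.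
  have h := is_derive1_comp (dG _ cx) dl.
  apply: (is_derive_eq h); rewrite /id /GRing.scale/=; field.
  by rewrite !gt_eqF.
Qed.

Lemma is_derive1_exp F (x a : R) (n : nat) : is_derive x 1 F a ->
  is_derive x 1 (fun y => F y ^+ n) (n%:R * F x ^+ n.-1 * a).
Proof.
move=> dF; elim: n => [|n ih].
  by rewrite !mul0r; under eq_fun do rewrite expr0; exact: is_derive_cst.
under eq_fun do rewrite exprS.
apply: (is_derive_eq (is_derive1_mul dF ih)).
by case: n {ih} => [|n]; rewrite -?[n.+2%:R]natr1 /= ?exprS; ring.
Qed.

Lemma is_derive_sqr (x : R) : is_derive x 1 (fun y : R => y ^+ 2) (2 * x).
Proof.
have := is_derive1_mul (is_derive_id x 1) (is_derive_id x 1) => h.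
by apply: (is_derive_eq h); rewrite /id/=; ring.
Qed.

Lemma is_derive_gauss (x : R) : is_derive x 1 (fun y : R => expR (- y ^+ 2))
  (- (2 * x) * expR (- x ^+ 2)).
Proof.
have h := @is_derive1_comp R expR (fun y => - y ^+ 2) x _ _ (is_derive_expR _) (is_deriveN (is_derive_sqr x)).
by apply: (is_derive_eq h); rewrite mulrC.
Qed.

Lemma expR_ge_pow (n : nat) (x : R) : 0 <= x -> x ^+ n <= n%:R ^+ n * expR x.
Proof.
move=> x0; case: n => [|n]; first by rewrite !expr0 mul1r -expR0 ler_expR.
have n0 : 0 < n.+1%:R :> R by rewrite ltr0n.
have -> : expR x = expR (x / n.+1%:R) ^+ n.+1.
  by rewrite -expRM_natl mulrC divfK// gt_eqF.
rewrite -exprMn ler_pXn2r ?nnegrE ?mulr_ge0 ?expR_ge0//.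
by rewrite mulrC -ler_pdivrMr//; apply: le_trans (expR_ge1Dx _); rewrite lerDr.
Qed.

(** Together these span a family closed under x d/dx, which is why [gaussm_sym] is proved for all i
    at once. *)
Definition gaussm (i : nat) (x : R) := x ^+ i.*2 * expR (- x ^+ 2).

Lemma gaussm_bd i (x : R) : 0 < x -> `|gaussm i x| <= i%:R ^+ i.
Proof.
move=> x0; rewrite /gaussm ger0_norm ?mulr_ge0 ?exprn_ge0 ?expR_ge0 ?(ltW x0)//.
rewrite expRN ler_pdivrMr ?expR_gt0// -mul2n exprM.
by rewrite expr2 -expr2; apply: expR_ge_pow; exact: sqr_ge0.
Qed.

Lemma gaussm_derive i (x : R) : 0 < x ->
  is_derive x 1 (gaussm i) (((i.*2)%:R * gaussm i x - 2 * gaussm i.+1 x) / x).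
Proof.
move=> x0; have hX : is_derive x 1 (fun y : R => y ^+ i.*2) ((i.*2)%:R * x ^+ i.*2 / x).
  apply: (is_derive_eq (is_derive1_exp i.*2 (is_derive_id x 1))).
  case: i => [|i]; first by rewrite !mul0r.
  by rewrite doubleS/= mulr1 [in RHS]exprS; field; rewrite gt_eqF.
apply: (is_derive_eq (is_derive1_mul hX (is_derive_gauss x))).
rewrite /gaussm doubleS !exprS; field; by rewrite gt_eqF.
Qed.

Lemma gaussm_sym k i : Symc pos id k (gaussm i).
Proof.
elim: k i => [|k ih] i.
  exists (i%:R ^+ i); first exact: exprn_ge0.
  split; first by move=> x x0; exact: gaussm_bd.
  by move=> x x0; apply: is_derive_continuous (gaussm_derive i x0).
have [C C0 sC] := SymcD (SymcM (Symc_cst _ _ k (i.*2)%:R) (ih i))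
  (SymcM (Symc_cst _ _ k (-2)) (ih i.+1)).
exists (i%:R ^+ i + C); first by rewrite addr_ge0// exprn_ge0.
split; first by move=> x x0; rewrite (le_trans (gaussm_bd _ x0))// lerDl.
exists (fun x => (i.*2)%:R * gaussm i x + -2 * gaussm i.+1 x).
  by move=> x x0; apply: (is_derive_eq (gaussm_derive i x0)); rewrite mulNr.
by apply: Sym_le sC => x _; rewrite lerDr exprn_ge0.
Qed.

(** The factor that relates x d/dx to the angular derivative: see [radial_derive]. *)
Definition ang (x : R) := (1 - expR (- x ^+ 2)) / x ^+ 2.

Lemma ang_bd (x : R) : 0 < x -> `|ang x| <= 1.
Proof.
move=> x0; have x2 : 0 < x ^+ 2 by rewrite exprn_gt0.
have e1 : expR (- x ^+ 2) <= 1 by rewrite -expR0 ler_expR oppr_le0 ltW.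
rewrite /ang ger0_norm ?divr_ge0 ?subr_ge0 ?(ltW x2)//.
by rewrite ler_pdivrMr// mul1r; have := expR_ge1Dx (- x ^+ 2); lra.
Qed.

Lemma ang_derive (x : R) : 0 < x -> is_derive x 1 ang ((2 * gaussm 0 x - 2 * ang x) / x).
Proof.
move=> x0; have x2 : x ^+ 2 != 0 by rewrite expf_neq0// gt_eqF.
have h1 : is_derive x 1 (fun y => 1 + - expR (- y ^+ 2)) (0 + - (- (2 * x) * expR (- x ^+ 2))).
  by apply: is_derive1_add (is_deriveN (is_derive_gauss x)); exact: is_derive_cst.
have h2 := @is_deriveV R (fun y => y ^+ 2) x _ 1 x2 (is_derive_sqr x).
apply: (is_derive_eq (is_derive1_mul h1 h2)).
rewrite /gaussm /ang /GRing.scale/= expr0 mul1r; field; by rewrite gt_eqF.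
Qed.

Lemma ang_sym k : Symc pos id k ang.
Proof.
elim: k => [|k ih].
  exists 1 => //; split; first by move=> x; exact: ang_bd.
  by move=> x x0; apply: is_derive_continuous (ang_derive x0).
have [C C0 sC] := SymcD (SymcM (Symc_cst _ _ k 2) (gaussm_sym k 0))
  (SymcM (Symc_cst _ _ k (-2)) ih).
exists (1 + C); first by rewrite addr_ge0.
split; first by move=> x x0; rewrite (le_trans (ang_bd x0))// lerDl.
exists (fun x => 2 * gaussm 0 x + -2 * ang x).
  by move=> x x0; apply: (is_derive_eq (ang_derive x0)); rewrite mulNr.
by apply: Sym_le sC => x _; rewrite lerDr.
Qed.

End symbol_classes.

(** * The angle x defined by exp(-l^2) = (1 + cos x) / 2 *)

Section angular_variable.
Context {R : realType}.
Implicit Types (F G om : R -> R) (k : nat).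

Definition opi : pred R := fun x => 0 < x < pi.
Local Notation Syms := (Sym opi sin).
Local Notation Syml := (Sym pos id).

Definition yvar (x : R) := (1 + cos x) / 2.

Lemma opi_sin (x : R) : opi x -> 0 < sin x.
Proof. exact: sin_gt0_pi. Qed.

Lemma sin_sqr_yvar (x : R) : sin x ^+ 2 = 4 * (yvar x * (1 - yvar x)).
Proof. by rewrite sin2cos2 /yvar; field. Qed.

Lemma yvar_itv (x : R) : opi x -> 0 < yvar x < 1.
Proof.
move=> px; have h : 0 < sin x ^+ 2 by rewrite exprn_gt0// opi_sin.
have c1 := cos_le1 x; have c2 := cos_geN1 x.
have [c3 c4] : cos x != 1 /\ cos x != -1.
  by split; apply: contraTneq h => e; rewrite sin2cos2 e ?sqrrN expr1n subrr ltxx.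
have c5 : cos x < 1 by rewrite lt_neqAle c3.
have c6 : -1 < cos x by rewrite lt_neqAle eq_sym c4.
by rewrite /yvar; apply/andP; split; lra.
Qed.

(** The variable l recovered from the angle. *)
Definition radial (x : R) := Num.sqrt (- ln (yvar x)).

Lemma radial_gt0 (x : R) : opi x -> 0 < radial x.
Proof.
by move=> /yvar_itv /andP[y0 y1]; rewrite sqrtr_gt0 oppr_gt0 ln_lt0// y0 y1.
Qed.

Lemma expR_radial (x : R) : opi x -> expR (- radial x ^+ 2) = yvar x.
Proof.
move=> /yvar_itv /andP[y0 y1]; rewrite /radial sqr_sqrtr; last first.
  by rewrite oppr_ge0 ln_le0// ltW.
by rewrite opprK lnK.
Qed.

(** As sin^2 x = 4 y (1 - y) with y = exp(-l^2), the operator sin x d/dx equals [ang] l times l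
    d/dl. Mikhlin symbols in l thus become symbols for sin x d/dx on the open interval (0, pi). *)
Lemma radial_derive (x : R) : opi x ->
  is_derive x 1 radial (radial x * ang (radial x) / sin x).
Proof.
move=> px; have s0 := opi_sin px; have l0 := radial_gt0 px.
have /andP[y0 y1] := yvar_itv px.
have dy : is_derive x 1 yvar (- sin x / 2).
  have h := is_derive1_add (is_derive_cst (1 : R) x 1) (is_derive_cos x).
  have := is_derive1_scale (2^-1) h; rewrite add0r => h'.
  rewrite (_ : yvar = fun y => 2^-1 * (1 + cos y)); last by apply/funext => y; rewrite mulrC.
  by apply: (is_derive_eq h'); rewrite mulrC.
have dln := is_deriveN (is_derive1_comp (is_derive1_ln y0) dy).
have g0 : 0 < - ln (yvar x) by rewrite oppr_gt0 ln_lt0// y0 y1.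
have dsq := @is_derive1_comp R Num.sqrt (- (@ln R \o yvar)) x _ _ (is_derive1_sqrt g0) dln.
apply: (is_derive_eq dsq).
rewrite -/(radial x) /ang expR_radial//.
have := sin_sqr_yvar x; move: (sin x) (radial x) (yvar x) s0 l0 y0 => s l y s0 l0 y0 e.
apply: (mulfI (lt0r_neq0 s0)).
transitivity (s ^+ 2 / (4 * y * l)); first by field; rewrite !gt_eqF.
by rewrite e; field; rewrite !gt_eqF.
Qed.

(** Each derivative brings out a factor [ang], itself a bounded symbol by [ang_sym], which the
    product rule absorbs into the constant. *)
Lemma Sym_radial k : exists2 C : R, 0 <= C & forall om F,
  Syml k om F -> Syms k (fun x => C * om (radial x)) (fun x => F (radial x)).
Proof.
elim: k => [|k [C C0 ih]].
  exists 1 => // om F [b c]; split.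
    by move=> x px; rewrite mul1r; apply: b; exact: radial_gt0.
  move=> x px; apply: (@continuous_comp _ _ _ radial F).
    exact: is_derive_continuous (radial_derive px).
  by apply: c; exact: radial_gt0.
have [A A0 hA] := Symc_mul (ang_sym (R := R) k).
exists (1 + C * A); first by rewrite addr_ge0// mulr_ge0.
move=> om F [b [G dG sG]]; split.
  move=> x px; have := b _ (radial_gt0 px) => h; apply: (le_trans h).
  rewrite mulrDl mul1r lerDl !mulr_ge0//.
  exact: le_trans h.
exists (fun x => ang (radial x) * G (radial x)).
  move=> x px; have l0 := radial_gt0 px.
  apply: (is_derive_eq (is_derive1_comp (dG _ l0) (radial_derive px))).
  rewrite /id/=; field.
  by rewrite !gt_eqF// opi_sin.
apply: Sym_le (ih _ _ (hA _ _ sG)) => x px.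
rewrite mulrDl mulrA ler_wpDl//.
by rewrite mul1r (le_trans _ (b _ (radial_gt0 px))).

Qed.

Lemma Symc_sin_cos k : Symc opi sin k (@sin R) /\ Symc opi sin k (@cos R).
Proof.
have bs (x : R) : `|sin x| <= 1 by rewrite ler_norml sin_geN1 sin_le1.
have bc (x : R) : `|cos x| <= 1 by rewrite ler_norml cos_geN1 cos_le1.
elim: k => [|k [ihs ihc]].
  split; exists 1 => //; split=> // x _.
    exact: continuous_sin.
  exact: continuous_cos.
split.
  have [C C0 sC] := SymcM ihs ihc; exists (1 + C); first by rewrite addr_ge0.
  split; first by move=> x px; rewrite (le_trans (bs x))// lerDl.
  exists (fun x => sin x * cos x).
    move=> x px; apply: (is_derive_eq (is_derive_sin x)); field.
    by rewrite gt_eqF// opi_sin.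
  by apply: Sym_le sC => x _; rewrite lerDr.
have [C C0 sC] := SymcM (Symc_cst _ _ k (-1)) (SymcM ihs ihs).
exists (1 + C); first by rewrite addr_ge0.
split; first by move=> x px; rewrite (le_trans (bc x))// lerDl.
exists (fun x => -1 * (sin x * sin x)).
  move=> x px; apply: (is_derive_eq (is_derive_cos x)); field.
  by rewrite gt_eqF// opi_sin.
by apply: Sym_le sC => x _; rewrite lerDr.
Qed.

Lemma Symc_yvar k : Symc opi sin k yvar.
Proof.
rewrite (_ : yvar = fun x => 2^-1 + 2^-1 * cos x); last first.
  by apply/funext => x; rewrite /yvar mulrC mulrDr mulr1.
apply: SymcD; first exact: Symc_cst.
by apply: SymcM; [exact: Symc_cst|exact: (Symc_sin_cos k).2].
Qed.

(* Each derivative costs one power of [sin], so that [sin^(r+k) G] keeps a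
   factor [sin^r] in all of its first [k] derivatives. *)
Lemma derivative_family r k : exists2 C : R, 0 <= C & forall om G,
  Syms k om G -> exists g : nat -> R -> R,
  [/\ g 0%N = (fun x => sin x ^+ (r + k) * G x),
      forall j x, (j <= k)%N -> opi x -> `|g j x| <= C * (sin x ^+ r * om x),
      forall j x, (j <= k)%N -> opi x -> {for x, continuous (g j)} &
      forall j x, (j < k)%N -> opi x -> is_derive x 1 (g j) (g j.+1 x)].
Proof.
elim: k => [|k [C C0 ih]].
  exists 1 => // om G [b c]; exists (fun _ x => sin x ^+ (r + 0) * G x); split=> //.
    move=> _ x _ px; rewrite addn0 mul1r normrM ger0_norm ?exprn_ge0 ?(ltW (opi_sin px))//.
    by rewrite ler_wpM2l ?exprn_ge0 ?(ltW (opi_sin px))// b.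
  move=> j x _ px; apply: cvgM; last exact: c.
  exact: is_derive_continuous (is_derive1_exp _ (is_derive_sin x)).
have [A A0 sA] := Symc_mul (SymcM (Symc_cst opi sin k (r + k.+1)%:R) (Symc_sin_cos k).2).
exists (1 + C * (1 + A)); first by rewrite addr_ge0// mulr_ge0// addr_ge0.
move=> om G sG; have sG1 := Sym_S sG; case: (sG) => b [G1 dG1 sG'].
have [g [ge gb gc gd]] := ih _ _ (SymD sG' (sA _ _ sG1)).
exists (fun j => if j is j'.+1 then g j' else (fun x => sin x ^+ (r + k.+1) * G x)).
have om0 x : opi x -> 0 <= om x by move=> /b; exact: le_trans.
split=> //.
- move=> [|j] x jk px.
  + rewrite normrM (ger0_norm (exprn_ge0 _ (ltW (opi_sin px)))).
    have s0 := ltW (opi_sin px).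
    apply: (@le_trans _ _ (sin x ^+ r * om x)); last first.
      by rewrite ler_peMl ?mulr_ge0 ?exprn_ge0 ?om0// lerDl mulr_ge0// addr_ge0.
    apply: ler_pM => //; [exact: exprn_ge0| |exact: b].
    by rewrite exprD ler_piMr ?exprn_ge0// exprn_ile1// sin_le1.
  + apply: (le_trans (gb _ _ jk px)).
    have h : 0 <= sin x ^+ r * om x by rewrite mulr_ge0 ?om0// exprn_ge0// ltW// opi_sin.
    by rewrite mulrDl (_ : C * _ = C * (1 + A) * (sin x ^+ r * om x)) ?lerDr ?mul1r//; ring.
- move=> [|j] x jk px; last exact: gc.
  apply: cvgM; last exact: Sym_cont sG _ px.
  exact: is_derive_continuous (is_derive1_exp _ (is_derive_sin x)).
- move=> [|j] x jk px; last exact: gd.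
  have h := is_derive1_mul (is_derive1_exp (r + k.+1) (is_derive_sin x)) (dG1 _ px).
  apply: (is_derive_eq h); rewrite ge addnS/= exprS; field.
  by rewrite gt_eqF// opi_sin.
Qed.

Lemma sin_le_id (y : R) : 0 <= y -> sin y <= y.
Proof.
rewrite le_eqVlt => /predU1P[<-|y0]; first by rewrite sin0.
have [c _ e] := @MVT R sin cos 0 y y0 (fun x _ => is_derive_sin x)
  (continuous_subspaceT (@continuous_sin R)).
by move: e; rewrite sin0 !subr0 => ->; rewrite ler_piMl ?cos_le1 ?(ltW y0).
Qed.

Definition zext F (x : R) := if opi x then F x else 0.

Lemma zext_near F (x : R) : opi x -> \near x, F x = zext F x.
Proof.
move=> px; near=> y; rewrite /zext ifT//; apply/andP; split; near: y.
  by apply: lt_nbhsr; case/andP: px.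
by apply: lt_nbhsl; case/andP: px.
Unshelve. all: by end_near. Qed.

Lemma zext_derive F (x a : R) : opi x -> is_derive x 1 F a -> is_derive x 1 (zext F) a.
Proof. by move=> px; apply: near_eq_is_derive; exact: zext_near. Qed.

(** The bound by a multiple of the sine forces the limit 0 at both endpoints. *)
Lemma zext_continuous F K : (forall x, opi x -> {for x, continuous F}) ->
  (forall x, opi x -> `|F x| <= K * sin x) -> continuous (zext F).
Proof.
move=> cF bF x; have [px|npx] := boolP (opi x).
  rewrite /continuous_at /zext px; apply: cvg_trans (cF _ px).
  by apply: near_eq_cvg; exact: zext_near.
have K0 : 0 <= K.
  have pp : opi (pi / 2).
    by rewrite /opi; have := pi_gt0 R; move: (pi : R) => p p0; apply/andP; split; lra.
  by have := le_trans (normr_ge0 _) (bF _ pp); rewrite sin_pihalf mulr1.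
have h y : `|zext F y| <= K * `|y - x|.
  rewrite /zext; case: ifPn => [py|_]; last by rewrite normr0 mulr_ge0.
  apply: (le_trans (bF _ py)); rewrite ler_wpM2l//.
  move: npx; rewrite /opi negb_and -!leNgt => /orP[x0|xp].
    have /andP[y0 _] := py; apply: (le_trans (sin_le_id (ltW y0))).
    by rewrite ger0_norm; lra.
  have /andP[_ yp] := py.
  have -> : sin y = sin (pi - y) by rewrite sinB sinpi cospi mul0r sub0r mulN1r opprK.
  apply: (@le_trans _ _ (pi - y)); first by apply: sin_le_id; rewrite subr_ge0 ltW.
  by rewrite distrC ler_normr lerD2r xp.
have zx : zext F x = 0 by rewrite /zext (negbTE npx).
rewrite /continuous_at zx; apply/cvgr0Pnorm_le => e e0.
near=> y; apply: (le_trans (h y)).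
apply: (@le_trans _ _ ((K + 1) * `|y - x|)); first by rewrite ler_wpM2r ?lerDl.
rewrite mulrC -ler_pdivlMr ?ltr_wpDl// distrC.
near: y; apply: cvgr_dist_le; last by rewrite divr_gt0// ltr_wpDl.
exact: cvg_id.
Unshelve. all: by end_near. Qed.

Lemma expR_half_sqr (l : R) : expR (- l ^+ 2) = expR (- (l ^+ 2 / 2)) ^+ 2.
Proof. by rewrite -expRM_natl; congr expR; field. Qed.

(** In the angle, (Y (1 - Y))^(kappa + 1) is a multiple of sin^(2 kappa + 2). Taking kappa
    derivatives costs sin^kappa and leaves sin^(kappa + 2). Two of these powers absorb [om], because
    sin^2 <= 4 exp(-l^2), and at least one more remains, so that all derivatives vanish at 0 and pi
    as the cosine series requires and the first is bounded by a multiple of the sine. *)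
Lemma symbol_poly kappa q nq Aq : (0 < kappa)%N -> poly_repr q nq Aq ->
  exists2 C : R, 0 <= C & forall om F M, Syml kappa om F ->
    (forall l, 0 < l -> om l * expR (- (l ^+ 2 / 2)) <= M) ->
    forall n, (0 < n)%N -> exists2 f, poly_repr f n (C * M * n.+1%:R * 7 ^+ n) &
    forall l : R, 0 < l ->
      let Y := expR (- l ^+ 2) in
      (F l * (Y * (1 - Y)) ^+ kappa.+1 * q Y - f Y) ^+ 2 * n%:R ^+ kappa.*2.-1 <= C * M ^+ 2.
Proof.
move=> kappa0 qp.
have [C1 C10 h1] := Sym_radial kappa.
have [C2 C20 h2] := Symc_mul (SymcM (Symc_cst opi sin kappa (4^-1 ^+ kappa.+1))
  (Symc_poly (Symc_yvar kappa) qp)).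
have [C3 C30 h3] := derivative_family kappa.+2 kappa.
pose K := C3 * (C2 * C1) * 4.
have K0 : 0 <= K by rewrite !mulr_ge0.
exists (2 * K + 2 * K ^+ 2); first by rewrite addr_ge0 ?mulr_ge0// sqr_ge0.
move=> om F M sF hM n n0.
have [g [ge gb gc gd]] := h3 _ _ (h2 _ _ (h1 _ _ sF)).
have om0 l : 0 < l -> 0 <= om l by move=> /(Sym_bd sF); exact: le_trans.
have M0 : 0 <= M by rewrite (le_trans _ (hM 1 ltr01))// mulr_ge0 ?expR_ge0 ?om0.
have gK j x : (j <= kappa)%N -> opi x -> `|g j x| <= K * M * sin x.
  move=> jk px; apply: (le_trans (gb _ _ jk px)).
  have s0 := opi_sin px; have /andP[y0 y1] := yvar_itv px.
  have l0 := radial_gt0 px.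
  have hs : sin x ^+ 2 * om (radial x) <= 4 * M.
    rewrite sin_sqr_yvar -mulrA ler_pM2l//.
    apply: le_trans (hM _ l0); rewrite mulrC ler_wpM2l ?om0//.
    rewrite -expR_radial// expR_half_sqr; set z := expR (- (_ / _)).
    have z0 : 0 < z by exact: expR_gt0.
    have z1 : z <= 1 by rewrite -expR0 ler_expR oppr_le0 divr_ge0// sqr_ge0.
    by nra.
  apply: (@le_trans _ _ (sin x ^+ 3 * om (radial x) * (C3 * (C2 * C1)))); last first.
    have -> : K * M * sin x = sin x * (4 * M) * (C3 * (C2 * C1)) by rewrite /K; ring.
    by rewrite ler_wpM2r ?mulr_ge0// exprS -mulrA ler_wpM2l// ltW.
  rewrite [leLHS](_ : _ = sin x ^+ kappa.+2 * om (radial x) * (C3 * (C2 * C1))); last first.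
    by move=> /=; ring.
  rewrite ler_wpM2r ?mulr_ge0// ler_wpM2r ?om0//.
  case: (kappa) kappa0 => // k _; rewrite -addn3 exprD ler_piMl ?exprn_ge0 ?(ltW s0)//.
pose gz j := zext (g j).
have gzK j x : (j <= kappa)%N -> `|gz j x| <= K * M.
  move=> jk; rewrite /gz /zext; case: ifPn => [px|_]; last by rewrite normr0 mulr_ge0.
  by apply: (le_trans (gK _ _ jk px)); rewrite ler_piMr ?sin_le1// mulr_ge0.
have gz1 x : 0 < x < pi -> `|gz 1 x| <= K * M * sin x.
  by move=> px; rewrite /gz /zext (_ : opi x)//; exact: gK.
have gzd j x : (j < kappa)%N -> 0 < x < pi -> is_derive x 1 (gz j) (gz j.+1 x).
  move=> jk px; have px' : opi x by [].
  by rewrite {2}/gz /zext px'; apply: zext_derive => //; exact: gd.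
have gzc j : (j <= kappa)%N -> continuous (gz j).
  by move=> jk; apply: (@zext_continuous _ (K * M)) => x px; [exact: gc|exact: gK].
have gz0 j : (j <= kappa)%N -> gz j 0 = 0 by move=> _; rewrite /gz /zext /opi ltxx.
have gzpi j : (j <= kappa)%N -> gz j pi = 0 by move=> _; rewrite /gz /zext /opi ltxx andbF.
have [f rf hf] := fourier_poly kappa0 gzc gzd gz0 gzpi
  (fun x _ => gzK _ x (leqnn _)) (fun x _ => gzK 0%N x (leq0n _)) gz1 n0.
exists f.
  apply: poly_repr_le rf; rewrite ler_wpM2r ?exprn_ge0// ler_wpM2r//.
  by rewrite mulrA ler_wpM2r// lerDl mulr_ge0// sqr_ge0.
move=> l l0; cbv zeta; set Y := expR _.
have /andP[Y0 Y1] : 0 < Y < 1.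
  by rewrite expR_gt0 -expR0 ltr_expR oppr_lt0 exprn_gt0.
(* The angle at which [yvar] equals Y and [radial] equals l. *)
pose x := acos (2 * Y - 1).
have Yi : -1 <= 2 * Y - 1 <= 1 by apply/andP; split; lra.
have px : opi x.
  by apply/andP; split; [apply: acos_gt0|apply: acos_ltpi]; apply/andP; split; lra.
have yx : yvar x = Y by rewrite /yvar /x acosK ?in_itv//; field.
have rx : radial x = l.
  rewrite /radial yx /Y expRK opprK sqrtr_sqr ger0_norm//; exact: ltW.
have := hf _ px; rewrite -/(yvar x) yx {1}/gz /zext px ge rx.
have -> : sin x ^+ (kappa.+2 + kappa) * (4^-1 ^+ kappa.+1 * q (yvar x) * F l) =
   F l * (Y * (1 - Y)) ^+ kappa.+1 * q Y.
  rewrite (_ : (kappa.+2 + kappa = 2 * kappa.+1)%N); last first.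
    by rewrite mul2n -addnn !addSn addnS.
  rewrite exprM sin_sqr_yvar exprMn yx exprVn; field.
  by rewrite expf_neq0.
move=> /le_trans; apply.
have -> : (2 * K + 2 * K ^+ 2) * M ^+ 2 = 2 * (K * M) ^+ 2 + 2 * K * M ^+ 2 by ring.
by rewrite lerDl !mulr_ge0// sqr_ge0.
Qed.

End angular_variable.

(** * Kernels approximable by polynomials in a heat symbol *)

Section good_kernels.
Context {R : realType}.
Implicit Types (F om k u : R -> R) (kappa : nat).
Local Notation Syml := (Sym pos id).

Lemma poly_repr_horner (p : {poly R}) : exists A, poly_repr (horner p) (size p) A.
Proof.
exists (\sum_(i < (size p).+1) `|p`_i|); exists (fun i => p`_i); split=> // y.
by rewrite (@horner_coef_wide _ (size p).+1).
Qed.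

Lemma poly_repr_continuous f n (A : R) : poly_repr f n A -> continuous f.
Proof.
move=> [c [_ fE]] x; rewrite (_ : f = fun y => \sum_(i < n.+1) c i * y ^+ i); last first.
  exact/funext.
elim: {fE} n => [|n ih].
  rewrite (_ : (fun _ => _) = fun=> c 0%N); first exact: cst_continuous.
  by apply/funext => y; rewrite big_ord1 mulr1.
rewrite (_ : (fun _ => _) = fun y => \sum_(i < n.+1) c i * y ^+ i + c n.+1 * y ^+ n.+1).
  apply: cvgD; first exact: ih.
  by apply: cvgM; [exact: cvg_cst|exact: exprn_continuous].
by apply/funext => y; rewrite big_ord_recr.
Qed.

Lemma poly_repr_bd f n (A y : R) : poly_repr f n A -> 0 <= y <= 1 -> `|f y| <= A.
Proof.
move=> [c [cA ->]] /andP[y0 y1]; apply: le_trans cA; apply: (le_trans (ler_norm_sum _ _ _)).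
apply: ler_sum => i _; rewrite normrM ler_piMr// normrX ger0_norm//.
exact: exprn_ile1.
Qed.

Definition gexp (r l : R) := expR (- (r * l) ^+ 2).

Lemma gexp_itv r l : 0 < gexp r l <= 1.
Proof. by rewrite expR_gt0 -expR0 ler_expR oppr_le0 sqr_ge0. Qed.

(** What the off-diagonal estimate uses of a kernel at scale r: a uniform bound, and for each n an
    approximating polynomial of degree n in exp(-(r l)^2) with squared error at most M^2 n^-(2 kappa
    - 1). A single M measures all three sizes, so the estimates are homogeneous in it. *)
Definition good kappa (r M : R) k :=
  (forall l, 0 <= l -> `|k l| <= M) /\
  forall n, (0 < n)%N -> exists2 f, poly_repr f n (M * n.+1%:R * 7 ^+ n) &
    forall l, 0 <= l -> (k l - f (gexp r l)) ^+ 2 * n%:R ^+ kappa.*2.-1 <= M ^+ 2.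

Lemma good_ge0 kappa r M k : good kappa r M k -> 0 <= M.
Proof. by case=> /(_ 0 (lexx _)) h _; exact: le_trans h. Qed.

Lemma goodD kappa r M1 M2 k1 k2 : good kappa r M1 k1 -> good kappa r M2 k2 ->
  good kappa r (M1 + M2) (fun l => k1 l + k2 l).
Proof.
move=> g1 g2; have M10 := good_ge0 g1; have M20 := good_ge0 g2.
case: g1 => b1 h1; case: g2 => b2 h2; split.
  by move=> l l0; rewrite (le_trans (ler_normD _ _))// lerD ?b1 ?b2.
move=> n n0; have [f1 rf1 hf1] := h1 _ n0; have [f2 rf2 hf2] := h2 _ n0.
exists (fun y => f1 y + f2 y).
  by apply: poly_repr_le (poly_reprD rf1 rf2); rewrite -!mulrDl.
move=> l l0; have := hf1 _ l0; have := hf2 _ l0.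
set a := k1 l - _; set b := k2 l - _.
rewrite (_ : k1 l + k2 l - _ = a + b); last by rewrite /a /b; ring.
have N0 : 0 <= n%:R ^+ kappa.*2.-1 :> R by rewrite exprn_ge0.
have aux (x : R) : x ^+ 2 * n%:R ^+ kappa.*2.-1 = (x * Num.sqrt (n%:R ^+ kappa.*2.-1)) ^+ 2.
  by rewrite exprMn (@sqr_sqrtr _ (n%:R ^+ kappa.*2.-1)).
rewrite !aux (mulrDl a b); set x := a * _; set y := b * _ => hy hx.
have xM : `|x| <= M1 by rewrite -(ger0_norm M10) -ler_sqr ?nnegrE// !real_normK ?num_real.
have yM : `|y| <= M2 by rewrite -(ger0_norm M20) -ler_sqr ?nnegrE// !real_normK ?num_real.
rewrite -(@real_normK _ (x + y)) ?num_real// ler_pXn2r ?nnegrE ?addr_ge0//.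
by rewrite (le_trans (ler_normD _ _))// lerD.
Qed.

Lemma expR_sqr_half (l : R) : gexp 1 l = expR (- (l ^+ 2 / 2)) ^+ 2.
Proof. by rewrite /gexp mul1r expR_half_sqr. Qed.

(** The approximation at scale r, from [symbol_poly]. The latter concerns l > 0, and the point l = 0
    is reached by continuity: the kernel tends to its value 0 there thanks to the factor 1 -
    [gexp r l], however F behaves near 0. *)
Lemma good_symbol kappa q nq Aq : (0 < kappa)%N -> poly_repr q nq Aq ->
  exists2 C : R, 0 <= C & forall r om F M, 0 < r -> Syml kappa om F ->
    (forall x, 0 < x -> om x * expR (- (x ^+ 2 / 2)) <= M) ->
    good kappa r (C * M) (fun l => F (r * l) *
      (gexp r l * (1 - gexp r l)) ^+ kappa.+1 * q (gexp r l)).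
Proof.
move=> kappa0 qp; have [C C0 hC] := symbol_poly kappa0 qp.
have Aq0 := poly_repr_ge0 qp.
exists (1 + C + Aq); first by rewrite !addr_ge0.
move=> r om F M r0 sF hM.
have om0 l : 0 < l -> 0 <= om l by move=> /(Sym_bd sF); exact: le_trans.
have M0 : 0 <= M by rewrite (le_trans _ (hM 1 ltr01))// mulr_ge0 ?expR_ge0 ?om0.
pose k x := F x * (gexp 1 x * (1 - gexp 1 x)) ^+ kappa.+1 * q (gexp 1 x).
have kb x : 0 < x -> `|k x| <= M * Aq * (1 - gexp 1 x).
  move=> x0; have /andP[y0 y1] := gexp_itv 1 x.
  have qb := poly_repr_bd qp (y := gexp 1 x).
  rewrite /k 2!normrM [leRHS]mulrAC ler_pM ?mulr_ge0// ?qb ?(ltW y0)//.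
  rewrite (ger0_norm (exprn_ge0 _ (mulr_ge0 (ltW y0) _))) ?subr_ge0// exprMn mulrA.
  rewrite ler_pM// ?mulr_ge0 ?exprn_ge0 ?(ltW y0) ?subr_ge0//; last first.
    by rewrite exprS ler_piMr ?subr_ge0// exprn_ile1 ?subr_ge0// gerBl ltW.
  apply: le_trans (hM _ x0); apply: ler_pM => //.
  - by rewrite exprn_ge0// ltW.
  - exact: Sym_bd sF _ x0.
  - move: y0 y1; rewrite expR_sqr_half; set z := expR _ => y0 y1.
    have z0 : 0 < z by exact: expR_gt0.
    have z1 : z <= 1 by rewrite -expR0 ler_expR oppr_le0 divr_ge0// sqr_ge0.
    rewrite -exprM mul2n doubleS exprS ler_piMr ?(ltW z0)//.
    by rewrite exprn_ile1// ltW.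
have scale l : F (r * l) * (gexp r l * (1 - gexp r l)) ^+ kappa.+1 * q (gexp r l) = k (r * l).
  by rewrite /k /gexp mul1r.
have k00 : k 0 = 0 by rewrite /k /gexp mulr0 expr0n oppr0 expR0 subrr mulr0 expr0n mulr0 mul0r.
split.
  move=> l; rewrite le_eqVlt scale => /predU1P[<-|l0].
    by rewrite mulr0 k00 normr0 mulr_ge0 ?addr_ge0.
  have rl0 : 0 < r * l by exact: mulr_gt0.
  apply: (le_trans (kb _ rl0)); have /andP[y0 y1] := gexp_itv 1 (r * l).
  apply: (@le_trans _ _ (M * Aq)).
    by rewrite ler_piMr ?mulr_ge0// gerBl ltW.
  by rewrite mulrC ler_wpM2r// lerDr addr_ge0.
move=> n n0; have [f rf hf] := hC om F M sF hM n n0.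
have hk x : 0 < x -> (k x - f (gexp 1 x)) ^+ 2 * n%:R ^+ kappa.*2.-1 <= C * M ^+ 2.
  by move=> x0; have := hf _ x0; rewrite /k /gexp mul1r.
exists f.
  apply: poly_repr_le rf; rewrite ler_wpM2r ?exprn_ge0// ler_wpM2r// ler_wpM2r//.
  by rewrite addrAC lerDr addr_ge0.
have bound x : 0 <= x -> (k x - f (gexp 1 x)) ^+ 2 * n%:R ^+ kappa.*2.-1 <= C * M ^+ 2.
  rewrite le_eqVlt => /predU1P[<-|]; last exact: hk.
  have cg : gexp 1 x @[x --> 0^'+] --> gexp 1 0.
    have ge : gexp 1 = fun y => expR (- y ^+ 2) by apply/funext => y; rewrite /gexp mul1r.
    by apply: cvg_at_right_filter; rewrite ge; exact: is_derive_continuous (is_derive_gauss 0).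
  have g10 : gexp 1 0 = 1 by rewrite /gexp mulr0 expr0n oppr0 expR0.
  have ck : k x @[x --> 0^'+] --> k 0.
    rewrite k00; apply/norm_cvg0P.
    apply: (@squeeze_cvgr _ _ _ _ (fun=> 0) (fun x => M * Aq * (1 - gexp 1 x))).
    - near=> z; rewrite normr_ge0/=; apply: kb; near: z; exact: nbhs_right_gt.
    - exact: cvg_cst.
    - have h : (1 - gexp 1 x) @[x --> 0^'+] --> 1 - gexp 1 0 by apply: cvgB cg; exact: cvg_cst.
      have := cvgM (cvg_cst (M * Aq)) h; rewrite g10 subrr mulr0; apply.
  have cf : f (gexp 1 x) @[x --> 0^'+] --> f (gexp 1 0).
    by apply: cvg_comp cg _; exact: poly_repr_continuous rf _.
  have ct : (k x - f (gexp 1 x)) ^+ 2 * n%:R ^+ kappa.*2.-1 @[x --> 0^'+] -->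
     (k 0 - f (gexp 1 0)) ^+ 2 * n%:R ^+ kappa.*2.-1.
    apply: cvgM; last exact: cvg_cst.
    apply: (@cvg_comp _ _ _ (fun x => k x - f (gexp 1 x)) (fun y => y ^+ 2)); last first.
      exact: exprn_continuous.
    exact: cvgB.
  refine (@cvgr_to_le _ _ _ _ _ _ _ ct _); near=> z; apply: hk; near: z; exact: nbhs_right_gt.
move=> l l0; rewrite scale (_ : gexp r l = gexp 1 (r * l)); last by rewrite /gexp mul1r.
apply: (le_trans (bound _ _)); first by rewrite mulr_ge0// ltW.
by rewrite exprMn ler_wpM2r ?sqr_ge0//; nra.
Unshelve. all: by end_near. Qed.

(** Meant for p j = l^j u^(j), for which l p_j' = j p_j + p_(j+1): bounds on these quantities become
    bounds on the iterates of l d/dl. *)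
Lemma Syml_radial kappa : exists2 C : R, 0 <= C & forall om (p : nat -> R -> R),
  (forall j (l : R), (j <= kappa)%N -> 0 < l -> `|p j l| <= om l) ->
  (forall j (l : R), (j < kappa)%N -> 0 < l -> is_derive l 1 (p j) ((j%:R * p j l + p j.+1 l) / l)) ->
  (forall l : R, 0 < l -> {for l, continuous (p kappa)}) ->
  Syml kappa (fun x => C * om x) (p 0%N).
Proof.
suff : forall n, exists2 C : R, 0 <= C & forall om (p : nat -> R -> R),
  (forall j (l : R), (j <= kappa)%N -> 0 < l -> `|p j l| <= om l) ->
  (forall j (l : R), (j < kappa)%N -> 0 < l -> is_derive l 1 (p j) ((j%:R * p j l + p j.+1 l) / l)) ->
  (forall l : R, 0 < l -> {for l, continuous (p kappa)}) ->
  forall j, (j + n <= kappa)%N -> Syml n (fun x => C * om x) (p j).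
  move=> /(_ kappa) [C C0 h]; exists C => // om p b dp cp; exact: (h om p b dp cp 0%N).
elim=> [|n [C C0 ih]].
  exists 1 => // om p b dp cp j; rewrite addn0 => jk; split.
    by move=> x x0; rewrite mul1r; exact: b.
  move=> x x0; move: jk; rewrite leq_eqVlt => /orP[/eqP ->|jk]; first exact: cp.
  exact: is_derive_continuous (dp _ _ jk x0).
exists (1 + kappa%:R * C + C); first by rewrite !addr_ge0// mulr_ge0.
move=> om p b dp cp j jn; have jk : (j < kappa)%N by rewrite (leq_trans _ jn)// addnS ltnS leq_addr.
have om0 x : 0 < x -> 0 <= om x by move=> x0; apply: le_trans (b 0%N _ (leq0n _) x0).
split.
  move=> x x0; apply: (le_trans (b _ _ (ltnW jk) x0)).
  by rewrite -addrA ler_peMl ?om0// lerDl addr_ge0// mulr_ge0.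
exists (fun x => j%:R * p j x + p j.+1 x); first by move=> x; exact: dp.
have s1 := ih om p b dp cp j _; have s2 := ih om p b dp cp j.+1 _.
apply: Sym_le (SymD (SymZ j%:R (s1 _)) (s2 _)).
- move=> x x0; rewrite normr_nat mulrA -mulrDl ler_wpM2r ?om0// -lerBlDr addrK.
  have : j%:R * C <= kappa%:R * C by rewrite ler_wpM2r// ler_nat ltnW.
  by lra.
- by rewrite (leq_trans _ jn)// addnS.
- by rewrite addSn -addnS.
Qed.

End good_kernels.

(** * A discrete reproducing formula *)

Section reproducing_formula.
Context {R : realType}.
Implicit Types (F om k u : R -> R) (kappa N j J : nat) (t s l : R).
Local Notation Syml := (Sym pos id).

Lemma gexpX r l n : gexp r l ^+ n = gexp (Num.sqrt n%:R * r) l.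
Proof.
rewrite /gexp -expRM_natl; congr expR.
by rewrite -mulrA [in RHS]exprMn (@sqr_sqrtr _ n%:R)// mulrN.
Qed.

(** Division by sqrt 2 makes the Gaussian at scale 2^j t the square of the one at scale [scl j t]:
    one factor goes into [qd], the other stays in the kernel. *)
Definition scl j t : R := 2 ^+ j * t / Num.sqrt 2.

Lemma sqrt2_sqr : Num.sqrt 2 ^+ 2 = 2 :> R. Proof. by rewrite (@sqr_sqrtr R 2). Qed.

Lemma sqrt2_gt0 : 0 < Num.sqrt 2 :> R. Proof. by rewrite sqrtr_gt0. Qed.

Lemma scl_gt0 j t : 0 < t -> 0 < scl j t.
Proof. by move=> t0; rewrite divr_gt0 ?sqrt2_gt0// mulr_gt0// exprn_gt0. Qed.

Lemma scl_sqr j t : scl j t ^+ 2 = 4 ^+ j * t ^+ 2 / 2.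
Proof.
by rewrite /scl expr_div_n sqrt2_sqr exprMn -exprM mulnC exprM (_ : 2 ^+ 2 = 4)// -natrX.
Qed.

Lemma gexp_scl j t l : gexp (2 ^+ j * t) l = gexp (scl j t) l ^+ 2.
Proof.
rewrite gexpX (_ : Num.sqrt 2%:R * scl j t = 2 ^+ j * t)//.
by rewrite mulrC divfK// gt_eqF// sqrt2_gt0.
Qed.

(** The symbol of s^2 L exp(-s^2 L). *)
Definition qd s l := (s * l) ^+ 2 * gexp s l.

(** The quotient of (1 - X^4)^N - (1 - X)^N by X (1 - X)^N. The fourth power appears because
    doubling the scale multiplies the heat time by 4. *)
Definition ppoly N X : R := (1 + X + X ^+ 2) * \sum_(i < N) (1 + X + X ^+ 2 + X ^+ 3) ^+ i.

Lemma ppolyE N X : (1 - X ^+ 4) ^+ N - (1 - X) ^+ N = X * (1 - X) ^+ N * ppoly N X.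
Proof.
rewrite (_ : 1 - X ^+ 4 = (1 - X) * (1 + X + X ^+ 2 + X ^+ 3)); last by ring.
rewrite exprMn -[X in _ - X]mulr1 -mulrBr subrX1 /ppoly; ring.
Qed.

(** The second summand accounts for the increment of (1 - [gexp (2 ^+ j * t) l])^N from j to j + 1;
    the first, present for j = 0 only, accounts for its initial value. In both, one Gaussian has
    been left to [qd (scl j t)]. *)
Definition brk N j t l :=
  (if j == 0%N then (1 - gexp t l) ^+ N * gexp (scl 0 t) l else 0) +
  gexp t l * (gexp (scl j t) l * (1 - gexp (2 ^+ j * t) l) ^+ N * ppoly N (gexp (2 ^+ j * t) l)).

(** The sum telescopes to [qd t l] times (1 - [gexp (2 ^+ J.+1 * t) l])^N. The coefficient 2/4^j is
    (t / [scl j t])^2, so large scales enter with summable weights. *)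
Lemma reproducing N J t l :
  qd t l = \sum_(j < J.+1) 2 / 4 ^+ j * brk N j t l * qd (scl j t) l +
           qd t l * (1 - (1 - gexp (2 ^+ J.+1 * t) l) ^+ N).
Proof.
have qs j : 2 / 4 ^+ j * qd (scl j t) l = (t * l) ^+ 2 * gexp (scl j t) l.
  have e4 : (4 : R) ^+ j != 0 by rewrite expf_neq0.
  by rewrite /qd exprMn scl_sqr; field.
have g4 j : gexp (2 ^+ j.+1 * t) l = gexp (2 ^+ j * t) l ^+ 4.
  by rewrite /gexp -expRM_natl [2 ^+ j.+1]exprS; congr expR; ring.
pose E j := (1 - gexp (2 ^+ j * t) l) ^+ N.
have step j : 2 / 4 ^+ j * (gexp t l * (gexp (scl j t) l * (1 - gexp (2 ^+ j * t) l) ^+ N *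
    ppoly N (gexp (2 ^+ j * t) l))) * qd (scl j t) l = qd t l * (E j.+1 - E j).
  rewrite /E g4 ppolyE.
  transitivity (2 / 4 ^+ j * qd (scl j t) l * (gexp t l * (gexp (scl j t) l *
    (1 - gexp (2 ^+ j * t) l) ^+ N * ppoly N (gexp (2 ^+ j * t) l)))); first by ring.
  by rewrite qs /qd gexp_scl; ring.
have gt : gexp t l = gexp (scl 0 t) l ^+ 2 by rewrite -gexp_scl expr0 mul1r.
have first : 2 / 4 ^+ 0 * ((1 - gexp t l) ^+ N * gexp (scl 0 t) l) * qd (scl 0 t) l = qd t l * E 0%N.
  transitivity (2 / 4 ^+ 0 * qd (scl 0 t) l * ((1 - gexp t l) ^+ N * gexp (scl 0 t) l)); first by ring.
  by rewrite qs /E expr0 mul1r /qd gt; ring.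
have main : \sum_(j < J.+1) 2 / 4 ^+ j * brk N j t l * qd (scl j t) l = qd t l * E J.+1.
  elim: J => [|J ih].
    by rewrite big_ord1 /brk/= mulrDr mulrDl first step; ring.
  by rewrite big_ord_recr/= ih /brk/= add0r step; ring.
by rewrite main /E; ring.
Qed.

(** Combines 1 - (1 - X)^N <= N X with (t l)^2 exp(-4^J (t l)^2) <= 4^-J. *)
Lemma reproducing_rest N J t l : 0 <= l ->
  `|qd t l * (1 - (1 - gexp (2 ^+ J * t) l) ^+ N)| <= N%:R / 4 ^+ J.
Proof.
move=> l0; have /andP[x0 x1] := gexp_itv (2 ^+ J * t) l; have /andP[y0 y1] := gexp_itv t l.
set X := gexp _ _ in x0 x1 *.
have h : 1 - (1 - X) ^+ N <= N%:R * X /\ 0 <= 1 - (1 - X) ^+ N.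
  split; last by rewrite subr_ge0 exprn_ile1 ?subr_ge0// gerBl ltW.
  elim: N => [|N ih]; first by rewrite expr0 subrr mul0r.
  have : 0 <= (1 - X) ^+ N <= 1 by rewrite exprn_ge0 ?subr_ge0//= exprn_ile1 ?subr_ge0// gerBl ltW.
  by rewrite exprS -natr1 => /andP[a b]; nra.
rewrite ger0_norm; last exact: (mulr_ge0 (mulr_ge0 (sqr_ge0 _) (ltW y0)) h.2).
have e4 : (0 : R) < 4 ^+ J by rewrite exprn_gt0.
have hX : (t * l) ^+ 2 * X <= (4 ^+ J)^-1.
  rewrite /X /gexp expRN (_ : (_ * t * l) ^+ 2 = 4 ^+ J * (t * l) ^+ 2); last first.
    by rewrite -mulrA exprMn -exprM mulnC exprM (_ : 2 ^+ 2 = 4)// -natrX.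
  rewrite ler_pdivrMr ?expR_gt0// ler_pdivlMl//.
  by apply: le_trans (expR_ge1Dx _); rewrite lerDr.
rewrite /qd; apply: (@le_trans _ _ (N%:R * ((t * l) ^+ 2 * X))); last by rewrite ler_wpM2l.
rewrite [leRHS]mulrCA -mulrA ler_wpM2l ?sqr_ge0//.
by apply: le_trans (h.1); rewrite ler_piMl// h.2.
Qed.

Definition geo N : {poly R} := (\sum_(i < N.*2) 'X^i) ^+ N.

Lemma geoE N Y : (1 - Y ^+ N.*2) ^+ N = (1 - Y) ^+ N * (geo N).[Y].
Proof.
rewrite /geo horner_exp horner_sum -exprMn; congr (_ ^+ N).
under eq_bigr do rewrite hornerXn.
by rewrite -[LHS]opprB subrX1; ring.
Qed.

Definition ppolyp N : {poly R} :=
  ((1 + 'X + 'X^2) * \sum_(i < N) (1 + 'X + 'X^2 + 'X^3) ^+ i) \Po 'X^(N.*2).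

Lemma ppolypE N Y : (ppolyp N).[Y] = ppoly N (Y ^+ N.*2).
Proof.
rewrite /ppolyp horner_comp hornerXn hornerM horner_sum /ppoly !hornerE.
by congr (_ * _); apply: eq_bigr => i _; rewrite horner_exp !hornerE.
Qed.

(** The scale r is chosen so that, with Y = [gexp r l], the Gaussians at scales [scl j t] and 2^j t
    are Y^(kappa + 1) and Y^(2 kappa + 2). Then [brk] is (Y (1 - Y))^(kappa + 1) times a polynomial
    in Y, the form treated by [good_symbol]. The factor [gexp t l], in general a fractional power of
    Y, is counted as part of the symbol: it is a dilate of [gaussm 0]. *)
Lemma good_brk kappa : (0 < kappa)%N -> exists2 C : R, 0 <= C &
  forall om u j t M, 0 < t -> Syml kappa om u ->
    let r := scl j t / Num.sqrt kappa.+1%:R in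
    (forall x, 0 < x -> om (x / r) * expR (- (x ^+ 2 / 2)) <= M) ->
    good kappa r (C * M) (fun l => u l * brk kappa.+1 j t l).
Proof.
move=> kappa0; have [A1 q1] := poly_repr_horner (geo kappa.+1).
have [A2 q2] := poly_repr_horner (geo kappa.+1 * ppolyp kappa.+1).
have [C1 C10 h1] := good_symbol kappa0 q1.
have [C2 C20 h2] := good_symbol kappa0 q2.
have [G G0 sG] := gaussm_sym (R := R) kappa 0.
exists (C1 + C2 * (2 ^+ kappa * G)); first by rewrite addr_ge0// !mulr_ge0// exprn_ge0.
move=> om u j t M t0 su; cbv zeta; set r := _ / _ => hM.
have sN : 0 < Num.sqrt kappa.+1%:R :> R by rewrite sqrtr_gt0 ltr0n.
have r0 : 0 < r by rewrite divr_gt0// scl_gt0.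
have Y2 l : gexp (scl j t) l = gexp r l ^+ kappa.+1.
  by rewrite gexpX /r mulrC divfK// gt_eqF.
have X2 l : gexp (2 ^+ j * t) l = gexp r l ^+ kappa.+1.*2.
  by rewrite gexp_scl Y2 -exprM muln2.
have su' : Syml kappa (fun x => om (x / r)) (fun x => u (x / r)).
  have := Syml_scale (c := r^-1) _ su; rewrite invr_gt0 => /(_ r0).
  by rewrite [X in Sym _ _ _ X _](_ : _ = fun x => om (x / r)) ?[X in Sym _ _ _ _ X](_ : _ = fun x => u (x / r))//; apply/funext => x; rewrite mulrC.
have om0 x : 0 < x -> 0 <= om (x / r) by move=> /(Sym_bd su'); exact: le_trans.
have M0 : 0 <= M by rewrite (le_trans _ (hM 1 ltr01))// mulr_ge0 ?expR_ge0 ?om0.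
have ul l : u l = u (r * l / r) by rewrite mulrAC divff ?mul1r// gt_eqF.
have sB := SymM su' (Syml_scale (c := t / r) (divr_gt0 t0 r0) sG).
have gB := h2 r _ _ (2 ^+ kappa * G * M) r0 sB.
have gB' : good kappa r (C2 * (2 ^+ kappa * G) * M) (fun l => u l * (gexp t l *
  (gexp (scl j t) l * (1 - gexp (2 ^+ j * t) l) ^+ kappa.+1 * ppoly kappa.+1 (gexp (2 ^+ j * t) l)))).
  rewrite -mulrA (_ : (fun l => _) = fun l => u (r * l / r) * gaussm 0 (t / r * (r * l)) *
    (gexp r l * (1 - gexp r l)) ^+ kappa.+1 * (geo kappa.+1 * ppolyp kappa.+1).[gexp r l]).
    apply: gB => x x0 /=.
    rewrite [leLHS](_ : _ = 2 ^+ kappa * G * (om (x / r) * expR (- (x ^+ 2 / 2)))); last by ring.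
    by rewrite ler_wpM2l ?hM// mulr_ge0// exprn_ge0.
  apply/funext => l; rewrite -ul hornerM ppolypE -X2 Y2 {1}X2 geoE exprMn.
  have -> : gaussm 0 (t / r * (r * l)) = gexp t l.
    by rewrite /gaussm expr0 mul1r /gexp mulrA divfK// gt_eqF.
  by ring.
rewrite (_ : (fun l => _) = fun l => (if j == 0%N then u l * ((1 - gexp t l) ^+ kappa.+1 * gexp (scl 0 t) l) else 0) +
   u l * (gexp t l * (gexp (scl j t) l * (1 - gexp (2 ^+ j * t) l) ^+ kappa.+1 * ppoly kappa.+1 (gexp (2 ^+ j * t) l)))); last first.
  by apply/funext => l; rewrite /brk mulrDr; case: ifP => //; rewrite mulr0.
rewrite mulrDl; apply: goodD gB'.
case: eqP => [j0|_]; last first.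
  split=> [l _|n n0]; first by rewrite normr0 mulr_ge0.
  exists (fun=> 0).
    exists (fun=> 0); split; last by move=> y; rewrite big1// => i _; rewrite mul0r.
    by rewrite big1 ?normr0// !mulr_ge0// exprn_ge0.
  by move=> l _; rewrite subr0 expr0n mul0r sqr_ge0.
move: Y2 X2; rewrite j0 expr0 mul1r => Y2 X2.
have := h1 r _ _ M r0 su' hM.
rewrite [X in good _ _ _ X -> _](_ : _ = fun l => u l * ((1 - gexp t l) ^+ kappa.+1 * gexp (scl 0 t) l))//.
apply/funext => l; rewrite -ul Y2 X2 geoE exprMn; ring.
Qed.

End reproducing_formula.

(** * Symbol bounds for the multiplier and its behaviour at the origin *)

Section mikhlin.
Context {R : realType}.
Variables (kappa : nat) (m : R -> R[i]).
Hypothesis mc : continuous_on_nonneg m.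
Hypothesis ms : smooth_on_pos kappa m.
Hypothesis mb : exists M : R, forall (j : nat) (l : R), (j <= kappa)%N -> 0 < l ->
     cmod (scaled_derive j m l) <= M.
Hypothesis ml : forall j : nat, (1 <= j <= kappa)%N ->
     cmod (scaled_derive j m l) @[l --> 0^'+] --> (0 : R).
Implicit Types (u : R -> R).
Local Notation Syml := (Sym pos id).

Definition part u := u = @complex.Re R \o m \/ u = @complex.Im R \o m.

Definition euler u j (l : R) := l ^+ j * derive1n j u l.

Lemma euler_le u j (l : R) : part u -> `|euler u j l| <= cmod (scaled_derive j m l).
Proof.
move=> pu; have -> : scaled_derive j m l = Complex
    (euler (@complex.Re R \o m) j l) (euler (@complex.Im R \o m) j l).
  by rewrite /scaled_derive /cderive /euler; simpc.
by case: pu => ->; [exact: (cRe_le (Complex _ _))|exact: (cIm_le (Complex _ _))].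
Qed.

Lemma euler_derive u j (l : R) : part u -> (j < kappa)%N -> 0 < l ->
  is_derive l 1 (euler u j) ((j%:R * euler u j l + euler u j.+1 l) / l).
Proof.
move=> pu jk l0; have [du _] := ms pu.
have h1 : is_derive l 1 (derive1n j u) (derive1n j.+1 u l).
  apply: DeriveDef; first exact: du.
  by rewrite derive1nS derive1E.
apply: (is_derive_eq (is_derive1_mul (is_derive1_exp j (is_derive_id l 1)) h1)).
rewrite /euler exprS; case: (j) => [|i]; rewrite ?exprS /id/=; field; by rewrite gt_eqF.
Qed.

Lemma euler_cont u (l : R) : part u -> 0 < l -> {for l, continuous (euler u kappa)}.
Proof.
move=> pu l0; have [_ cu] := ms pu.
by apply: cvgM; [exact: exprn_continuous|exact: cu].
Qed.

Lemma part_right u : part u -> u x @[x --> 0^'+] --> u 0.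
Proof.
have [cr ci] := mc; case=> ->.
  by have /continuous_within_itvcyP[] := cr.
by have /continuous_within_itvcyP[] := ci.
Qed.

Lemma part_sym u : part u -> exists2 B : R, 0 <= B &
  Syml kappa (fun=> B) u /\ forall l, 0 <= l -> `|u l| <= B.
Proof.
move=> pu; have [C C0 hC] := Syml_radial (R := R) kappa; have [M hM] := mb.
have b j (l : R) : (j <= kappa)%N -> 0 < l -> `|euler u j l| <= `|M|.
  move=> jk l0; apply: le_trans (euler_le _ _ pu) _.
  exact: le_trans (hM _ _ jk l0) (ler_norm _).
have e0 : euler u 0 = u by apply/funext => l; rewrite /euler expr0 mul1r.
exists (C * `|M| + `|M| + `|u 0|); first by rewrite !addr_ge0// mulr_ge0.
split; last first.
  move=> l; rewrite le_eqVlt => /predU1P[<-|l0]; first by rewrite lerDr addr_ge0// mulr_ge0.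
  by have := b 0%N l (leq0n _) l0; rewrite e0 => /le_trans; apply; rewrite addrAC lerDr addr_ge0// mulr_ge0.
have := hC (fun=> `|M|) (euler u) b (fun j l => euler_derive pu) (fun l => euler_cont pu).
by rewrite e0; apply: Sym_le => x _; rewrite -addrA lerDl addr_ge0.
Qed.

(** Near 0 the limit provides e; at distance d or more from 0 the bound A is dominated by a linear
    function. The linear term will be small at scales large compared with t. *)
Lemma small_at_origin (p : R -> R) (A e : R) : 0 < e -> p x @[x --> 0^'+] --> (0 : R) ->
  (forall l, 0 < l -> `|p l| <= A) ->
  exists2 D : R, 0 <= D & forall l, 0 < l -> `|p l| <= e + D * l.
Proof.
move=> e0 /cvgr0Pnorm_le/(_ _ e0) [d /= d0 hd] hA; exists (`|A| / d).
  by rewrite divr_ge0// ltW.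
move=> l l0; have [ld|dl] := ltP l d.
  apply: (@le_trans _ _ e); last by rewrite lerDl !mulr_ge0 ?invr_ge0// ltW.
  by apply: hd => //=; rewrite sub0r normrN gtr0_norm.
apply: (le_trans (hA _ l0)); rewrite (le_trans (ler_norm _))//.
rewrite (le_trans (_ : _ <= `|A| / d * l)) ?lerDr ?(ltW e0)//.
by rewrite -mulrA ler_peMr// mulrC ler_pdivlMr// mul1r.
Qed.

Lemma part_sym_small u (e : R) : part u -> 0 < e -> exists2 D : R, 0 <= D &
  Syml kappa (fun l => e + D * l) (fun l => u l - u 0).
Proof.
move=> pu e0; have [C C0 hC] := Syml_radial (R := R) kappa; have [M hM] := mb.
have [B B0 [_ uB]] := part_sym pu.
pose p j := if j is 0%N then fun l => u l - u 0 else euler u j.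
have e00 : euler u 0 = u by apply/funext => l; rewrite /euler expr0 mul1r.
(* Anticipates the constant of [Syml_radial]. *)
pose d : R := e / (C + 1); have d0 : 0 < d by rewrite divr_gt0// ltr_wpDl.
have lim j : (j <= kappa)%N -> exists2 D : R, 0 <= D & forall l, 0 < l -> `|p j l| <= d + D * l.
  case: j => [_|j jk].
    apply: (@small_at_origin (p 0%N) (B + B)) => //.
      by have := cvgB (part_right pu) (cvg_cst (u 0)); rewrite subrr; apply.
    move=> l l0; rewrite (le_trans (ler_normB _ _))// lerD ?uB//; exact: ltW.
  apply: (@small_at_origin (p j.+1) M) => //.
    apply/norm_cvg0P; apply: (@squeeze_cvgr _ _ _ _ (fun=> 0) (fun x => cmod (scaled_derive j.+1 m x))).
    - by near=> x; rewrite normr_ge0/= euler_le.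
    - exact: cvg_cst.
    - exact: ml.
  by move=> l l0; apply: le_trans (euler_le _ _ pu) (hM _ _ jk l0).
have [D D0 hD] : exists2 D : R, 0 <= D &
    forall j l, (j <= kappa)%N -> 0 < l -> `|p j l| <= d + D * l.
  suff : forall n, (n <= kappa)%N -> exists2 D : R, 0 <= D &
      forall j l, (j <= n)%N -> 0 < l -> `|p j l| <= d + D * l by apply.
  elim=> [_|n ih nk].
    by have [D D0 h] := lim 0%N (leq0n _); exists D => // j l; rewrite leqn0 => /eqP ->; exact: h.
  have [D D0 h] := ih (ltnW nk); have [D' D0' h'] := lim _ nk.
  exists (D + D'); first exact: addr_ge0.
  move=> j l; rewrite leq_eqVlt => /predU1P[->|jn] l0.
    by rewrite (le_trans (h' _ l0))// lerD2l ler_wpM2r ?(ltW l0)// lerDr.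
  by rewrite (le_trans (h _ _ jn l0))// lerD2l ler_wpM2r ?(ltW l0)// lerDl.
have dp j (l : R) : (j < kappa)%N -> 0 < l -> is_derive l 1 (p j) ((j%:R * p j l + p j.+1 l) / l).
  case: j => [|j] jk l0; last exact: euler_derive.
  rewrite mul0r add0r /p.
  have := euler_derive pu jk l0; rewrite mul0r add0r e00 => h.
  by have := is_derive1_add h (is_derive_cst (- u 0) l 1); rewrite addr0.
have cp (l : R) : 0 < l -> {for l, continuous (p kappa)}.
  move=> l0; have := euler_cont pu l0; rewrite /p; case: (kappa) => [|//].
  by rewrite e00 => h; apply: cvgB => //; exact: cvg_cst.
exists (C * D); first exact: mulr_ge0.
have := hC (fun l => d + D * l) p hD dp cp; apply: Sym_le => x x0.
rewrite mulrDr mulrA lerD2r /d mulrCA ler_piMr ?(ltW e0)//.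
by rewrite ler_pdivrMr ?ltr_wpDl// mul1r lerDl.
Unshelve. all: by end_near. Qed.

End mikhlin.

(** * Restriction of classes to measurable sets *)

Section restriction.
Context d (R : realType) (Omega : borelMetricType d R).
Variable mu : {measure set Omega -> \bar R}.
Local Notation Re := (@complex.Re R).
Local Notation nm := (nm (@ipc d R Omega mu)).
Local Notation ipc := (@ipc d R Omega mu).
Local Notation cls := (cls mu).
Implicit Types (A B : set Omega) (u v w : L2cls mu).

Definition restr A (f : Omega -> R[i]) (x : Omega) : R[i] := (\1_A x)%:C%C * f x.

Lemma restr_le A f x : cmod (restr A f x) <= cmod (f x).
Proof.
rewrite /restr cmodM cmodR indicE ger0_norm//.
by case: (_ \in _); rewrite ?mul1r// mul0r cmod_ge0.
Qed.

Lemma L2_restr A f : measurable A -> L2 mu f -> L2 mu (restr A f).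
Proof.
move=> mA lf; apply: (L2_le _ lf) => [|x]; last exact: restr_le.
apply: mfun2M; last exact: ((L2P mu f).1 lf).1.
apply: mfun2_real; exact: measurable_indic.
Qed.

Definition ind A v := cls (restr A (rp v)).

Lemma ind_cls A f : measurable A -> L2 mu f -> ind A (cls f) = cls (restr A f).
Proof.
move=> mA lf; apply: cls_eq; [by apply: L2_restr => //; exact: rpL2|exact: L2_restr|].
by apply: filterS (cls_ae lf) => x h _; rewrite /restr h.
Qed.

Lemma indI A B v : measurable A -> measurable B -> ind A (ind B v) = ind (A `&` B) v.
Proof.
move=> mA mB; rewrite {2}/ind ind_cls//; last by apply: L2_restr => //; exact: rpL2.
by congr cls; apply/funext => x; rewrite /restr mulrA -rmorphM indicI.
Qed.

Lemma indD A u v : measurable A -> ind A (u + v) = ind A u + ind A v.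
Proof.
move=> mA; rewrite -(rpK u) -(rpK v) -clsD; try exact: rpL2.
rewrite !ind_cls//; try exact: rpL2; last by apply: L2D; exact: rpL2.
rewrite -clsD; try by apply: L2_restr => //; exact: rpL2.
by congr cls; apply/funext => x; rewrite /restr mulrDr.
Qed.

Lemma indZ A a v : measurable A -> ind A (a *: v) = a *: ind A v.
Proof.
move=> mA; rewrite -(rpK v) -clsZ; try exact: rpL2.
rewrite !ind_cls//; try exact: rpL2; last by apply: L2Z; exact: rpL2.
rewrite -clsZ; last by apply: L2_restr => //; exact: rpL2.
by congr cls; apply/funext => x; rewrite /restr mulrCA.
Qed.

Lemma indB A u v : measurable A -> ind A (u - v) = ind A u - ind A v.
Proof. by move=> mA; rewrite -scaleN1r indD// indZ// scaleN1r. Qed.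

Lemma indr0 A : measurable A -> ind A 0 = 0.
Proof. by move=> mA; have := indZ 0 (0 : L2cls mu) mA; rewrite !scale0r. Qed.

Lemma ind_sum A (I : Type) (r : seq I) (F : I -> L2cls mu) : measurable A ->
  ind A (\sum_(i <- r) F i) = \sum_(i <- r) ind A (F i).
Proof.
move=> mA; elim: r => [|i r ih]; last by rewrite !big_cons indD// ih.
by rewrite !big_nil indr0.
Qed.

Lemma ind0 v : ind set0 v = 0.
Proof.
by rewrite -cls0; congr cls; apply/funext => x; rewrite /restr indic0 mul0r.
Qed.

Lemma indT v : ind setT v = v.
Proof.
rewrite -[RHS]rpK; congr cls; apply/funext => x.
by rewrite /restr indicT mul1r.
Qed.

Lemma indC A v : measurable A -> ind A v + ind (~` A) v = v.
Proof.
move=> mA; have lA := L2_restr mA (rpL2 v); have lC := L2_restr (measurableC mA) (rpL2 v).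
rewrite -clsD// -[RHS]rpK; congr cls; apply/funext => x.
rewrite /restr -mulrDl -rmorphD !indicE in_setC.
by case: (x \in A); rewrite ?addr0 ?add0r mul1r.
Qed.

Lemma ind_sym A u v : measurable A -> ipc (ind A u) v = ipc u (ind A v).
Proof.
move=> mA; have [lu lv] := (rpL2 u, rpL2 v); have [lu' lv'] := (L2_restr mA lu, L2_restr mA lv).
transitivity (ipc (cls (restr A (rp u))) (cls (rp v))); first by rewrite rpK.
transitivity (ipc (cls (rp u)) (cls (restr A (rp v)))); last by rewrite rpK.
rewrite !ipc_cls// /inner; congr Complex; congr Rintegral.
  by apply/funext => x /=; rewrite /restr -mulrA rmorphM/= mulrCA oppr0.
by apply/funext => x /=; rewrite /restr -mulrA rmorphM/= mulrCA oppr0.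
Qed.

Lemma nm2_ind A v : measurable A ->
  (nm (ind A v) ^+ 2)%:E = (\int[mu]_(x in A) (cmod (rp v x) ^+ 2)%:E)%E.
Proof.
move=> mA.
have h := nm2_cls (L2_restr mA (rpL2 v)).
apply: (etrans h).
rewrite /N2.
rewrite [RHS]integral_mkcond; apply: eq_integral => x _.
rewrite /restr patchE cmodM cmodR indicE ger0_norm//.
by case: (x \in A); rewrite ?mul1r// mul0r expr0n.
Qed.

Lemma nm_ind_mono A B v : measurable A -> measurable B -> A `<=` B ->
  nm (ind A v) <= nm (ind B v).
Proof.
move=> mA mB AB.
have aux (a b : R) (x y : \bar R) : 0 <= a -> 0 <= b -> (a ^+ 2)%:E = x -> (b ^+ 2)%:E = y ->
    (x <= y)%E -> a <= b.
  by move=> a0 b0 <- <-; rewrite lee_fin ler_pXn2r.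
apply: (aux _ _ _ _ (nm_ge0 _ _) (nm_ge0 _ _) (nm2_ind v mA) (nm2_ind v mB)).
apply: ge0_subset_integral => //; last by move=> x _; rewrite lee_fin sqr_ge0.
by apply: measurable_funTS; apply: mod2_meas; exact: ((L2P mu _).1 (rpL2 _)).1.
Qed.

Lemma nm_ind A v : measurable A -> nm (ind A v) <= nm v.
Proof. by move=> mA; rewrite -[in leRHS](indT v); exact: nm_ind_mono. Qed.

Lemma ind_ind A v : measurable A -> ind A (ind A v) = ind A v.
Proof. by move=> mA; rewrite indI// setIid. Qed.

End restriction.

Lemma metric_ball_open (R : realType) (T : metricType R) (x : T) (r : R) : open (ball x r).
Proof.
rewrite openE => y; rewrite ballEmdist/= => xy.
apply/nbhs_ballP; exists (r - mdist x y); first by rewrite /= subr_gt0.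
move=> z; rewrite !ballEmdist/= => yz.
by rewrite (le_lt_trans (metric_triangle x y z))// -ltrBrDl.
Qed.

(** * Off-diagonal estimates *)

Section off_diagonal.
Context d (R : realType) (Omega : borelMetricType d R).
Variable mu : {measure set Omega -> \bar R}.
Variable E : proj_measure mu.
Local Notation nm := (nm (@ipc d R Omega mu)).
Local Notation ipc := (@ipc d R Omega mu).
Local Notation cls := (cls mu).
Local Notation mult := (mult (spv E)).
Local Notation complete := (@L2cls_complete _ _ _ mu).
Local Notation ipP := (@ipc_inner _ _ _ mu).
Implicit Types (A B : set Omega) (u v w : L2cls mu).

Definition apart (rho : R) A B := forall x y, A x -> B y -> rho <= mdist x y.

(** The hypothesis is about open sets containing the supports. Neighbourhoods of radius rho/4 are
    open and still rho/2 apart, which changes c into 4 c. Pairing the restricted output with itself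
    turns the bilinear estimate into a norm estimate. *)
Lemma davies_gaffney_ind : davies_gaffney E -> exists C c : R, [/\ 0 < C, 0 < c &
  forall (t rho : R) A B v, 0 < t -> 0 < rho -> measurable A -> measurable B -> apart rho A B ->
    nm (ind A (mult (heat_symbol t) (ind B v))) <= C * expR (- (rho ^+ 2 / (c * t))) * nm v].
Proof.
move=> [C [c [C0 c0 DG]]]; exists C, (4 * c); split=> //; first exact: mulr_gt0.
move=> t rho A B v t0 rho0 mA mB AB.
(* Empty sets are set aside, as the infimum in [set_dist] is bounded below only over a nonempty set
   of pairs. *)
have [->|/set0P A0] := eqVneq A set0.
  by rewrite ind0 (nm0 ipP) ?mulr_ge0 ?expR_ge0 ?nm_ge0 ?(ltW C0).
have [->|/set0P B0] := eqVneq B set0.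
  have -> : mult (heat_symbol t) (ind set0 v) = 0.
    have := mult_lin (spv E) complete (-1) (ind set0 v) (ind set0 v) (bsym_heat (ltW t0)).
    by rewrite ind0 scaler0 addr0 scaleN1r addNr.
  by rewrite (indr0 mu mA) (nm0 ipP) ?mulr_ge0 ?expR_ge0 ?nm_ge0 ?(ltW C0).
set u := ind A _; have r4 : 0 < rho / 4 by rewrite divr_gt0.
pose nbd (S : set Omega) := \bigcup_(y in S) ball y (rho / 4).
have onbd S : open (nbd S) by apply: bigcup_open => y _; exact: metric_ball_open.
have supp S f : Defs.support mu (restr S f) `<=` nbd S.
  move=> x sx; apply: contrapT => nx; apply: (sx _ r4).
  apply: aeW => y bxy; rewrite /restr indicE.
  case: (boolP (y \in S)) => [/set_mem Sy|_]; last by rewrite mul0r.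
  by case: nx; exists y => //; exact: ball_sym.
have dist : rho / 2 <= set_dist (nbd B) (nbd A).
  apply: lb_le_inf.
    case: A0 => a Aa; case: B0 => b Bb; exists (mdist b a); exists (b, a) => //=.
    by split; [exists b|exists a] => //; exact: ballxx.
  move=> _ [[x y] [[b Bb bx] [a Aa ay]] <-] /=.
  have := AB _ _ Aa Bb; move: bx ay; rewrite !ballEmdist/= => bx ay h.
  have h1 := metric_triangle a y b; have h2 := metric_triangle y x b.
  move: h1 h2; rewrite (metric_sym x b) (metric_sym y x) => h1 h2.
  by lra.
have [lB lu] := (L2_restr mB (rpL2 v), rpL2 u).
have lT := L2_restr mA (rpL2 (mult (heat_symbol t) (ind B v))).
have [lh eh] := cls_heat E (ltW t0) lB.
have key := DG t _ _ _ _ t0 (onbd B) (onbd A) lB lT (supp _ _) (supp _ _).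
have n2 : nm u ^+ 2 <= C * expR (- (rho ^+ 2 / (4 * c * t))) * nm v * nm u.
  rewrite (nm2 ipP) (_ : ipc u u = inner mu (heat E t (restr B (rp v))) (restr A (rp (mult (heat_symbol t) (ind B v))))); last first.
    by rewrite -ipc_cls// eh -/(ind _ _) -/(ind _ _) -ind_sym// -ind_sym// ind_ind.
  apply: (le_trans (ler_norm _)); apply: (le_trans (cRe_le _)); apply: (le_trans key).
  rewrite -!nm_cls//= -!/(ind _ _) ler_wpM2r ?nm_ge0//.
  apply: ler_pM; rewrite ?nm_ge0 ?mulr_ge0 ?expR_ge0 ?(ltW C0)//; last exact: nm_ind.
  rewrite ler_wpM2l ?(ltW C0)// ler_expR lerN2.
  rewrite (_ : rho ^+ 2 / (4 * c * t) = (rho / 2) ^+ 2 / (c * t)); last first.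
    by field; rewrite !gt_eqF.
  rewrite ler_pM2r ?invr_gt0 ?mulr_gt0// ler_pXn2r ?nnegrE ?divr_ge0 ?(ltW rho0)//.
  by rewrite (le_trans _ dist)// divr_ge0// ltW.
have [u0|u0] := eqVneq (nm u) 0.
  by rewrite u0 !mulr_ge0 ?expR_ge0 ?nm_ge0// ltW.
by rewrite -(ler_pM2r (_ : 0 < nm u)) -?expr2// lt_neqAle eq_sym u0 nm_ge0.
Qed.

End off_diagonal.

Lemma double_add_le (R : realFieldType) (X Y Z K : R) :
  X * Z <= K -> Y * Z <= K -> (2 * X + 2 * Y) * Z <= 2 * K + 2 * K.
Proof. lra. Qed.

Lemma sqrD_le2 (R : realDomainType) (a b : R) : (a + b) ^+ 2 <= 2 * a ^+ 2 + 2 * b ^+ 2.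
Proof.
rewrite -subr_ge0 (_ : _ - _ = (a - b) ^+ 2) ?sqr_ge0//; ring.
Qed.

Section kernel_off_diagonal.
Context d (R : realType) (Omega : borelMetricType d R).
Variable mu : {measure set Omega -> \bar R}.
Variable E : proj_measure mu.
Local Notation nm := (nm (@ipc d R Omega mu)).
Local Notation cls := (cls mu).
Local Notation mult := (mult (spv E)).
Local Notation complete := (@L2cls_complete _ _ _ mu).
Local Notation ipP := (@ipc_inner _ _ _ mu).
Implicit Types (A B : set Omega) (u v w : L2cls mu).

(** The j-th power of [gexp r] is the heat symbol at time j r^2. The constant term acts as a scalar
    and does not connect separated sets; the other times are at most n r^2, the worst one in the
    exponential. *)
Lemma mult_ind_poly (C c r rho : R) f n a A B v : 0 < C -> 0 < c -> 0 < r -> 0 < rho ->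
  (forall (t rho : R) A B v, 0 < t -> 0 < rho -> measurable A -> measurable B -> apart rho A B ->
    nm (ind A (mult (heat_symbol t) (ind B v))) <= C * expR (- (rho ^+ 2 / (c * t))) * nm v) ->
  poly_repr f n a -> measurable A -> measurable B -> apart rho A B ->
  bsym (fun l => (f (gexp r l))%:C%C) /\
  nm (ind A (mult (fun l => (f (gexp r l))%:C%C) (ind B v))) <=
    a * (C * expR (- (rho ^+ 2 / (c * (n%:R * r ^+ 2)))) * nm v).
Proof.
move=> C0 c0 r0 rho0 DG [g [ga fE]] mA mB AB.
pose F (j : 'I_n.+1) (l : R) : R[i] := (g j)%:C%C * heat_symbol (j%:R * r ^+ 2) l.
have tj (j : 'I_n.+1) : 0 <= j%:R * r ^+ 2 by rewrite mulr_ge0// sqr_ge0.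
have bF j : bsym (F j) by apply: bsymZ; exact: bsym_heat.
have eF : (fun l => (f (gexp r l))%:C%C) = (fun l => \sum_j F j l).
  apply/funext => l; rewrite fE rmorph_sum; apply: eq_bigr => j _.
  rewrite rmorphM /F /heat_symbol /=; congr (_ * (_)%:C%C).
  by rewrite /gexp -expRM_natl; congr expR; rewrite exprMn; ring.
split; first by rewrite eF; exact: bsym_sum.
rewrite eF mult_sum//; last exact: complete.
rewrite ind_sum//; apply: (le_trans (nm_sum ipP _ _)).
have P0 : 0 <= C * expR (- (rho ^+ 2 / (c * (n%:R * r ^+ 2)))) * nm v.
  by rewrite !mulr_ge0 ?expR_ge0 ?nm_ge0// ltW.
apply: (@le_trans _ _ (\sum_(j < n.+1) `|g j| * (C * expR (- (rho ^+ 2 / (c * (n%:R * r ^+ 2)))) * nm v))); last first.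
  by rewrite -mulr_suml ler_wpM2r.
apply: ler_sum => j _; rewrite /F multZ//; [|exact: complete|exact: bsym_heat].
rewrite indZ// (nmZ ipP) cmodR ler_wpM2l//.
have [j0|j0] := posnP j.
  rewrite j0 mul0r (_ : heat_symbol 0 = cst 1); last first.
    by apply/funext => l; rewrite /heat_symbol mul0r oppr0 expR0.
  rewrite mult_cst ?scale1r; last exact: complete.
  rewrite indI// (_ : A `&` B = set0) ?ind0 ?(nm0 ipP)//.
  rewrite -subset0 => x [Ax Bx]; have := AB _ _ Ax Bx.
  by rewrite mdistxx leNgt rho0.
have r2 : 0 < r ^+ 2 by rewrite exprn_gt0.
have jr : 0 < j%:R * r ^+ 2 by rewrite mulr_gt0// ltr0n.
apply: (le_trans (DG _ _ _ _ _ jr rho0 mA mB AB)).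
rewrite ler_wpM2r ?nm_ge0// ler_wpM2l ?(ltW C0)// ler_expR lerN2.
have nr : 0 < n%:R * r ^+ 2 by rewrite mulr_gt0// ltr0n (leq_trans j0)// -ltnS.
rewrite ler_wpM2l ?sqr_ge0// lef_pV2 ?posrE ?(mulr_gt0 c0)//.
by rewrite ler_pM2l// ler_pM2r// ler_nat -ltnS.
Qed.

(** From (n + 1) 7^n <= 14^n <= exp(14 n), the product with exp(-16 n) is at most exp(-n), which
    beats every power of n. *)
Lemma exp_dominates p n : (0 < n)%N ->
  (n.+1%:R * 7 ^+ n * expR (- (16 * n%:R))) ^+ 2 * n%:R ^+ p <= p%:R ^+ p :> R.
Proof.
move=> n0; have e0 := expR_gt0 (n%:R : R).
have h1 : n.+1%:R * 7 ^+ n <= expR n%:R ^+ 14 :> R.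
  apply: (@le_trans _ _ (14 ^+ n)).
    have -> : (14 : R) ^+ n = 2 ^+ n * 7 ^+ n by rewrite -exprMn -natrM.
    by rewrite ler_wpM2r ?exprn_ge0// -natrX ler_nat ltn_expl.
  rewrite -!expRM_natl mulrC expRM_natl ler_pXn2r ?nnegrE ?expR_ge0//.
  by apply: le_trans (expR_ge1Dx _); rewrite lerDr.
have h2 : n.+1%:R * 7 ^+ n * expR (- (16 * n%:R)) <= (expR n%:R)^-1 :> R.
  rewrite expRN expRM_natl -/(expR _) ler_pdivrMr ?exprn_gt0//.
  apply: (le_trans h1); rewrite [leRHS](_ : _ = expR n%:R ^+ 15); last first.
    by rewrite exprS mulrA mulVf ?mul1r// gt_eqF.
  by rewrite [leRHS]exprS ler_peMl ?exprn_ge0 ?(ltW e0)// -expR0 ler_expR.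
have h3 := expR_ge_pow p (ler0n R n).
apply: (@le_trans _ _ ((expR n%:R)^-1 * (p%:R ^+ p * expR n%:R))); last first.
  by rewrite mulrCA mulVf ?mulr1// gt_eqF.
apply: ler_pM => //; try exact: sqr_ge0; try exact: exprn_ge0.
have q0 : 0 <= n.+1%:R * 7 ^+ n * expR (- (16 * n%:R)) :> R by rewrite !mulr_ge0 ?expR_ge0// exprn_ge0.
have i1 : (expR n%:R)^-1 <= 1 :> R by rewrite invf_le1// -expR0 ler_expR.
rewrite expr2; apply: (@le_trans _ _ ((expR n%:R)^-1 * 1)); last by rewrite mulr1.
by apply: ler_pM => //; exact: le_trans i1.
Qed.

(** The kernel is approximated in degree n = 2^(i - i0). At distance 2^i r the Davies-Gaffney
    exponent is then 4^i0 n / c >= 16 n, enough against coefficients of size 7^n, so the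
    approximation error n^-(2 kappa - 1) governs the squared norm. For i < i0 the L^2 bound
    suffices. *)
Lemma good_off_diagonal kappa : davies_gaffney E -> (0 < kappa)%N ->
  exists2 C : R, 0 <= C & forall (r M : R) k i A B v, 0 < r ->
    good kappa r M k -> bsym (fun l => (k l)%:C%C) -> measurable A -> measurable B ->
    i = 0%N \/ apart (2 ^+ i * r) A B ->
    nm (ind A (mult (fun l => (k l)%:C%C) (ind B v))) ^+ 2 * (2 ^+ kappa.*2.-1) ^+ i <=
      C * M ^+ 2 * nm v ^+ 2.
Proof.
move=> /davies_gaffney_ind [C [c [C0 c0 DG]]] kappa0.
set p := kappa.*2.-1.
(* The rate 16 is the one that [exp_dominates] asks for. *)
have [i0 hi0] : exists i0 : nat, 16 * c <= 4 ^+ i0.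
  have := @archi_boundP R (16 * c) (mulr_ge0 (ler0n _ _) (ltW c0)); set n := Num.bound _ => hn.
  exists n; rewrite (le_trans (ltW hn))// -natrX ler_nat ltnW// ltn_expl//.
have K0 : 0 <= 2 * C ^+ 2 * p%:R ^+ p.
  by apply: mulr_ge0; [apply: mulr_ge0 => //; exact: sqr_ge0|exact: exprn_ge0].
exists ((2 ^+ p) ^+ i0 * (2 * C ^+ 2 * p%:R ^+ p + 2)).
  by apply: mulr_ge0; [rewrite !exprn_ge0|exact: addr_ge0 K0 _].
move=> r M k i A B v r0 gk bk mA mB sep.
have M0 := good_ge0 gk; case: gk => kb kh.
have D1 : (1 : R) <= 2 ^+ p by rewrite exprn_ege1// ler1n.
have [ii|ii] := ltnP i i0.
  have h : nm (ind A (mult (fun l => (k l)%:C%C) (ind B v))) <= M * nm v.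
    apply: (le_trans (nm_ind _ mA)).
    apply: le_trans (mult_le (spv E) complete (ind B v) bk (M := M) _) _.
      by move=> l l0; rewrite cmodR; exact: kb.
    by rewrite ler_wpM2l// nm_ind.
  apply: (@le_trans _ _ ((M * nm v) ^+ 2 * (2 ^+ p) ^+ i0)).
    apply: ler_pM; rewrite ?sqr_ge0 ?exprn_ge0//.
      by rewrite ler_pXn2r ?nnegrE ?mulr_ge0 ?nm_ge0.
    by rewrite ler_weXn2l// ltnW.
  rewrite [leRHS](_ : _ = (M * nm v) ^+ 2 * (2 ^+ p) ^+ i0 * (2 * C ^+ 2 * p%:R ^+ p + 2)); last by ring.
  rewrite ler_peMr//; last by move: K0; lra.
  by apply: mulr_ge0; [exact: sqr_ge0|rewrite !exprn_ge0].
have [ieq|ipos] := posnP i.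
  have h : nm (ind A (mult (fun l => (k l)%:C%C) (ind B v))) <= M * nm v.
    apply: (le_trans (nm_ind _ mA)).
    apply: le_trans (mult_le (spv E) complete (ind B v) bk (M := M) _) _.
      by move=> l l0; rewrite cmodR; exact: kb.
    by rewrite ler_wpM2l// nm_ind.
  move: ii; rewrite ieq leqn0 => /eqP ->; rewrite !expr0 mulr1 mul1r.
  apply: (@le_trans _ _ ((M * nm v) ^+ 2)).
    by rewrite ler_pXn2r ?nnegrE ?mulr_ge0 ?nm_ge0.
  rewrite [leRHS](_ : _ = (M * nm v) ^+ 2 * (2 * C ^+ 2 * p%:R ^+ p + 2)); last by ring.
  by rewrite ler_peMr ?sqr_ge0//; move: K0; lra.
case: sep => [i00|AB]; first by rewrite i00 in ipos.
pose n := (2 ^ (i - i0))%N; have n0 : (0 < n)%N by rewrite expn_gt0.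
have nR : n%:R = 2 ^+ (i - i0) :> R by rewrite natrX.
have [f rf hf] := kh _ n0.
have rho0 : 0 < 2 ^+ i * r by rewrite mulr_gt0// exprn_gt0.
have [bf hm] := mult_ind_poly v C0 c0 r0 rho0 DG rf mA mB AB.
set a := nm (ind A (mult (fun l => (f _)%:C%C) _)) in hm.
set b := nm (mult (fun l => (k l)%:C%C - (f (gexp r l))%:C%C) (ind B v)).
have tri : nm (ind A (mult (fun l => (k l)%:C%C) (ind B v))) <= a + b.
  rewrite (_ : mult (fun l => (k l)%:C%C) (ind B v) = mult (fun l => (f (gexp r l))%:C%C) (ind B v) +
    mult (fun l => (k l)%:C%C - (f (gexp r l))%:C%C) (ind B v)).
    by rewrite indD//; apply: (le_trans (nmD ipP _ _)); rewrite lerD2l; exact: nm_ind.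
  by rewrite [X in _ = _ + X](multB (spv E) complete)// addrC subrK.
have np0 : 0 < (n%:R : R) ^+ p by rewrite exprn_gt0// ltr0n.
have hb : b ^+ 2 * n%:R ^+ p <= M ^+ 2 * nm v ^+ 2.
  have hb1 : b <= M / Num.sqrt (n%:R ^+ p) * nm (ind B v).
    apply: (mult_le (spv E) complete) => [|l l0]; first exact: bsymB.
    rewrite -rmorphB cmodR ler_pdivlMr ?sqrtr_gt0//.
    rewrite -(@ler_pXn2r _ 2) ?nnegrE ?mulr_ge0 ?sqrtr_ge0//.
    by rewrite exprMn (@sqr_sqrtr _ (n%:R ^+ p)) ?(ltW np0)// real_normK ?num_real// hf.
  have hb2 : b <= M / Num.sqrt (n%:R ^+ p) * nm v.
    apply: (le_trans hb1); rewrite ler_wpM2l ?divr_ge0 ?sqrtr_ge0//; exact: nm_ind.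
  have := hb2; rewrite -(@ler_pXn2r _ 2) ?nnegrE ?mulr_ge0 ?divr_ge0 ?sqrtr_ge0 ?nm_ge0//.
  rewrite exprMn expr_div_n (@sqr_sqrtr _ (n%:R ^+ p)) ?(ltW np0)// mulrAC ler_pdivlMr//.
have ha : a ^+ 2 * n%:R ^+ p <= M ^+ 2 * C ^+ 2 * p%:R ^+ p * nm v ^+ 2.
  have ha1 : a <= (M * C * nm v) * (n.+1%:R * 7 ^+ n * expR (- (16 * n%:R))).
    apply: (le_trans hm).
    rewrite [leLHS](_ : _ = M * C * nm v * (n.+1%:R * 7 ^+ n *
      expR (- ((2 ^+ i * r) ^+ 2 / (c * (n%:R * r ^+ 2)))))); last by ring.
    rewrite ler_wpM2l ?mulr_ge0 ?nm_ge0 ?(ltW C0)// ler_wpM2l ?mulr_ge0 ?exprn_ge0//.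
    rewrite ler_expR lerN2.
    have -> : (2 ^+ i * r) ^+ 2 / (c * (n%:R * r ^+ 2)) = 4 ^+ i0 * n%:R / c.
      have -> : (2 : R) ^+ i = 2 ^+ i0 * n%:R by rewrite nR -exprD subnKC.
      have -> : (4 : R) ^+ i0 = (2 ^+ i0) ^+ 2 by rewrite exprAC (_ : (2 : R) ^+ 2 = 4)// -natrX.
      by field; rewrite !gt_eqF// ltr0n.
    by rewrite ler_pdivlMr// mulrAC ler_wpM2r.
  apply: (@le_trans _ _ ((M * C * nm v) ^+ 2 * ((n.+1%:R * 7 ^+ n * expR (- (16 * n%:R))) ^+ 2 * n%:R ^+ p))).
    rewrite mulrA ler_wpM2r ?(ltW np0)// -exprMn ler_pXn2r ?nnegrE ?nm_ge0//.
    by rewrite !mulr_ge0 ?nm_ge0 ?expR_ge0 ?exprn_ge0// ltW.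
  rewrite (_ : M ^+ 2 * C ^+ 2 * p%:R ^+ p * nm v ^+ 2 = (M * C * nm v) ^+ 2 * p%:R ^+ p); last by ring.
  by rewrite ler_wpM2l ?sqr_ge0// exp_dominates.
have -> : (2 ^+ p) ^+ i = n%:R ^+ p * (2 ^+ p) ^+ i0 :> R.
  by rewrite nR !(exprAC _ p) -exprMn -exprD subnK.
rewrite mulrA [leRHS](_ : _ = (2 * (M ^+ 2 * C ^+ 2 * p%:R ^+ p * nm v ^+ 2) +
  2 * (M ^+ 2 * nm v ^+ 2)) * (2 ^+ p) ^+ i0); last by ring.
rewrite ler_wpM2r ?exprn_ge0//.
apply: (@le_trans _ _ ((2 * a ^+ 2 + 2 * b ^+ 2) * n%:R ^+ p)); last first.
  by rewrite mulrDl; apply: lerD; rewrite -(mulrA 2) ler_pM2l.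
rewrite ler_wpM2r ?(ltW np0)//.
have ab : nm (ind A (mult (fun l => (k l)%:C%C) (ind B v))) ^+ 2 <= (a + b) ^+ 2.
  by rewrite ler_pXn2r ?nnegrE ?addr_ge0 ?nm_ge0.
exact: le_trans ab (sqrD_le2 _ _).
Qed.

Lemma good_off_diagonal_complex kappa : davies_gaffney E -> (0 < kappa)%N ->
  exists2 C : R, 0 <= C & forall (r M : R) k1 k2 i A B v, 0 < r ->
    good kappa r M k1 -> good kappa r M k2 ->
    bsym (fun l => (k1 l)%:C%C) -> bsym (fun l => (k2 l)%:C%C) -> measurable A -> measurable B ->
    i = 0%N \/ apart (2 ^+ i * r) A B ->
    nm (ind A (mult (fun l => Complex (k1 l) (k2 l)) (ind B v))) ^+ 2 * (2 ^+ kappa.*2.-1) ^+ i <=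
      C * M ^+ 2 * nm v ^+ 2.
Proof.
move=> DG k0; have [C C0 hC] := good_off_diagonal DG k0.
exists (4 * C); first by rewrite mulr_ge0.
move=> r M k1 k2 i A B v r0 g1 g2 b1 b2 mA mB sep.
have h1 := hC r M k1 i A B v r0 g1 b1 mA mB sep.
have h2 := hC r M k2 i A B v r0 g2 b2 mA mB sep.
rewrite (_ : (fun l => _) = fun l => (k1 l)%:C%C + 'i%C * (k2 l)%:C%C); last first.
  by apply/funext => l; simpc.
rewrite (multD (spv E) complete)//; last exact: bsymZ.
rewrite (multZ (spv E) complete)// indD// indZ//.
set x := ind A _ in h1 *; set y := ind A _ in h2 *.
have -> : 4 * C * M ^+ 2 * nm v ^+ 2 = 2 * (C * M ^+ 2 * nm v ^+ 2) + 2 * (C * M ^+ 2 * nm v ^+ 2) by ring.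
set D := _ ^+ i in h1 h2 *; have D0 : 0 <= D by rewrite !exprn_ge0.
have h3 : nm (x + 'i%C *: y) <= nm x + nm y.
  apply: (le_trans (nmD ipP _ _)); rewrite (nmZ ipP) (_ : cmod 'i%C = 1) ?mul1r//.
  by rewrite cmodE /= expr0n add0r expr1n sqrtr1.
have h4 : nm (x + 'i%C *: y) ^+ 2 <= 2 * nm x ^+ 2 + 2 * nm y ^+ 2.
  apply: (@le_trans _ _ ((nm x + nm y) ^+ 2)).
    by rewrite ler_pXn2r ?nnegrE ?addr_ge0 ?nm_ge0.
  exact: sqrD_le2.
apply: (le_trans (ler_wpM2r D0 h4)).
exact: double_add_le h1 h2.
Qed.

End kernel_off_diagonal.

(** * Volume growth, separability and measurability of the distance *)

Section growth.
Context d (R : realType) (Omega : borelMetricType d R).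
Variable mu : {measure set Omega -> \bar R}.

(** Iterated doubling. It ensures that the infimum [homogeneous_dim] is taken over a nonempty
    set. *)
Lemma growth_exponent_exists : homogeneous_space mu -> exists q : R, growth_exponent mu q.
Proof.
move=> [hv [C C0 dbl]]; pose D := 1 + C.
have D1 : 1 <= D by rewrite lerDl ltW.
have [n n0 Dn] : exists2 n : nat, (0 < n)%N & D <= 2 ^+ n.
  have := archi_boundP (le_trans ler01 D1); set n := Num.bound _ => hn.
  exists n; last by rewrite (le_trans (ltW hn))// -natrX ler_nat ltnW// ltn_expl.
  by case: (n) hn => // h; have := lt_le_trans h ler01; rewrite ltNge D1.
have step x t k : 0 < t -> (vol mu x (2 ^+ k * t) <= (D ^+ k)%:E * vol mu x t)%E.
  move=> t0; elim: k => [|k ih]; first by rewrite !expr0 mul1r mul1e.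
  have tk : 0 < 2 ^+ k * t by rewrite mulr_gt0// exprn_gt0.
  rewrite exprS -mulrA; apply: le_trans (dbl _ _ tk) _.
  rewrite exprS EFinM -muleA; apply: lee_pmul => //; first by rewrite lee_fin ltW.
  by rewrite lee_fin lerDr.
exists n%:R; split; first by rewrite ltr0n.
exists D; first exact: lt_le_trans ltr01 D1.
move=> x t s t0 s1.
have ex : exists k, s <= 2 ^+ k.
  have := archi_boundP (ltW (lt_trans ltr01 s1)); set k := Num.bound _ => hk.
  by exists k; rewrite (le_trans (ltW hk))// -natrX ler_nat ltnW// ltn_expl.
case: (ex_minnP ex) => [[|k]] sk kmin; first by move: sk; rewrite expr0 leNgt s1.
have ks : 2 ^+ k < s by rewrite ltNge; apply/negP => /kmin; rewrite ltnn.
have sub : (vol mu x (s * t) <= vol mu x (2 ^+ k.+1 * t))%E.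
  apply: le_measure; rewrite ?inE; try by rewrite measurable_borelE; apply: sub_sigma_algebra; exact: metric_ball_open.
  by apply: le_ball; rewrite ler_wpM2r// ltW.
apply: (le_trans sub); apply: le_trans (step _ _ _ t0) _.
have /andP[v0 _] : (0 <= vol mu x t)%E && true by rewrite measure_ge0.
apply: lee_wpmul2r => //; rewrite lee_fin exprS ler_wpM2l ?(le_trans ler01)//.
rewrite powR_mulrn ?(le_trans ler01) ?(ltW s1)//.
have D0 := le_trans ler01 D1; have s0 := ltW (lt_trans ltr01 s1).
apply: (@le_trans _ _ ((2 ^+ n) ^+ k)); first by apply: lerXn2r; rewrite ?nnegrE ?exprn_ge0.
by rewrite exprAC; apply: lerXn2r; rewrite ?nnegrE ?exprn_ge0 ?(ltW ks).
Qed.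

(** The hypothesis on kappa says n_0 < 2 kappa - 1, so some growth exponent q lies below 2 kappa -
    1, and theta = 2^q. *)
Lemma dyadic_growth kappa : homogeneous_space mu -> (homogeneous_dim mu + 1) / 2 < kappa%:R ->
  (0 < kappa)%N /\ exists theta C0 : R, [/\ 1 <= theta, theta < 2 ^+ kappa.*2.-1, 0 < C0 &
    forall (x : Omega) (t : R) k, 0 < t ->
      fine (vol mu x (2 ^+ k * t)) <= C0 * theta ^+ k * fine (vol mu x t)].
Proof.
move=> hs hk; have [hv _] := hs; have [q0 hq0] := growth_exponent_exists hs.
have d0 : 0 <= homogeneous_dim mu.
  by apply: lb_le_inf; [exists q0|move=> q [/ltW]].
have k0 : (0 < kappa)%N.
  case: (kappa) hk => // hk; exfalso; move: hk; rewrite ltNge divr_ge0// addr_ge0//.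
split=> //; have dk : homogeneous_dim mu < (kappa.*2.-1)%:R.
  have -> : (kappa.*2.-1)%:R = 2 * kappa%:R - 1 :> R.
    by rewrite -subn1 natrB ?double_gt0// -mul2n natrM.
  by move: hk; rewrite ltr_pdivrMr//; lra.
have [q [q_gt0 [C0 C00 gq]] qk] := inf_lt (ex_intro _ q0 hq0) dk.
(* Growth is given for s > 1 only; adding 1 to the constant covers k = 0. *)
exists (2 `^ q), (C0 + 1); split.
- by have := @ler_powR R 2 (ler1n _ _) 0 q (ltW q_gt0); rewrite powRr0.
- by rewrite -powR_mulrn// /powR gt_eqF// ltr_expR ltr_pM2r// ln_gt0// ltr1n.
- by rewrite addr_gt0.
move=> x t [|k] t0; have [v0 vy] := hv x t t0.
  by rewrite !expr0 mul1r mulr1 ler_peMl ?fine_ge0 ?(ltW v0)// lerDr ltW.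
have k1 : 1 < 2 ^+ k.+1 :> R by rewrite exprn_egt1// ltr1n.
have := gq x t _ t0 k1; have [w0 wy] := hv x (2 ^+ k.+1 * t) (mulr_gt0 (lt_trans ltr01 k1) t0).
rewrite -[vol mu x t]fineK ?ge0_fin_numE ?(ltW v0)//.
rewrite -[vol mu x (2 ^+ _ * t)]fineK ?ge0_fin_numE ?(ltW w0)// -EFinM lee_fin => h.
apply: (le_trans h); rewrite ler_wpM2r ?fine_ge0 ?(ltW v0)//.
have e : (2 ^+ k.+1) `^ q = (2 `^ q) ^+ k.+1 :> R.
  rewrite -(@powR_mulrn R 2 k.+1)// -(@powR_mulrn R (2 `^ q) k.+1 (powR_ge0 _ _)).
  by rewrite -powRrM mulrC powRrM.
by rewrite e ler_wpM2r ?exprn_ge0 ?powR_ge0// lerDl.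
Qed.

End growth.

Lemma seq_disjoint_measure d (T : measurableType d) (R : realType)
    (mu : {measure set T -> \bar R}) (I : eqType) (F : I -> set T) (s : seq I) (S : set T) :
  (forall i, measurable (F i)) -> measurable S ->
  pairwise (fun i j => `[< F i `&` F j = set0 >]) s ->
  (\sum_(i <- s) mu (F i `&` S) <= mu S)%E.
Proof.
move=> mF; elim: s S => [|i s ih] S mS /=; first by rewrite big_nil.
move=> /andP[/allP hi hs]; rewrite big_cons.
have -> : mu S = (mu (F i `&` S) + mu (S `\` F i))%E.
  rewrite -measureU; [|exact: measurableI|exact: measurableD|].
    congr (mu _); apply/seteqP; split=> [x Sx|x [][]//].
    by have [Fx|nFx] := pselect (F i x); [left|right].
  by rewrite -subset0 => x [[]] ? ? [].
apply: leeD => //; apply: le_trans (ih _ (measurableD mS (mF i)) hs).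
rewrite big_seq [leRHS]big_seq; apply: lee_sum => j js.
apply: le_measure; rewrite ?inE; [exact: measurableI|by apply: measurableI => //; exact: measurableD|].
move=> x [Fj Sx]; split=> //; split=> // Fi.
by have /asboolP h := hi _ js; have : (F i `&` F j) x by []; rewrite h.
Qed.

Section space.
Context d (R : realType) (Omega : borelMetricType d R).
Variable mu : {measure set Omega -> \bar R}.
Variables (C0 theta : R).
Hypothesis hv : forall (x : Omega) (t : R), 0 < t -> (0 < vol mu x t)%E /\ (vol mu x t < +oo)%E.
Hypothesis C00 : 0 < C0.
Hypothesis theta1 : 1 <= theta.
Hypothesis growth : forall (x : Omega) (t : R) k, 0 < t ->
  fine (vol mu x (2 ^+ k * t)) <= C0 * theta ^+ k * fine (vol mu x t).
Implicit Types (x y z : Omega) (r s t : R).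

Lemma ball_measurable x r : measurable (ball x r).
Proof. by rewrite measurable_borelE; apply: sub_sigma_algebra; exact: metric_ball_open. Qed.

Lemma volE x t : 0 < t -> vol mu x t = (fine (vol mu x t))%:E.
Proof. by move=> /(hv x) [v0 vy]; rewrite fineK// ge0_fin_numE ?ltW. Qed.

Lemma fvol_gt0 x t : 0 < t -> 0 < fine (vol mu x t).
Proof. by move=> /(hv x) [v0 vy]; rewrite fine_gt0// v0. Qed.

Lemma ball_sub x y r s : mdist x y + r <= s -> ball y r `<=` ball x s.
Proof.
move=> h z; rewrite !ballEmdist/= => yz.
by rewrite (le_lt_trans (metric_triangle x y z))// (lt_le_trans _ h)// ltrD2l.
Qed.

Lemma vol_sub x y r s : mdist x y + r <= s -> (vol mu y r <= vol mu x s)%E.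
Proof.
by move=> h; apply: le_measure; rewrite ?inE; [exact: ball_measurable|exact: ball_measurable|exact: ball_sub].
Qed.

Lemma theta_gt0 : 0 < theta. Proof. exact: lt_le_trans theta1. Qed.

Lemma vol_growth x y r s k : 0 < r -> 0 < s -> mdist x y + r <= 2 ^+ k * s ->
  fine (vol mu y r) <= C0 * theta ^+ k * fine (vol mu x s).
Proof.
move=> r0 s0 h; apply: le_trans (growth _ _ s0).
have k0 : 0 < 2 ^+ k * s by rewrite mulr_gt0// exprn_gt0.
by apply: fine_le; [rewrite volE|rewrite volE|exact: vol_sub].
Qed.

(** A maximal e-separated subset of the ball is a net. Its size is bounded because the balls of
    radius e/2 about its points are disjoint, lie in the ball of radius r + e, and each has at least
    1/K of its volume. *)
Lemma finite_net x0 r (e : R) : 0 < e -> 0 < r -> exists s : seq Omega,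
  forall y, mdist x0 y < r -> exists2 z, z \in s & mdist z y < e.
Proof.
move=> e0 r0.
pose sep n := exists s : seq Omega, [/\ size s = n, {in s, forall z, mdist x0 z < r} &
  pairwise (fun a b => e <= mdist a b) s].
have [k hk] : exists k : nat, 2 * (r + e) <= 2 ^+ k * (e / 2).
  have h0 : 0 <= 2 * (r + e) / (e / 2) by rewrite divr_ge0 ?mulr_ge0 ?addr_ge0 ?ltW// divr_gt0.
  have := archi_boundP h0; set k := Num.bound _ => hk.
  exists k; rewrite -ler_pdivrMr ?divr_gt0// (le_trans (ltW hk))// -natrX ler_nat ltnW// ltn_expl//.
have e2 : 0 < e / 2 by rewrite divr_gt0.
have re : 0 < r + e by rewrite addr_gt0.
pose K := C0 * theta ^+ k; have K0 : 0 < K by rewrite mulr_gt0 ?exprn_gt0 ?theta_gt0.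
pose N := Num.bound K.
have bound n : sep n -> (n <= N)%N.
  move=> [s [sn sb sp]].
  have vs z : z \in s -> fine (vol mu x0 (r + e)) <= K * fine (vol mu z (e / 2)).
    move=> zs; apply: vol_growth => //; apply: le_trans hk.
    rewrite (metric_sym z x0); have := sb _ zs; have := e0; have := r0; lra.
  have := @seq_disjoint_measure _ _ _ mu _ (fun z => ball z (e / 2)) s (ball x0 (r + e))
    (fun z => ball_measurable _ _) (ball_measurable _ _) _.
  have sd : pairwise (fun a b => `[< ball a (e / 2) `&` ball b (e / 2) = set0 >]) s.
    apply: sub_pairwise sp => a b ab; apply/asboolP; rewrite -subset0 => z [].
    rewrite !ballEmdist/= => az bz; have := metric_triangle a z b.
    by rewrite (metric_sym z b) => h; move: ab az bz h; lra.
  move=> /(_ sd) h.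
  have h2 : (\sum_(z <- s) (fine (vol mu z (e / 2)))%:E <= (fine (vol mu x0 (r + e)))%:E)%E.
    rewrite -volE//; apply: le_trans h; rewrite big_seq [leRHS]big_seq; apply: lee_sum => z zs.
    rewrite -volE// setIidl//; apply: ball_sub.
    by have := sb _ zs; have := e0; have := r0; lra.
  move: h2; rewrite sumEFin lee_fin => h2.
  have h3 : n%:R * fine (vol mu x0 (r + e)) <= K * fine (vol mu x0 (r + e)).
    apply: (@le_trans _ _ (K * \sum_(z <- s) fine (vol mu z (e / 2)))); last by rewrite ler_pM2l.
    rewrite mulr_sumr -sn -sum1_size natr_sum mulr_suml big_seq [leRHS]big_seq.
    by apply: ler_sum => z zs; rewrite mul1r; exact: vs.
  rewrite ler_pM2r ?fvol_gt0// in h3.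
  by rewrite -(ler_nat R) (le_trans h3)// ltW// archi_boundP// ltW.
have ex : exists n, `[< sep n >] by exists 0%N; apply/asboolP; exists [::].
have bd n : `[< sep n >] -> (n <= N)%N by move=> /asboolP; exact: bound.
case: (ex_maxnP ex bd) => n /asboolP[s [sn sb sp]] nmax; exists s => y yr.
apply: contrapT => hn; suff : (n.+1 <= n)%N by rewrite ltnn.
apply: nmax; apply/asboolP; exists (y :: s); split; first by rewrite /= sn.
  by move=> z; rewrite inE => /predU1P[->//|]; exact: sb.
rewrite /= sp andbT; apply/allP => z zs; rewrite leNgt; apply/negP => yz; apply: hn.
by exists z => //; rewrite metric_sym.
Qed.

(** Enumerates the nets of all integer radii and precisions. Separability makes the distance jointly
    measurable and the weight a supremum over countably many balls. *)
Lemma dense_sequence (x0 : Omega) : exists y : nat -> Omega,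
  forall x (e : R), 0 < e -> exists n, mdist x (y n) < e.
Proof.
have net (mn : nat * nat) : exists s : seq Omega, forall y, mdist x0 y < mn.1.+1%:R ->
    exists2 z, z \in s & mdist z y < mn.2.+1%:R^-1.
  by apply: finite_net; rewrite ?invr_gt0 ltr0n.
have [f hf] := choice net.
pose dec k := if unpickle k is Some (mn, i) then nth x0 (f mn) i else x0.
exists dec => x e e0.
have [m hm] : exists m : nat, mdist x0 x < m.+1%:R.
  by exists (Num.bound (mdist x0 x)); rewrite (lt_trans (archi_boundP (mdist_ge0 _ _)))// ltr_nat.
have [n hn] : exists n : nat, n.+1%:R^-1 < e.
  have ei : 0 <= e^-1 by rewrite invr_ge0 ltW.
  exists (Num.bound e^-1); rewrite invf_plt ?posrE ?ltr0n//.
  by rewrite (lt_trans (archi_boundP ei))// ltr_nat.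
have [z zs zx] := hf (m, n) x hm.
exists (pickle ((m, n), index z (f (m, n)))); rewrite /dec pickleK nth_index// metric_sym.
exact: lt_trans hn.
Qed.

(* Countably many balls, approximating every ball from inside. *)
Lemma ball_sequence (x0 : Omega) : exists cb : nat -> Omega * R,
  (forall n, 0 < (cb n).2) /\
  forall x s, 0 < s -> exists n, [/\ mdist x (cb n).1 < s / 4, s / 4 < (cb n).2 & (cb n).2 < s / 2].
Proof.
have [y hy] := dense_sequence x0.
(* Rational radii, replaced by 1 when not positive, so that every index gives a genuine ball. *)
pose rad (q : rat) : R := if 0 < ratr q :> R then ratr q else 1.
pose cb k := if unpickle k is Some (n, q) then (y n, rad q) else (x0, 1).
exists cb; split.
  move=> n; rewrite /cb; case: (unpickle n) => [[k q]|]//=.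
  by rewrite /rad; case: ifP.
move=> x s s0; have s4 : 0 < s / 4 by rewrite divr_gt0.
have [n hn] := hy x _ s4.
have ss : s / 4 < s / 2 by lra.
have [q /[!in_itv]/= /andP[q1 q2]] := rat_in_itvoo ss.
exists (pickle (n, q)); rewrite /cb pickleK /= /rad (lt_trans s4 q1).
by split.
Qed.

(** By density, d(u, v) >= a exactly when d(y n, u) + d(y n, v) >= a for all n. This expresses the
    level sets by products of functions of one variable, hence in the product sigma-algebra. *)
Lemma mdist_measurable (x0 : Omega) :
  measurable_fun [set: Omega * Omega] (fun p => mdist p.1 p.2).
Proof.
have mdx (y : Omega) : measurable_fun [set: Omega] (mdist y).
  apply: (measurability _ (RGenCInfty.measurableE R)) => //.
  move=> _ [_ [a ->] <-]; rewrite setTI.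
  rewrite [X in measurable X](_ : _ = ~` ball y a).
    by apply: measurableC; exact: ball_measurable.
  by apply/seteqP; split=> z /=; rewrite ballEmdist/= in_itv/= andbT leNgt => /negP.
have [y hy] := dense_sequence x0.
apply: (measurability _ (RGenCInfty.measurableE R)) => //.
move=> _ [_ [a ->] <-]; rewrite setTI.
rewrite [X in measurable X](_ : _ = \bigcap_n [set p : Omega * Omega | a <= mdist (y n) p.1 + mdist (y n) p.2]).
  apply: bigcap_measurableType => n _.
  have mf : measurable_fun [set: Omega * Omega] (fun p => mdist (y n) p.1 + mdist (y n) p.2).
    by apply: measurable_funD; apply: measurableT_comp => //; exact: mdx.
  have := mf measurableT _ (measurable_itv `[a, +oo[); rewrite setTI.
  by congr measurable; apply/seteqP; split=> p /=; rewrite in_itv/= andbT.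
apply/seteqP; split=> [[u v]|[u v]] /=; rewrite in_itv/= andbT.
  move=> h n _ /=; apply: (le_trans h).
  by rewrite (metric_sym (y n) u); exact: metric_triangle.
move=> h; rewrite leNgt; apply/negP => uv.
have e0 : 0 < (a - mdist u v) / 2 by rewrite divr_gt0// subr_gt0.
have [n hn] := hy u _ e0; have := h n I; rewrite /= => h'.
have := metric_triangle (y n) u v; rewrite (metric_sym (y n) u) in h' * => t.
by move: hn h' t; lra.
Qed.

Lemma space_sigma_finite (x0 : Omega) : sigma_finite setT mu.
Proof.
exists (fun n => ball x0 n.+1%:R).
  apply/esym; rewrite -subTset => x _; exists (Num.bound (mdist x0 x)) => //.
  by rewrite ballEmdist/= (lt_trans (archi_boundP (mdist_ge0 _ _)))// ltr_nat.
move=> n; split; first exact: ball_measurable.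
exact: (hv x0 (ltr0Sn _ n)).2.
Qed.

End space.

Section sigma_finite_package.
Context d (T : measurableType d) (R : realType).
Variable mu : {measure set T -> \bar R}.
Hypothesis sf : sigma_finite setT mu.

Let sfm : set T -> \bar R := mu.
HB.instance Definition _ := Measure.on sfm.
HB.instance Definition _ := @Measure_isSigmaFinite.Build d T R sfm sf.

(** Tonelli's theorem is applied to measures bundled as sigma-finite; here the given measure is
    bundled without being changed. *)
Lemma sigma_finite_package :
  exists nu : {sigma_finite_measure set T -> \bar R}, (nu : {measure set T -> \bar R}) = mu.
Proof. by exists sfm; exact: eq_measure. Qed.

End sigma_finite_package.

(** * Extended inverses, layer-cake formula and covering *)

Section extended_inverse.
Context {R : realType}.
Implicit Types (x y : \bar R) (c : R).
Local Open Scope ereal_scope.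

(* [0^-1 = +oo] and [(+oo)^-1 = 0]. *)
Definition iv x : \bar R :=
  if x is r%:E then (if (r <= 0)%R then +oo else (r^-1)%:E)
  else if x == +oo then 0 else +oo.

Lemma le_iv c x : (0 < c)%R -> (c%:E <= iv x) = (x <= (c^-1)%:E).
Proof.
move=> c0; have ci : (0 < c^-1)%R by rewrite invr_gt0.
case: x => [r| |] /=.
- case: ifPn => [r0|]; first by rewrite leey lee_fin (le_trans r0) ?ltW.
  rewrite -ltNge => r0; rewrite !lee_fin.
  by rewrite -[in RHS](invrK r) lef_pV2 ?posrE ?invr_gt0.
- by rewrite lee_fin leNgt c0 leye_eq.
- by rewrite leey leNye.
Qed.

Lemma iv_ge0 x : 0 <= iv x.
Proof.
case: x => [r| |] //=; case: ifPn => //; rewrite -ltNge => r0.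
by rewrite lee_fin invr_ge0 ltW.
Qed.

Lemma le_test x y : 0 <= y -> (forall c, (0 < c)%R -> c%:E <= x -> c%:E <= y) -> x <= y.
Proof.
move=> y0 h; case: x h => [r| |] h; last exact: leNye.
  have [r0|r0] := leP r 0%R; first by rewrite (le_trans _ y0)// lee_fin.
  exact: h.
case: y y0 h => [r| |] // r0 h.
have := h (r + 1)%R; rewrite leey lee_fin => /(_ _ isT); rewrite ltr_wpDl// => /(_ isT).
by rewrite leNgt ltrDl ltr01.
Qed.

(** Upper bounds on an inverse are tested on the positive reals a above x, which hides the infinite
    cases. *)
Lemma iv_test x y c : (0 < c)%R -> 0 <= y ->
  (forall a, (0 < a)%R -> x <= a%:E -> (c / a)%:E <= y) -> c%:E * iv x <= y.
Proof.
move=> c0 y0 h; apply: le_test => // b b0; rewrite -lee_pdivrMl// -EFinM le_iv; last first.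
  by rewrite mulr_gt0// invr_gt0.
move=> /(h _ _); rewrite invr_gt0 mulr_gt0 ?invr_gt0// => /(_ isT).
by rewrite invrK mulrA divff ?mul1r// gt_eqF.
Qed.

Lemma iv_measurable : measurable_fun setT iv.
Proof.
apply: (measurability _ (ErealGenCInfty.measurableE R)) => //.
move=> _ [_ [r ->] <-]; rewrite setTI.
have [r0|r0] := leP r 0%R.
  rewrite [X in measurable X](_ : _ = setT)//; apply/seteqP; split=> // x _ /=.
  by rewrite in_itv/= andbT (le_trans _ (iv_ge0 x))// lee_fin.
rewrite [X in measurable X](_ : _ = [set x | x <= (r^-1)%:E]).
  have := emeasurable_fun_infty_c measurableT (@measurable_id _ (\bar R) setT) (r^-1)%:E.
  by rewrite setTI.
by apply/seteqP; split=> x /=; rewrite in_itv/= andbT le_iv.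
Qed.

Definition chi (b : bool) : \bar R := if b then 1 else 0.

Lemma chi_ge0 b : 0 <= chi b. Proof. by case: b. Qed.

Lemma chi_measurable d (T : measurableType d) (b : T -> bool) :
  measurable [set z | b z] -> measurable_fun setT (fun z => chi (b z)).
Proof.
move=> mb; rewrite (_ : (fun _ => _) = fun z => (\1_[set z | b z] z)%:E).
  by apply/measurable_EFinP; exact: measurable_indic.
apply/funext => z; rewrite indicE /chi; case: (boolP (b z)) => bz; first by rewrite mem_set.
by rewrite memNset//=; exact/negP.
Qed.

Lemma integral_chi d (T : measurableType d) (mu : {measure set T -> \bar R}) (f : T -> \bar R)
    (b : T -> bool) :
  \int[mu]_(z in [set z | b z]) f z = \int[mu]_z (f z * chi (b z)).
Proof.
rewrite integral_mkcond; apply: eq_integral => x _.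
rewrite patchE /chi; case: (boolP (b x)) => bx; first by rewrite mem_set ?mule1.
by rewrite memNset ?mule0//=; exact/negP.
Qed.

End extended_inverse.
Arguments iv_measurable {R}.

Lemma lte_measurable d (T : measurableType d) (R : realType) (f g : T -> \bar R) :
  measurable_fun setT f -> measurable_fun setT g -> measurable [set x | (f x < g x)%E].
Proof.
move=> mf mg; have -> : [set x | (f x < g x)%E] =
    \bigcup_(q : rat) ([set x | (f x < (ratr q)%:E)%E] `&` [set x | ((ratr q)%:E < g x)%E]).
  apply/seteqP; split=> [x /= fg|x [q _ [/= h1 h2]]]; last exact: lt_trans h1 h2.
  suff [q h1 h2] : exists2 q : rat, (f x < (ratr q)%:E)%E & ((ratr q)%:E < g x)%E by exists q.
  case: (f x) fg => [r| |]; case: (g x) => [s| |] //.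
  - by rewrite lte_fin => /rat_in_itvoo[q]; rewrite in_itv/= => /andP[? ?]; exists q; rewrite lte_fin.
  - move=> _; have := @rat_in_itvoo R r (r + 1); rewrite ltrDl ltr01 => /(_ isT)[q].
    by rewrite in_itv/= => /andP[h _]; exists q; rewrite ?lte_fin ?ltry.
  - move=> _; have := @rat_in_itvoo R (s - 1) s; rewrite ltrBlDr ltrDl ltr01 => /(_ isT)[q].
    by rewrite in_itv/= => /andP[_ h]; exists q; rewrite ?lte_fin ?ltNyr.
  - by move=> _; exists 0; rewrite ?ltry ?ltNyr.
apply: bigcupT_measurable_rat => q; apply: measurableI.
  have := emeasurable_fun_infty_o measurableT mf (ratr q)%:E; by rewrite setTI.
have := emeasurable_fun_o_infty measurableT mg (ratr q)%:E; by rewrite setTI.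
Qed.

Section layer_cake.
Context d (T : measurableType d) (R : realType).
Variable mu : {sigma_finite_measure set T -> \bar R}.
Local Notation leb := (@lebesgue_measure R).
Local Open Scope ereal_scope.

(** Tonelli's theorem, with f x written as the length of the set of levels a in (0, f x). *)
Lemma layer_cake (g f : T -> \bar R) : measurable_fun setT g -> measurable_fun setT f ->
  (forall x, 0 <= g x) -> (forall x, 0 <= f x) ->
  \int[mu]_x (g x * f x) = \int[leb]_(a in [set a | (0 < a)%R]) \int[mu]_x (g x * chi (a%:E < f x)).
Proof.
move=> mg mf g0 f0.
pose F (p : T * measurableTypeR R) := g p.1 * (chi (p.2%:E < f p.1) * chi (0 < p.2)%R).
have mF : measurable_fun setT F.
  apply: emeasurable_funM; first exact: measurableT_comp mg measurable_fst.
  apply: emeasurable_funM; apply: chi_measurable.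
    apply: lte_measurable; last exact: measurableT_comp mf measurable_fst.
    by apply/measurable_EFinP; exact: measurable_snd.
  have := measurable_snd (T1 := T) (T2 := measurableTypeR R) measurableT _ (measurable_itv `]0%R, +oo[).
  by rewrite setTI; congr measurable; apply/seteqP; split=> p /=; rewrite in_itv/= andbT.
have F0 p : 0 <= F p by rewrite !mule_ge0 ?chi_ge0.
have mc x : measurable_fun setT (fun a : measurableTypeR R => chi (a%:E < f x) * chi (0 < a)%R : \bar R).
  apply: emeasurable_funM; apply: chi_measurable.
    by apply: lte_measurable => //; exact/measurable_EFinP.
  have := @measurable_itv R `]0%R, +oo[.
  by congr measurable; apply/seteqP; split=> p /=; rewrite in_itv/= andbT.
transitivity (\int[mu]_x \int[leb]_a F (x, a)).
  apply: eq_integral => x _; rewrite /F/= ge0_integralZl//; last by move=> a _; rewrite mule_ge0 ?chi_ge0.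
  congr (_ * _); transitivity (leb [set a : R | (0 < a)%R /\ a%:E < f x]).
    case: (f x) (f0 x) => [r| |]// r0.
      rewrite [X in _ = _ X](_ : _ = `]0%R, r[%classic).
        by rewrite lebesgue_measure_itv/= lte_fin; case: ltP => h; rewrite ?oppr0 ?adde0//; congr (_%:E); apply/eqP; rewrite eq_le h -lee_fin r0.
      by apply/seteqP; split=> a /=; rewrite in_itv/= lte_fin => /andP.
    rewrite [X in _ = _ X](_ : _ = `]0%R, +oo[%classic).
      by rewrite lebesgue_measure_itv/= ltry.
    by apply/seteqP; split=> a /=; rewrite in_itv/= andbT ?ltry// => -[].
  pose A : set R := [set a : R | (0 < a)%R /\ a%:E < f x].
  have mA : measurable (A : set (measurableTypeR R)).
    apply: measurableI; last by apply: lte_measurable => //; exact/measurable_EFinP.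
    have := @measurable_itv R `]0%R, +oo[.
    by congr measurable; apply/seteqP; split=> p /=; rewrite in_itv/= andbT.
  transitivity (\int[leb]_a (\1_A a)%:E).
    by rewrite integral_indic// setIT.
  apply: eq_integral => a _; rewrite indicE /chi /A.
  case: (ltP (a%:E) (f x)) => h1; case: (ltP 0%R a) => h2; rewrite ?mule1 ?mul0e ?mule0.
  - by rewrite mem_set.
  - by rewrite memNset//= => -[]; rewrite ltNge h2.
  - by rewrite memNset//= => -[_]; rewrite ltNge h1.
  - by rewrite memNset//= => -[_]; rewrite ltNge h1.
rewrite (fubini_tonelli F mF F0) integral_chi; apply: eq_integral => a _.
rewrite -ge0_integralZr//.
- by apply: eq_integral => x _; rewrite /F/= muleA.
- apply: emeasurable_funM => //; apply: chi_measurable; exact: lte_measurable.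
- by move=> x _; rewrite mule_ge0 ?chi_ge0.
- exact: chi_ge0.
Qed.

End layer_cake.

(** Vitali selection by induction on a list sorted by increasing radius: the smallest ball is kept
    only if it is disjoint from those already selected among the larger ones. Otherwise it meets one
    of these, of at least its own radius. *)
Lemma greedy_cover (R : realType) (T : metricType R) (s : seq (T * R)) :
  exists t : seq (T * R), [/\ {subset t <= s},
    pairwise (fun b c => `[< ball b.1 b.2 `&` ball c.1 c.2 = set0 >]) t &
    {in s, forall b, exists2 c, c \in t & mdist b.1 c.1 <= b.2 + c.2 /\ b.2 <= c.2 \/ b = c}].
Proof.
pose le2 (b c : T * R) := b.2 <= c.2.
suff : forall s, sorted le2 s -> exists t : seq (T * R), [/\ {subset t <= s},
    pairwise (fun b c => `[< ball b.1 b.2 `&` ball c.1 c.2 = set0 >]) t &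
    {in s, forall b, exists2 c, c \in t & mdist b.1 c.1 <= b.2 + c.2 /\ b.2 <= c.2 \/ b = c}].
  move=> /(_ (sort le2 s)) []; first by apply: sort_sorted => b c; exact: le_total.
  move=> t [h1 h2 h3]; exists t; split=> // b; first by move=> /h1; rewrite mem_sort.
  by rewrite -(mem_sort le2); exact: h3.
elim=> [|b {}s ih] so; first by exists [::].
have bmin : {in s, forall c, b.2 <= c.2}.
  have tr : transitive le2 by move=> x y z; exact: le_trans.
  by move: so => /= /(order_path_min tr)/allP.
have [t [ts td tc]] := ih (path_sorted so).
have [/hasP[c ct /negP hc]|/hasPn nh] := boolP (has (fun c => ~~ `[< ball b.1 b.2 `&` ball c.1 c.2 = set0 >]) t).
  exists t; split=> //; first by move=> x /ts xs; rewrite inE xs orbT.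
  move=> x; rewrite inE => /predU1P[->|/tc//]; exists c => //; left; split; last exact/bmin/ts.
  have /asboolPn/eqP/set0P[z []] : ~~ `[< ball b.1 b.2 `&` ball c.1 c.2 = set0 >] by exact/negP.
  rewrite !ballEmdist/= => bz cz; rewrite (le_trans (metric_triangle b.1 z c.1))//.
  by rewrite (metric_sym z) lerD// ltW.
exists (b :: t); split.
- by move=> x; rewrite !inE => /predU1P[->|/ts ->]; rewrite ?eqxx ?orbT.
- by rewrite /= td andbT; apply/allP => c /nh; rewrite negbK.
- move=> x; rewrite inE => /predU1P[->|/tc [c ct h]].
    by exists b; rewrite ?inE ?eqxx//; right.
  by exists c => //; rewrite inE ct orbT.
Qed.

Lemma measure_seq_cover d (T : measurableType d) (R : realType)
    (mu : {measure set T -> \bar R}) (I : eqType) (F : I -> set T) (s : seq I) (U : set T) :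
  (forall i, measurable (F i)) -> measurable U ->
  (forall x, U x -> exists2 i, i \in s & F i x) -> (mu U <= \sum_(i <- s) mu (F i))%E.
Proof.
move=> mF; elim: s U => [|i s ih] U mU h.
  rewrite big_nil (_ : U = set0) ?measure0//; rewrite -subset0 => x Ux.
  by case: (h x Ux) => i; rewrite in_nil.
rewrite big_cons; have -> : mu U = (mu (U `&` F i) + mu (U `\` F i))%E.
  rewrite -measureU; [|exact: measurableI|exact: measurableD|].
    congr (mu _); apply/seteqP; split=> [x Ux|x [][]//].
    by have [Fx|nFx] := pselect (F i x); [left|right].
  by rewrite -subset0 => x [[]] ? ? [].
apply: leeD; first by apply: le_measure; rewrite ?inE//; exact: measurableI.
apply: ih => [|x [Ux nF]]; first exact: measurableD.
by case: (h x Ux) => j; rewrite inE => /predU1P[->//|js Fx]; exists j.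
Qed.

(** * Construction of the weight *)

Section weight.
Context d (R : realType) (Omega : borelMetricType d R).
Variable mu : {sigma_finite_measure set Omega -> \bar R}.
Variables (C0 theta : R).
Hypothesis hv : forall (x : Omega) (t : R), 0 < t -> (0 < vol mu x t)%E /\ (vol mu x t < +oo)%E.
Hypothesis C00 : 0 < C0.
Hypothesis theta1 : 1 <= theta.
Hypothesis growth : forall (x : Omega) (t : R) k, 0 < t ->
  fine (vol mu x (2 ^+ k * t)) <= C0 * theta ^+ k * fine (vol mu x t).
Variable cb : nat -> Omega * R.
Hypothesis cb0 : forall n, 0 < (cb n).2.
Hypothesis cbP : forall x s, 0 < s -> exists n,
  [/\ mdist x (cb n).1 < s / 4, s / 4 < (cb n).2 & (cb n).2 < s / 2].
Variables (th : R) (sg : Omega -> \bar R).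
Hypothesis th_gt : theta < th.
Hypothesis sg_meas : measurable_fun setT sg.
Hypothesis sg0 : forall x, (0 <= sg x)%E.
Local Notation V x t := (fine (vol mu x t)).
Local Notation leb := (@lebesgue_measure R).

Let theta0 : 0 < theta. Proof. exact: lt_le_trans theta1. Qed.
Let th0 : 0 < th. Proof. exact: lt_trans th_gt. Qed.
Let volE := volE hv.
Let fvol_gt0 := fvol_gt0 hv.

Definition superlevel (a : R) := [set x | (a%:E < sg x)%E].

Lemma superlevel_meas a : measurable (superlevel a).
Proof. by apply: lte_measurable => //; exact: measurable_cst. Qed.

(** The superlevel set fills more than half of the ball; this stands in for a large average and
    makes sense without integrability of [sg]. *)
Definition heavy n (a : R) := ((V (cb n).1 (cb n).2 / 2)%:E < mu (ball (cb n).1 (cb n).2 `&` superlevel a))%E.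

Definition dil k n := ball (cb n).1 (2 ^+ k * (cb n).2).

(** A maximal function of [sg] with slow decay: a ball heavy at level a still counts for a / th^k on
    its dilate by 2^k. Only the balls of the sequence [cb] are used, for the sake of
    measurability. *)
Definition wgt (x : Omega) : \bar R := ereal_sup [set z | z = 0%E \/ exists n k a,
  [/\ z = (a / th ^+ k)%:E, 0 < a, heavy n a & dil k n x]].

Lemma wgt_ge0 x : (0 <= wgt x)%E.
Proof. by apply: ereal_sup_ubound; left. Qed.

Lemma heavy_anti n a b : a <= b -> heavy n b -> heavy n a.
Proof.
move=> ab h; apply: lt_le_trans h _.
apply: le_measure; rewrite ?inE; try by apply: measurableI; [exact: ball_measurable|exact: superlevel_meas].
by move=> x [Bx h]; split=> //; rewrite /superlevel /= (le_lt_trans _ h)// lee_fin.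
Qed.

Lemma wgt_superlevel (c : R) : 0 <= c ->
  [set x | (c%:E < wgt x)%E] `<=` \bigcup_k \bigcup_(n in [set n | heavy n (c * th ^+ k)]) dil k n.
Proof.
move=> c0 x /= /ereal_sup_gt[z [->|[n [k [a [-> a0 hn dx]]]]]].
  by rewrite lte_fin ltNge c0.
rewrite lte_fin ltr_pdivlMr ?exprn_gt0// => h; exists k => //; exists n => //.
exact: heavy_anti (ltW h) hn.
Qed.

Lemma wgt_meas : measurable_fun setT wgt.
Proof.
apply: (measurability _ (ErealGenOInfty.measurableE R)) => //.
move=> _ [_ [c ->] <-]; rewrite setTI.
have [c0|c0] := ltP c 0.
  rewrite [X in measurable X](_ : _ = setT)//; apply/seteqP; split=> // x _ /=.
  by rewrite in_itv/= andbT (lt_le_trans _ (wgt_ge0 x))// lte_fin.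
(* The union runs over k and n only; the uncountably many levels a are absorbed in the predicate on
   n. *)
pose Q k n := exists a, [/\ c < a / th ^+ k, 0 < a & heavy n a].
rewrite [X in measurable X](_ : _ = \bigcup_k \bigcup_(n in Q k) dil k n).
  by apply: bigcupT_measurable => k; apply: bigcup_measurable => n _; exact: ball_measurable.
apply/seteqP; split=> x /=.
  rewrite in_itv/= andbT => /ereal_sup_gt[z [->|[n [k [a [-> a0 hn dx]]]]]].
    by rewrite lte_fin ltNge c0.
  by rewrite lte_fin => h; exists k => //; exists n => //; exists a.
move=> [k _ [n [a [ca a0 hn]] dx]]; rewrite in_itv/= andbT.
apply: (@lt_le_trans _ _ (a / th ^+ k)%:E); first by rewrite lte_fin.
by apply: ereal_sup_ubound; right; exists n, k, a.
Qed.

(** Vitali selection among finitely many heavy balls. A selected ball dilated by 2^(k+2) covers the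
    2^k-dilates of the smaller balls it meets. By heaviness its volume is at most twice its share of
    the superlevel set, and the shares of the selected balls are disjoint. *)
Lemma dil_union_le k b : (mu (\bigcup_(n in [set n | heavy n b]) dil k n) <=
  (2 * (C0 * theta ^+ k.+2))%:E * mu (superlevel b))%E.
Proof.
pose F N := \bigcup_(n in [set n | heavy n b /\ (n < N)%N]) dil k n.
have mF N : measurable (F N) by apply: bigcup_measurable => n _; exact: ball_measurable.
have FU : \bigcup_N F N = \bigcup_(n in [set n | heavy n b]) dil k n.
  apply/seteqP; split=> x; first by move=> [N _ [n [hn _] dx]]; exists n.
  by move=> [n hn dx]; exists n.+1 => //; exists n.
have nd : nondecreasing_seq F.
  apply/nondecreasing_seqP => N; rewrite subsetEset => x [n [hn nN] dx].
  by exists n => //; split=> //; exact: leq_trans nN _.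
have mU : measurable (\bigcup_N F N) by exact: bigcupT_measurable.
have cv := @nondecreasing_cvg_mu _ _ _ mu F mF mU nd; rewrite -FU.
rewrite -(cvg_lim (@ereal_hausdorff R) cv); apply: lime_le; first by apply/cvg_ex; eexists; exact: cv.
apply: nearW => N /=.
pose s := [seq cb n | n <- iota 0 N & `[< heavy n b >]].
have hs bl : bl \in s -> exists2 n, bl = cb n & heavy n b.
  by move=> /mapP[n]; rewrite mem_filter => /andP[/asboolP hn _] ->; exists n.
have [t [ts td tc]] := greedy_cover s.
have cov : (mu (F N) <= \sum_(c <- t) mu (ball c.1 (2 ^+ k.+2 * c.2)))%E.
  apply: measure_seq_cover => // [c|x [n [hn nN] dx]]; first exact: ball_measurable.
  have ns : cb n \in s by apply/mapP; exists n => //; rewrite mem_filter mem_iota/= add0n nN andbT; exact/asboolP.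
  have [c ct h] := tc _ ns; exists c => //.
  have c0 : 0 < c.2 by have [m -> _] := hs _ (ts _ ct).
  have k1 : 1 <= 2 ^+ k :> R by rewrite exprn_ege1// ler1n.
  move: dx; rewrite /dil !ballEmdist/= => dx.
  have e4 : 2 ^+ k.+2 = 4 * 2 ^+ k :> R by rewrite !exprS; ring.
  rewrite e4; case: h => [[h1 h2]|<-]; last by have := cb0 n; nra.
  have := metric_triangle c.1 (cb n).1 x; rewrite (metric_sym c.1 (cb n).1) => h3.
  have h4 : 2 ^+ k * (cb n).2 <= 2 ^+ k * c.2 by rewrite ler_wpM2l// exprn_ge0.
  have h5 : c.2 <= 2 ^+ k * c.2 by rewrite ler_peMl// ltW.
  by rewrite -mulrA; move: h1 h2 h3 h4 h5 dx; lra.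
apply: (le_trans cov).
have dj := @seq_disjoint_measure _ _ _ mu _ (fun c : Omega * R => ball c.1 c.2) t (superlevel b)
  (fun c => ball_measurable _ _) (superlevel_meas b) td.
have K0 : 0 <= 2 * (C0 * theta ^+ k.+2) by apply/ltW/mulr_gt0/mulr_gt0/exprn_gt0.
apply: (@le_trans _ _ (\sum_(c <- t) (2 * (C0 * theta ^+ k.+2))%:E * mu (ball c.1 c.2 `&` superlevel b)))%E; last first.
  by rewrite -ge0_sume_distrr//; apply: lee_wpmul2l.
rewrite big_seq [leRHS]big_seq; apply: lee_sum => c ct.
have [n -> hn] := hs _ (ts _ ct).
apply: (@le_trans _ _ ((2 * (C0 * theta ^+ k.+2))%:E * (V (cb n).1 (cb n).2 / 2)%:E)%E).
  have k0 : 0 < 2 ^+ k.+2 * (cb n).2 by rewrite mulr_gt0// ?exprn_gt0.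
  rewrite -/(vol mu _ _) volE// -EFinM lee_fin; apply: (le_trans (growth _ _ (cb0 n))).
  by rewrite le_eqVlt; apply/orP; left; apply/eqP; field.
by apply: lee_wpmul2l; [rewrite lee_fin|exact: ltW].
Qed.

(** A superlevel set of the weight is covered by the 2^k-dilates of the balls heavy at level c th^k.
    Dilation costs theta^k in measure, while integration over the levels gains th^-k, so the sum
    over k is geometric with ratio theta / th. *)
Lemma integral_wgt :
  (\int[mu]_x wgt x <= (2 * (C0 * theta ^+ 2) / (1 - theta / th))%:E * \int[mu]_x sg x)%E.
Proof.
pose K1 := 2 * (C0 * theta ^+ 2); have K10 : 0 < K1 by rewrite !mulr_gt0// ?exprn_gt0.
pose rho := theta / th.
have rho01 : 0 <= rho < 1 by rewrite ltW ?divr_gt0//= ltr_pdivrMr// mul1r.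
have cake (f : Omega -> \bar R) : measurable_fun setT f -> (forall x, 0 <= f x)%E ->
    (\int[mu]_x f x = \int[leb]_(a in [set a : R | (0 < a)%R]) mu [set x | a%:E < f x])%E.
  move=> mf f0; transitivity (\int[mu]_x (cst 1%E x * f x))%E.
    by apply: eq_integral => x _; rewrite mul1e.
  rewrite layer_cake//; apply: eq_integral => a _.
  rewrite -(integral_chi mu (cst 1%E)) integral_cst ?mul1e//.
  by apply: lte_measurable => //; exact: measurable_cst.
have mpos : measurable [set a : measurableTypeR R | (0 < a)%R].
  by have := @measurable_itv R `]0%R, +oo[; congr measurable; apply/seteqP; split=> p /=; rewrite in_itv/= andbT.
have mlev (f : Omega -> \bar R) : measurable_fun setT f ->
    measurable_fun setT (fun a : measurableTypeR R => mu [set x | a%:E < f x]%E).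
  move=> mf; pose A := [set p : Omega * measurableTypeR R | (p.2%:E < f p.1)%E].
  have mA : measurable A.
    apply: lte_measurable; last exact: measurableT_comp mf measurable_fst.
    by apply/measurable_EFinP; exact: measurable_snd.
  have := measurable_fun_ysection mu mA; congr measurable_fun; apply/funext => a /=.
  by congr (mu _); apply/seteqP; split=> x; rewrite /ysection/= ?inE.
pose g k (a : R) := ((K1 * theta ^+ k)%:E * mu (superlevel (a * th ^+ k)))%E.
(* The level a th^k of [sg] is the level a of [sg] / th^k; this replaces a change of variable in
   a. *)
have gE k a : mu (superlevel (a * th ^+ k)) = mu [set x | (a%:E < sg x * ((th ^+ k)^-1)%:E)%E].
  congr (mu _); apply/seteqP; split=> x; rewrite /superlevel/= EFinM lte_pdivlMr ?exprn_gt0//.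
have mg k : measurable_fun setT (g k : measurableTypeR R -> \bar R).
  apply: measurable_funeM; under [X in measurable_fun _ X]eq_fun do rewrite gE.
  by apply: mlev; apply: emeasurable_funM.
have g0 k a : (0 <= g k a)%E.
  by rewrite mule_ge0// lee_fin; apply/ltW/mulr_gt0/exprn_gt0.
have ig k : (\int[leb]_(a in [set a : R | (0 < a)%R]) g k a = (K1 * rho ^+ k)%:E * \int[mu]_x sg x)%E.
  rewrite /g ge0_integralZl//; first last.
  - by rewrite lee_fin; apply/ltW/mulr_gt0/exprn_gt0.
  - under [X in measurable_fun _ X]eq_fun do rewrite gE.
    by apply: measurable_funTS; apply: mlev; exact: emeasurable_funM.
  under eq_integral do rewrite gE.
  rewrite -cake; [|exact: emeasurable_funM|by move=> x; rewrite mule_ge0// lee_fin invr_ge0 ltW// exprn_gt0].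
  rewrite ge0_integralZr//; last by rewrite lee_fin invr_ge0 ltW// exprn_gt0.
  by rewrite muleA muleAC -EFinM /rho expr_div_n mulrA.
have rho1 : 0 < 1 - rho by rewrite subr_gt0; case/andP: rho01.
have pw (a : R) : 0 < a -> (mu [set x | a%:E < wgt x] <= \sum_(k <oo) g k a)%E.
  move=> a0; apply: (@le_trans _ _ (\sum_(k <oo) mu (\bigcup_(n in [set n | heavy n (a * th ^+ k)]) dil k n))%E).
    apply: measure_sigma_subadditive; last exact: wgt_superlevel (ltW a0).
    + by move=> k; apply: bigcup_measurable => n _; exact: ball_measurable.
    + by apply: lte_measurable; [exact: measurable_cst|exact: wgt_meas].
  apply: lee_nneseries => k _ //; apply: le_trans (dil_union_le _ _) _.
  apply: lee_wpmul2r => //; rewrite lee_fin [leLHS](_ : _ = K1 * theta ^+ k)//.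
  by rewrite /K1 -[k.+2]addn2 exprD; ring.
have -> : 2 * (C0 * theta ^+ 2) / (1 - theta / th) = K1 / (1 - rho) by [].
rewrite cake//; [|exact: wgt_meas|exact: wgt_ge0].
apply: (@le_trans _ _ (\int[leb]_(a in [set a : R | (0 < a)%R]) \sum_(k <oo) g k a)%E).
  apply: ge0_le_integral => //.
  - by apply: measurable_funTS; apply: mlev; exact: wgt_meas.
  - apply: measurable_funTS; apply: (@ge0_emeasurable_sum _ _ _ setT g xpredT) => // k _; exact: mg.
rewrite integral_nneseries//; last by move=> k; apply: measurable_funTS.
under eq_eseriesr do rewrite ig.
apply: lime_le; first by apply: is_cvg_nneseries => k _ _; rewrite mule_ge0// ?integral_ge0// lee_fin; exact/ltW/mulr_gt0/exprn_gt0/divr_gt0.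
apply: nearW => N; rewrite -ge0_sume_distrl; last by move=> k _; rewrite lee_fin; exact/ltW/mulr_gt0/exprn_gt0/divr_gt0.
apply: lee_wpmul2r; first exact: integral_ge0.
rewrite sumEFin lee_fin -mulr_sumr ler_pM2l// -[leRHS]mul1r ler_pdivlMr//.
rewrite big_mkord (_ : _ * (1 - rho) = 1 - rho ^+ N); last by rewrite -[RHS]opprB subrX1; ring.
by rewrite gerBl exprn_ge0//; case/andP: rho01.
Qed.

End weight.

Lemma ltr_measurable d (T : measurableType d) (R : realType) (f g : T -> R) :
  measurable_fun setT f -> measurable_fun setT g -> measurable [set x | f x < g x].
Proof.
move=> mf mg; have := @lte_measurable _ _ R (EFin \o f) (EFin \o g).
by move=> h; apply: h; exact/measurable_EFinP.
Qed.

Lemma ler_measurable d (T : measurableType d) (R : realType) (f g : T -> R) :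
  measurable_fun setT f -> measurable_fun setT g -> measurable [set x | f x <= g x].
Proof.
move=> mf mg; rewrite [X in measurable X](_ : _ = ~` [set x | g x < f x]).
  by apply: measurableC; exact: ltr_measurable.
by apply/seteqP; split=> x /=; rewrite leNgt => /negP.
Qed.

Lemma half_ereal (R : realType) (v : R) (p q : \bar R) : (0 <= p)%E -> (0 <= q)%E ->
  v%:E = (p + q)%E -> (q <= (v / 2)%:E)%E -> ((v / 2)%:E <= p)%E.
Proof.
case: p => [p| |]// _; last by rewrite leey.
by case: q => [q| |]// _ [->]; rewrite !lee_fin; lra.
Qed.

(** * Averages of inverse weights *)

Section averages.
Context d (R : realType) (Omega : borelMetricType d R).
Variable mu : {sigma_finite_measure set Omega -> \bar R}.
Variables (C0 theta : R).
Hypothesis hv : forall (x : Omega) (t : R), 0 < t -> (0 < vol mu x t)%E /\ (vol mu x t < +oo)%E.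
Hypothesis C00 : 0 < C0.
Hypothesis theta1 : 1 <= theta.
Hypothesis growth : forall (x : Omega) (t : R) k, 0 < t ->
  fine (vol mu x (2 ^+ k * t)) <= C0 * theta ^+ k * fine (vol mu x t).
Variable x0 : Omega.
Local Notation V x t := (fine (vol mu x t)).
Let theta0 : 0 < theta. Proof. exact: lt_le_trans theta1. Qed.
Let volE := volE hv.
Let fvol_gt0 := fvol_gt0 hv.
Let md := mdist_measurable hv C00 theta1 growth x0.

Lemma vol_meas (s : R) : measurable_fun setT (fun x => vol mu x s).
Proof.
pose A := [set p : Omega * Omega | mdist p.1 p.2 < s].
have mA : measurable A.
  by apply: ltr_measurable => //; exact: md.
have := measurable_fun_xsection mu mA; congr measurable_fun; apply/funext => x /=.
by rewrite /vol; congr (mu _); apply/seteqP; split=> y; rewrite /xsection ballEmdist/= ?inE.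
Qed.

Lemma inv_vol_meas (s : R) : measurable_fun setT (fun x => (V x s)^-1).
Proof.
apply: (measurableT_comp (@measurable_invr R)); apply: measurableT_comp => //.
exact: vol_meas.
Qed.

Lemma inv_vol_ge0 x (s : R) : (0 <= ((V x s)^-1)%:E)%E.
Proof. by rewrite lee_fin invr_ge0 fine_ge0// measure_ge0. Qed.

(** The weight in y that Tonelli's theorem produces from a weight g in x when the cone integral at
    height s is integrated in x. *)
Definition avg (g : Omega -> \bar R) (s : R) (y : Omega) : \bar R :=
  (\int[mu]_(x in [set x | (mdist x y <= s)%R]) (g x * ((V x s)^-1)%:E))%E.

Lemma cball_meas y (s : R) : measurable [set x : Omega | mdist x y <= s].
Proof.
have m1 : measurable_fun setT (fun x : Omega => mdist x y).
  have mp : measurable_fun setT (fun x : Omega => (x, y)) by exact: measurable_fun_pair.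
  exact: (measurableT_comp md mp).
by apply: ler_measurable => //; exact: m1.
Qed.

Lemma avg_meas g (s : R) : measurable_fun setT g -> (forall x, 0 <= g x)%E ->
  measurable_fun setT (avg g s).
Proof.
move=> mg g0.
pose F (p : Omega * Omega) := (g p.1 * ((V p.1 s)^-1)%:E * chi (mdist p.1 p.2 <= s)%R)%E.
have mF : measurable_fun setT F.
  apply: emeasurable_funM.
    apply: emeasurable_funM; first exact: measurableT_comp mg measurable_fst.
    by apply/measurable_EFinP; exact: measurableT_comp (inv_vol_meas s) measurable_fst.
  by apply: chi_measurable; apply: ler_measurable => //; exact: md.
have F0 p : (0 <= F p)%E by rewrite !mule_ge0 ?chi_ge0 ?inv_vol_ge0.
have := @measurable_fun_fubini_tonelli_G _ _ _ _ R mu F mF F0.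
by congr measurable_fun; apply/funext => y; rewrite /avg integral_chi.
Qed.

Lemma avg_ge0 g s y : (forall x, 0 <= g x)%E -> (0 <= avg g s y)%E.
Proof. by move=> g0; apply: integral_ge0 => x _; rewrite mule_ge0// inv_vol_ge0. Qed.

Lemma avg_lower g (s c : R) y (B : set Omega) : measurable_fun setT g -> (forall x, 0 <= g x)%E ->
  0 <= c -> measurable B ->
  (forall x, B x -> mdist x y <= s /\ (c%:E <= g x * ((V x s)^-1)%:E)%E) ->
  (c%:E * mu B <= avg g s y)%E.
Proof.
move=> mg g0 c0 mB h; rewrite /avg.
have mf : measurable_fun setT (fun x => g x * ((V x s)^-1)%:E)%E.
  by apply: emeasurable_funM => //; apply/measurable_EFinP; exact: inv_vol_meas.
apply: (@le_trans _ _ (\int[mu]_(x in B) (g x * ((V x s)^-1)%:E))%E).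
  rewrite -integral_cst//; apply: ge0_le_integral => //; try exact: measurable_funTS.
  - by move=> x /h[].
apply: ge0_subset_integral => //; try exact: cball_meas; try exact: measurable_funTS.
- by move=> x _; rewrite mule_ge0// inv_vol_ge0.
- by move=> x /h[].
Qed.

(** For x in the averaging ball, V(x, s) is at least V(y, 2 s) / (C0 theta^2), so the average
    exceeds the supremum by at most this factor. *)
Lemma avg_upper g (s : R) y (X : \bar R) : 0 < s -> (0 <= X)%E ->
  measurable_fun setT g -> (forall x, 0 <= g x)%E ->
  (forall x, mdist x y <= s -> (g x <= X)%E) ->
  (avg g s y <= (C0 * theta ^+ 2)%:E * X)%E.
Proof.
move=> s0 X0 mg g0 h; have s2 : 0 < 2 * s by rewrite mulr_gt0.
have v2 := fvol_gt0 y s2.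
have mf : measurable_fun setT (fun x => g x * ((V x s)^-1)%:E)%E.
  by apply: emeasurable_funM => //; apply/measurable_EFinP; exact: inv_vol_meas.
have K0 : 0 <= C0 * theta ^+ 2 by apply/ltW/mulr_gt0/exprn_gt0.
have Z0 : (0 <= X * (C0 * theta ^+ 2 / V y (2 * s))%:E)%E.
  by rewrite mule_ge0// lee_fin divr_ge0// ltW.
apply: (@le_trans _ _ (\int[mu]_(x in [set x | (mdist x y <= s)%R]) cst (X * (C0 * theta ^+ 2 / V y (2 * s))%:E) x)%E).
  apply: ge0_le_integral => //.
  - exact: cball_meas.
  - by move=> x _; rewrite mule_ge0// inv_vol_ge0.
  - exact: measurable_funTS.
  - move=> x /= xy; apply: lee_pmul => //; [exact: inv_vol_ge0|exact: h|].
    rewrite lee_fin -[leRHS]invrK invf_div lef_pV2 ?posrE ?fvol_gt0 ?divr_gt0 ?mulr_gt0 ?exprn_gt0//.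
    rewrite ler_pdivrMr ?mulr_gt0 ?exprn_gt0// [leRHS]mulrC; apply: (vol_growth hv growth) => //.
    by rewrite -natrX; move: xy s0; rewrite (_ : (2 ^ 2)%:R = 4 :> R)//; lra.
rewrite integral_cst; last exact: cball_meas.
apply: (@le_trans _ _ (X * (C0 * theta ^+ 2 / V y (2 * s))%:E * (V y (2 * s))%:E)%E).
  apply: lee_wpmul2l => //; rewrite -volE//; apply: le_measure; rewrite ?inE.
  - exact: cball_meas.
  - exact: ball_measurable.
  - by move=> x /= xy; rewrite ballEmdist/= metric_sym (le_lt_trans xy)//; move: s0; lra.
by rewrite -muleA -EFinM divfK ?gt_eqF// muleC.
Qed.

Variable cb : nat -> Omega * R.
Hypothesis cb0 : forall n, 0 < (cb n).2.
Hypothesis cbP : forall x s, 0 < s -> exists n,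
  [/\ mdist x (cb n).1 < s / 4, s / 4 < (cb n).2 & (cb n).2 < s / 2].
Variables (th : R) (sg : Omega -> \bar R).
Hypothesis th_gt : theta < th.
Hypothesis sg_meas : measurable_fun setT sg.
Hypothesis sg0 : forall x, (0 <= sg x)%E.
Local Notation wgt := (wgt mu cb th sg).
Let th0 : 0 < th. Proof. exact: lt_trans th_gt. Qed.

Lemma half_light n (b : R) : ~ heavy mu cb sg n b ->
  ((V (cb n).1 (cb n).2 / 2)%:E <= mu (ball (cb n).1 (cb n).2 `\` superlevel sg b))%E.
Proof.
move=> nh; have mS := superlevel_meas sg_meas b.
have mB := ball_measurable (cb n).1 (cb n).2.
have e : ((V (cb n).1 (cb n).2)%:E = mu (ball (cb n).1 (cb n).2 `\` superlevel sg b) +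
    mu (ball (cb n).1 (cb n).2 `&` superlevel sg b))%E.
  by rewrite -volE// -measureDI.
have h : (mu (ball (cb n).1 (cb n).2 `&` superlevel sg b) <= (V (cb n).1 (cb n).2 / 2)%:E)%E.
  by rewrite leNgt; exact/negP.
exact: half_ereal (measure_ge0 _ _) (measure_ge0 _ _) e h.
Qed.

(** A factor 2 from the level b = 2 a th^(k+3), another 2 from half of a ball, th^3 from the three
    extra doublings, and C0 theta^3 from comparing volumes. *)
Definition wgtK : R := 4 * th ^+ 3 * (C0 * theta ^+ 3).

Lemma wgtK_gt0 : 0 < wgtK.
Proof. by rewrite /wgtK !mulr_gt0 ?exprn_gt0. Qed.

(** Suppose [wgt x] <= a. A ball of the sequence close to y at scale s is not heavy at level 2 a
    th^(k+3), as its dilate contains x. Hence [sg] is at most this level on half of the ball, which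
    bounds the average of its inverse from below. *)
Lemma wgt_bound x y s k : 0 < s -> mdist y x < 2 ^+ k * s ->
  (iv (wgt x) <= (wgtK * th ^+ k)%:E * avg (iv \o sg) s y)%E.
Proof.
move=> s0 yx; have K0 := wgtK_gt0; set K := wgtK in K0 *.
have K1 : 0 < K * th ^+ k by rewrite mulr_gt0 ?exprn_gt0.
have miv : measurable_fun setT (iv \o sg) by exact: measurableT_comp iv_measurable sg_meas.
have iv0 z : (0 <= (iv \o sg) z)%E by exact: iv_ge0.
rewrite -lee_pdivrMl//; apply: iv_test; [by rewrite invr_gt0|exact: avg_ge0|].
move=> a a0 wa; have [n [yn sn1 sn2]] := cbP y s0.
have s'0 := cb0 n; set sn := (cb n).2 in sn1 sn2 s'0 *; set z := (cb n).1 in yn *.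
(* The 2 makes heaviness at b contradict [wgt x] <= a. Three doublings are added because the radius
   of the ball may be as small as s / 4 and its centre differs from y. *)
pose b := 2 * a * th ^+ (k + 3); have b0 : 0 < b by rewrite !mulr_gt0 ?exprn_gt0.
have dx : dil cb (k + 3) n x.
  rewrite /dil ballEmdist/= -/z -/sn.
  have t := metric_triangle z y x; rewrite (metric_sym z y) in t.
  have k1 : 1 <= 2 ^+ k :> R by rewrite exprn_ege1// ler1n.
  have -> : 2 ^+ (k + 3) * sn = 2 ^+ k * (8 * sn) by rewrite exprD -mulrA; congr (_ * (_ * _)); rewrite -natrX.
  have h : 2 ^+ k * s + s / 4 <= 2 ^+ k * (8 * sn).
    apply: (@le_trans _ _ (2 ^+ k * (s + s / 4))); first by rewrite mulrDr lerD2l ler_peMl// divr_ge0// ltW.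
    by rewrite ler_wpM2l ?exprn_ge0//; move: sn1 s0; lra.
  by move: t h yx yn; lra.
have nh : ~ heavy mu cb sg n b.
  move=> hb; have : ((b / th ^+ (k + 3))%:E <= wgt x)%E.
    by apply: ereal_sup_ubound; right; exists n, (k + 3)%N, b.
  move=> /le_trans/(_ wa); rewrite lee_fin /b mulfK ?gt_eqF ?exprn_gt0//.
  by rewrite leNgt => /negP; apply; rewrite mulr_natl mulr2n ltrDl.
have hl := half_light nh.
have Vn := fvol_gt0 z s'0.
pose c := b^-1 * (C0 * theta ^+ 3 * V z sn)^-1.
have c0 : 0 < c by rewrite mulr_gt0 ?invr_gt0 ?mulr_gt0 ?exprn_gt0.
apply: (@le_trans _ _ (c%:E * mu (ball z sn `\` superlevel sg b))%E).
  apply: (@le_trans _ _ (c%:E * (V z sn / 2)%:E)%E); last first.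
    by apply: lee_wpmul2l => //; rewrite lee_fin ltW.
  rewrite -EFinM lee_fin le_eqVlt; apply/orP; left; apply/eqP.
  rewrite /c /b /K /wgtK exprD; field.
  by rewrite !gt_eqF ?exprn_gt0.
apply: avg_lower => //; first exact: ltW.
  by apply: measurableD; [exact: ball_measurable|exact: superlevel_meas].
move=> w [Bw /negP]; rewrite -leNgt => sw.
move: Bw; rewrite ballEmdist/= => Bw.
have t := metric_triangle w z y; rewrite (metric_sym w z) (metric_sym z y) in t.
split; first by move: t Bw yn sn2 s0; lra.
rewrite /c EFinM; apply: lee_pmul; rewrite ?lee_fin ?invr_ge0 ?(ltW b0)//.
- by apply/ltW/mulr_gt0 => //; apply: mulr_gt0 => //; exact: exprn_gt0.
- by rewrite /= le_iv ?invr_gt0// invrK.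
- rewrite lef_pV2 ?posrE ?fvol_gt0 ?mulr_gt0 ?exprn_gt0//.
  apply: (vol_growth hv growth) => //; rewrite -natrX (_ : (2 ^ 3)%:R = 8 :> R)//.
  by move: Bw sn1; lra.
Qed.

Definition avgK : R := C0 * theta ^+ 2 * (wgtK * th ^+ 2).

Lemma avgK_gt0 : 0 < avgK.
Proof. by rewrite /avgK !mulr_gt0 ?exprn_gt0 ?wgtK_gt0. Qed.

(** [wgt_bound] averaged over a ball. It relates the inverse of the weight near y to the inverse of
    [sg] near y', at the price th^i for a distance of 2^i s; this is how the weight enters the
    operator estimates. *)
Lemma avg_compare i y y' s t : 0 < t -> t <= 2 * s ->
  mdist y y' < 2 ^+ i * s ->
  (avg (iv \o wgt) t y <= (avgK * th ^+ i)%:E * avg (iv \o sg) s y')%E.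
Proof.
have K0 := wgtK_gt0; have hK := wgt_bound; set K := wgtK in K0 hK.
move=> t0 ts yy; have s0 : 0 < s by move: t0 ts; lra.
have iv0 z : (0 <= (iv \o sg) z)%E by exact: iv_ge0.
have K1 : 0 <= K * th ^+ (i + 2) by rewrite mulr_ge0 ?exprn_ge0 ?ltW.
(* Two further doublings make room for the averaging radius t <= 2 s. *)
apply: (@le_trans _ _ ((C0 * theta ^+ 2)%:E * ((K * th ^+ (i + 2))%:E * avg (iv \o sg) s y'))%E).
  apply: avg_upper => //.
  - by rewrite mule_ge0 ?avg_ge0.
  - by apply: measurableT_comp iv_measurable _; exact: wgt_meas.
  - by move=> z; exact: iv_ge0.
  - move=> x xy; apply: hK => //; rewrite metric_sym.
    have tr := metric_triangle x y y'.
    have k1 : 1 <= 2 ^+ i :> R by rewrite exprn_ege1// ler1n.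
    have h : s <= 2 ^+ i * s by rewrite ler_peMl// ltW.
    rewrite exprD (_ : 2 ^+ 2 = 4 :> R); last by rewrite -natrX.
    by rewrite mulrAC; move: tr h xy ts yy; lra.
rewrite muleA -EFinM; apply: lee_wpmul2r; first exact: avg_ge0.
by rewrite lee_fin exprD /avgK -/K le_eqVlt; apply/orP; left; apply/eqP; ring.
Qed.

End averages.

Lemma weight_swap (R : realType) (x K n r p : R) : 0 < r -> 0 < p -> x * p <= K * n ->
  r^-1 * x <= K * (r * p)^-1 * n.
Proof.
move=> r0 p0 h; have -> : r^-1 * x = x * p / (r * p) by field; rewrite !gt_eqF.
have -> : K * (r * p)^-1 * n = K * n / (r * p) by rewrite mulrAC.
by apply: ler_wpM2r h; rewrite invr_ge0; exact: ltW (mulr_gt0 r0 p0).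
Qed.

(** Weighted Cauchy-Schwarz; the induction step is the nonnegativity of the quadratic A y^2 - 2 B y
    + D, whose discriminant is controlled by the induction hypothesis. *)
Lemma weighted_square_sum (R : realFieldType) (c n : nat -> R) J : (forall j, 0 <= c j) ->
  (\sum_(j < J) c j * n j) ^+ 2 <= (\sum_(j < J) c j) * \sum_(j < J) c j * n j ^+ 2.
Proof.
move=> c0; elim: J => [|J ih]; first by rewrite !big_ord0 expr0n mul0r.
rewrite !big_ord_recr/=; move: ih.
have : 0 <= \sum_(j < J) c j by exact: sumr_ge0.
have : 0 <= \sum_(j < J) c j * n j ^+ 2 by apply: sumr_ge0 => j _; rewrite mulr_ge0 ?sqr_ge0.
move: (\sum_(j < J) c j) (\sum_(j < J) c j * n j) (\sum_(j < J) c j * n j ^+ 2) (c0 J).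
move: (c J) (n J) => x y A B D x0 D0 A0 h.
suff h2 : 0 <= A * y ^+ 2 - 2 * B * y + D.
  have : 0 <= x * (A * y ^+ 2 - 2 * B * y + D) by exact: mulr_ge0.
  by move: h; rewrite -subr_ge0 => h h3; rewrite -subr_ge0; move: h h3; lra.
move: A0; rewrite le_eqVlt => /predU1P[A0|A0].
  have B0 : B = 0 by apply/eqP; rewrite -sqrf_eq0 eq_le sqr_ge0 andbT (le_trans h)// -A0 mul0r.
  by rewrite -A0 B0 !(mul0r, mulr0) subr0 add0r.
rewrite -(pmulr_rge0 _ A0) [X in 0 <= X](_ : _ = (A * y - B) ^+ 2 + (A * D - B ^+ 2)); last by ring.
by rewrite addr_ge0 ?sqr_ge0// subr_ge0.
Qed.

Lemma geometric_sum_le (R : realFieldType) (rho : R) N : 0 <= rho < 1 ->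
  \sum_(j < N) rho ^+ j <= (1 - rho)^-1.
Proof.
move=> /andP[r0 r1]; have h : 0 < 1 - rho by rewrite subr_gt0.
rewrite -[leRHS]mul1r ler_pdivlMr// (_ : _ * (1 - rho) = 1 - rho ^+ N); last by rewrite -[RHS]opprB subrX1; ring.
by rewrite gerBl exprn_ge0.
Qed.

Lemma geometric_eseries (R : realType) (q rho : R) (Y : \bar R) : 0 <= q -> 0 <= rho < 1 -> (0 <= Y)%E ->
  (\sum_(i <oo) ((q * rho ^+ i)%:E * Y) <= (q / (1 - rho))%:E * Y)%E.
Proof.
move=> q0 r01 Y0; have [r0 r1] := andP r01.
have t0 i : (0 <= (q * rho ^+ i)%:E)%E by rewrite lee_fin mulr_ge0// exprn_ge0.
apply: lime_le; first by apply: is_cvg_nneseries => k _ _; rewrite mule_ge0.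
apply: nearW => N; rewrite -ge0_sume_distrl//.
apply: lee_wpmul2r => //.
by rewrite sumEFin lee_fin -mulr_sumr ler_wpM2l// big_mkord geometric_sum_le.
Qed.

(** * Weighted estimates for series and kernels *)

Section inner_series.
Context {R : realType} {V : lmodType R[i]} {ip : V -> V -> R[i]}.
Hypothesis ipP : is_inner ip.
Local Notation nm := (nm ip).

(** Weighted Cauchy-Schwarz for a partial sum close to v, followed by a limit in norm. *)
Lemma nm_series (v : V) (w : nat -> V) (c : nat -> R) (S : R) : (forall j, 0 <= c j) -> 0 < S ->
  (forall J, \sum_(j < J) c j <= S) ->
  (forall e : R, 0 < e -> exists J, nm (v - \sum_(j < J) (c j)%:C%C *: w j) <= e) ->
  ((nm v ^+ 2)%:E <= S%:E * \sum_(j <oo) (c j * nm (w j) ^+ 2)%:E)%E.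
Proof.
move=> c0 S0 cS hv.
have t0 j : 0 <= c j * nm (w j) ^+ 2 by rewrite mulr_ge0 ?sqr_ge0.
set X := (\sum_(j <oo) _)%E.
have X0 : (0 <= X)%E by apply: nneseries_ge0 => j _ _; rewrite lee_fin.
have pX J : ((\sum_(j < J) c j * nm (w j) ^+ 2)%:E <= X)%E.
  rewrite -sumEFin -(big_mkord xpredT (fun j => (c j * nm (w j) ^+ 2)%:E)).
  by apply: nneseries_lim_ge => j _; rewrite lee_fin.
case: X X0 pX => [x| |]// x0 pX; last by rewrite gt0_muley ?lte_fin// leey.
rewrite -EFinM lee_fin; rewrite lee_fin in x0.
have Sx : 0 <= S * x by rewrite mulr_ge0// ltW.
suff h : nm v <= Num.sqrt (S * x).
  have := ler_pM (nm_ge0 _ _) (nm_ge0 _ _) h h.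
  by rewrite -!expr2 (@sqr_sqrtr _ (S * x)).
apply/ler_addgt0Pl => e e0; have [J hJ] := hv e e0.
apply: le_trans (nm_dist ipP v (\sum_(j < J) (c j)%:C%C *: w j)) _.
rewrite addrC lerD//.
have h1 : nm (\sum_(j < J) (c j)%:C%C *: w j) <= \sum_(j < J) c j * nm (w j).
  apply: (le_trans (nm_sum ipP _ _)); apply: ler_sum => j _.
  by rewrite (nmZ ipP) cmodR ger0_norm.
apply: (le_trans h1).
have B0 : 0 <= \sum_(j < J) c j * nm (w j) by apply: sumr_ge0 => j _; rewrite mulr_ge0 ?nm_ge0.
rewrite -(ger0_norm B0) -sqrtr_sqr ler_wsqrtr//.
apply: le_trans (weighted_square_sum (fun j => nm (w j)) J c0) _.
have := pX J; rewrite lee_fin => pJ.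
apply: ler_pM => //; [exact: sumr_ge0|exact: sumr_ge0].
Qed.

End inner_series.

Section layers.
Context d (T : measurableType d) (R : realType).
Variable mu : {sigma_finite_measure set T -> \bar R}.
Local Notation leb := (@lebesgue_measure R).
Local Open Scope ereal_scope.

Lemma layer_meas (g f : T -> \bar R) : measurable_fun setT g -> measurable_fun setT f ->
  (forall x, 0 <= g x) ->
  measurable_fun setT (fun a : measurableTypeR R => \int[mu]_x (g x * chi (a%:E < f x))).
Proof.
move=> mg mf g0.
pose F (p : T * measurableTypeR R) := g p.1 * chi (p.2%:E < f p.1).
have mF : measurable_fun setT F.
  apply: emeasurable_funM; first exact: measurableT_comp mg measurable_fst.
  apply: chi_measurable.
  apply: lte_measurable; last exact: measurableT_comp mf measurable_fst.
  by apply/measurable_EFinP; exact: measurable_snd.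
by apply: (@measurable_fun_fubini_tonelli_G _ _ _ _ R mu F mF) => p; rewrite mule_ge0 ?chi_ge0.
Qed.

Lemma pos_measurable : measurable [set a : measurableTypeR R | (0 < a)%R].
Proof.
have := @measurable_itv R `]0%R, +oo[.
by congr measurable; apply/seteqP; split=> p /=; rewrite in_itv/= andbT.
Qed.

(* Comparison of weighted integrals through their superlevel sets. *)
Lemma layer_compare (g f : T -> \bar R) (gs fs : nat -> T -> \bar R) (S : R) (c : nat -> R) :
  measurable_fun setT g -> measurable_fun setT f -> (forall x, 0 <= g x) -> (forall x, 0 <= f x) ->
  (forall i, measurable_fun setT (gs i)) -> (forall i, measurable_fun setT (fs i)) ->
  (forall i x, 0 <= gs i x) -> (forall i x, 0 <= fs i x) ->
  (0 <= S)%R -> (forall i, 0 <= c i)%R ->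
  (forall a : R, (0 < a)%R -> \int[mu]_x (g x * chi (a%:E < f x)) <=
     S%:E * \sum_(i <oo) ((c i)%:E * \int[mu]_x (gs i x * chi (a%:E < fs i x)))) ->
  \int[mu]_x (g x * f x) <= S%:E * \sum_(i <oo) ((c i)%:E * \int[mu]_x (gs i x * fs i x)).
Proof.
move=> mg mf g0 f0 mgs mfs gs0 fs0 S0 c0 h; rewrite layer_cake//.
have i0 i a : 0 <= \int[mu]_x (gs i x * chi (a%:E < fs i x)).
  by apply: integral_ge0 => x _; rewrite mule_ge0 ?chi_ge0.
have ci0 i : 0 <= (c i)%:E by rewrite lee_fin.
have mi i : measurable_fun setT (fun a : measurableTypeR R => (c i)%:E * \int[mu]_x (gs i x * chi (a%:E < fs i x))).
  by apply: measurable_funeM; exact: layer_meas.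
have ms : measurable_fun setT (fun a : measurableTypeR R =>
    \sum_(i <oo) ((c i)%:E * \int[mu]_x (gs i x * chi (a%:E < fs i x)))).
  apply: (@ge0_emeasurable_sum _ (measurableTypeR R) R setT (fun i a => (c i)%:E * \int[mu]_x (gs i x * chi (a%:E < fs i x))) xpredT).
    by move=> k x _ _; rewrite mule_ge0.
  by move=> k _; exact: mi.
have s0 a : 0 <= \sum_(i <oo) ((c i)%:E * \int[mu]_x (gs i x * chi (a%:E < fs i x))).
  by apply: nneseries_ge0 => i _ _; rewrite mule_ge0.
apply: (@le_trans _ _ (\int[leb]_(a in [set a | (0 < a)%R]) (S%:E *
    \sum_(i <oo) ((c i)%:E * \int[mu]_x (gs i x * chi (a%:E < fs i x)))))).
  apply: ge0_le_integral.
  - exact: pos_measurable.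
  - by move=> a _; apply: integral_ge0 => x _; rewrite mule_ge0 ?chi_ge0.
  - by apply: measurable_funTS; exact: layer_meas.
  - by apply: measurable_funTS; apply: measurable_funeM; exact: ms.
  - by move=> a; exact: h.
rewrite ge0_integralZl.
- rewrite integral_nneseries.
  + apply: lee_wpmul2l; first by rewrite lee_fin.
    rewrite le_eqVlt; apply/orP; left; apply/eqP; apply: eq_eseriesr => i _.
    rewrite ge0_integralZl//.
    * by rewrite layer_cake.
    * exact: pos_measurable.
    * by apply: measurable_funTS; exact: layer_meas.
  + exact: pos_measurable.
  + by move=> i; apply: measurable_funTS; exact: mi.
  + by move=> i a _; rewrite mule_ge0.
- exact: pos_measurable.
- by apply: measurable_funTS; exact: ms.
- by move=> a _; exact: s0.
- by rewrite lee_fin.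
Qed.

End layers.

Section weighted.
Context d (R : realType) (Omega : borelMetricType d R).
Variable mu : {sigma_finite_measure set Omega -> \bar R}.
Local Notation nm := (nm (@ipc d R Omega mu)).
Local Notation ipP := (@ipc_inner _ _ _ mu).
Local Notation complete := (@L2cls_complete _ _ _ mu).

Definition msq (v : L2cls mu) (x : Omega) : \bar R := (cmod (rp v x) ^+ 2)%:E.

Lemma msq_meas v : measurable_fun setT (msq v).
Proof. by apply: mod2_meas; exact: ((L2P mu _).1 (rpL2 _)).1. Qed.

Lemma msq_ge0 v x : (0 <= msq v x)%E. Proof. by rewrite lee_fin sqr_ge0. Qed.

Definition lev (f : Omega -> \bar R) (a : R) : set Omega := [set x | (a%:E < f x)%E].

Lemma lev_meas f a : measurable_fun setT f -> measurable (lev f a).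
Proof. by move=> mf; apply: lte_measurable => //; exact: measurable_cst. Qed.

Lemma msq_lev f a (v : L2cls mu) : measurable_fun setT f ->
  (\int[mu]_x (msq v x * chi (a%:E < f x)) = (nm (ind (lev f a) v) ^+ 2)%:E)%E.
Proof.
move=> mf; have h := nm2_ind v (lev_meas a mf).
by rewrite -integral_chi; exact: esym h.
Qed.

(** On each superlevel set of W this is [nm_series] for the restricted classes; [layer_compare]
    integrates over the levels. *)
Lemma weighted_series (v : L2cls mu) (w : nat -> L2cls mu) (c : nat -> R) (S : R)
    (W : Omega -> \bar R) : (forall j, 0 <= c j) -> 0 < S -> (forall J, \sum_(j < J) c j <= S) ->
  (forall e : R, 0 < e -> exists J, nm (v - \sum_(j < J) (c j)%:C%C *: w j) <= e) ->
  measurable_fun setT W -> (forall x, 0 <= W x)%E ->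
  (\int[mu]_x (msq v x * W x) <= S%:E * \sum_(j <oo) ((c j)%:E * \int[mu]_x (msq (w j) x * W x)))%E.
Proof.
move=> c0 S0 cS hv mW W0.
apply: (@layer_compare _ _ _ mu (msq v) W (fun j => msq (w j)) (fun=> W)) => //.
all: try exact: msq_meas; try (by move=> i; exact: msq_meas); try exact: ltW.
all: try exact: msq_ge0; try (by move=> i; exact: msq_ge0).
move=> a a0; have mA := lev_meas a mW; rewrite msq_lev//.
under eq_eseriesr do rewrite msq_lev// -EFinM.
apply: (nm_series ipP (v := ind (lev W a) v) (w := fun j => ind (lev W a) (w j)) c0 S0 cS) => e e0.
have [J hJ] := hv e e0; exists J.
have e1 : ind (lev W a) v - \sum_(j < J) (c j)%:C%C *: ind (lev W a) (w j) =
    ind (lev W a) (v - \sum_(j < J) (c j)%:C%C *: w j).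
  by rewrite (indB _ _ mA) (ind_sum _ _ mA); congr (_ - _); apply: eq_bigr => j _; rewrite indZ.
rewrite e1; exact: le_trans (nm_ind (v - \sum_(j < J) (c j)%:C%C *: w j) mA) hJ.
Qed.

(** At level a, let A = {Wv > a} and D_i = {Lam th^i Wu > a}. By the comparison of weights, A is 2^i
    r apart from the complement of D_i. So the part of u carried by D_(i+1) outside D_i reaches A
    with a squared factor D^-i, D = 2^(2 kappa - 1), while the weight has grown by th^i only, and th
    < D makes the sum over i converge. *)
Lemma weighted_kernel (E : proj_measure mu) kappa (C th : R) : 0 <= C ->
  (forall (r M : R) k1 k2 i A B (v : L2cls mu), 0 < r ->
    good kappa r M k1 -> good kappa r M k2 ->
    bsym (fun l => (k1 l)%:C%C) -> bsym (fun l => (k2 l)%:C%C) -> measurable A -> measurable B ->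
    i = 0%N \/ apart (2 ^+ i * r) A B ->
    nm (ind A (mult (spv E) (fun l => Complex (k1 l) (k2 l)) (ind B v))) ^+ 2 * (2 ^+ kappa.*2.-1) ^+ i <=
      C * M ^+ 2 * nm v ^+ 2) ->
  (0 < kappa)%N -> 1 <= th -> th < 2 ^+ kappa.*2.-1 ->
  exists2 C' : R, 0 <= C' & forall (r M Lam : R) k1 k2 (Wu Wv : Omega -> \bar R) (u : L2cls mu),
    0 < r -> 0 < Lam -> good kappa r M k1 -> good kappa r M k2 ->
    bsym (fun l => (k1 l)%:C%C) -> bsym (fun l => (k2 l)%:C%C) ->
    measurable_fun setT Wu -> measurable_fun setT Wv ->
    (forall x, 0 <= Wu x)%E -> (forall x, 0 <= Wv x)%E ->
    (forall i y y', mdist y y' < 2 ^+ i * r -> (Wv y <= (Lam * th ^+ i)%:E * Wu y')%E) ->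
    (\int[mu]_x (msq (mult (spv E) (fun l => Complex (k1 l) (k2 l)) u) x * Wv x) <=
      (C' * M ^+ 2 * Lam)%:E * \int[mu]_x (msq u x * Wu x))%E.
Proof.
move=> C0 hC kappa0 th1 thD; set D := 2 ^+ kappa.*2.-1 in hC thD.
have th0 : 0 < th by exact: lt_le_trans th1.
have D2 : 2 <= D.
  have p1 : (1 <= kappa.*2.-1)%N by case: (kappa) kappa0.
  by have := ler_weXn2l (ler1n R 2) p1; rewrite expr1.
have D1 : 1 <= D by rewrite exprn_ege1// ler1n.
have D0 : 0 < D by exact: lt_le_trans D1.
(* Half of the decay th / D supplies the Cauchy-Schwarz weights rho^i, the other half sums the
   resulting series. *)
pose rho := Num.sqrt (th / D).
have r2 : rho ^+ 2 = th / D by rewrite (@sqr_sqrtr _ (th / D))// divr_ge0// ltW.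
have rho0 : 0 < rho by rewrite sqrtr_gt0 divr_gt0.
have rho1 : rho < 1 by rewrite -[X in _ < X]sqrtr1 ltr_sqrt// ltr_pdivrMr// mul1r.
have r01 : 0 <= rho < 1 by rewrite ltW.
have S0 : 0 < (1 - rho)^-1 by rewrite invr_gt0 subr_gt0.
exists ((1 - rho)^-1 * (C * D / (1 - rho))).
  by rewrite mulr_ge0 ?(ltW S0)// mulr_ge0 ?(ltW S0)// mulr_ge0// ltW.
move=> r M Lam k1 k2 Wu Wv u r0 L0 g1 g2 b1 b2 mWu mWv Wu0 Wv0 cmp.
set K := mult _ _.
have bk : bsym (fun l => Complex (k1 l) (k2 l)).
  rewrite (_ : (fun l => _) = fun l => (k1 l)%:C%C + 'i%C * (k2 l)%:C%C); last first.
    by apply/funext => l; simpc.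
  by apply: bsymD => //; exact: bsymZ.
have KB x y : K (x - y) = K x - K y.
  have := mult_lin (spv E) complete (-1) y x bk; rewrite !scaleN1r => h.
  by rewrite /K (addrC x) h addrC.
have K0 : K 0 = 0 by have := KB 0 0; rewrite !subrr.
have KD x y : K (x + y) = K x + K y.
  by have := mult_lin (spv E) complete 1 x y bk; rewrite !scale1r.
have Ksum n (F : 'I_n -> L2cls mu) : K (\sum_i F i) = \sum_i K (F i).
  elim: n F => [|n ih] F; first by rewrite !big_ord0.
  by rewrite !big_ord_recr/= KD ih.
have fi0 i x : (0 <= (Lam * th ^+ i)%:E * Wu x)%E.
  by rewrite mule_ge0// lee_fin mulr_ge0 ?exprn_ge0 ?ltW.
have mfi i : measurable_fun setT (fun x => (Lam * th ^+ i)%:E * Wu x)%E by exact: measurable_funeM.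
have ci0 i : 0 <= C * M ^+ 2 * D * (rho * D) ^- i.
  apply: mulr_ge0; first exact: mulr_ge0 (mulr_ge0 C0 (sqr_ge0 M)) (ltW D0).
  by rewrite invr_ge0 exprn_ge0// mulr_ge0 ?(ltW rho0) ?(ltW D0).
apply: (@le_trans _ _ ((1 - rho)^-1%:E * \sum_(i <oo) ((C * M ^+ 2 * D * (rho * D) ^- i)%:E *
    \int[mu]_x (msq u x * ((Lam * th ^+ i)%:E * Wu x))))%E); last first.
  have Y0 : (0 <= \int[mu]_x (msq u x * Wu x))%E.
    by apply: integral_ge0 => x _; rewrite mule_ge0// msq_ge0.
  have e i : ((C * M ^+ 2 * D * (rho * D) ^- i)%:E * \int[mu]_x (msq u x * ((Lam * th ^+ i)%:E * Wu x)) =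
     (C * M ^+ 2 * D * Lam * rho ^+ i)%:E * \int[mu]_x (msq u x * Wu x))%E.
    under eq_integral do rewrite muleCA.
    rewrite ge0_integralZl//; first last.
    - by rewrite lee_fin mulr_ge0 ?exprn_ge0 ?ltW.
    - by move=> x _; rewrite mule_ge0// msq_ge0.
    - by apply: emeasurable_funM => //; exact: msq_meas.
    rewrite muleA -EFinM; congr (_%:E * _)%E.
    rewrite exprMn (_ : th ^+ i = rho ^+ i * (rho ^+ i * D ^+ i)); last first.
      by rewrite mulrA -exprD addnn -mul2n exprM r2 -exprMn divfK// gt_eqF.
    by field; rewrite !expf_neq0// gt_eqF.
  under eq_eseriesr do rewrite e.
  apply: (@le_trans _ _ ((1 - rho)^-1%:E * ((C * M ^+ 2 * D * Lam / (1 - rho))%:E * \int[mu]_x (msq u x * Wu x)))%E).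
    apply: lee_wpmul2l; first by rewrite lee_fin ltW.
    apply: geometric_eseries => //.
    exact: mulr_ge0 (mulr_ge0 (mulr_ge0 C0 (sqr_ge0 M)) (ltW D0)) (ltW L0).
  rewrite muleA -EFinM; apply: lee_wpmul2r => //.
  by rewrite lee_fin le_eqVlt; apply/orP; left; apply/eqP; ring.
apply: (@layer_compare _ _ _ mu (msq (K u)) Wv (fun=> msq u) (fun i x => (Lam * th ^+ i)%:E * Wu x)%E) => //.
all: try exact: msq_meas; try (by move=> i; exact: msq_meas); try exact: ltW.
all: try exact: msq_ge0; try (by move=> i; exact: msq_ge0).
move=> a a0; rewrite msq_lev//; under eq_eseriesr do rewrite msq_lev//.
set A := lev Wv a; pose Di i := lev (fun x => (Lam * th ^+ i)%:E * Wu x)%E a.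
have mA : measurable A by exact: lev_meas.
have mDi i : measurable (Di i) by exact: lev_meas.
have apD i : apart (2 ^+ i * r) A (~` Di i).
  move=> x y Ax nDy; rewrite leNgt; apply/negP => xy; apply: nDy; rewrite /Di /lev/=.
  exact: lt_le_trans Ax (cmp _ _ _ xy).
(* The rings between consecutive sets Di. Ring i + 1 is only known to be 2^i r apart from A, hence
   the additional factor D in [hb]. *)
pose P i := if i is j.+1 then ~` Di j `&` Di i else Di 0%N.
have mP i : measurable (P i) by case: i => [|i] //=; apply: measurableI => //; exact: measurableC.
have PD i : P i `<=` Di i by case: i => [|i] //= x [].
have DS i : Di i `<=` Di i.+1.
  move=> x; rewrite /Di /lev/= => /lt_le_trans; apply.
  by apply: lee_wpmul2r => //; rewrite lee_fin ler_pM2l// exprS ler_peMl ?exprn_ge0 ?(ltW th0).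
have tele I : \sum_(i < I.+1) ind (P i) u = ind (Di I) u.
  elim: I => [|I ih]; first by rewrite big_ord1.
  rewrite big_ord_recr ih -[RHS](indC _ (mDi I)) !indI//; last exact: measurableC.
  by rewrite (setIidl (@DS I)).
pose b i := nm (ind A (K (ind (P i) u))).
have hb i : b i ^+ 2 * D ^+ i <= C * M ^+ 2 * D * nm (ind (Di i) u) ^+ 2.
  have nP : nm (ind (P i) u) ^+ 2 <= nm (ind (Di i) u) ^+ 2.
    by rewrite ler_pXn2r ?nnegrE ?nm_ge0//; exact: nm_ind_mono.
  have CM : 0 <= C * M ^+ 2 by rewrite mulr_ge0 ?sqr_ge0.
  case: i nP => [|i] nP.
    have := hC r M k1 k2 0%N A (P 0%N) (ind (P 0%N) u) r0 g1 g2 b1 b2 mA (mP 0%N) (or_introl erefl).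
    rewrite (ind_ind _ (mP 0%N)) => h; apply: (le_trans h).
    apply: (@le_trans _ _ (C * M ^+ 2 * nm (ind (Di 0%N) u) ^+ 2)); first by rewrite ler_wpM2l.
    by rewrite [leRHS]mulrAC ler_peMr// mulr_ge0// sqr_ge0.
  have ap : i = 0%N \/ apart (2 ^+ i * r) A (P i.+1).
    by right=> x y Ax [nD _]; exact: apD.
  have := hC r M k1 k2 i A (P i.+1) (ind (P i.+1) u) r0 g1 g2 b1 b2 mA (mP i.+1) ap.
  rewrite (ind_ind _ (mP i.+1)) => h.
  have hh : b i.+1 ^+ 2 * D ^+ i <= C * M ^+ 2 * nm (ind (Di i.+1) u) ^+ 2.
    by apply: (le_trans h); rewrite ler_wpM2l.
  move: hh; move: (b i.+1 ^+ 2) (nm (ind (Di i.+1) u) ^+ 2) => p q hh.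
  have e1 : p * D ^+ i.+1 = D * (p * D ^+ i) by rewrite exprS; ring.
  have e2 : C * M ^+ 2 * D * q = D * (C * M ^+ 2 * q) by ring.
  by rewrite e1 e2 (ler_pM2l D0).
(* Normalised so that rho^i times w i is the contribution of ring i. *)
pose w i := (rho ^- i)%:C%C *: ind A (K (ind (P i) u)).
have cw i : (rho ^+ i)%:C%C *: w i = ind A (K (ind (P i) u)).
  by rewrite /w scalerA -rmorphM divff ?scale1r// expf_neq0// gt_eqF.
(* What rings 0 to I leave of u lies off Di I, hence 2^I r apart from A. *)
have tail I : nm (ind A (K u) - \sum_(i < I.+1) (rho ^+ i)%:C%C *: w i) ^+ 2 * D ^+ I <= C * M ^+ 2 * nm u ^+ 2.
  have -> : \sum_(i < I.+1) (rho ^+ i)%:C%C *: w i = ind A (K (ind (Di I) u)).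
    by rewrite -tele Ksum ind_sum//; apply: eq_bigr => i _; exact: cw.
  rewrite -indB// -KB (_ : u - ind (Di I) u = ind (~` Di I) u); last first.
    by rewrite -{1}(indC u (mDi I)) addrC addKr.
  exact: (hC r M k1 k2 I A (~` Di I) u r0 g1 g2 b1 b2 mA (measurableC (mDi I)) (or_intror (apD I))).
have small (e : R) : 0 < e -> exists J, nm (ind A (K u) - \sum_(i < J) (rho ^+ i)%:C%C *: w i) <= e.
  move=> e0; pose X := C * M ^+ 2 * nm u ^+ 2.
  have X0 : 0 <= X := mulr_ge0 (mulr_ge0 C0 (sqr_ge0 M)) (sqr_ge0 (nm u)).
  have Xe : 0 <= X / e ^+ 2 by rewrite divr_ge0 ?sqr_ge0.
  have := archi_boundP Xe; set I := Num.bound _ => hI; exists I.+1.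
  have DI : I%:R <= D ^+ I.
    apply: (@le_trans _ _ (2 ^+ I)); first by rewrite -natrX ler_nat ltnW// ltn_expl.
    by apply: lerXn2r; rewrite ?nnegrE ?(ltW D0).
  have h : X <= e ^+ 2 * D ^+ I.
    by rewrite -ler_pdivrMl ?exprn_gt0// mulrC (le_trans (ltW hI)).
  have := le_trans (tail I) h; rewrite ler_pM2r ?exprn_gt0//.
  by rewrite ler_pXn2r ?nnegrE ?nm_ge0// ltW.
have cS J : \sum_(j < J) rho ^+ j <= (1 - rho)^-1 by exact: geometric_sum_le.
have rj0 j : 0 <= rho ^+ j by rewrite exprn_ge0// ltW.
apply: le_trans (nm_series ipP rj0 S0 cS small) _.
apply: lee_wpmul2l; first by rewrite lee_fin ltW.
apply: lee_nneseries => i _; first by rewrite lee_fin mulr_ge0 ?sqr_ge0.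
rewrite -EFinM lee_fin /w (nmZ ipP) cmodR ger0_norm ?invr_ge0// -/(b i).
have ri0 : 0 < rho ^+ i by rewrite exprn_gt0.
have Di0 : 0 < D ^+ i by rewrite exprn_gt0.
have -> : rho ^+ i * (rho ^- i * b i) ^+ 2 = rho ^- i * b i ^+ 2 by field; rewrite gt_eqF.
rewrite exprMn; exact: weight_swap ri0 Di0 (hb i).
Qed.

End weighted.

(** The image of Lebesgue measure under the dilation, multiplied by c, agrees with Lebesgue measure
    on half-open intervals, hence on all measurable sets. *)
Lemma ge0_integral_scale (R : realType) (f : measurableTypeR R -> \bar R) (c : R) : 0 < c ->
  measurable_fun setT f -> (forall t, 0 <= f t)%E ->
  (\int[@lebesgue_measure R]_t f (c * t)%R = (c^-1)%:E * \int[@lebesgue_measure R]_t f t)%E.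
Proof.
move=> c0 mf f0.
pose phi (t : measurableTypeR R) : measurableTypeR R := c * t.
have mphi : measurable_fun setT phi by apply: measurable_funM.
pose m1 : {measure set (measurableTypeR R) -> \bar R} := pushforward (@lebesgue_measure R) phi.
pose m2 := m1 mphi.
pose cn : {nonneg R} := NngNum (ltW c0).
have h X : ocitv X -> lebesgue_measure X = mscale cn m2 X.
  move=> [[a b] /= ab <-]; rewrite /mscale/= /m2 /m1/= /pushforward.
  rewrite (_ : phi @^-1` _ = `]a / c, b / c]%classic); last first.
    by apply/seteqP; split=> t /=; rewrite !in_itv/= ltr_pdivrMr// ler_pdivlMr// mulrC.
  rewrite !lebesgue_measure_itv/= !lte_fin ltr_pM2r ?invr_gt0//.
  case: ifP => _; last by rewrite mule0.
  by rewrite -!EFinD -EFinM; congr EFin; field; rewrite gt_eqF.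
have e A : measurable A -> lebesgue_measure A = mscale cn m2 A by exact: lebesgue_measure_unique h A.
have -> : (\int[@lebesgue_measure R]_t f t = \int[mscale cn m2]_t f t)%E.
  by apply: eq_measure_integral => A mA _; exact: e.
rewrite (ge0_integral_mscale m2 measurableT cn mf)//.
rewrite muleA -EFinM/= mulVf ?gt_eqF// mul1e /m2 /m1.
by rewrite ge0_integral_pushforward.
Qed.

(** Invariance of dt/t, which brings every scale [scl j t] of the series back to t. *)
Lemma ge0_integral_dilation (R : realType) (f : R -> \bar R) (c : R) : 0 < c ->
  measurable_fun setT (f : measurableTypeR R -> \bar R) -> (forall t, 0 <= f t)%E ->
  (\int[@lebesgue_measure R]_(t in [set t : R | (0 < t)%R]) (f (c * t)%R * (t^-1)%:E) =
   \int[@lebesgue_measure R]_(t in [set t : R | (0 < t)%R]) (f t * (t^-1)%:E))%E.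
Proof.
move=> c0 mf f0.
pose g (t : measurableTypeR R) : \bar R := (f t * (if (0 < t)%R then (t^-1)%:E else 0))%E.
have mg : measurable_fun setT g.
  apply: emeasurable_funM => //.
  rewrite (_ : (fun _ => _) = fun t : measurableTypeR R => ((t^-1)%:E * chi (0 < t)%R)%E); last first.
    by apply/funext => t; rewrite /chi; case: ifP; rewrite ?mule1 ?mule0.
  apply: emeasurable_funM; first by apply/measurable_EFinP; exact: measurable_invr.
  by apply: chi_measurable; exact: pos_measurable.
have g0 t : (0 <= g t)%E.
  by rewrite /g mule_ge0//; case: ifP => // t0; rewrite lee_fin invr_ge0 ltW.
rewrite !integral_chi; transitivity (\int[@lebesgue_measure R]_t (c%:E * g (c * t)%R))%E.
  apply: eq_integral => t _; rewrite /g pmulr_rgt0// /chi; case: ifP => [t0|_].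
    rewrite mule1 muleCA -EFinM; congr (_ * _%:E)%E.
    by rewrite invfM mulrA divff ?mul1r// gt_eqF.
  by rewrite !mule0.
rewrite ge0_integralZl//; [|by apply: measurableT_comp mg _; exact: measurable_funM|by rewrite lee_fin ltW].
rewrite ge0_integral_scale// muleA -EFinM divff ?gt_eqF// mul1e.
by apply: eq_integral => t _; rewrite /g /chi -muleA; case: ifP; rewrite ?mule1 ?mule0.
Qed.

Section indicator_combination.
Context d (R : realType) (Omega : borelMetricType d R).
Variable mu : {measure set Omega -> \bar R}.
Local Notation nm := (nm (@ipc d R Omega mu)).

Lemma nm_ind_comb (S : set Omega) (a : R[i]) (p q : L2cls mu) : measurable S ->
  ((nm (ind S (a *: p + q)%R) ^+ 2)%:E <=
   (2 * cmod a ^+ 2)%:E * (nm (ind S p) ^+ 2)%:E + 2%:E * (nm (ind S q) ^+ 2)%:E)%E.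
Proof.
move=> mS; rewrite -!EFinM -EFinD lee_fin (indD _ _ mS) (indZ _ _ mS).
have h1 := nmD (@ipc_inner _ _ _ mu) (a *: ind S p) (ind S q).
have h2 := nmZ (@ipc_inner _ _ _ mu) a (ind S p).
rewrite h2 in h1; move: h1 (nm_ge0 (ipc (mu := mu)) (a *: ind S p + ind S q)).
set z := nm (a *: ind S p + ind S q); set x := nm (ind S p); set y := nm (ind S q).
move: z x y => z x y h1 z0.
have h3 : z ^+ 2 <= (cmod a * x + y) ^+ 2.
  by apply: lerXn2r; rewrite ?nnegrE ?(le_trans z0 h1).
by apply: (le_trans h3); apply: le_trans (sqrD_le2 _ _) _; rewrite exprMn mulrA.
Qed.

End indicator_combination.

Lemma chi_comb (R : realType) (b : bool) (X Y Z c p q : \bar R) : (b -> 0 <= c)%E ->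
  (0 <= p)%E -> (0 <= q)%E -> (0 <= Y)%E -> (0 <= Z)%E -> (b -> X <= p * Y + q * Z)%E ->
  (X * chi b * (c * chi b) <= p * (Y * chi b * (c * chi b)) + q * (Z * chi b * (c * chi b)))%E.
Proof.
move=> c0 p0 q0 Y0 Z0; rewrite /chi; case: b c0 => c0 h; last by rewrite !mule0 adde0.
rewrite !mule1; apply: le_trans (lee_wpmul2r (c0 isT) (h isT)) _.
by rewrite ge0_muleDl ?mule_ge0// !muleA.
Qed.

Lemma nm_lipschitz (R : realType) (V : lmodType R[i]) (ip : V -> V -> R[i]) (u v : V) :
  is_inner ip -> `|nm ip u - nm ip v| <= nm ip (u - v).
Proof.
move=> ipP; have h1 := nm_dist ipP u v; have h2 := nm_dist ipP v u.
have e := nmBC ipP v u; rewrite e in h2; move: h1 h2.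
move: (nm ip u) (nm ip v) (nm ip (u - v)) => x y z h1 h2.
by rewrite ler_norml; apply/andP; split; move: h1 h2; lra.
Qed.

(** * The heat operators t^2 L exp(-t^2 L) as functions of t *)

Section heat_scale.
Context d (R : realType) (Omega : borelMetricType d R).
Variable mu : {measure set Omega -> \bar R}.
Variables (E : proj_measure mu) (L : operator mu).
Local Notation nm := (nm (@ipc d R Omega mu)).
Local Notation complete := (@L2cls_complete _ _ _ mu).
Local Notation cls := (cls mu).
Implicit Types (v w : L2cls mu).

Lemma qd_dheat (t l : R) : (qd t l)%:C%C = (t ^+ 2)%:C%C * dheat_symbol (t ^+ 2) l :> R[i].
Proof. by rewrite /dheat_symbol /qd /gexp !exprMn -mulrA rmorphM. Qed.

Lemma bsym_qd (t : R) : 0 < t -> bsym (fun l => (qd t l)%:C%C).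
Proof.
move=> t0; rewrite (_ : (fun l => _) = fun l => (t ^+ 2)%:C%C * dheat_symbol (t ^+ 2) l); last first.
  by apply/funext => l; exact: qd_dheat.
by apply: bsymZ; apply: bsym_dheat; rewrite exprn_gt0.
Qed.

(** The class of t^2 L exp(-t^2 L) applied to v. *)
Definition ut v (t : R) : L2cls mu := mult (spv E) (fun l => (qd t l)%:C%C) v.

Lemma utE (LE : spectral_measure_sqrt L E) f (t : R) : 0 < t -> L2 mu f ->
  L2 mu (fun y => (t ^+ 2)%:C%C * L (heat E (t ^+ 2) f) y) /\
  cls (fun y => (t ^+ 2)%:C%C * L (heat E (t ^+ 2) f) y) = ut (cls f) t.
Proof.
move=> t0 lf; have t2 : 0 < t ^+ 2 by rewrite exprn_gt0.
have [l1 e1] := cls_L_heat LE t2 lf; split; first exact: L2Z.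
apply: (etrans (clsZ _ l1)); rewrite e1; apply: esym.
apply: (etrans _ (multZ (spv E) complete (t ^+ 2)%:C%C (cls f) (bsym_dheat t2))).
by rewrite /ut; congr (mult _ _ _); apply/funext => l; rewrite qd_dheat.
Qed.

Lemma exp_diff_le (a b : R) : 0 <= a -> a <= b ->
  `|a * expR (- a) - b * expR (- b)| <= (b - a) * (1 + a) * expR (- a).
Proof.
move=> a0 ab; have e1 : expR (- b) <= expR (- a) by rewrite ler_expR lerN2.
have e0 := expR_gt0 (- b).
have e2 : expR (- a) - expR (- b) <= (b - a) * expR (- a).
  have := expR_ge1Dx (- (b - a)).
  have -> : expR (- b) = expR (- (b - a)) * expR (- a) by rewrite -expRD; congr expR; ring.
  by have := expR_gt0 (- a); move: (expR (- a)) (expR (- (b - a))) => x y; nra.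
move: e1 e0 e2; move: (expR (- a)) (expR (- b)) => x y h1 h0 h2.
have h3 : a * (x - y) <= a * ((b - a) * x) by rewrite ler_wpM2l.
have h4 : (b - a) * y <= (b - a) * x by rewrite ler_wpM2l// subr_ge0.
have h5 : 0 <= a * (x - y) by rewrite mulr_ge0// subr_ge0.
have h6 : 0 <= (b - a) * y by rewrite mulr_ge0 ?subr_ge0// ltW.
by rewrite ler_norml; apply/andP; split; move: h3 h4 h5 h6; lra.
Qed.

Lemma qd_diff (s t l : R) : 0 < s -> s <= t -> `|qd s l - qd t l| <= 5 * ((t ^+ 2 - s ^+ 2) / s ^+ 2).
Proof.
move=> s0 st; have s2 : 0 < s ^+ 2 by rewrite exprn_gt0.
have st2 : s ^+ 2 <= t ^+ 2 by rewrite ler_pXn2r ?nnegrE ?(le_trans (ltW s0)) ?(ltW s0).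
pose a := (s * l) ^+ 2; pose b := (t * l) ^+ 2.
have a0 : 0 <= a by exact: sqr_ge0.
have ab : a <= b by rewrite /a /b !exprMn ler_wpM2r ?sqr_ge0.
have eba : b - a = a * ((t ^+ 2 - s ^+ 2) / s ^+ 2).
  by rewrite /a /b !exprMn; field; rewrite gt_eqF.
apply: (le_trans (exp_diff_le a0 ab)); rewrite eba.
have q0 : 0 <= (t ^+ 2 - s ^+ 2) / s ^+ 2 by rewrite divr_ge0 ?subr_ge0 ?(ltW s2).
rewrite [leLHS](_ : _ = (a * expR (- a) + a ^+ 2 * expR (- a)) * ((t ^+ 2 - s ^+ 2) / s ^+ 2)); last by ring.
rewrite ler_wpM2r//.
have p1 : a * expR (- a) <= 1.
  have := expR_ge_pow 1 a0; rewrite !expr1 mul1r expRN => h.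
  by rewrite ler_pdivrMr ?expR_gt0// mul1r.
have p2 : a ^+ 2 * expR (- a) <= 4.
  have := expR_ge_pow 2 a0; rewrite expRN (_ : 2%:R ^+ 2 = 4 :> R); last by rewrite -natrX.
  by move=> h; rewrite ler_pdivrMr ?expR_gt0.
by move: p1 p2; lra.
Qed.

(** Continuity in t away from 0, on which the joint measurability of the cone integrals relies. *)
Lemma ut_diff v (s t : R) : 0 < s -> s <= t ->
  nm (ut v s - ut v t) <= 5 * ((t ^+ 2 - s ^+ 2) / s ^+ 2) * nm v.
Proof.
move=> s0 st; have t0 := lt_le_trans s0 st.
apply: (mult_dist (spv E) complete v (bsym_qd s0) (bsym_qd t0)) => l l0.
by rewrite -rmorphB cmodR; exact: qd_diff.
Qed.

End heat_scale.

(** * Measurability and weighted integrals of the square function *)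

Section square_function_theory.
Context d (R : realType) (Omega : borelMetricType d R).
Variable mu : {sigma_finite_measure set Omega -> \bar R}.
Variables (E : proj_measure mu).
Variables (C0 theta : R).
Hypothesis hv : forall (x : Omega) (t : R), 0 < t -> (0 < vol mu x t)%E /\ (vol mu x t < +oo)%E.
Hypothesis C00 : 0 < C0.
Hypothesis theta1 : 1 <= theta.
Hypothesis growth : forall (x : Omega) (t : R) k, 0 < t ->
  fine (vol mu x (2 ^+ k * t)) <= C0 * theta ^+ k * fine (vol mu x t).
Variable x0 : Omega.
Local Notation V x t := (fine (vol mu x t)).
Local Notation nm := (nm (@ipc d R Omega mu)).
Local Notation ut := (ut E).
Local Notation leb := (@lebesgue_measure R).
Local Notation RM := (measurableTypeR R).
Let md := mdist_measurable hv C00 theta1 growth x0.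
Implicit Types (v : L2cls mu).

Lemma md3 : measurable_fun [set: (Omega * RM) * Omega] (fun p => mdist p.1.1 p.2).
Proof.
have mp : measurable_fun [set: (Omega * RM) * Omega] (fun p => (p.1.1, p.2)).
  apply: measurable_fun_pair; last exact: measurable_snd.
  exact: measurableT_comp measurable_fst measurable_fst.
exact: (measurableT_comp md mp).
Qed.

Lemma mt3 : measurable_fun [set: (Omega * RM) * Omega] (fun p => p.1.2 : R).
Proof. exact: measurableT_comp measurable_snd measurable_fst. Qed.

Lemma joint_meas (g : Omega -> \bar R) (b : (Omega * RM) * Omega -> bool) :
  measurable_fun setT g -> (forall y, 0 <= g y)%E -> measurable [set p | b p] ->
  measurable_fun [set: Omega * RM] (fun q => \int[mu]_y (g y * chi (b (q, y))))%E.
Proof.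
move=> mg g0 mb; pose F (p : (Omega * RM) * Omega) := (g p.2 * chi (b p))%E.
have mF : measurable_fun setT F.
  apply: emeasurable_funM; first exact: measurableT_comp mg measurable_snd.
  exact: chi_measurable.
by apply: (@measurable_fun_fubini_tonelli_F _ _ _ _ R mu F mF) => p; rewrite mule_ge0 ?chi_ge0.
Qed.

Lemma joint_vol : measurable_fun [set: Omega * RM] (fun q => vol mu q.1 q.2).
Proof.
have := @joint_meas (cst 1%E) (fun p => mdist p.1.1 p.2 < p.1.2)
  (measurable_cst _) (fun=> lee01) (ltr_measurable md3 mt3).
congr measurable_fun; apply/funext => q /=.
rewrite -(integral_chi mu (cst 1%E)) integral_cst ?mul1e.
  by congr (mu _); apply/seteqP; split=> y; rewrite /= ballEmdist.
have := ball_measurable q.1 q.2; congr measurable.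
by apply/seteqP; split=> y; rewrite /= ballEmdist.
Qed.

Lemma joint_inv_vol : measurable_fun [set: Omega * RM] (fun q => ((V q.1 q.2)^-1)%:E).
Proof.
apply/measurable_EFinP; apply: (measurableT_comp (@measurable_invr R)).
by apply: measurableT_comp => //; exact: joint_vol.
Qed.

Definition cone v (x : Omega) (t : R) : \bar R :=
  (\int[mu]_(y in [set y | (mdist x y <= t)%R]) msq v y)%E.

Lemma cone_ge0 v x t : (0 <= cone v x t)%E.
Proof. by apply: integral_ge0 => y _; exact: msq_ge0. Qed.

Lemma cball_meas' x (t : R) : measurable [set y : Omega | mdist x y <= t].
Proof.
have := cball_meas hv C00 theta1 growth x0 x t; congr measurable.
by apply/seteqP; split=> y /=; rewrite metric_sym.
Qed.

Lemma coneE v x t : cone v x t = (nm (ind [set y | mdist x y <= t] v) ^+ 2)%:E.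
Proof. exact: esym (nm2_ind v (cball_meas' x t)). Qed.

Lemma cone_joint v : measurable_fun [set: Omega * RM] (fun q => cone v q.1 q.2).
Proof.
have := @joint_meas (msq v) (fun p => mdist p.1.1 p.2 <= p.1.2)
  (msq_meas v) (msq_ge0 v) (ler_measurable md3 mt3).
by congr measurable_fun; apply/funext => q /=; rewrite /cone integral_chi.
Qed.

(* Smallest dyadic number of generation [n] above [t]. *)
Definition dyad n (t : R) : R := (Num.truncn (t * 2 ^+ n)).+1%:R / 2 ^+ n.

Lemma dyad_itv n (t : R) : 0 < t -> t <= dyad n t <= t + (2 ^+ n)^-1.
Proof.
move=> t0; have p0 : 0 < 2 ^+ n :> R by rewrite exprn_gt0.
have := Num.Theory.truncn_itv (mulr_ge0 (ltW t0) (ltW p0)) => /andP[h1 h2].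
rewrite /dyad ler_pdivlMr// (ltW h2)/= ler_pdivrMr// mulrDl mulVf ?gt_eqF//.
by rewrite -natr1 lerD2r.
Qed.

Lemma cone_dyad_cvg v x (t : R) : 0 < t ->
  cone (ut v (dyad n t)) x t @[n --> \oo] --> cone (ut v t) x t.
Proof.
move=> t0; under eq_fun do rewrite coneE; rewrite coneE.
apply: cvg_EFin; first exact: nearW.
set A := [set y | _].
have mA : measurable A by exact: cball_meas'.
suff h : nm (ind A (ut v (dyad n t))) @[n --> \oo] --> nm (ind A (ut v t)).
  apply: (@cvg_comp _ _ _ (fun n => nm (ind A (ut v (dyad n t)))) (fun x : R => x ^+ 2) _ _ _ h).
  exact: exprn_continuous.
apply/cvgrPdist_le => e e0.
pose K := 5 * ((2 * t + 1) / t ^+ 2) * nm v + 1.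
have nv := nm_ge0 (@ipc d R Omega mu) v.
have K0 : 0 < K by rewrite ltr_wpDl// !mulr_ge0// ?addr_ge0 ?mulr_ge0 ?invr_ge0 ?sqr_ge0 ?ltW.
near=> n.
have /andP[d1 d2] := dyad_itv n t0.
have n1 : (2 ^+ n)^-1 <= e / K :> R.
  near: n; have eK : 0 < e / K by rewrite divr_gt0.
  exists (Num.bound (e / K)^-1) => // n /= hn.
  rewrite invf_ple ?posrE ?exprn_gt0//.
  apply: (le_trans (ltW (archi_boundP _))); first by rewrite invr_ge0 ltW.
  by rewrite -natrX ler_nat (leq_trans hn)// ltnW// ltn_expl.
have n2 : (2 ^+ n)^-1 <= 1 :> R by rewrite invf_le1 ?exprn_gt0// exprn_ege1// ler1n.
have s1 : `|nm (ind A (ut v t)) - nm (ind A (ut v (dyad n t)))| <= nm (ut v t - ut v (dyad n t)).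
  apply: (le_trans (nm_lipschitz _ _ (@ipc_inner _ _ _ mu))); rewrite -(indB _ _ mA).
  exact: nm_ind.
apply: (le_trans s1); apply: (le_trans (ut_diff E v t0 d1)).
apply: (@le_trans _ _ (K * (2 ^+ n)^-1)); last by rewrite mulrC -ler_pdivlMr.
set D := dyad n t in d1 d2 *; set r := (2 ^+ n)^-1 in n1 n2 d2 *.
have r0 : 0 <= r by rewrite invr_ge0 exprn_ge0.
have dd : D ^+ 2 - t ^+ 2 <= (2 * t + 1) * r.
  have : D ^+ 2 <= (t + r) ^+ 2 by rewrite ler_pXn2r ?nnegrE ?(le_trans (ltW t0) d1)// addr_ge0// ltW.
  by move: n2 r0 t0; nra.
have -> : K * r = 5 * ((2 * t + 1) / t ^+ 2) * nm v * r + r by rewrite /K mulrDl mul1r.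
apply: (@le_trans _ _ (5 * ((2 * t + 1) / t ^+ 2) * nm v * r)); last by rewrite lerDl.
rewrite [leRHS](_ : _ = 5 * (((2 * t + 1) * r) / t ^+ 2) * nm v); last by ring.
by rewrite ler_wpM2r// ler_wpM2l// ler_wpM2r// invr_ge0 sqr_ge0.
Unshelve. all: by end_near.
Qed.

(** Dyadic times of generation n are countable, so the function is a sum over p of functions with
    one fixed class, cut off to p <= t 2^n < p + 1. *)
Lemma cone_dyad_joint v n : measurable_fun [set: Omega * RM]
  (fun q => cone (ut v (dyad n q.2)) q.1 q.2 * chi (0 < q.2)%R)%E.
Proof.
pose b p (q : Omega * RM) := (p%:R <= q.2 * 2 ^+ n) && (q.2 * 2 ^+ n < p.+1%:R).
have mt : measurable_fun [set: Omega * RM] (fun q => q.2 * 2 ^+ n : R).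
  by apply: measurable_funM => //; exact: measurable_snd.
have mb p : measurable [set q | b p q].
  rewrite [X in measurable X](_ : _ = [set q : Omega * RM | p%:R <= q.2 * 2 ^+ n] `&` [set q : Omega * RM | q.2 * 2 ^+ n < p.+1%:R]).
    apply: measurableI; [exact: ler_measurable|exact: ltr_measurable].
  by apply/seteqP; split=> q /=; [move/andP|move=> [h1 h2]; rewrite /b h1 h2].
pose G p (q : Omega * RM) := (cone (ut v (p.+1%:R / 2 ^+ n)) q.1 q.2 * chi (b p q) * chi (0 < q.2)%R)%E.
have mpos : measurable_fun [set: Omega * RM] (fun q => chi (0 < q.2)%R : \bar R).
  by apply: chi_measurable; apply: ltr_measurable => //; exact: measurable_snd.
have G0 p q : (0 <= G p q)%E by rewrite /G !mule_ge0 ?chi_ge0 ?cone_ge0.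
have mG p : measurable_fun setT (G p).
  by apply: emeasurable_funM => //; apply: emeasurable_funM; [exact: cone_joint|exact: chi_measurable].
have := @ge0_emeasurable_sum _ _ R setT G xpredT (fun k x _ _ => G0 k x) (fun k _ => mG k).
congr measurable_fun; apply/funext => q /=.
have [q0|q0] := ltP 0 q.2; last first.
  by rewrite [chi _]/= mule0 eseries0// => k _ _; rewrite /G /chi ltNge q0/= mule0.
have t0 : 0 <= q.2 * 2 ^+ n by rewrite mulr_ge0 ?exprn_ge0 ?ltW.
have /andP[i1 i2] := Num.Theory.truncn_itv t0.
set p0 := Num.truncn _ in i1 i2.
rewrite (@nneseriesD1 _ (fun k => G k q) p0 xpredT)//; last first.
rewrite eseries0 ?adde0; last first.
  move=> k _ /andP[_ kp]; rewrite /G /chi /b; case: ifP => [/andP[h1 h2]|]; rewrite ?mule0 ?mul0e//.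
  case/negP: kp; rewrite eqn_leq -ltnS -(ltnS p0) -!(ltr_nat R).
  by rewrite (le_lt_trans h1)//= (le_lt_trans i1).
by rewrite /G /b i1 i2 q0 /dyad -/p0 /= !mule1.
Qed.

(** The representatives of the classes [ut v t] are chosen separately for each t, so joint
    measurability in (x, t) is obtained for the cone integrals, as a limit over dyadic times. *)
Lemma cone_ut_joint v : measurable_fun [set: Omega * RM]
  (fun q => cone (ut v q.2) q.1 q.2 * chi (0 < q.2)%R)%E.
Proof.
apply: (emeasurable_fun_cvg (fun n (q : Omega * RM) => cone (ut v (dyad n q.2)) q.1 q.2 * chi (0 < q.2)%R)%E).
  by move=> n; exact: cone_dyad_joint.
move=> q _; have [q0|q0] := ltP 0 q.2.
  by rewrite [chi _]/=; under eq_fun do rewrite mule1; rewrite mule1; exact: cone_dyad_cvg.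
by rewrite [chi _]/=; under eq_fun do rewrite mule0; rewrite mule0; exact: cvg_cst.
Qed.

Definition sq v (x : Omega) : \bar R :=
  (\int[leb]_(t in [set t : R | (0 < t)%R]) (cone (ut v t) x t * ((V x t)^-1)%:E * (t^-1)%:E))%E.

Let F v (q : Omega * RM) : \bar R :=
  (cone (ut v q.2) q.1 q.2 * chi (0 < q.2)%R * (((V q.1 q.2)^-1)%:E * (q.2^-1)%:E * chi (0 < q.2)%R))%E.

Let mF v : measurable_fun setT (F v).
Proof.
apply: emeasurable_funM; first exact: cone_ut_joint.
apply: emeasurable_funM.
  apply: emeasurable_funM; first exact: joint_inv_vol.
  apply/measurable_EFinP; apply: (measurableT_comp (@measurable_invr R)); exact: measurable_snd.
by apply: chi_measurable; apply: ltr_measurable => //; exact: measurable_snd.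
Qed.

Let F0 v q : (0 <= F v q)%E.
Proof.
rewrite /F /chi; case: ltP => q0; rewrite ?mule0// !mule_ge0 ?cone_ge0 ?inv_vol_ge0//.
by rewrite lee_fin invr_ge0 ltW.
Qed.

Let sqE v x : sq v x = (\int[leb]_t F v (x, t))%E.
Proof.
rewrite /sq integral_chi; apply: eq_integral => t _; rewrite /F/= /chi.
by case: ifP; rewrite ?mule1 ?mule0 ?mul0e// muleA.
Qed.

Lemma sq_ge0 v x : (0 <= sq v x)%E.
Proof. by rewrite sqE; apply: integral_ge0 => t _; exact: F0. Qed.

Lemma sq_meas v : measurable_fun setT (sq v).
Proof.
have := @measurable_fun_fubini_tonelli_F _ _ _ _ R leb (F v) (mF v) (F0 v).
by congr measurable_fun; apply/funext => x; rewrite sqE.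
Qed.

(** The contribution of height t to the integral of phi against the squared square function, once
    the integral in x has been carried out. *)
Definition slice v (phi : Omega -> \bar R) (t : R) : \bar R := (\int[mu]_y (msq (ut v t) y * avg mu phi t y))%E.

Lemma slice_ge0 v phi t : (forall x, 0 <= phi x)%E -> (0 <= slice v phi t)%E.
Proof. by move=> p0; apply: integral_ge0 => y _; rewrite mule_ge0 ?msq_ge0 ?avg_ge0. Qed.

Let sliceE v phi t : measurable_fun setT phi -> (forall x, 0 <= phi x)%E -> 0 < t ->
  (\int[mu]_x (phi x * F v (x, t)) = slice v phi t * (t^-1)%:E)%E.
Proof.
move=> mp p0 t0.
have mV := inv_vol_meas hv C00 theta1 growth x0 t.
have ti : (0 <= (t^-1)%:E)%E by rewrite lee_fin invr_ge0 ltW.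
pose H (p : Omega * Omega) := (phi p.1 * ((V p.1 t)^-1)%:E * (msq (ut v t) p.2 * chi (mdist p.1 p.2 <= t)%R))%E.
have mH : measurable_fun setT H.
  apply: emeasurable_funM.
    apply: emeasurable_funM; first exact: measurableT_comp mp measurable_fst.
    by apply/measurable_EFinP; exact: measurableT_comp mV measurable_fst.
  apply: emeasurable_funM; first exact: measurableT_comp (msq_meas _) measurable_snd.
  by apply: chi_measurable; apply: ler_measurable => //; exact: md.
have H0 p : (0 <= H p)%E by rewrite !mule_ge0 ?inv_vol_ge0 ?msq_ge0 ?chi_ge0.
have mc : measurable_fun setT (fun x => cone (ut v t) x t).
  have h := @measurable_fun_pair _ _ _ _ _ _ (fun x : Omega => x) (fun=> t : RM) (@measurable_id _ _ setT) (measurable_cst _).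
  exact: (measurableT_comp (cone_joint (ut v t)) h).
transitivity (\int[mu]_x (phi x * ((V x t)^-1)%:E * cone (ut v t) x t * (t^-1)%:E))%E.
  apply: eq_integral => x _; rewrite /F/= /chi t0 !mule1.
  by rewrite -!muleA; congr (_ * _)%E; rewrite muleCA.
rewrite ge0_integralZr//; first last.
- by move=> x _; rewrite !mule_ge0 ?inv_vol_ge0 ?cone_ge0.
- apply: emeasurable_funM => //; apply: emeasurable_funM => //; exact/measurable_EFinP.
congr (_ * _)%E; transitivity (\int[mu]_x \int[mu]_y H (x, y))%E.
  apply: eq_integral => x _; rewrite /cone integral_chi -ge0_integralZl//.
  - apply: emeasurable_funM; first exact: msq_meas.
    by apply: chi_measurable; exact: cball_meas'.
  - by move=> y _; rewrite mule_ge0 ?msq_ge0 ?chi_ge0.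
  - by rewrite mule_ge0 ?inv_vol_ge0.
rewrite (fubini_tonelli H mH H0); apply: eq_integral => y _.
rewrite /avg integral_chi -ge0_integralZl.
- by apply: eq_integral => x _; rewrite /H/= muleCA muleA.
- by [].
- apply: emeasurable_funM.
    by apply: emeasurable_funM => //; exact/measurable_EFinP.
  by apply: chi_measurable; exact: cball_meas hv C00 theta1 growth x0 y t.
- by move=> x _; rewrite !mule_ge0 ?inv_vol_ge0 ?chi_ge0.
- exact: msq_ge0.
Qed.

Lemma slice_meas v phi : measurable_fun setT phi -> (forall x, 0 <= phi x)%E ->
  measurable_fun [set: RM] (fun t => slice v phi t * (t^-1)%:E * chi (0 < t)%R)%E.
Proof.
move=> mp p0; pose G (q : Omega * RM) := (phi q.1 * F v q)%E.
have mG : measurable_fun setT G.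
  by apply: emeasurable_funM => //; exact: measurableT_comp mp measurable_fst.
have G0 q : (0 <= G q)%E by rewrite mule_ge0.
have := @measurable_fun_fubini_tonelli_G _ _ _ _ R mu G mG G0.
congr measurable_fun; apply/funext => t; rewrite /fubini_G /G /chi; case: ifP => t0; last first.
  by rewrite mule0; apply: integral0_eq => x _; rewrite /F/= /chi t0 !mule0.
by rewrite mule1 -sliceE.
Qed.

(** Tonelli's theorem in (x, t) and then, through [sliceE], in (x, y): the cone condition and the
    factor 1 / V(x, t) are gathered in [avg]. *)
Lemma sq_weighted v phi : measurable_fun setT phi -> (forall x, 0 <= phi x)%E ->
  (\int[mu]_x (phi x * sq v x) =
   \int[leb]_(t in [set t : R | (0 < t)%R]) (slice v phi t * (t^-1)%:E))%E.
Proof.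
move=> mp p0; pose G (q : Omega * RM) := (phi q.1 * F v q)%E.
have mG : measurable_fun setT G.
  by apply: emeasurable_funM => //; exact: measurableT_comp mp measurable_fst.
have G0 q : (0 <= G q)%E by rewrite mule_ge0.
transitivity (\int[mu]_x \int[leb]_t G (x, t))%E.
  apply: eq_integral => x _; rewrite sqE -ge0_integralZl//.
    by apply: measurableT_comp (mF v) _; exact: pair1_measurable.
rewrite (fubini_tonelli G mG G0) integral_chi; apply: eq_integral => t _; rewrite /G /chi.
case: ifP => t0; first by rewrite mule1 -sliceE.
by rewrite mule0; apply: integral0_eq => x _; rewrite /F/= /chi t0 !mule0.
Qed.

Let cone_comb (a : R[i]) (u w : L2cls mu) x t : 0 < t ->
  (cone (ut (a *: u + w)%R t) x t <=
   (2 * cmod a ^+ 2)%:E * cone (ut u t) x t + 2%:E * cone (ut w t) x t)%E.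
Proof.
move=> t0; have e : ut (a *: u + w) t = a *: ut u t + ut w t.
  by apply: (mult_lin (spv E) (@L2cls_complete _ _ _ mu)); exact: bsym_qd.
have gen (r p q : L2cls mu) : ((nm (ind [set y | mdist x y <= t] r) ^+ 2)%:E <=
    (2 * cmod a ^+ 2)%:E * (nm (ind [set y | mdist x y <= t] p) ^+ 2)%:E +
    2%:E * (nm (ind [set y | mdist x y <= t] q) ^+ 2)%:E)%E ->
    (cone r x t <= (2 * cmod a ^+ 2)%:E * cone p x t + 2%:E * cone q x t)%E.
  by rewrite (coneE r) (coneE p) (coneE q).
have k := nm_ind_comb a (ut u t) (ut w t) (cball_meas' x t); rewrite -e in k.
exact: (gen _ _ _ k).
Qed.

(** Quadratic subadditivity; its constants suffice for the functions of finite Hardy norm to form a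
    vector space. *)
Lemma sq_comb (a : R[i]) (u w : L2cls mu) x :
  (sq (a *: u + w)%R x <= (2 * cmod a ^+ 2)%:E * sq u x + 2%:E * sq w x)%E.
Proof.
rewrite !sqE.
have mx v : measurable_fun [set: RM] (fun t : RM => F v (x, t)).
  by apply: measurableT_comp (mF v) _; exact: pair1_measurable.
have ca : 0 <= 2 * cmod a ^+ 2 by rewrite mulr_ge0// sqr_ge0.
have zl (k : R) v : 0 <= k -> (k%:E * \int[leb]_t F v (x, t) = \int[leb]_t (k%:E * F v (x, t)))%E.
  by move=> k0; rewrite ge0_integralZl//; exact: mx.
have fu t : (0 <= (2 * cmod a ^+ 2)%:E * F u (x, t))%E by apply: mule_ge0; [rewrite lee_fin|exact: F0].
have fw t : (0 <= 2%:E * F w (x, t))%E by apply: mule_ge0; [rewrite lee_fin|exact: F0].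
have mfu : measurable_fun [set: RM] (fun t : RM => (2 * cmod a ^+ 2)%:E * F u (x, t))%E by exact: measurable_funeM.
have mfw : measurable_fun [set: RM] (fun t : RM => 2%:E * F w (x, t))%E by exact: measurable_funeM.
apply: (@le_trans _ _ (\int[leb]_t ((2 * cmod a ^+ 2)%:E * F u (x, t) + 2%:E * F w (x, t)))%E); last first.
  rewrite (zl _ u ca) (zl 2 w (ler0n _ 2)) le_eqVlt; apply/orP; left; apply/eqP; apply: ge0_integralD.
  - exact: measurableT.
  - by move=> t _; exact: fu.
  - exact: mfu.
  - by move=> t _; exact: fw.
  - exact: mfw.
apply: ge0_le_integral.
- exact: measurableT.
- by move=> t _; exact: F0.
- exact: mx.
- exact: (emeasurable_funD mfu mfw).
move=> t _; apply: chi_comb.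
- move=> t0; apply: mule_ge0; [exact: inv_vol_ge0|by rewrite lee_fin invr_ge0 ltW].
- by rewrite lee_fin.
- by rewrite lee_fin.
- exact: cone_ge0.
- exact: cone_ge0.
move=> t0; exact: (cone_comb a u w x t0).
Qed.

(** The definition works with representatives produced by [heat] and L; their class is [ut], and the
    cone integral depends on the class only. *)
Lemma square_functionE (L : operator mu) (LE : spectral_measure_sqrt L E) f x : L2 mu f ->
  square_function L E f x = (sq (cls mu f) x `^ 2^-1)%E.
Proof.
move=> lf; rewrite /square_function /sq; congr (_ `^ _)%E.
apply: eq_integral => t; rewrite inE/= => t0; congr (_ * _ * _)%E.
have [l1 e1] := utE LE t0 lf; rewrite /cone -e1.
apply: ge0_ae_eq_integral.
- exact: cball_meas'.
- by apply: measurable_funTS; apply: mod2_meas; exact: ((L2P mu _).1 l1).1.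
- by apply: measurable_funTS; exact: msq_meas.
- by move=> y _; rewrite lee_fin sqr_ge0.
- by move=> y _; exact: msq_ge0.
- by apply: filterS (cls_ae l1) => y h _; rewrite /msq h.
Qed.

End square_function_theory.

Lemma div_le_swap (R : realType) (x e p j : R) : 0 < e -> 0 < p -> x / e < j -> j <= p -> x / p <= e.
Proof.
move=> e0 p0 h jp; rewrite ler_pdivrMr//; rewrite ltr_pdivrMr// in h.
by apply: (le_trans (ltW h)); rewrite mulrC ler_pM2l.
Qed.

Lemma nat_le_pow4 (R : realType) (J : nat) : J%:R <= 4 ^+ J.+1 :> R.
Proof.
rewrite -natrX ler_nat.
exact: leq_trans (leqnSn J) (ltnW (ltn_expl J.+1 (isT : (1 < 4)%N))).
Qed.

(** * Expansion of a multiplier by the reproducing formula *)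

Section real_symbols.
Context {R : realType}.
Implicit Types f g : R -> R.

Definition bs f := bsym (fun l => (f l)%:C%C : R[i]).

Lemma bsD f g : bs f -> bs g -> bs (fun l => f l + g l).
Proof.
move=> bf bg; rewrite /bs (_ : (fun l => _) = fun l => (f l)%:C%C + (g l)%:C%C); first exact: bsymD.
by apply/funext => l; rewrite rmorphD.
Qed.

Lemma bsM f g : bs f -> bs g -> bs (fun l => f l * g l).
Proof.
move=> bf bg; rewrite /bs (_ : (fun l => _) = fun l => (f l)%:C%C * (g l)%:C%C); first exact: bsymM.
by apply/funext => l; rewrite rmorphM.
Qed.

Lemma bs_cst (a : R) : bs (fun=> a).
Proof. exact: bsym_cst. Qed.

Lemma bsX f n : bs f -> bs (fun l => f l ^+ n).
Proof.
move=> bf; elim: n => [|n ih].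
  by rewrite (_ : (fun l => _) = fun=> 1); [exact: bs_cst|apply/funext => l; rewrite expr0].
by rewrite (_ : (fun l => _) = fun l => f l * f l ^+ n); [exact: bsM|apply/funext => l; rewrite exprS].
Qed.

Lemma bs_sum n (F : nat -> R -> R) : (forall i, bs (F i)) -> bs (fun l => \sum_(i < n) F i l).
Proof.
move=> bF; elim: n => [|n ih].
  by rewrite (_ : (fun l => _) = fun=> 0); [exact: bs_cst|apply/funext => l; rewrite big_ord0].
by rewrite (_ : (fun l => _) = fun l => \sum_(i < n) F i l + F n l); [exact: bsD|apply/funext => l; rewrite big_ord_recr].
Qed.

Lemma bs_gexp (r : R) : bs (gexp r).
Proof.
rewrite /bs (_ : (fun l => _) = heat_symbol (r ^+ 2)); first by apply: bsym_heat; exact: sqr_ge0.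
by apply/funext => l; rewrite /heat_symbol /gexp exprMn.
Qed.

Lemma bs_one_sub f : bs f -> bs (fun l => 1 - f l).
Proof.
move=> bf; rewrite (_ : (fun l => _) = fun l => 1 + (-1) * f l).
  by apply: bsD; [exact: bs_cst|apply: bsM => //; exact: bs_cst].
by apply/funext => l; rewrite mulN1r.
Qed.

Lemma bs_brk N j (t : R) : bs (brk N j t).
Proof.
rewrite /brk; apply: bsD.
  case: (j == 0%N); last exact: bs_cst.
  apply: bsM; last exact: bs_gexp.
  by apply: bsX; apply: bs_one_sub; exact: bs_gexp.
apply: bsM; first exact: bs_gexp.
apply: bsM.
  apply: bsM; first exact: bs_gexp.
  by apply: bsX; apply: bs_one_sub; exact: bs_gexp.
rewrite /ppoly; set g := gexp _; have bg : bs g by exact: bs_gexp.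
have b3 : bs (fun l => 1 + g l + g l ^+ 2).
  by apply: bsD; [apply: bsD => //; exact: bs_cst|exact: bsX].
apply: bsM => //.
by apply: (@bs_sum N (fun i l => (1 + g l + g l ^+ 2 + g l ^+ 3) ^+ i)) => i; apply: bsX; apply: bsD => //; exact: bsX.
Qed.

Lemma bsym_complex f g : bs f -> bs g -> bsym (fun l => Complex (f l) (g l)).
Proof.
move=> bf bg; rewrite (_ : (fun l => _) = fun l => (f l)%:C%C + 'i%C * (g l)%:C%C).
  by apply: bsymD => //; exact: bsymZ.
by apply/funext => l; simpc.
Qed.

Lemma sum_quarter J : \sum_(j < J) 2 / 4 ^+ j <= 4 :> R.
Proof.
have h : 0 <= (4^-1 : R) < 1 by rewrite invr_ge0 ler0n/= invf_lt1// ltr1n.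
rewrite (eq_bigr (fun j : 'I_J => 2 * 4^-1 ^+ j)); last by move=> j _; rewrite exprVn.
rewrite -mulr_sumr; have := geometric_sum_le J h.
have -> : (1 - 4^-1)^-1 = 4 / 3 :> R by field.
by move: (\sum_(j < J) _) => S; lra.
Qed.

End real_symbols.

Section multiplier_series.
Context d (R : realType) (Omega : borelMetricType d R).
Variable mu : {measure set Omega -> \bar R}.
Variables (E : proj_measure mu).
Local Notation nm := (nm (@ipc d R Omega mu)).
Local Notation complete := (@L2cls_complete _ _ _ mu).
Local Notation mult := (mult (spv E)).

(** The reproducing formula multiplied by the symbol of the multiplier. The remainder is at most Mb
    N / 4^(J+1) uniformly in l, so the operators converge in L^2 norm. *)
Lemma ut_series (m1 m2 : R -> R) N (t : R) (v : L2cls mu) (e : R) : bs m1 -> bs m2 -> 0 < t -> 0 < e ->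
  exists J, nm (ut E (mult (fun l => Complex (m1 l) (m2 l)) v) t - \sum_(j < J) (2 / 4 ^+ j)%:C%C *:
    mult (fun l => Complex (m1 l * brk N j t l) (m2 l * brk N j t l)) (ut E v (scl j t))) <= e.
Proof.
move=> b1 b2 t0 e0.
have bm := bsym_complex b1 b2; have [Mb hMb] := bm.2.
have bq (s : R) : 0 < s -> bsym (fun l => (qd s l)%:C%C : R[i]) by exact: bsym_qd.
pose k j := fun l => Complex (m1 l * brk N j t l) (m2 l * brk N j t l).
have bk j : bsym (k j) by apply: bsym_complex; apply: bsM => //; exact: bs_brk.
pose F j := fun l => (2 / 4 ^+ j)%:C%C * (k j l * (qd (scl j t) l)%:C%C).
have bF j : bsym (F j) by apply: bsymZ; apply: bsymM => //; apply: bq; exact: scl_gt0.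
have FE j : (2 / 4 ^+ j)%:C%C *: mult (k j) (ut E v (scl j t)) = mult (F j) v.
  have h1 := multZ (spv E) complete (2 / 4 ^+ j)%:C%C v (bsymM (bk j) (bq _ (scl_gt0 j t0))).
  have h2 := multM (spv E) complete v (bk j) (bq _ (scl_gt0 j t0)).
  exact: (etrans (f_equal (fun z => (2 / 4 ^+ j)%:C%C *: z) (esym h2)) (esym h1)).
pose Q := (fun l => (qd t l)%:C%C * Complex (m1 l) (m2 l)) : R -> R[i].
have bQ : bsym Q by apply: bsymM => //; exact: bq.
have QE : ut E (mult (fun l => Complex (m1 l) (m2 l)) v) t = mult Q v.
  by apply: esym; exact: (multM (spv E) complete v (bq _ t0) bm).
have dE J : ut E (mult (fun l => Complex (m1 l) (m2 l)) v) t - \sum_(j < J) (2 / 4 ^+ j)%:C%C *: mult (k j) (ut E v (scl j t)) =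
    mult (fun l => Q l - \sum_(j < J) F j l) v.
  rewrite QE (eq_bigr (fun j : 'I_J => mult (F j) v)); last by move=> j _; exact: FE.
  apply: esym; apply: (etrans (multB (spv E) complete v bQ (bsym_sum _ (fun j : 'I_J => bF j)))).
  by congr (_ - _); exact: (mult_sum (spv E) complete _ v (fun j : 'I_J => bF j)).
have Mb0 : 0 <= Mb by apply: le_trans (hMb 0 (lexx _)); exact: cmod_ge0.
pose X := Mb * N%:R * nm v.
have X0 : 0 <= X by rewrite !mulr_ge0 ?nm_ge0.
have Xe : 0 <= X / e := divr_ge0 X0 (ltW e0).
have := archi_boundP Xe; set J := Num.bound _ => hJ; exists J.+1.
rewrite dE; have bd : bsym (fun l => Q l - \sum_(j < J.+1) F j l).
  exact: (bsymB bQ (bsym_sum _ (fun j : 'I_J.+1 => bF j))).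
have pw l : 0 <= l -> cmod (Q l - \sum_(j < J.+1) F j l) <= Mb * (N%:R / 4 ^+ J.+1).
  move=> l0; have -> : Q l - \sum_(j < J.+1) F j l =
      Complex (m1 l) (m2 l) * (qd t l * (1 - (1 - gexp (2 ^+ J.+1 * t) l) ^+ N))%:C%C.
    have kE j : F j l = Complex (m1 l) (m2 l) * (2 / 4 ^+ j * brk N j t l * qd (scl j t) l)%:C%C.
      rewrite /F /k (_ : Complex (m1 l * _) _ = Complex (m1 l) (m2 l) * (brk N j t l)%:C%C); last by simpc.
      by rewrite !rmorphM/=; ring.
    rewrite (eq_bigr _ (fun (j : 'I_J.+1) _ => kE j)) -mulr_sumr -rmorph_sum /Q mulrC -mulrBr -rmorphB.
    by congr (_ * _%:C%C); rewrite {1}(reproducing N J) addrC addKr.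
  rewrite cmodM cmodR; apply: ler_pM.
  - exact: cmod_ge0.
  - exact: normr_ge0.
  - exact: hMb.
  - exact: reproducing_rest.
apply: (le_trans (mult_le (spv E) complete v bd pw)).
have J4 := nat_le_pow4 R J.
have p4 : 0 < 4 ^+ J.+1 :> R by rewrite exprn_gt0.
rewrite [leLHS](_ : _ = X / 4 ^+ J.+1); last by rewrite /X; ring.
exact: div_le_swap e0 p4 hJ J4.
Qed.

End multiplier_series.

Section young_scalar.
Context (R : realType).

Lemma young_real (s b eta : R) : 0 <= s -> 0 < b -> 0 < eta ->
  s <= eta * (b^-1 * s ^+ 2) + eta^-1 * b.
Proof.
move=> s0 b0 e0; rewrite -subr_ge0.
have -> : eta * (b^-1 * s ^+ 2) + eta^-1 * b - s = ((eta * s - b) ^+ 2 + eta * s * b) / (b * eta).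
  by field; rewrite !gt_eqF.
apply: divr_ge0; last exact: ltW (mulr_gt0 b0 e0).
by apply: addr_ge0; [exact: sqr_ge0|exact: mulr_ge0 (mulr_ge0 (ltW e0) s0) (ltW b0)].
Qed.

Lemma iv_gt0 (b : R) : 0 < b -> iv b%:E = (b^-1)%:E.
Proof. by move=> b0; rewrite /iv leNgt b0. Qed.

Lemma iv_le0 (b : R) : b <= 0 -> iv b%:E = +oo%E.
Proof. by move=> b0; rewrite /iv b0. Qed.

Lemma regroupE (t a b c q p : R) (z : \bar R) : t * a * b * c = q * t * p ->
  (t%:E * (a%:E * (b%:E * (c%:E * z))) = q%:E * (p%:E * z * t%:E))%E.
Proof. by move=> e; rewrite (muleC (p%:E * z)%E) !muleA -!EFinM e. Qed.

End young_scalar.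

(** * The main estimate *)

Section main_estimate.
Context d (R : realType) (Omega : borelMetricType d R).
Variable mu : {sigma_finite_measure set Omega -> \bar R}.
Variables (E : proj_measure mu).
Variables (C0 theta : R).
Hypothesis hv : forall (x : Omega) (t : R), 0 < t -> (0 < vol mu x t)%E /\ (vol mu x t < +oo)%E.
Hypothesis C00 : 0 < C0.
Hypothesis theta1 : 1 <= theta.
Hypothesis growth : forall (x : Omega) (t : R) k, 0 < t ->
  fine (vol mu x (2 ^+ k * t)) <= C0 * theta ^+ k * fine (vol mu x t).
Variable x0 : Omega.
Variable cb : nat -> Omega * R.
Hypothesis cb0 : forall n, 0 < (cb n).2.
Hypothesis cbP : forall x s, 0 < s -> exists n,
  [/\ mdist x (cb n).1 < s / 4, s / 4 < (cb n).2 & (cb n).2 < s / 2].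
Variables (th : R) (kappa : nat).
Hypothesis th_gt : theta < th.
Hypothesis th_lt : th < 2 ^+ kappa.*2.-1.
Hypothesis kappa0 : (0 < kappa)%N.
Hypothesis DG : davies_gaffney E.
Local Notation leb := (@lebesgue_measure R).
Local Notation RM := (measurableTypeR R).
Local Notation mult := (mult (spv E)).
Local Notation slice := (slice E).
Local Notation sq := (sq E).

Local Notation W := (wgt mu cb th).
Let iv0 (g : Omega -> \bar R) x : (0 <= (iv \o g) x)%E. Proof. exact: iv_ge0. Qed.
Let miv (g : Omega -> \bar R) : measurable_fun setT g -> measurable_fun setT (iv \o g).
Proof. by move=> mg; exact: measurableT_comp iv_measurable mg. Qed.

(** B s is the size of the symbol as seen at scale s: its majorant [om] is rescaled to the r of
    [good_brk] and damped by the Gaussian factor allowed in [symbol_poly]. A constant B serves for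
    boundedness, a B that is small at large scales for convergence. *)
Definition admissible (B : R -> R) (u : R -> R) := forall s : R, 0 < s ->
  exists2 om, Sym pos id kappa om u &
    forall x, 0 < x -> om (x / (s / Num.sqrt kappa.+1%:R)) * expR (- (x ^+ 2 / 2)) <= B s.

(** Each term of the series is a good kernel at scale [scl j t] / sqrt(kappa + 1), and [avg_compare]
    verifies the comparison of weights in [weighted_kernel] with Lam = [avgK]. The weight changes on
    the way, from the inverse of the constructed weight at height t to the inverse of [sg] at height
    [scl j t]. *)
Lemma slice_series : exists2 C : R, 0 < C & forall (sg : Omega -> \bar R),
  measurable_fun setT sg -> (forall x, 0 <= sg x)%E -> forall (B m1 m2 : R -> R) (v : L2cls mu) (t : R), 0 < t ->
  bs m1 -> bs m2 -> admissible B m1 -> admissible B m2 ->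
  (slice (mult (fun l => Complex (m1 l) (m2 l)) v) (iv \o W sg) t <=
   4%:E * \sum_(j <oo) ((2 / 4 ^+ j)%:E * ((C * B (scl j t) ^+ 2)%:E * slice v (iv \o sg) (scl j t))))%E.
Proof.
have [Ck Ck0 hk] := good_off_diagonal_complex DG kappa0.
have th1 : 1 <= th by apply: le_trans theta1 _; exact: ltW.
have [C' C'0 hC'] := weighted_kernel Ck0 hk kappa0 th1 th_lt.
have [Cb Cb0 hb] := good_brk (R := R) kappa0.
pose K := avgK C0 theta th; have K0 : 0 < K by exact: avgK_gt0.
exists (C' * Cb ^+ 2 * K + 1).
  by apply: ltr_wpDl; [exact: mulr_ge0 (mulr_ge0 C'0 (sqr_ge0 _)) (ltW K0)|exact: ltr01].
move=> sg sgm sg0 B m1 m2 v t t0 b1 b2 a1 a2.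
have ivsg0 := iv0 sg; have ivw0 := iv0 (W sg); have mivsg := miv sgm.
have mivw := miv (@wgt_meas _ _ _ mu cb th sg).
have hK := avg_compare hv C00 theta1 growth x0 cb0 cbP th_gt sgm.
pose w j := mult (fun l => Complex (m1 l * brk kappa.+1 j t l) (m2 l * brk kappa.+1 j t l)) (ut E v (scl j t)).
have c0 j : 0 <= 2 / 4 ^+ j :> R by rewrite divr_ge0// exprn_ge0.
have S0 : 0 < 4 :> R by [].
have mW : measurable_fun setT (avg mu (iv \o W sg) t).
  by apply: (avg_meas hv C00 theta1 growth x0).
have W0 x := avg_ge0 mu t x ivw0.
have conv (e : R) : 0 < e -> exists J, nm (@ipc d R Omega mu) (ut E (mult (fun l => Complex (m1 l) (m2 l)) v) t -
    \sum_(j < J) (2 / 4 ^+ j)%:C%C *: w j) <= e by exact: ut_series.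
apply: le_trans (weighted_series c0 S0 (@sum_quarter R) conv mW W0) _.
apply: lee_wpmul2l => //; apply: lee_nneseries => j _.
  by rewrite mule_ge0 ?lee_fin// integral_ge0// => x _; rewrite mule_ge0 ?msq_ge0.
apply: lee_wpmul2l; first by rewrite lee_fin.
have s0 := scl_gt0 j t0.
have sN : 1 <= Num.sqrt kappa.+1%:R :> R by rewrite -[X in X <= _]sqrtr1 ler_sqrt ?ler1n// ltr0n.
pose r := scl j t / Num.sqrt kappa.+1%:R.
have r0 : 0 < r by rewrite divr_gt0// (lt_le_trans ltr01).
have [om1 so1 ho1] := a1 _ s0; have [om2 so2 ho2] := a2 _ s0.
have g1 := hb om1 m1 j t (B (scl j t)) t0 so1 ho1.
have g2 := hb om2 m2 j t (B (scl j t)) t0 so2 ho2.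
have mU : measurable_fun setT (avg mu (iv \o sg) (scl j t)).
  by apply: (avg_meas hv C00 theta1 growth x0).
have U0 x := avg_ge0 mu (scl j t) x ivsg0.
(* Required by [avg_compare]; the worst case is j = 0, where the scale is t / sqrt 2. *)
have ts : t <= 2 * scl j t.
  rewrite /scl mulrA ler_pdivlMr ?sqrt2_gt0// mulrC mulrA ler_wpM2r ?(ltW t0)//.
  have h2 : Num.sqrt 2 <= 2 :> R.
    by rewrite -(@ler_pXn2r _ 2) ?nnegrE ?sqrtr_ge0// sqrt2_sqr expr2; lra.
  by apply: (le_trans h2); rewrite ler_peMr// exprn_ege1// ler1n.
have cmp i y y' : mdist y y' < 2 ^+ i * r ->
    (avg mu (iv \o W sg) t y <= (K * th ^+ i)%:E * avg mu (iv \o sg) (scl j t) y')%E.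
  move=> yy; apply: (hK i y y' (scl j t) t t0 ts).
  apply: (lt_le_trans yy); rewrite ler_wpM2l ?exprn_ge0//.
  by rewrite /r ler_pdivrMr ?(lt_le_trans ltr01)// ler_peMr// ltW.
have bb1 : bsym (fun l => (m1 l * brk kappa.+1 j t l)%:C%C : R[i]) by apply: bsM => //; exact: bs_brk.
have bb2 : bsym (fun l => (m2 l * brk kappa.+1 j t l)%:C%C : R[i]) by apply: bsM => //; exact: bs_brk.
apply: le_trans (hC' r (Cb * B (scl j t)) K _ _ _ _ (ut E v (scl j t)) r0 K0 g1 g2 bb1 bb2 mU mW U0 W0 cmp) _.
apply: lee_wpmul2r; first by apply: integral_ge0 => x _; rewrite mule_ge0 ?msq_ge0.
rewrite lee_fin exprMn.
rewrite [leLHS](_ : _ = C' * Cb ^+ 2 * K * B (scl j t) ^+ 2); last by ring.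
by rewrite ler_wpM2r ?sqr_ge0// lerDl.
Qed.

(** [slice_series] integrated against dt/t: each integral over [scl j t] equals the one over t by
    dilation invariance, and the coefficients 2/4^j are summable. *)
Lemma weighted_square_bound : exists2 C : R, 0 < C & forall (sg : Omega -> \bar R),
  measurable_fun setT sg -> (forall x, 0 <= sg x)%E -> forall (B m1 m2 : R -> R) (v : L2cls mu),
  bs m1 -> bs m2 -> admissible B m1 -> admissible B m2 -> measurable_fun setT B ->
  (\int[mu]_x ((iv \o W sg) x * sq (mult (fun l => Complex (m1 l) (m2 l)) v) x) <=
   C%:E * \int[leb]_(t in [set t : R | (0 < t)%R]) ((B t ^+ 2)%:E * (slice v (iv \o sg) t * (t^-1)%:E)))%E.
Proof.
have [C Cp hC] := slice_series; exists (4 * (2 * C / (1 - 4^-1))).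
  by rewrite !mulr_gt0// invr_gt0; lra.
move=> sg sgm sg0 B m1 m2 v b1 b2 a1 a2 mB.
have ivsg0 := iv0 sg; have ivw0 := iv0 (W sg); have mivsg := miv sgm.
have mivw := miv (@wgt_meas _ _ _ mu cb th sg).
rewrite (sq_weighted E hv C00 theta1 growth x0)//.
have sl0 w t : (0 <= slice w (iv \o sg) t)%E by exact: slice_ge0.
have ti0 (t : R) : 0 < t -> (0 <= (t^-1)%:E)%E by move=> t0; rewrite lee_fin invr_ge0 ltW.
have mti : measurable_fun [set: RM] (fun t => (t^-1)%:E : \bar R).
  by apply/measurable_EFinP; exact: measurable_invr.
have mB' : measurable_fun [set: RM] (fun t : RM => (B t : R)) by exact: mB.
(* On t > 0 the factors t and 1/t cancel; this form extends the integrand measurably to the whole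
   line, as the dilation lemma asks. *)
pose G (t : RM) : \bar R := (slice v (iv \o sg) t * (t^-1)%:E * chi (0 < t)%R * (B t ^+ 2 * t)%:E)%E.
have mG : measurable_fun setT G.
  apply: emeasurable_funM; first exact: (slice_meas E hv C00 theta1 growth x0).
  by apply/measurable_EFinP; apply: measurable_funM => //; exact: measurable_funX.
have G0 t : (0 <= G t)%E.
  rewrite /G /chi; case: ltP => t0; last by rewrite mule0 mul0e.
  by rewrite !mule_ge0 ?ti0// lee_fin mulr_ge0 ?sqr_ge0// ltW.
have GE (t : R) : 0 < t -> G t = ((B t ^+ 2)%:E * slice v (iv \o sg) t)%E.
  move=> t0; rewrite /G /chi t0 mule1 -muleA -EFinM mulrCA mulVf ?gt_eqF// mulr1.
  by rewrite muleC.
pose q : R := 4 * 2 * C.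
pose H j (t : RM) : \bar R := ((q * 4^-1 ^+ j)%:E * (G (2 ^+ j / Num.sqrt 2 * t)%R * (t^-1)%:E))%E.
have cj j : 0 < 2 ^+ j / Num.sqrt 2 :> R by rewrite divr_gt0 ?sqrt2_gt0// exprn_gt0.
have mG' j : measurable_fun setT (fun t : RM => G (2 ^+ j / Num.sqrt 2 * t)%R).
  by apply: measurableT_comp mG _; exact: measurable_funM.
have mH j : measurable_fun setT (H j) by apply: measurable_funeM; exact: emeasurable_funM.
have q0 j : 0 <= q * 4^-1 ^+ j by rewrite /q !mulr_ge0 ?exprn_ge0 ?invr_ge0// ltW.
have H0 j (t : RM) : 0 < t -> (0 <= H j t)%E by move=> t0; apply: mule_ge0; [rewrite lee_fin; exact: q0|apply: mule_ge0; [exact: G0|exact: ti0]].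
have mpos := @pos_measurable R.
apply: (@le_trans _ _ (\int[leb]_(t in [set t : R | (0 < t)%R]) \sum_(j <oo) H j t)%E).
  apply: ge0_le_integral.
  - exact: mpos.
  - by move=> t t0; rewrite mule_ge0 ?ti0//; exact: slice_ge0.
  - have := slice_meas E hv C00 theta1 growth x0 (mult (fun l => Complex (m1 l) (m2 l)) v) mivw ivw0.
    move=> /(@measurable_funTS _ _ _ _ [set t : RM | (0 < t)%R]); apply: eq_measurable_fun => t.
    by rewrite inE/= /chi => ->; rewrite mule1.
  - apply: (@ge0_emeasurable_sum _ _ R [set t : RM | (0 < t)%R] H xpredT) => [k t t0 _|k _]; [exact: H0|apply: measurable_funTS; exact: mH].
  - move=> t /= t0; apply: le_trans (lee_wpmul2r (ti0 t t0) (hC sg sgm sg0 B m1 m2 v t t0 b1 b2 a1 a2)) _.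
    rewrite -nneseriesZl//; last first.
      move=> j _; rewrite !mule_ge0 ?lee_fin ?divr_ge0 ?exprn_ge0//.
      by rewrite mulr_ge0 ?sqr_ge0// ltW.
    rewrite muleC -nneseriesZl//; last first.
      move=> j _; rewrite !mule_ge0 ?lee_fin ?divr_ge0 ?exprn_ge0//.
      by rewrite mulr_ge0 ?sqr_ge0// ltW.
    apply: lee_nneseries => j _.
      rewrite !mule_ge0 ?ti0 ?lee_fin ?divr_ge0 ?exprn_ge0//.
      by rewrite mulr_ge0 ?sqr_ge0// ltW.
    have sE : 2 ^+ j / Num.sqrt 2 * t = scl j t by rewrite /scl mulrAC.
    rewrite /H sE (GE _ (scl_gt0 j t0)) le_eqVlt; apply/orP; left; apply/eqP.
    by apply: regroupE; rewrite /q exprVn; ring.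
have EI : (\int[leb]_(t in [set t : R | (0 < t)%R]) \sum_(j <oo) H j t =
    \sum_(j <oo) \int[leb]_(t in [set t : R | (0 < t)%R]) H j t)%E.
  apply: integral_nneseries => //.
  by move=> j; apply: measurable_funTS; exact: mH.
rewrite EI.
set Y := (\int[leb]_(t in _) _)%E.
have Y0 : (0 <= Y)%E.
  by apply: integral_ge0 => t t0; rewrite !mule_ge0 ?ti0// lee_fin sqr_ge0.
have HE j : (\int[leb]_(t in [set t : R | (0 < t)%R]) H j t = (q * 4^-1 ^+ j)%:E * Y)%E.
  rewrite /H ge0_integralZl//; first last.
  - by rewrite lee_fin.
  - by move=> t t0; rewrite mule_ge0 ?ti0.
  - by apply: measurable_funTS; exact: emeasurable_funM.
  congr (_ * _)%E; rewrite (@ge0_integral_dilation R G)//.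
  by apply: eq_integral => t; rewrite inE/= => t0; rewrite GE// muleA.
under eq_eseriesr do rewrite HE.
have h4 : 0 <= (4^-1 : R) < 1 by rewrite invr_ge0 ler0n/= invf_lt1// ltr1n.
apply: le_trans (geometric_eseries _ h4 Y0) _; first by rewrite /q !mulr_ge0// ltW.
by apply: lee_wpmul2r => //; rewrite lee_fin /q le_eqVlt; apply/orP; left; apply/eqP; ring.
Qed.

(** Pointwise, sqrt f <= eta f / w + w / eta, where the conventions of [iv] take care of the points
    at which w is 0 or infinite. *)
Lemma young_bound (sg f : Omega -> \bar R) (eta : R) : 0 < eta -> measurable_fun setT f -> (forall x, 0 <= f x)%E ->
  (\int[mu]_x (f x `^ 2^-1) <=
   eta%:E * \int[mu]_x ((iv \o W sg) x * f x) + (eta^-1)%:E * \int[mu]_x W sg x)%E.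
Proof.
move=> e0 mf f0; have w0 x : (0 <= W sg x)%E by exact: wgt_ge0.
have mw : measurable_fun setT (W sg) by exact: wgt_meas.
have mfw : measurable_fun setT (fun x => (iv \o W sg) x * f x)%E.
  by apply: emeasurable_funM => //; exact: miv.
have fw0 x : (0 <= (iv \o W sg) x * f x)%E by apply: mule_ge0; [exact: iv0|exact: f0].
have ei : (0 <= (eta^-1)%:E)%E by rewrite lee_fin invr_ge0 ltW.
have ee : (0 <= eta%:E)%E by rewrite lee_fin ltW.
rewrite -ge0_integralZl// -ge0_integralZl// -ge0_integralD//; first last.
- exact: measurable_funeM.
- by move=> x _; rewrite mule_ge0.
- exact: measurable_funeM.
- by move=> x _; rewrite mule_ge0.
apply: ge0_le_integral => //.
- by move=> x _; exact: poweR_ge0.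
- exact: (measurableT_comp (measurable_poweR 2^-1) mf).
- by apply: emeasurable_funD; exact: measurable_funeM.
move=> x _; rewrite /comp; move: (f x) (W sg x) (f0 x) (w0 x) => [a| |] [b| |]// a0 b0.
- rewrite lee_fin in a0; rewrite lee_fin in b0; rewrite poweR_EFin powR12_sqrt//.
  have [b1|b1] := leP b 0.
    rewrite (iv_le0 b1); move: a0; rewrite le_eqVlt => /predU1P[<-|a0].
      by rewrite sqrtr0 mule0 mule0 add0e mule_ge0.
    by rewrite gt0_mulye ?lte_fin// gt0_muley ?lte_fin// addye ?leey// -ltNye ltNyr.
  rewrite (iv_gt0 b1) -[X in (_ * (_ * X%:E))%E](@sqr_sqrtr _ a)// -!EFinM -EFinD lee_fin.
  exact: young_real (sqrtr_ge0 a) b1 e0.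
- by rewrite (gt0_muley (x := (eta^-1)%:E)) ?lte_fin ?invr_gt0// addey ?leey// -ltNye (lt_le_trans (ltNyr 0))// mule_ge0// mule_ge0// iv_ge0.
- have [b1|b1] := leP b 0.
    rewrite (iv_le0 b1) mulyy gt0_muley ?lte_fin// addye ?leey// -ltNye; exact: ltNyr.
  rewrite (iv_gt0 b1) (gt0_muley (x := (b^-1)%:E)) ?lte_fin ?invr_gt0// gt0_muley ?lte_fin//.
  by rewrite addye ?leey// -ltNye; exact: ltNyr.
- by rewrite (gt0_muley (x := (eta^-1)%:E)) ?lte_fin ?invr_gt0// addey ?leey// -ltNye (lt_le_trans (ltNyr 0))// mule_ge0// mule_ge0// iv_ge0.
Qed.

Definition sfun v (x : Omega) : \bar R := (sq v x `^ 2^-1)%E.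

Lemma sfun_ge0 v x : (0 <= sfun v x)%E. Proof. exact: poweR_ge0. Qed.

Lemma sfun_meas v : measurable_fun setT (sfun v).
Proof.
exact: (measurableT_comp (measurable_poweR 2^-1) (sq_meas E hv C00 theta1 growth x0 v)).
Qed.

(** With phi the inverse of the square function, the weighted integral of its square is its
    integral. Only an inequality holds, since the inverse is 0 where the square function is
    infinite. *)
Lemma slice_total v : (\int[leb]_(t in [set t : R | (0 < t)%R]) (slice v (iv \o sfun v) t * (t^-1)%:E) <=
  \int[mu]_x sfun v x)%E.
Proof.
have mv : measurable_fun setT (iv \o sfun v) by exact: miv (sfun_meas v).
have v0 x : (0 <= (iv \o sfun v) x)%E by exact: iv_ge0.
rewrite -(sq_weighted E hv C00 theta1 growth x0 v mv v0).
have msq0 : measurable_fun setT (sq v) by exact: (sq_meas E hv C00 theta1 growth x0).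
apply: ge0_le_integral => //.
- by move=> x _; rewrite mule_ge0// sq_ge0.
- exact: emeasurable_funM.
- exact: sfun_meas.
move=> x _; rewrite /= /sfun; move: (sq v x) (sq_ge0 E v x) => [a| |]// a0.
  rewrite lee_fin in a0; rewrite poweR_EFin powR12_sqrt//=.
  have [s0|s0] := leP (Num.sqrt a) 0.
    have -> : a = 0 by apply/eqP; rewrite eq_le a0 andbT -sqrtr_eq0 eq_le s0 sqrtr_ge0.
    by rewrite sqrtr0 mule0.
  by rewrite -EFinM lee_fin -[X in _ * X](@sqr_sqrtr _ a)// expr2 mulrA mulVf ?mul1r// gt_eqF.
by rewrite poweRyr ?invr_eq0// leey.
Qed.

(** The parameter eta stays free: eta = 1 yields boundedness, and a large eta makes the second term
    small while the smallness of B compensates in the first. *)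
Lemma sfun_bound : exists2 C : R, 0 < C & forall (B m1 m2 : R -> R) (v : L2cls mu) (eta : R),
  bs m1 -> bs m2 -> admissible B m1 -> admissible B m2 -> measurable_fun setT B -> 0 < eta ->
  (\int[mu]_x sfun (mult (fun l => Complex (m1 l) (m2 l)) v) x <=
   (eta * C)%:E * \int[leb]_(t in [set t : R | (0 < t)%R])
     ((B t ^+ 2)%:E * (slice v (iv \o sfun v) t * (t^-1)%:E)) +
   (eta^-1 * C)%:E * \int[mu]_x sfun v x)%E.
Proof.
have [C Cp hC] := weighted_square_bound.
pose C2 := 2 * (C0 * theta ^+ 2) / (1 - theta / th).
have t0 : 0 < theta by exact: lt_le_trans theta1.
have C20 : 0 < C2.
  apply: divr_gt0; first by rewrite !mulr_gt0// exprn_gt0.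
  by rewrite subr_gt0 ltr_pdivrMr ?mul1r// (lt_trans t0).
exists (C + C2); first exact: addr_gt0.
move=> B m1 m2 v eta b1 b2 a1 a2 mB e0.
have mq := sq_meas E hv C00 theta1 growth x0 (mult (fun l => Complex (m1 l) (m2 l)) v).
apply: le_trans (young_bound (sfun v) e0 mq (sq_ge0 E _)) _.
apply: leeD; rewrite EFinM -muleA; apply: lee_wpmul2l.
- by rewrite lee_fin ltW.
- apply: le_trans (hC _ (sfun_meas v) (sfun_ge0 v) B m1 m2 v b1 b2 a1 a2 mB) _.
  apply: lee_wpmul2r; last by rewrite lee_fin lerDl ltW.
  apply: integral_ge0 => t p; apply: mule_ge0; first by rewrite lee_fin sqr_ge0.
  by apply: mule_ge0; [apply: slice_ge0 => x; exact: iv0|rewrite lee_fin invr_ge0 ltW].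
- by rewrite lee_fin invr_ge0 ltW.
- apply: le_trans (integral_wgt hv C00 theta1 growth cb0 th_gt (sfun_meas v) (sfun_ge0 v)) _.
  apply: lee_wpmul2r; last by rewrite lee_fin lerDr ltW.
  by apply: integral_ge0 => x _; exact: sfun_ge0.
Qed.

End main_estimate.

(** * Norm, density and extension in the completion *)

Section complex_norm.
Context (R : realType) (H : normedModType R[i]).
Implicit Types (x y : H) (e : R).

(** The norm of H has values in R[i]; this is the same number as a real. *)
Definition rn x : R := complex.Re `|x|.

Lemma rnE x : `|x| = (rn x)%:C%C.
Proof. by apply: cplx_eq => //=; exact: ger0_Im. Qed.

Lemma rn_ge0 x : 0 <= rn x.
Proof. by have := normr_ge0 x; rewrite rnE lecR. Qed.

Lemma rnD x y : rn (x + y) <= rn x + rn y.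
Proof. by have := ler_normD x y; rewrite !rnE -rmorphD/= lecR. Qed.

Lemma rnZ (a : R[i]) x : rn (a *: x) = cmod a * rn x.
Proof. by rewrite /rn normrZ rnE cnormE -rmorphM. Qed.

Lemma rnN x : rn (- x) = rn x.
Proof. by rewrite /rn normrN. Qed.

Lemma rnBC x y : rn (x - y) = rn (y - x).
Proof. by rewrite -opprB rnN. Qed.

Lemma rn_trans y x z : rn (x - z) <= rn (x - y) + rn (y - z).
Proof. by have := rnD (x - y) (y - z); rewrite addrA subrK. Qed.

Lemma rn_eq0 x : rn x = 0 -> x = 0.
Proof. by move=> h; apply/eqP; rewrite -normr_eq0 rnE h. Qed.

Lemma rn_small_eq x y : (forall e, 0 < e -> rn (x - y) <= e) -> x = y.
Proof.
move=> h; apply/eqP; rewrite -subr_eq0; apply/eqP; apply: rn_eq0.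
apply/eqP; rewrite eq_le rn_ge0 andbT; apply/ler_addgt0Pl => e e0; rewrite addr0.
exact: h.
Qed.

Lemma pos_complex (e : R[i]) : 0 < e -> exists2 r : R, 0 < r & e = r%:C%C.
Proof.
move=> e0; exists (complex.Re e); last by apply: cplx_eq => //=; apply: ger0_Im; exact: ltW.
by move: e0; rewrite ltcE/= => /andP[_].
Qed.

Lemma cvg_rnP (T : Type) (F : set_system T) (FF : Filter F) (f : T -> H) (l : H) :
  (f @ F --> l) <-> (forall e, 0 < e -> \forall t \near F, rn (l - f t) < e).
Proof.
split=> [h e e0|h].
  have e0' : 0 < e%:C%C :> R[i] by rewrite ltcR.
  move/cvgrPdist_lt: h => /(_ _ e0'); apply: filterS => t.
  by rewrite rnE ltcR.
apply/cvgrPdist_lt => e /pos_complex[r r0 ->].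
by have := h r r0; apply: filterS => t; rewrite rnE ltcR.
Qed.

Lemma closure_rn (S : set H) (F : H) (U : set H) (e : R) : closure S F -> 0 < e -> nbhs F U ->
  exists G, [/\ S G, rn (F - G) < e & U G].
Proof.
move=> cS e0 nU.
have nB : nbhs F [set G | rn (F - G) < e].
  have e0' : 0 < e%:C%C :> R[i] by rewrite ltcR.
  have := nbhsx_ballx F _ e0'; apply: filterS => G.
  by rewrite -ball_normE/= rnE ltcR.
by have [G [SG [h1 h2]]] := cS _ (filterI nB nU); exists G.
Qed.

End complex_norm.

Section density_extension.
Context (R : realType) (H : completeNormedModType R[i]) (X : Type).
Variables (hd : set X) (lc : R[i] -> X -> X -> X) (iota J : X -> H) (C : R).
Hypothesis hd_lc : forall a f g, hd f -> hd g -> hd (lc a f g).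
Hypothesis iota_lc : forall a f g, hd f -> hd g -> iota (lc a f g) = a *: iota f + iota g.
Hypothesis J_lc : forall a f g, hd f -> hd g -> J (lc a f g) = a *: J f + J g.
Hypothesis C0 : 0 <= C.
Hypothesis J_le : forall f, hd f -> rn (J f) <= C * rn (iota f).
Hypothesis dense : closure (iota @` hd) = setT.

Let approx (F : H) (e : R) : 0 < e -> exists2 f, hd f & rn (F - iota f) < e.
Proof.
move=> e0; have cF : closure (iota @` hd) F by rewrite dense.
have [G [[f hf <-] h _]] := closure_rn cF e0 (@filterT _ (nbhs F) _).
by exists f.
Qed.

Let J_dist f g : hd f -> hd g -> rn (J f - J g) <= C * rn (iota f - iota g).
Proof.
move=> hf hg; have h1 := J_lc (-1) hg hf; have h2 := iota_lc (-1) hg hf.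
have := J_le (hd_lc (-1) hg hf); rewrite h1 h2 !scaleN1r.
by rewrite (addrC (- J g)) (addrC (- iota g)).
Qed.

(** The value at F is described by its distance to every J f. Linearity, boundedness and agreement
    with J all follow from this inequality, with no further reference to the approximating
    sequence. *)
Let ext_point (F : H) : exists G : H, forall f, hd f -> rn (G - J f) <= C * rn (F - iota f).
Proof.
pose e n : R := n.+1%:R^-1.
have e0 n : 0 < e n by rewrite invr_gt0 ltr0n.
pose x n := projT1 (cid2 (approx F (e0 n))).
have xh n : hd (x n) by rewrite /x; case: cid2.
have xF n : rn (F - iota (x n)) < e n by rewrite /x; case: cid2.
have e_small (r : R) : 0 < r -> exists N, forall n, (N <= n)%N -> e n < r.
  move=> r0; exists (Num.bound r^-1) => n hn; rewrite /e invf_plt ?posrE ?ltr0n//.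
  have ri : 0 <= r^-1 by rewrite invr_ge0 ltW.
  by rewrite (lt_le_trans (archi_boundP ri))// ler_nat ltnW.
have cau : cauchy (J (x n) @[n --> \oo]).
  apply/cauchy_ballP => e1 /pos_complex[r r0 ->].
  have r1 : 0 < r / (2 * (C + 1)) by rewrite divr_gt0// mulr_gt0// ltr_wpDl.
  have [N hN] := e_small _ r1.
  exists ([set z | exists2 n, (N <= n)%N & z = J (x n)], [set z | exists2 n, (N <= n)%N & z = J (x n)]).
    by split; exists N => // n hn; exists n.
  move=> [_ _] /= [[a Na ->] [b Nb ->]]; rewrite -ball_normE/= rnE ltcR.
  apply: (le_lt_trans (J_dist (xh a) (xh b))).
  have t : rn (iota (x a) - iota (x b)) <= rn (F - iota (x a)) + rn (F - iota (x b)).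
    by rewrite (rnBC F (iota (x a))); exact: rn_trans.
  have t2 : rn (iota (x a) - iota (x b)) < 2 * (r / (2 * (C + 1))).
    apply: (le_lt_trans t); rewrite mulr_natl mulr2n.
    by apply: ltrD; apply: (lt_trans (xF _)); exact: hN.
  have -> : r = (C + 1) * (2 * (r / (2 * (C + 1)))) by field; rewrite gt_eqF// ltr_wpDl.
  apply: (@le_lt_trans _ _ (C * (2 * (r / (2 * (C + 1)))))); first by rewrite ler_wpM2l// ltW.
  by rewrite ltr_pM2r ?ltrDl// mulr_gt0.
have cv : cvg (J (x n) @[n --> \oo]) by exact: cauchy_cvg.
exists (lim (J (x n) @[n --> \oo])) => f hf.
apply/ler_addgt0Pl => r r0.
have r3 : 0 < r / 2 by rewrite divr_gt0.
have r4 : 0 < r / 2 / (C + 1) by rewrite divr_gt0// ltr_wpDl.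
have [N4 hN4] := e_small _ r4.
have /cvg_rnP/(_ _ r3) [N3 _ hN3] : (fun n => J (x n)) @ \oo --> lim (J (x n) @[n --> \oo]) by [].
pose n := maxn N3 N4.
have k3 := hN3 n (leq_maxl _ _); have k4 := hN4 n (leq_maxr _ _).
apply: (le_trans (rn_trans (J (x n)) _ _)).
have k5 := J_dist (xh n) hf.
have k6 : rn (iota (x n) - iota f) <= rn (F - iota (x n)) + rn (F - iota f).
  by rewrite (rnBC F (iota (x n))); exact: rn_trans.
have k7 : C * rn (F - iota (x n)) <= r / 2.
  apply: (@le_trans _ _ (C * (r / 2 / (C + 1)))); first by rewrite ler_wpM2l// ltW// (lt_trans (xF n)).
  by rewrite mulrA ler_pdivrMr ?ltr_wpDl// mulrC ler_wpM2l ?(ltW r3)// lerDl.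
have k8 : C * rn (iota (x n) - iota f) <= C * rn (F - iota (x n)) + C * rn (F - iota f).
  by rewrite -mulrDr ler_wpM2l.
by rewrite /= in k3; move: k3 k5 k7 k8; lra.
Qed.

Lemma density_extension : exists B : H -> H, [/\ forall (a : R[i]) v w, B (a *: v + w) = a *: B v + B w,
  continuous B & forall f, hd f -> B (iota f) = J f].
Proof.
have [B hB] := choice ext_point; exists B.
have lin (a : R[i]) v w : B (a *: v + w) = a *: B v + B w.
  apply: rn_small_eq => e e0.
  have cm := cmod_ge0 a.
  pose k := 2 * (C + 1) * (cmod a + 1); have k0 : 0 < k by rewrite !mulr_gt0 ?ltr_wpDl.
  have ek : 0 < e / k by rewrite divr_gt0.
  have [f hf vf] := approx v ek; have [g hg wg] := approx w ek.
  have h1 := hB (a *: v + w) _ (hd_lc a hf hg).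
  have h2 := hB v f hf; have h3 := hB w g hg.
  rewrite J_lc// iota_lc// in h1.
  have e1 : a *: v + w - (a *: iota f + iota g) = a *: (v - iota f) + (w - iota g).
    by rewrite scalerBr opprD addrACA.
  rewrite e1 in h1.
  have h4 := rnD (a *: (v - iota f)) (w - iota g); rewrite rnZ in h4.
  apply: (le_trans (rn_trans (a *: J f + J g) _ _)).
  have e2 : a *: J f + J g - (a *: B v + B w) = a *: (J f - B v) + (J g - B w).
    by rewrite scalerBr opprD addrACA.
  rewrite e2; have h5 := rnD (a *: (J f - B v)) (J g - B w); rewrite rnZ in h5.
  rewrite (rnBC (J f)) (rnBC (J g)) in h5.
  have ee : e = 2 * (C + 1) * (cmod a + 1) * (e / k) by rewrite /k; field; rewrite !gt_eqF ?ltr_wpDl.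
  set s := e / k in vf wg ek ee.
  have b1 : C * rn (v - iota f) <= C * s by rewrite ler_wpM2l// ltW.
  have b2 : C * rn (w - iota g) <= C * s by rewrite ler_wpM2l// ltW.
  have b3 : cmod a * rn (B v - J f) <= cmod a * (C * s) by rewrite ler_wpM2l// (le_trans h2).
  have b4 : C * (cmod a * rn (v - iota f)) <= cmod a * (C * s) by rewrite mulrCA ler_wpM2l.
  have b5 : C * rn (a *: (v - iota f) + (w - iota g)) <= C * (cmod a * rn (v - iota f)) + C * rn (w - iota g).
    by rewrite -mulrDr ler_wpM2l.
  have b6 : 0 <= (cmod a + 1) * s by rewrite mulr_ge0 ?addr_ge0// ltW.
  rewrite ee; move: h1 h3 h5 b2 b3 b4 b5 b6.
  move: (cmod a) (rn (a *: _ + _)) => c0 z.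
  by move=> h1 h3 h5 b2 b3 b4 b5 b6; lra.
have zero : B 0 = 0 by have := lin 1 0 0; rewrite !scale1r addr0 => /(congr1 (fun z => z - B 0)); rewrite subrr addrK.
have bd F : rn (B F) <= C * rn F.
  apply/ler_addgt0Pl => e e0; have e1 : 0 < e / (2 * C + 1) by rewrite divr_gt0// ltr_wpDl// mulr_ge0.
  have [f hf Ff] := approx F e1.
  have h1 := hB F f hf; have h2 := J_le hf.
  have h3 := rnD (B F - J f) (J f); rewrite subrK in h3.
  have h4 := rnD (iota f - F) F; rewrite subrK rnBC in h4.
  have h5 : C * rn (iota f) <= C * rn (F - iota f) + C * rn F by rewrite -mulrDr ler_wpM2l.
  have h6 : C * rn (F - iota f) <= C * (e / (2 * C + 1)) by rewrite ler_wpM2l// ltW.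
  have h7 : 2 * (C * (e / (2 * C + 1))) <= e.
    by rewrite !mulrA ler_pdivrMr ?ltr_wpDl ?mulr_ge0// mulrC ler_wpM2l ?(ltW e0)// lerDl.
  by move: h1 h2 h3 h5 h6 h7; lra.
have sub v w : B (v - w) = B v - B w.
  by have := lin (-1) w v; rewrite !scaleN1r => h; rewrite addrC h addrC.
split=> // [F|f hf].
  apply/cvg_rnP => e e0.
  have e1 : 0 < e / (C + 1) by rewrite divr_gt0// ltr_wpDl.
  have /cvg_rnP/(_ _ e1) : (fun x : H => x) @ F --> F by exact: cvg_id.
  apply: filterS => G FG; rewrite -sub; apply: (le_lt_trans (bd _)).
  have -> : e = (C + 1) * (e / (C + 1)) by field; rewrite gt_eqF// ltr_wpDl.
  apply: (@le_lt_trans _ _ (C * (e / (C + 1)))); first by rewrite ler_wpM2l// ltW.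
  by rewrite ltr_pM2r ?ltrDl.
apply: rn_small_eq => e e0; apply: (le_trans (hB _ f hf)).
by rewrite subrr /rn normr0 mulr0 ltW.
Qed.

End density_extension.

Section integral_near_zero.
Context (R : realType).
Local Notation leb := (@lebesgue_measure R).
Local Notation RM := (measurableTypeR R).

(** Dominated convergence for the cut-offs at 1/(n + 1). *)
Lemma integral_near_zero (g : RM -> \bar R) (e : R) :
  measurable_fun [set t : RM | (0 < t)%R] g -> (forall t : R, 0 < t -> (0 <= g t)%E) ->
  (\int[leb]_(t in [set t : R | (0 < t)%R]) g t < +oo)%E -> 0 < e ->
  exists2 dl : R, 0 < dl &
    (\int[leb]_(t in [set t : R | (0 < t)%R]) (g t * chi (t < dl)%R) <= e%:E)%E.
Proof.
move=> mg g0 gi e0; have mP := @pos_measurable R.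
pose f_ n (t : RM) : \bar R := (g t * chi (t < n.+1%:R^-1)%R)%E.
have mf n : measurable_fun [set t : RM | (0 < t)%R] (f_ n).
  apply: emeasurable_funM => //; apply: measurable_funTS; apply: chi_measurable.
  by apply: ltr_measurable.
have cf : {ae leb, forall t : RM, [set t : RM | (0 < t)%R] t -> f_ ^~ t @ \oo --> (cst 0%E : RM -> \bar R) t}.
  apply: aeW => t /= t0; apply: cvg_near_cst; exists (Num.bound t^-1) => // n /= hn.
  have ti : 0 <= t^-1 by rewrite invr_ge0 ltW.
  have h : n.+1%:R^-1 <= t.
    rewrite invf_ple ?posrE ?ltr0n//; apply: (le_trans (ltW (archi_boundP ti))).
    by rewrite ler_nat (leq_trans hn).
  by rewrite /f_ /chi ltNge h/= mule0.
have ig : leb.-integrable [set t : RM | (0 < t)%R] g.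
  apply/integrableP; split=> //.
  rewrite (eq_integral g) => [//|t]; rewrite inE/= => t0; rewrite gee0_abs//; exact: g0.
have dom : {ae leb, forall (t : RM) n, [set t : RM | (0 < t)%R] t -> (`|f_ n t| <= g t)%E}.
  apply: aeW => t n /= t0; rewrite /f_ /chi; case: ifP => _; first by rewrite mule1 gee0_abs ?g0.
  by rewrite mule0 abse0 g0.
have [_ _] := dominated_convergence mP mf (measurable_cst _) cf ig dom.
rewrite integral0_eq// => /fine_cvgP[[N1 _ hN1] /cvgr_lt/(_ _ e0)[N2 _ hN2]].
exists (maxn N1 N2).+1%:R^-1; first by rewrite invr_gt0 ltr0n.
have h1 := hN1 _ (leq_maxl N1 N2); have h2 := hN2 _ (leq_maxr N1 N2).
rewrite /= in h1 h2; by rewrite -(fineK h1) lee_fin ltW.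
Qed.

End integral_near_zero.

Section poweR_half.
Context (R : realType).

Lemma sqrt_comb (c x y z : R) : 0 <= c -> 0 <= x -> 0 <= y -> 0 <= z ->
  x <= 2 * c ^+ 2 * y + 2 * z ->
  Num.sqrt x <= 2 * (c + 1) * Num.sqrt y + 2 * Num.sqrt z.
Proof.
move=> c0 x0 y0 z0; rewrite -{1}(@sqr_sqrtr _ x)// -{1}(@sqr_sqrtr _ y)// -{1}(@sqr_sqrtr _ z)//.
move: (Num.sqrt x) (Num.sqrt y) (Num.sqrt z) (sqrtr_ge0 x) (sqrtr_ge0 y) (sqrtr_ge0 z) => a b e a0 b0 e0 h.
have r0 : 0 <= 2 * (c + 1) * b + 2 * e by rewrite addr_ge0 ?mulr_ge0 ?addr_ge0.
rewrite -(@ler_pXn2r _ 2) ?nnegrE//; apply: (le_trans h).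
have h1 : 0 <= c * b by exact: mulr_ge0.
have h2 : 0 <= c * b * e by exact: mulr_ge0.
have h3 : 0 <= b * e by exact: mulr_ge0.
rewrite -subr_ge0 (_ : _ - _ = 2 * (c * b) ^+ 2 + 8 * (c * b * b) + 4 * b ^+ 2 + 8 * (c * b * e) +
  8 * (b * e) + 2 * e ^+ 2); last by ring.
by rewrite !addr_ge0// mulr_ge0 ?sqr_ge0 ?mulr_ge0.
Qed.

Lemma poweR_comb (c : R) (x y z : \bar R) : 0 <= c -> (0 <= x)%E -> (0 <= y)%E -> (0 <= z)%E ->
  (x <= (2 * c ^+ 2)%:E * y + 2%:E * z)%E ->
  (x `^ 2^-1 <= (2 * (c + 1))%:E * y `^ 2^-1 + 2%:E * z `^ 2^-1)%E.
Proof.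
move=> c0 x0 y0 z0 h; have c1 : 0 < 2 * (c + 1) by rewrite mulr_gt0// ltr_wpDl.
have i0 : (2^-1 : R) != 0 by rewrite invr_eq0.
case: y y0 h => [y| |]// y0 h; last first.
  rewrite (poweRyr i0) gt0_muley ?lte_fin// addye ?leey// -ltNye.
  by apply: (lt_le_trans (ltNyr 0)); rewrite mule_ge0// poweR_ge0.
case: z z0 h => [z| |]// z0 h; last first.
  by rewrite (poweRyr i0) (gt0_muley (x := 2%:E)) ?lte_fin// addey ?leey.
case: x x0 h => [x| |]// x0 h.
rewrite -!EFinM -EFinD lee_fin in h; rewrite !lee_fin in x0 y0 z0.
by rewrite !poweR_EFin !powR12_sqrt// -!EFinM -EFinD lee_fin sqrt_comb.
Qed.

End poweR_half.

(** * Uniform boundedness and convergence on the dense subspace *)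

Section hardy_estimates.
Context d (R : realType) (Omega : borelMetricType d R).
Variable mu : {sigma_finite_measure set Omega -> \bar R}.
Variables (L : operator mu) (E : proj_measure mu).
Hypothesis LE : spectral_measure_sqrt L E.
Variables (C0 theta : R).
Hypothesis hv : forall (x : Omega) (t : R), 0 < t -> (0 < vol mu x t)%E /\ (vol mu x t < +oo)%E.
Hypothesis C00 : 0 < C0.
Hypothesis theta1 : 1 <= theta.
Hypothesis growth : forall (x : Omega) (t : R) k, 0 < t ->
  fine (vol mu x (2 ^+ k * t)) <= C0 * theta ^+ k * fine (vol mu x t).
Variable x0 : Omega.
Variable cb : nat -> Omega * R.
Hypothesis cb0 : forall n, 0 < (cb n).2.
Hypothesis cbP : forall x s, 0 < s -> exists n,
  [/\ mdist x (cb n).1 < s / 4, s / 4 < (cb n).2 & (cb n).2 < s / 2].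
Variables (th : R) (kappa : nat).
Hypothesis th_gt : theta < th.
Hypothesis th_lt : th < 2 ^+ kappa.*2.-1.
Hypothesis kappa0 : (0 < kappa)%N.
Hypothesis DG : davies_gaffney E.
Variable m : R -> R[i].
Hypothesis mc : continuous_on_nonneg m.
Hypothesis ms : smooth_on_pos kappa m.
Hypothesis mb : exists M : R, forall (j : nat) (l : R), (j <= kappa)%N -> 0 < l ->
     cmod (scaled_derive j m l) <= M.
Hypothesis ml : forall j : nat, (1 <= j <= kappa)%N ->
     cmod (scaled_derive j m l) @[l --> 0^'+] --> (0 : R).
Local Notation leb := (@lebesgue_measure R).
Local Notation RM := (measurableTypeR R).
Local Notation mult := (mult (spv E)).
Local Notation complete := (@L2cls_complete _ _ _ mu).
Local Notation slice := (slice E).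
Local Notation sfun := (sfun E).
Local Notation cls := (cls mu).
Local Notation N := (hardy_norm L E).
Local Notation dil t := (fun l => m (t * l)).
Local Notation Syml := (Sym pos id).

Lemma hardy_normE f : L2 mu f -> N f = (\int[mu]_x sfun (cls f) x)%E.
Proof.
move=> lf; rewrite /hardy_norm Lnorm1; apply: eq_integral => x _.
by rewrite (square_functionE hv C00 theta1 growth x0 LE)// gee0_abs ?poweR_ge0.
Qed.

Lemma hardy_norm_cls f g : L2 mu f -> L2 mu g -> cls f = cls g -> N f = N g.
Proof. by move=> lf lg fg; rewrite (hardy_normE lf) (hardy_normE lg) fg. Qed.

Lemma hardy_dense_comb (a : R[i]) f g : hardy_dense L E f -> hardy_dense L E g ->
  hardy_dense L E (fun x => a * f x + g x).
Proof.
move=> [lf nf] [lg ng]; have lh := L2_comb a lf lg; split; first exact: lh.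
have e : cls (fun x => a * f x + g x) = a *: cls f + cls g.
  by rewrite (clsD (L2Z a lf) lg) (clsZ a lf).
have sq0 := sq_ge0 E; have msf := sfun_meas E hv C00 theta1 growth x0.
rewrite (hardy_normE lh) e; rewrite (hardy_normE lf) in nf; rewrite (hardy_normE lg) in ng.
have c1 : 0 <= 2 * (cmod a + 1) by rewrite mulr_ge0// addr_ge0 ?cmod_ge0.
have mt (c : R) v : measurable_fun setT (fun x => c%:E * sfun v x)%E by exact: measurable_funeM.
have t0 (c : R) v x : 0 <= c -> (0 <= c%:E * sfun v x)%E.
  by move=> c0; apply: mule_ge0; [rewrite lee_fin|exact: sfun_ge0].
apply: (@le_lt_trans _ _ (\int[mu]_x ((2 * (cmod a + 1))%:E * sfun (cls f) x + 2%:E * sfun (cls g) x))%E).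
  apply: ge0_le_integral => //.
  - by move=> x _; exact: sfun_ge0.
  - by apply: emeasurable_funD; exact: mt.
  - move=> x _; apply: poweR_comb; [exact: cmod_ge0|exact: sq0|exact: sq0|exact: sq0|].
    exact: (sq_comb E hv C00 theta1 growth x0).
rewrite ge0_integralD//; [|by move=> x _; exact: t0|by move=> x _; exact: t0].
have sf0 v x : (0 <= sfun v x)%E by exact: sfun_ge0.
have two : (0 <= 2%:E :> \bar R)%E by rewrite lee_fin.
have c2 : (0 <= (2 * (cmod a + 1))%:E)%E by rewrite lee_fin.
have iZ (c : R) v : (0 <= c%:E)%E -> (\int[mu]_x sfun v x < +oo)%E -> (\int[mu]_x (c%:E * sfun v x) < +oo)%E.
  move=> c0 fin; have -> : (\int[mu]_x (c%:E * sfun v x) = c%:E * \int[mu]_x sfun v x)%E.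
    by apply: ge0_integralZl => //; exact: msf.
  by apply: lte_mul_pinfty; [exact: c0|by []|exact: fin].
exact: lte_add_pinfty (iZ _ _ c2 nf) (iZ _ _ two ng).
Qed.

Let psym u : part m u -> exists2 B, 0 <= B & Syml kappa (fun=> B) u /\ forall l, 0 <= l -> `|u l| <= B.
Proof. by move=> pu; exact: (part_sym ms mb pu). Qed.

Let psmall u e : part m u -> 0 < e -> exists2 D, 0 <= D &
  Syml kappa (fun l => e + D * l) (fun l => u l - u 0).
Proof. by move=> pu; exact: (part_sym_small mc ms mb ml pu). Qed.

Lemma part_bs u (t : R) : part m u -> 0 < t -> bs (fun l => u (t * l)).
Proof.
move=> pu t0; have [B B0 [_ hB]] := psym pu.
apply: (bsym_real (M := B)); last by move=> l l0; apply: hB; rewrite mulr_ge0// ltW.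
have mu0 : measurable_fun (`[0%R, +oo[%classic : set R) u.
  have [cr ci] := mc; case: pu => ->; apply: subspace_continuous_measurable_fun => //.
apply: (measurable_comp (F := (`[0%R, +oo[%classic : set R)) _ _ mu0) => //.
  by move=> _ [l /= + <-]; rewrite !in_itv/= !andbT => l0; rewrite mulr_ge0// ltW.
Qed.

Lemma dil_bsym (t : R) : 0 < t -> bsym (dil t).
Proof.
move=> t0; have := bsym_complex (part_bs (or_introl erefl) t0) (part_bs (or_intror erefl) t0).
by congr bsym; apply/funext => l /=; case: (m _).
Qed.

Lemma admissible_cst (B : R) u : 0 <= B -> Syml kappa (fun=> B) u -> admissible kappa (fun=> B) u.
Proof.
move=> B0 su s s0; exists (fun=> B) => // x x0'.
by rewrite ler_piMr// -expR0 ler_expR oppr_le0 divr_ge0 ?sqr_ge0.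
Qed.

Let g v (t : RM) : \bar R := (slice v (iv \o sfun v) t * (t^-1)%:E)%E.

Let g0 v (t : R) : 0 < t -> (0 <= g v t)%E.
Proof.
move=> t0; apply: mule_ge0; last by rewrite lee_fin invr_ge0 ltW.
by apply: slice_ge0 => x; exact: iv_ge0.
Qed.

Let mg v : measurable_fun [set t : RM | (0 < t)%R] (g v).
Proof.
have miv : measurable_fun setT (iv \o sfun v).
  exact: measurableT_comp iv_measurable (sfun_meas E hv C00 theta1 growth x0 v).
have := slice_meas E hv C00 theta1 growth x0 v miv (fun x => iv_ge0 _).
move=> /(@measurable_funTS _ _ _ _ [set t : RM | (0 < t)%R]); apply: eq_measurable_fun => t.
by rewrite inE/= /chi => ->; rewrite mule1.
Qed.

Let g_total v : (\int[leb]_(t in [set t : R | (0 < t)%R]) g v t <= \int[mu]_x sfun v x)%E.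
Proof. exact: (slice_total E hv C00 theta1 growth x0 v). Qed.

(** Mikhlin bounds are invariant under dilation, so one constant B is admissible for all t;
    [sfun_bound] is used with eta = 1 and [slice_total]. *)
Lemma dilation_bounded : exists2 C : R, 0 <= C & forall (t : R) f, 0 < t -> hardy_dense L E f ->
  hardy_dense L E (multiplier E (dil t) f) /\ (N (multiplier E (dil t) f) <= C%:E * N f)%E.
Proof.
have [C Cp hC] := sfun_bound hv C00 theta1 growth x0 cb0 cbP th_gt th_lt kappa0 DG.
have p1 : part m (@complex.Re R \o m) by left.
have p2 : part m (@complex.Im R \o m) by right.
have [B1 B10 [s1 _]] := psym p1; have [B2 B20 [s2 _]] := psym p2.
pose B := B1 + B2; have B0 : 0 <= B by exact: addr_ge0.
have CB : 0 <= C * B ^+ 2 by apply: mulr_ge0; [exact: ltW|exact: sqr_ge0].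
exists (C * B ^+ 2 + C); first exact: addr_ge0 CB (ltW Cp).
move=> t f t0 [lf nf]; have bt := dil_bsym t0.
have [lM eM] := cls_multiplier E lf bt.
have a1 : admissible kappa (fun=> B) (fun l => (@complex.Re R \o m) (t * l)).
  apply: (admissible_cst B0); apply: (Syml_scale t0 (om := fun=> B)).
  by apply: Sym_le s1 => x _; rewrite lerDl.
have a2 : admissible kappa (fun=> B) (fun l => (@complex.Im R \o m) (t * l)).
  apply: (admissible_cst B0); apply: (Syml_scale t0 (om := fun=> B)).
  by apply: Sym_le s2 => x _; rewrite lerDr.
have bd : (N (multiplier E (dil t) f) <= (C * B ^+ 2 + C)%:E * N f)%E.
  rewrite (hardy_normE lM) (hardy_normE lf) eM.
  have -> : dil t = fun l => Complex ((@complex.Re R \o m) (t * l)) ((@complex.Im R \o m) (t * l)).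
    by apply/funext => l /=; case: (m _).
  apply: le_trans (hC _ _ _ (cls f) 1 (part_bs p1 t0) (part_bs p2 t0) a1 a2 (measurable_cst _) ltr01) _.
  have I0 : (0 <= \int[mu]_x sfun (cls f) x)%E by apply: integral_ge0 => x _; exact: sfun_ge0.
  rewrite invr1 !mul1r EFinD ge0_muleDl ?lee_fin ?(ltW Cp)//; apply: leeD => //.
  rewrite (EFinM C (B ^+ 2)) -(muleA C%:E); apply: lee_wpmul2l; first by rewrite lee_fin ltW.
  rewrite (ge0_integralZl _ (@pos_measurable R) (mg (cls f)) (@g0 (cls f))); last by rewrite lee_fin sqr_ge0.
  by apply: lee_wpmul2l; [rewrite lee_fin sqr_ge0|exact: g_total].
split; last exact: bd.
split; first exact: lM.
apply: (le_lt_trans bd); apply: lte_mul_pinfty; [|by []|exact: nf].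
by rewrite lee_fin; exact: addr_ge0 CB (ltW Cp).
Qed.

(** The choice of eps makes 5 C n eps at most e/2, where 5 = 4 + 1 collects the two terms containing
    n; then e1 makes the remaining term at most e/2. *)
Lemma small_constants (C B n e : R) : 0 < C -> 0 <= n -> 0 < e ->
  exists eps e1 : R, [/\ 0 < eps, 0 < e1 &
    eps^-1 * C * (B ^+ 2 * e1 + (2 * eps) ^+ 2 * n) + eps * C * n <= e].
Proof.
move=> Cp n0 e0; have n1 : 0 < n + 1 by rewrite ltr_wpDl.
have b1 : 0 < B ^+ 2 + 1 by rewrite ltr_wpDl// sqr_ge0.
have two : 0 < 2 :> R by [].
have ep : 0 < e / (10 * C * (n + 1)) by rewrite divr_gt0// !mulr_gt0.
exists (e / (10 * C * (n + 1))), (e * (e / (10 * C * (n + 1))) / (2 * C * (B ^+ 2 + 1))).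
split; first exact: ep.
  exact: divr_gt0 (mulr_gt0 e0 ep) (mulr_gt0 (mulr_gt0 two Cp) b1).
set eps := e / _ in ep *.
have E1 : eps^-1 * C * (B ^+ 2 * (e * eps / (2 * C * (B ^+ 2 + 1)))) = e / 2 * (B ^+ 2 / (B ^+ 2 + 1)).
  by field; rewrite !gt_eqF.
have E2 : eps^-1 * C * ((2 * eps) ^+ 2 * n) + eps * C * n = 5 * C * n * eps by field; rewrite !gt_eqF.
have E3 : 5 * C * n * eps = e / 2 * (n / (n + 1)) by rewrite /eps; field; rewrite !gt_eqF.
rewrite mulrDr -addrA E1 E2 E3.
have h1 : B ^+ 2 / (B ^+ 2 + 1) <= 1 by rewrite ler_pdivrMr// mul1r lerDl.
have h2 : n / (n + 1) <= 1 by rewrite ler_pdivrMr// mul1r lerDl.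
have e2 : 0 <= e / 2 by rewrite divr_ge0// ltW.
have k1 := ler_wpM2l e2 h1; have k2 := ler_wpM2l e2 h2.
by rewrite mulr1 in k1 k2; rewrite [leRHS](_ : e = e / 2 + e / 2); [exact: lerD|field].
Qed.

(** The scales are split at dl. Below dl the symbol is merely bounded, but the slices of f have a
    small integral there. Above dl the difference u(t l) - u(0) has size at most eps plus a multiple
    of t / s, hence 2 eps for small t. With eta = 1/eps in [sfun_bound] the square of 2 eps
    outweighs eta. *)
Lemma dilation_small f (e : R) : hardy_dense L E f -> 0 < e -> exists2 t0 : R, 0 < t0 &
  forall t, 0 < t -> t < t0 -> (N (fun x => - m 0 * f x + multiplier E (dil t) f x)%R <= e%:E)%E.
Proof.
move=> [lf nf] e0.
have [C Cp hC] := sfun_bound hv C00 theta1 growth x0 cb0 cbP th_gt th_lt kappa0 DG.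
have p1 : part m (@complex.Re R \o m) by left.
have p2 : part m (@complex.Im R \o m) by right.
set u1 := @complex.Re R \o m in p1 *; set u2 := @complex.Im R \o m in p2 *.
have [B1 B10 [s1 _]] := psym p1; have [B2 B20 [s2 _]] := psym p2.
pose B := B1 + `|- u1 0| + (B2 + `|- u2 0|).
have B0 : 0 <= B by rewrite !addr_ge0.
have S1 : Syml kappa (fun=> B) (fun l => u1 l - u1 0).
  by apply: Sym_le (SymD s1 (Sym_cst pos id kappa (- u1 0))) => x _; rewrite /B lerDl addr_ge0.
have S2 : Syml kappa (fun=> B) (fun l => u2 l - u2 0).
  by apply: Sym_le (SymD s2 (Sym_cst pos id kappa (- u2 0))) => x _; rewrite /B lerDr addr_ge0.
set v := cls f; pose n := fine (N f).
have Nf0 : (0 <= N f)%E by exact: Lnorm_ge0.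
have Nn : N f = n%:E by rewrite /n fineK// ge0_fin_numE.
have n0 : 0 <= n by rewrite /n fine_ge0.
have [eps [e1 [ep e10 hee]]] := small_constants B Cp n0 e0.
have [D1 D10 T1] := psmall p1 ep.
have [D2 D20 T2] := psmall p2 ep.
have gt := g_total v; rewrite -(hardy_normE lf) Nn in gt.
have [dl dl0 hdl] := integral_near_zero (mg v) (@g0 v) (le_lt_trans gt (ltry n)) e10.
pose sk := Num.sqrt kappa.+1%:R : R; have sk0 : 0 < sk by rewrite sqrtr_gt0 ltr0n.
pose D := D1 + D2; have D0 : 0 <= D by exact: addr_ge0.
have Dk : 0 < D * sk + 1 by rewrite ltr_wpDl// mulr_ge0// ltW.
(* Below this threshold D t sk <= eps dl, so the linear part of the majorant is at most eps at every
   scale s >= dl. *)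
exists (eps * dl / (D * sk + 1)); first by rewrite divr_gt0// mulr_gt0.
move=> t t0 tt; pose Bf s := if s < dl then B else 2 * eps.
have mBf : measurable_fun setT Bf.
  apply: measurable_fun_ifT; [|exact: measurable_cst|exact: measurable_cst].
  by apply: measurable_fun_ltr; [exact: measurable_id|exact: measurable_cst].
have adm u D' : 0 <= D' -> D' <= D -> Syml kappa (fun=> B) (fun l => u l - u 0) ->
    Syml kappa (fun l => eps + D' * l) (fun l => u l - u 0) ->
    admissible kappa Bf (fun l => u (t * l) - u 0).
  move=> D'0 D'D su tu s s0; rewrite /Bf; have [sd|sd] := ltP s dl.
    by apply: (admissible_cst B0) => //; exact: (Syml_scale t0 su).
  exists (fun l => eps + D' * (t * l)); first exact: (Syml_scale t0 tu).
  move=> x xp; rewrite -/sk.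
  have ex1 : expR (- (x ^+ 2 / 2)) <= 1 by rewrite -expR0 ler_expR oppr_le0 divr_ge0 ?sqr_ge0.
  have ex2 : x * expR (- (x ^+ 2 / 2)) <= 1.
    rewrite expRN ler_pdivrMr ?expR_gt0// mul1r; apply: le_trans (expR_ge1Dx _).
    have := sqr_ge0 (x - 1); rewrite sqrrB expr1n mulr1; lra.
  have ee0 := expR_ge0 (- (x ^+ 2 / 2)).
  rewrite mulrDl (_ : 2 * eps = eps + eps); last by ring.
  apply: lerD; first by rewrite ler_piMr// ltW.
  rewrite (_ : D' * (t * (x / (s / sk))) * _ = D' * t * sk / s * (x * expR (- (x ^+ 2 / 2)))); last first.
    by field; rewrite !gt_eqF.
  have q0 : 0 <= D' * t * sk / s by rewrite !mulr_ge0 ?invr_ge0// ltW.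
  apply: (@le_trans _ _ (D' * t * sk / s)); first by rewrite ler_piMr.
  rewrite ler_pdivrMr//; apply: (@le_trans _ _ (eps * dl)); last by rewrite ler_pM2l.
  rewrite ltr_pdivlMr// in tt; apply: le_trans (ltW tt).
  rewrite mulrAC mulrC ler_pM2l//; apply: (@le_trans _ _ (D * sk)); last by rewrite lerDl.
  by rewrite ler_wpM2r// ltW.
have D1D : D1 <= D by rewrite lerDl.
have D2D : D2 <= D by rewrite lerDr.
have bt := dil_bsym t0; have [lM eM] := cls_multiplier E lf bt.
have lh : L2 mu (fun x => - m 0 * f x + multiplier E (dil t) f x) by exact: (L2_comb (- m 0) lf lM).
have bsub u : part m u -> bs (fun l => u (t * l) - u 0).
  by move=> pu; apply: bsD; [exact: part_bs|exact: bs_cst].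
have eh : cls (fun x => - m 0 * f x + multiplier E (dil t) f x) =
    mult (fun l => Complex (u1 (t * l) - u1 0) (u2 (t * l) - u2 0)) v.
  rewrite (clsD (L2Z (- m 0) lf) lM) (clsZ (- m 0) lf) eM; have := multD (spv E) complete v (bsym_cst (- m 0)) bt.
  rewrite (mult_cst (spv E) complete) => <-; congr (mult _ v); apply/funext => l /=.
  by rewrite /u1 /u2 /=; case: (m 0) (m (t * l)) => [a b] [a' b']; simpc; rewrite addrC (addrC (- b)).
rewrite (hardy_normE lh) eh.
have ep' : 0 < eps^-1 by rewrite invr_gt0.
apply: le_trans (hC _ _ _ v eps^-1 (bsub _ p1) (bsub _ p2) (adm _ _ D10 D1D S1 T1)
  (adm _ _ D20 D2D S2 T2) mBf ep') _.
rewrite -(hardy_normE lf) Nn invrK.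
have mch : measurable_fun [set t : RM | (0 < t)%R] (fun s => g v s * chi (s < dl)%R)%E.
  apply: emeasurable_funM => //; apply: measurable_funTS; apply: chi_measurable.
  by apply: ltr_measurable.
have ch0 (s : R) : 0 < s -> (0 <= g v s * chi (s < dl)%R)%E.
  by move=> sp; apply: mule_ge0; [exact: g0|exact: chi_ge0].
have I : (\int[leb]_(s in [set s : R | (0 < s)%R]) ((Bf s ^+ 2)%:E * g v s) <=
    (B ^+ 2 * e1 + (2 * eps) ^+ 2 * n)%:E)%E.
  have b0 : (0 <= (B ^+ 2)%:E)%E by rewrite lee_fin sqr_ge0.
  have b1 : (0 <= ((2 * eps) ^+ 2)%:E)%E by rewrite lee_fin sqr_ge0.
  apply: (@le_trans _ _ (\int[leb]_(s in [set s : R | (0 < s)%R])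
      ((B ^+ 2)%:E * (g v s * chi (s < dl)%R) + ((2 * eps) ^+ 2)%:E * g v s))%E).
    apply: ge0_le_integral.
    - exact: pos_measurable.
    - by move=> s sp; apply: mule_ge0; [rewrite lee_fin sqr_ge0|exact: g0].
    - apply: emeasurable_funM; last exact: mg.
      by apply: measurable_funTS; apply/measurable_EFinP; exact: measurable_funX.
    - by apply: emeasurable_funD; exact: measurable_funeM.
    - move=> s sp; rewrite /Bf /chi; case: ifP => _.
        by rewrite mule1 leeDl// mule_ge0//; exact: g0.
      by rewrite mule0 mule0 add0e.
  rewrite ge0_integralD; first last.
  - exact: measurable_funeM.
  - by move=> s sp; apply: mule_ge0 => //; exact: g0.
  - exact: measurable_funeM.
  - by move=> s sp; apply: mule_ge0 => //; exact: ch0.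
  - exact: pos_measurable.
  rewrite (ge0_integralZl _ (@pos_measurable R) mch ch0 b0) (ge0_integralZl _ (@pos_measurable R) (mg v) (@g0 v) b1).
  rewrite EFinD (EFinM (B ^+ 2) e1) (EFinM ((2 * eps) ^+ 2) n).
  by apply: leeD; apply: lee_wpmul2l.
apply: (@le_trans _ _ ((eps^-1 * C)%:E * (B ^+ 2 * e1 + (2 * eps) ^+ 2 * n)%:E + (eps * C)%:E * n%:E)%E).
  apply: leeD => //; apply: lee_wpmul2l => //; by rewrite lee_fin mulr_ge0// ltW.
by rewrite -(EFinM (eps^-1 * C)) -(EFinM (eps * C)) -EFinD lee_fin.
Qed.

End hardy_estimates.

(** * Passage to the completion *)

Section hardy_limit.
Context d (R : realType) (Omega : borelMetricType d R).
Variable mu : {measure set Omega -> \bar R}.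
Variables (L : operator mu) (E : proj_measure mu).
Variables (H : completeNormedModType R[i]) (iota : (Omega -> R[i]) -> H).
Hypothesis hc : hardy_completion L E iota.
Variable m : R -> R[i].
Local Notation hd := (hardy_dense L E).
Local Notation N := (hardy_norm L E).
Local Notation A t := (multiplier E (fun l => m (t * l))).
Local Notation cls := (cls mu).
Hypothesis N_cls : forall f g, L2 mu f -> L2 mu g -> cls f = cls g -> N f = N g.
Hypothesis hd_comb : forall (a : R[i]) f g, hd f -> hd g -> hd (fun x => a * f x + g x).
Hypothesis m_bsym : forall t : R, 0 < t -> bsym (fun l => m (t * l)).
Hypothesis bounded : exists2 C : R, 0 <= C & forall (t : R) f, 0 < t -> hd f ->
  hd (A t f) /\ (N (A t f) <= C%:E * N f)%E.
Hypothesis small : forall f (e : R), hd f -> 0 < e -> exists2 t0 : R, 0 < t0 &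
  forall t, 0 < t -> t < t0 -> (N (fun x => - m 0 * f x + A t f x)%R <= e%:E)%E.

Let N0 f : (0 <= N f)%E. Proof. exact: Lnorm_ge0. Qed.

Let hdL f : hd f -> L2 mu f. Proof. by case. Qed.

Let rn_iota f : hd f -> rn (iota f) = fine (N f).
Proof. by move=> hf; rewrite /rn (hardy_isometry hc hf). Qed.

Let N_rn f : hd f -> N f = (rn (iota f))%:E.
Proof. by move=> hf; rewrite rn_iota// fineK// ge0_fin_numE//; case: hf. Qed.

Let cls_comb (a : R[i]) f g : L2 mu f -> L2 mu g ->
  cls (fun x => a * f x + g x) = a *: cls f + cls g.
Proof. by move=> lf lg; rewrite (clsD (L2Z a lf) lg) (clsZ a lf). Qed.

(** The embedding is given on functions. By linearity and isometry it identifies functions of the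
    same class, because the norm of their difference is that of g - g. *)
Let iota_cls f g : hd f -> hd g -> cls f = cls g -> iota f = iota g.
Proof.
move=> hf hg fg; have [[lf _] [lg _]] := (hf, hg).
have h1 := hd_comb (-1) hg hf; have h2 := hd_comb (-1) hg hg.
have e : rn (iota (fun x => -1 * g x + f x)) = rn (iota (fun x => -1 * g x + g x)).
  have ec : cls (fun x => -1 * g x + f x) = cls (fun x => -1 * g x + g x).
    by rewrite (cls_comb (-1) lg lf) (cls_comb (-1) lg lg) fg.
  by rewrite (rn_iota h1) (rn_iota h2) (N_cls (hdL h1) (hdL h2) ec).
rewrite (hardy_linear hc (-1) hg hf) (hardy_linear hc (-1) hg hg) in e; rewrite !scaleN1r addNr in e.
by apply/eqP; rewrite -subr_eq0 addrC; apply/eqP; apply: rn_eq0; rewrite e /rn normr0.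
Qed.

(** [multiplier] picks arbitrary representatives and is linear only up to almost everywhere
    equality; [iota_cls] removes the ambiguity. *)
Let J_lc (t : R) (a : R[i]) f g : 0 < t -> hd f -> hd g ->
  iota (A t (fun x => a * f x + g x)) = a *: iota (A t f) + iota (A t g).
Proof.
move=> t0 hf hg; have [C _ hC] := bounded; have bt := m_bsym t0.
have [h1 _] := hC t f t0 hf; have [h2 _] := hC t g t0 hg.
have hfg := hd_comb a hf hg; have [h3 _] := hC t _ t0 hfg.
have [[lf _] [lg _]] := (hf, hg); have [lfg _] := hfg.
rewrite -(hardy_linear hc a h1 h2); apply: (iota_cls h3 (hd_comb a h1 h2)).
have [_ e1] := cls_multiplier E lf bt; have [_ e2] := cls_multiplier E lg bt.
have [_ e3] := cls_multiplier E lfg bt.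
rewrite e3 (cls_comb a lf lg) (cls_comb a (hdL h1) (hdL h2)) e1 e2.
exact: (mult_lin (spv E) (@L2cls_complete _ _ _ mu)).
Qed.

Lemma dilation_limit (F : H) :
  hardy_multiplier L E iota (fun l => m (t * l)) F @[t --> (0 : R)^'+] --> m 0 *: F.
Proof.
have [C C0 hC] := bounded.
have J_le (t : R) f : 0 < t -> hd f -> rn (iota (A t f)) <= C * rn (iota f).
  move=> t0 hf; have [h1 h2] := hC t f t0 hf.
  by rewrite (N_rn h1) (N_rn hf) -EFinM lee_fin in h2.
(* Once some extension exists, the one selected by [xget] is an extension as well. *)
have hB (t : R) : 0 < t -> bounded_extension L E iota (A t) (hardy_multiplier L E iota (fun l => m (t * l))).
  move=> t0; rewrite /hardy_multiplier; apply: xgetPex.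
  have [B [B1 B2 B3]] := density_extension (lc := fun (a : R[i]) f g x => a * f x + g x)
    hd_comb (hardy_linear hc) (fun a f g => @J_lc t a f g t0) C0 (fun f => @J_le t f t0) (hardy_density hc).
  exists B; split; [exact: B1|exact: B2|].
  move=> f hf; split; last exact: (B3 f hf).
  exact: (hC t f t0 hf).1.
(* [bounded_extension] records continuity without a constant; density recovers the constant C,
   uniform in t. *)
have B_le (t : R) G : 0 < t -> rn (hardy_multiplier L E iota (fun l => m (t * l)) G) <= C * rn G.
  move=> t0; have [Bl Bc BE] := hB t t0; set B := hardy_multiplier _ _ _ _ in Bl Bc BE *.
  apply/ler_addgt0Pl => e e0.
  have e1 : 0 < e / (C + 1) by rewrite divr_gt0// ltr_wpDl.
  have nU : nbhs G [set G' | rn (B G - B G') < e / (C + 1)].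
    by have /cvg_rnP/(_ _ e1) : B x @[x --> G] --> B G by exact: Bc.
  have cG : closure (iota @` hd) G by rewrite (hardy_density hc).
  have [_ [[f hf <-] h1 h2]] := closure_rn cG e1 nU.
  have [_ Bf] := BE f hf; rewrite /= in h2; rewrite Bf in h2.
  have h3 := rnD (B G - iota (A t f)) (iota (A t f)); rewrite subrK in h3.
  have h4 := J_le t f t0 hf.
  have h5 := rnD (iota f - G) G; rewrite subrK rnBC in h5.
  have h6 := ler_wpM2l C0 h5; have h7 := ler_wpM2l C0 (ltW h1).
  have h8 : e = (C + 1) * (e / (C + 1)) by field; rewrite gt_eqF// ltr_wpDl.
  rewrite [X in _ <= X + _]h8; move: h2 h3 h4 h6 h7; rewrite mulrDr.
  by move: (rn _) (rn _) (rn _) (rn _) (rn _) (rn _) => *; lra.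
apply/cvg_rnP => e e0.
pose k := C + cmod (m 0) + 1; have k0 : 0 < k by rewrite ltr_wpDl// addr_ge0 ?cmod_ge0.
have e1 : 0 < e / (2 * k) by rewrite divr_gt0// mulr_gt0.
have e2 : 0 < e / 4 by rewrite divr_gt0.
have cF : closure (iota @` hd) F by rewrite (hardy_density hc).
have [_ [[f hf <-] Ff _]] := closure_rn cF e1 (@filterT _ (nbhs F) _).
have [t1 t10 ht1] := small hf e2.
near=> t.
have t0 : 0 < t by near: t; exact: nbhs_right_gt.
have tt : t < t1 by near: t; exact: nbhs_right_lt.
have [Bl Bc BE] := hB t t0; have bl := B_le t (F - iota f) t0.
set B := hardy_multiplier _ _ _ _ in Bl Bc BE bl *.
have [hA Bf] := BE f hf; have sm := ht1 t t0 tt.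
rewrite (N_rn (hd_comb _ hf hA)) (hardy_linear hc (- m 0) hf hA) lee_fin -Bf in sm.
have BB : B F = B (F - iota f) + B (iota f).
  by have := Bl 1 (F - iota f) (iota f); rewrite !scale1r subrK.
have -> : m 0 *: F - B F = m 0 *: (F - iota f) + (- (- m 0 *: iota f + B (iota f)) - B (F - iota f)).
  rewrite BB scalerBr scaleNr; move: (m 0 *: F) (m 0 *: iota f) (B _) (B _) => X Y P Q.
  by rewrite !opprD opprK !addrA subrK addrAC.
have h1 := rnD (m 0 *: (F - iota f)) (- (- m 0 *: iota f + B (iota f)) - B (F - iota f)).
have h2 := rnD (- (- m 0 *: iota f + B (iota f))) (- B (F - iota f)).
rewrite !rnN in h2; rewrite rnZ in h1.
have h3 := ler_wpM2l (cmod_ge0 (m 0)) (ltW Ff); have h4 := ler_wpM2l C0 (ltW Ff).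
apply: (le_lt_trans h1).
have ee : (cmod (m 0) + C) * (e / (2 * k)) <= e / 2.
  rewrite [leRHS](_ : _ = k * (e / (2 * k))); last by field; rewrite gt_eqF.
  by apply: ler_wpM2r; [exact: ltW|rewrite /k addrC lerDl].
move: (rn (- _ - _)) (rn (- m 0 *: _ + _)) (rn (B _)) (rn (F - _)) h2 h3 h4 ee bl sm Ff e0.
move: (cmod (m 0)) (e / (2 * k)) => c s X Y Z W h2 h3 h4 ee bl sm Ff e0.
rewrite mulrDl in ee; lra.
Unshelve. all: by end_near. Qed.

End hardy_limit.

(** * Proof of the limit theorem *)

Section nonempty_space.
Context d (R : realType) (Omega : borelMetricType d R).
Variable mu : {sigma_finite_measure set Omega -> \bar R}.

Lemma hardy_limit_sigma_finite (L : operator mu) (E : proj_measure mu)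
  (H : completeNormedModType R[i]) (iota : (Omega -> R[i]) -> H)
  (kappa : nat) (m : R -> R[i]) (x0 : Omega) :
  homogeneous_space mu -> spectral_measure_sqrt L E -> davies_gaffney E ->
  hardy_completion L E iota -> (homogeneous_dim mu + 1) / 2 < kappa%:R ->
  continuous_on_nonneg m -> smooth_on_pos kappa m ->
  (exists M : R, forall (j : nat) (l : R), (j <= kappa)%N -> 0 < l ->
     cmod (scaled_derive j m l) <= M) ->
  (forall j : nat, (1 <= j <= kappa)%N ->
     cmod (scaled_derive j m l) @[l --> 0^'+] --> (0 : R)) ->
  forall F : H,
    hardy_multiplier L E iota (fun l => m (t * l)) F @[t --> (0 : R)^'+] --> m 0 *: F.
Proof.
move=> hm LE DG hc hk mc ms mb ml.
have [kappa0 [theta [C0 [th1 thD C00 growth]]]] := dyadic_growth hm hk.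
have hv := hm.1; have [cb [cb0 cbP]] := ball_sequence hv C00 th1 growth x0.
(* Above theta for the weight to be integrable, below 2^(2 kappa - 1) for the off-diagonal sums to
   converge. *)
pose th := (theta + 2 ^+ kappa.*2.-1) / 2.
have th_gt : theta < th by rewrite /th ltr_pdivlMr//; move: thD; move: (2 ^+ _) => z; lra.
have th_lt : th < 2 ^+ kappa.*2.-1 by rewrite /th ltr_pdivrMr//; move: thD; move: (2 ^+ _) => z; lra.
apply: (dilation_limit hc).
- exact: (hardy_norm_cls LE hv C00 th1 growth x0).
- exact: (hardy_dense_comb LE hv C00 th1 growth x0).
- by move=> t t0; exact: (dil_bsym mc ms mb t0).
- exact: (dilation_bounded LE hv C00 th1 growth x0 cb0 cbP th_gt th_lt kappa0 DG mc ms mb).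
- exact: (dilation_small LE hv C00 th1 growth x0 cb0 cbP th_gt th_lt kappa0 DG mc ms mb ml).
Qed.

End nonempty_space.

Theorem theorem3p1 (d : measure_display) (R : realType)
  (Omega : borelMetricType d R) (mu : {measure set Omega -> \bar R})
  (L : operator mu) (E : proj_measure mu)
  (H : completeNormedModType R[i]) (iota : (Omega -> R[i]) -> H)
  (kappa : nat) (m : R -> R[i]) :
  homogeneous_space mu ->
  self_adjoint L -> nonnegative L -> injective_operator L ->
  spectral_measure_sqrt L E ->
  davies_gaffney E ->
  hardy_completion L E iota ->
  (homogeneous_dim mu + 1) / 2 < kappa%:R ->
  continuous_on_nonneg m ->
  smooth_on_pos kappa m ->
  (exists M : R, forall (j : nat) (l : R), (j <= kappa)%N -> 0 < l ->
     cmod (scaled_derive j m l) <= M) ->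
  (forall j : nat, (1 <= j <= kappa)%N ->
     cmod (scaled_derive j m l) @[l --> 0^'+] --> (0 : R)) ->
  forall F : H,
    hardy_multiplier L E iota (fun l => m (t * l)) F @[t --> (0 : R)^'+]
      --> m 0 *: F.
Proof.
move=> hm _ _ _ LE DG hc hk mc ms mb ml.
(* The nets and the sequence of balls start from a base point. On an empty space all Hardy norms are
   0 and the two estimates are immediate. *)
have [[x0 _]|nx] := pselect (exists x0 : Omega, True).
  have [nu nuE] := sigma_finite_package (space_sigma_finite hm.1 x0); subst mu.
  exact: (hardy_limit_sigma_finite x0 hm LE DG hc hk mc ms mb ml).
have N0 f : hardy_norm L E f = 0%E.
  by rewrite /hardy_norm Lnorm1; apply: integral0_eq => x; case: nx; exists x.
have hd f : L2 mu f -> hardy_dense L E f by move=> lf; split; rewrite // N0 ltry.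
have bt (t : R) : 0 < t -> bsym (fun l => m (t * l)) by move=> t0; exact: (dil_bsym mc ms mb t0).
apply: (dilation_limit hc).
- by move=> f g _ _ _; rewrite (N0 f) (N0 g).
- by move=> a f g [lf _] [lg _]; apply: hd; exact: L2_comb.
- exact: bt.
- exists 0; first exact: lexx.
  move=> t f t0 [lf _]; split; first exact: hd (cls_multiplier E lf (bt t t0)).1.
  by rewrite N0 (N0 f) mule0.
- by move=> f e _ e0; exists 1; [exact: ltr01|move=> t _ _; rewrite N0 lee_fin ltW].
Qed.
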